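(* (i) The form $(\mathbb{E},\mathfrak{C}^1(\mathcal{G}_0))$, with $\mathbb{E}(u,v)=\int\langle\mathbb{D}u(g),\mathbb{D}v(g)\rangle_{L^2}d\mathbb{Q}_0^\beta(g)$, is closable in $L^2(\mathcal{G}_0,\mathbb{Q}_0^\beta)$ and its closure coincides with $(\mathbb{E},\mathrm{Dom}(\mathbb{E}))$. Similarly, $(\mathbb{D},\mathfrak{C}^1(\mathcal{G}_0))$ is closable and its closure coincides with $(\overline{\mathbb{D}},\mathrm{Dom}(\overline{\mathbb{D}}))$. (ii) For all $u,w\in\mathfrak{Z}^1(\mathcal{G}_0)\cup\mathfrak{C}^1(\mathcal{G}_0)$, $\Gamma(u,w)(g)=\langle\mathbb{D}u(g),\mathbb{D}w(g)\rangle_{L^2}$; in particular $\mathbb{E}(u,w)=\int_{\mathcal{G}_0}\langle\mathbb{D}u(g),\mathbb{D}w(g)\rangle_{L^2}d\mathbb{Q}_0^\beta(g)$. (iii) For each $f\in\mathcal{G}_0$ the function $u_f:g\mapsto\|f-g\|_{L^2}$ belongs to $\mathrm{Dom}(\mathbb{E})$ and $\Gamma(u_f,u_f)\le1$ $\mathbb{Q}_0^\beta$-a.e. on $\mathcal{G}_0$. (iv) $(\mathbb{E},\mathrm{Dom}(\mathbb{E}))$ is strongly local.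
   Context: $\mathcal{G}_0$ is the set of right continuous nondecreasing maps $g:[0,1[\,\to[0,1]$ extended by $g(1):=1$, with $L^2([0,1])$ distance. Fix $\beta>0$; $\mathbb{Q}_0^\beta$ is the probability measure on $\mathcal{G}_0$ such that for every $N$ and $0=t_0<\dots<t_{N+1}=1$ the law of $(g(t_1),\dots,g(t_N))$ is $\frac{\Gamma(\beta)}{\prod_{i=0}^{N}\Gamma(\beta(t_{i+1}-t_i))}\prod_{i=0}^{N}(x_{i+1}-x_i)^{\beta(t_{i+1}-t_i)-1}dx$ on $\{0<x_1<\dots<x_N<1\}$, $x_0:=0,x_{N+1}:=1$. $\mathfrak{Z}^1(\mathcal{G}_0)$: functions $u(g)=U(\int_0^1\vec\alpha(g_s)ds)$, $U\in\mathcal{C}^1(\mathbb{R}^m)$, $\vec\alpha\in\mathcal{C}^1([0,1],\mathbb{R}^m)$, with $\mathbb{D}u(g)=\sum_i\partial_iU(\int\vec\alpha(g_s)ds)\alpha_i'(g(\cdot))$. $\mathfrak{C}^1(\mathcal{G}_0)$: functions $u(g)=U(\int_0^1\vec f(t)g(t)dt)$, $U\in\mathcal{C}^1(\mathbb{R}^m)$, $\vec f=(f_1,\dots,f_m)\in L^2([0,1],\mathbb{R}^m)$, with $\mathbb{D}u(g)=\sum_i\partial_iU(\int\vec f(t)g(t)dt)f_i(\cdot)$. $(\overline{\mathbb{D}},\mathrm{Dom}(\overline{\mathbb{D}}))$ is the closure of $\mathbb{D}$ on $\mathfrak{Z}^1(\mathcal{G}_0)$ (as operator $L^2(\mathcal{G}_0,\mathbb{Q}_0^\beta)\to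 L^2(\mathcal{G}_0\times[0,1],\mathbb{Q}_0^\beta\otimes\mathrm{Leb})$), $(\mathbb{E},\mathrm{Dom}(\mathbb{E}))$ the closure of $\mathbb{E}$ on $\mathfrak{Z}^1(\mathcal{G}_0)$ (a Dirichlet form with $\mathrm{Dom}(\mathbb{E})=\mathrm{Dom}(\overline{\mathbb{D}})$), and $\Gamma(u,v):=\langle\overline{\mathbb{D}}u,\overline{\mathbb{D}}v\rangle_{L^2([0,1])}$ its square field operator. *)

(* Defs.v *)
From HB Require Import structures.
From mathcomp Require Import all_boot all_order all_algebra.
From mathcomp Require Import all_classical all_reals all_analysis.
Set Implicit Arguments. Unset Strict Implicit. Unset Printing Implicit Defensive.
Import Order.TTheory GRing.Theory Num.Theory.
Import numFieldNormedType.Exports.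
Local Open Scope classical_set_scope.
Local Open Scope ring_scope.

(* The space G_0.  An element is a right continuous nondecreasing map  *)
(* g : [0,1[ -> [0,1] with g(1) := 1; we represent it by a function    *)
(* R -> R, normalised by g t = 0 for t < 0 and g t = 1 for t >= 1.     *)
Definition inG0 {R : realType} (g : R -> R) : Prop :=
  [/\ (forall t, t < 0 -> g t = 0),
      (forall t, 1 <= t -> g t = 1),
      (forall t, 0 <= t < 1 -> 0 <= g t <= 1),
      (forall s t, 0 <= s -> s <= t -> t < 1 -> g s <= g t) &
      (forall t, 0 <= t < 1 -> g x @[x --> t^'+] --> g t)].

Record G0 (R : realType) := MkG0 { gfun :> R -> R ; gfunP : inG0 gfun }.

HB.instance Definition _ (R : realType) := gen_eqMixin (G0 R).
HB.instance Definition _ (R : realType) := gen_choiceMixin (G0 R).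

Definition g0fun {R : realType} (t : R) : R := if t < 1 then 0 else 1.

Lemma g0funP (R : realType) : inG0 (@g0fun R).
Proof.
rewrite /inG0 /g0fun.
have h1 : forall t : R, t < 0 -> (if t < 1 then 0 else 1) = 0 :> R.
  by move=> t t0; rewrite (lt_trans t0 ltr01).
have h2 : forall t : R, 1 <= t -> (if t < 1 then 0 else 1) = 1 :> R.
  by move=> t t1; rewrite ltNge t1.
have h3 : forall t : R, 0 <= t < 1 -> 0 <= (if t < 1 then 0 else 1 : R) <= 1.
  by move=> t /andP[_ ->]; rewrite lexx ler01.
have h4 : forall s t : R, 0 <= s -> s <= t -> t < 1 ->
    (if s < 1 then 0 else 1 : R) <= (if t < 1 then 0 else 1).
  by move=> s t _ st t1; rewrite (le_lt_trans st t1) t1.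
split => //.
move=> t /andP[t0 t1]; rewrite t1.
apply: cvg_near_cst; near=> x.
have -> : x < 1 by near: x; apply: nbhs_right_lt.
by [].
Unshelve. all: by end_near.
Qed.

HB.instance Definition _ (R : realType) :=
  isPointed.Build (G0 R) (MkG0 (@g0funP R)).

Section Defs.
Variable R : realType.

Local Notation leb := (@lebesgue_measure R).
Definition I01 : set R := `[0%R, 1%R]%classic.

Definition L2dist (f g : G0 R) : R :=
  Num.sqrt (Rintegral leb I01 (fun s => (f s - g s) ^+ 2)).

Definition L2ball (f : G0 R) (r : R) : set (G0 R) := [set g | L2dist f g < r].

Definition L2open (O : set (G0 R)) : Prop :=
  forall f, O f -> exists2 r : R, 0 < r & L2ball f r `<=` O.

Definition G0m := g_sigma_algebraType (@L2open).

Definition C1fun (m : nat) (U : 'rV[R]_m -> R) : Prop :=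
  (forall x, differentiable U x) /\
  (forall i : 'I_m, continuous ('D_(delta_mx 0 i) U)).

Definition C1real (a : R -> R) : Prop :=
  (forall x, derivable a x 1) /\ continuous (derive1 a).

Definition Rint01 (h : R -> R) : R := Rintegral leb I01 h.

Definition Zgraph (u : G0m -> R) (F : G0m -> R -> R) : Prop :=
  exists (m : nat) (U : 'rV[R]_m -> R) (alpha : 'I_m -> R -> R),
    [/\ C1fun U, (forall i, C1real (alpha i)),
     u = (fun g : G0m => U (\row_i Rint01 (fun s => alpha i (gfun g s)))) &
     F = (fun (g : G0m) (s : R) =>
            \sum_(i < m) 'D_(delta_mx 0 i) U
                (\row_j Rint01 (fun s' => alpha j (gfun g s')))
              * derive1 (alpha i) (gfun g s))].

Definition Cgraph (u : G0m -> R) (F : G0m -> R -> R) : Prop :=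
  exists (m : nat) (U : 'rV[R]_m -> R) (f : 'I_m -> R -> R),
    [/\ C1fun U,
     (forall i, measurable_fun I01 (f i) /\
        (\int[leb]_(s in I01) ((f i s) ^+ 2)%:E < +oo)%E),
     u = (fun g : G0m => U (\row_i Rint01 (fun s => f i s * gfun g s))) &
     F = (fun (g : G0m) (s : R) =>
            \sum_(i < m) 'D_(delta_mx 0 i) U
                (\row_j Rint01 (fun s' => f j s' * gfun g s'))
              * f i s)].

Variable Q : probability G0m R.

Definition N2 (u : G0m -> R) : \bar R := (\int[Q]_g ((u g) ^+ 2)%:E)%E.

(* squared L^2(G_0 x [0,1], Q (x) Leb) norm (Tonelli: iterated integral) *)
Definition NN2 (F : G0m -> R -> R) : \bar R :=
  (\int[Q]_g \int[leb]_(s in I01) ((F g s) ^+ 2)%:E)%E.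

Definition L2cvg (un : nat -> G0m -> R) (u : G0m -> R) : Prop :=
  (fun n => N2 (fun g => un n g - u g)) @ \oo --> (0 : \bar R).

Definition L2Icvg (Fn : nat -> G0m -> R -> R) (F : G0m -> R -> R) : Prop :=
  (fun n => NN2 (fun g s => Fn n g s - F g s)) @ \oo --> (0 : \bar R).

Definition L2Icauchy (Fn : nat -> G0m -> R -> R) : Prop :=
  forall eps : R, 0 < eps -> exists N : nat, forall n k : nat,
    (N <= n)%N -> (N <= k)%N -> (NN2 (fun g s => (Fn n g s - Fn k g s)%R) < eps%:E)%E.

Definition jmeas (F : G0m -> R -> R) : Prop :=
  measurable_fun setT (fun p : G0m * R => F p.1 p.2).

Definition op_closable (Gr : (G0m -> R) -> (G0m -> R -> R) -> Prop) : Prop :=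
  forall (un : nat -> G0m -> R) (Fn : nat -> G0m -> R -> R) (F : G0m -> R -> R),
    (forall n, Gr (un n) (Fn n)) -> L2cvg un (fun _ => 0) ->
    jmeas F -> L2Icvg Fn F -> NN2 F = 0%E.

Definition op_closure (Gr : (G0m -> R) -> (G0m -> R -> R) -> Prop)
  (u : G0m -> R) (F : G0m -> R -> R) : Prop :=
  [/\ measurable_fun setT u, jmeas F &
   exists (un : nat -> G0m -> R) (Fn : nat -> G0m -> R -> R),
     [/\ forall n, Gr (un n) (Fn n), L2cvg un u & L2Icvg Fn F]].

Definition form_closable (Gr : (G0m -> R) -> (G0m -> R -> R) -> Prop) : Prop :=
  forall (un : nat -> G0m -> R) (Fn : nat -> G0m -> R -> R),
    (forall n, Gr (un n) (Fn n)) -> L2cvg un (fun _ => 0) -> L2Icauchy Fn ->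
    (fun n => NN2 (Fn n)) @ \oo --> (0 : \bar R).

Definition inner01 (F H : G0m -> R -> R) (g : G0m) : R :=
  Rint01 (fun s => F g s * H g s).

(* the closure of the form: form_closure Gr u v e  <->  u, v are in the
   domain of the closure and its value at (u, v) is e *)
Definition form_closure (Gr : (G0m -> R) -> (G0m -> R -> R) -> Prop)
  (u v : G0m -> R) (e : R) : Prop :=
  [/\ measurable_fun setT u, measurable_fun setT v &
   exists (un vn : nat -> G0m -> R) (Fn Hn : nat -> G0m -> R -> R),
     [/\ (forall n, Gr (un n) (Fn n) /\ Gr (vn n) (Hn n)),
         L2cvg un u, L2cvg vn v, L2Icauchy Fn /\ L2Icauchy Hn &
         (fun n => (\int[Q]_g (inner01 (Fn n) (Hn n) g)%:E)%E) @ \oo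
            --> e%:E]].

Definition form_dom (Gr : (G0m -> R) -> (G0m -> R -> R) -> Prop)
  (u : G0m -> R) : Prop := exists e, form_closure Gr u u e.

Definition Qsupp (u : G0m -> R) : set G0m :=
  [set f | forall r : R, 0 < r -> (0 < Q (L2ball f r `&` [set g | u g != 0%R]))%E].

(* strong locality of the closed form (E, Dom(E)) (G_0 is compact, so
   the compact-support requirement is vacuous) *)
Definition strongly_local (Gr : (G0m -> R) -> (G0m -> R -> R) -> Prop) : Prop :=
  forall (u v : G0m -> R) (O : set G0m) (c e : R),
    form_dom Gr u -> form_dom Gr v -> L2open O -> Qsupp u `<=` O ->
    {ae Q, forall g, O g -> v g = c} ->
    form_closure Gr u v e -> e = 0.

End Defs.

Section Dirichlet.
Variable R : realType.
Local Notation leb := (@lebesgue_measure R).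

Definition GammaR (s : R) : R :=
  fine (\int[leb]_(x in (`]0%R, +oo[%classic : set R)) ((x `^ (s - 1)) * expR (- x))%:E)%E.

Definition upd (x : nat -> R) (i : nat) (y : R) : nat -> R :=
  fun j => if j == i then y else x j.

Fixpoint iint (k : nat) (f : (nat -> R) -> \bar R) : \bar R :=
  match k with
  | 0 => f (fun _ => 0)
  | k'.+1 => (\int[leb]_(y in setT) iint k' (fun x => f (upd x k'.+1 y)))%E
  end.

Definition bnd (N : nat) (x : nat -> R) : nat -> R :=
  fun j => if j == 0%N then 0 else if j == N.+1 then 1 else x j.

Definition dirichlet_density (beta : R) (N : nat) (t x : nat -> R) : R :=
  GammaR beta / (\prod_(i < N.+1) GammaR (beta * (t i.+1 - t i))) *
  \prod_(i < N.+1) (bnd N x i.+1 - bnd N x i) `^ (beta * (t i.+1 - t i) - 1).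

(* Q is (the) measure Q_0^beta: for all N, 0 = t_0 < ... < t_{N+1} = 1, the
   law of (g(t_1),...,g(t_N)) has the Dirichlet density on the simplex;
   laws are identified through their values on the boxes prod_i ]-oo, a_i] *)
Definition is_entropic (beta : R) (Q : probability (G0m R) R) : Prop :=
  forall (N : nat) (t : nat -> R),
    t 0%N = 0 -> t N.+1 = 1 -> (forall i, (i < N.+1)%N -> t i < t i.+1) ->
    forall a : nat -> R,
      Q [set g : G0m R | forall i, (1 <= i <= N)%N -> gfun g (t i) <= a i] =
      iint N (fun x =>
        if `[< (forall i, (i < N.+1)%N -> bnd N x i < bnd N x i.+1) /\
               (forall i, (1 <= i <= N)%N -> x i <= a i) >]
        then (dirichlet_density beta N t x)%:E else 0%E).

End Dirichlet.

(* Main.v *)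
(** The measure [Q] is quasi-invariant under the maps [g |-> g + e * (phi o g)],
    where [phi] vanishes at 0 and 1: on the finite dimensional marginals this is
    an explicit change of variables, and the density is [exp(O(e))] uniformly
    in the partition.  Comparing
    the two sides to first order in [e] bounds [\int w * <Du, phi o g> dQ] by
    [\int |u| w2 dQ] for Lipschitz cutoffs [w <= w2] and every [u] with
    gradient [Du] along these flows, which covers the functions of both
    cylinder classes.  So if [u_n] tends to a constant on an L^2-open set, the
    limit gradient is orthogonal there to every field [phi o g]; as [g] is
    almost surely strictly increasing, these fields determine an element of
    L^2([0,1]) and the limit gradient vanishes on that set.  This is at once
    closability, uniqueness of the gradient, and strong locality.

    That both classes have the same closure follows by approximation.  The
    number [\int alpha(g)] is the limit of Riemann sums over averages of [g] on
    small cells, and, conversely, [\int psi' g] is the limit of the sums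
    [1/n * \sum_k (psi 1 - psi |{g < k/n}|)], where [|{g < y}|] is smoothed to
    the integral of a C^1 function of [g].  The distance to [f] is approximated
    by smoothing the square root of the squared L^2 norm of cell averages of
    [g - f], which only produces gradients of norm at most one. *)
Require Import Defs.
From HB Require Import structures.
From mathcomp Require Import all_boot all_order all_algebra.
From mathcomp Require Import all_classical all_reals all_analysis.
From mathcomp Require Import measurable_realfun.
From mathcomp Require Import ring lra.
Set Implicit Arguments. Unset Strict Implicit. Unset Printing Implicit Defensive.
Import Order.TTheory GRing.Theory Num.Theory.
Import numFieldNormedType.Exports.
Local Open Scope classical_set_scope.
Local Open Scope ring_scope.

(** * Square integrable functions *)

(** An exact integration by parts would need the logarithmic derivative of the measure, a limit over
    partitions that involves the jumps of [g]. An inequality whose constant does not depend on [u]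
    is enough: it survives limits of [u] in L^2, and cutoffs make it local.

    The obstacle is uniformity in the partition: density and Jacobian are products of about N
    factors, each distorted by O(e). The Dirichlet exponents [beta * dt - 1] save the estimate. The
    parts -1 yield inverse slopes that cancel against the Jacobian factors up to errors proportional
    to the spacings, whose sum is at most 1, and the parts [beta * dt] add up to [beta].

    The comparison is made for the step functions that interpolate [g] on a uniform mesh, and is
    carried to [g] itself on functions that are Lipschitz for the L^2 distance; this is why the
    cutoffs are built from distances to complements of open sets. Only times [e >= 0] of the flow
    occur: the comparison is two-sided, so it bounds absolute values. *)

Section SquareIntegrable.
Context d (T : measurableType d) (R : realType).
Variables (mu : {measure set T -> \bar R}) (D : set T).
Hypothesis mD : measurable D.
Implicit Types f h : T -> R.

Definition sq f : \bar R := (\int[mu]_(x in D) ((f x) ^+ 2)%:E)%E.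

Definition sqi f := measurable_fun D f /\ (sq f < +oo)%E.

Definition ip f h : R := \int[mu]_(x in D) (f x * h x).

Definition nrm f : R := Num.sqrt (ip f f).

Lemma sq_ge0 f : (0 <= sq f)%E.
Proof. by apply: integral_ge0 => x _; rewrite lee_fin sqr_ge0. Qed.

Lemma measurable_sq f : measurable_fun D f ->
  measurable_fun D (fun x => (f x ^+ 2)%:E : \bar R).
Proof. by move=> mf; apply/measurable_EFinP; exact: measurable_funX. Qed.

Lemma sqi_integrable f : sqi f -> mu.-integrable D (fun x => (f x ^+ 2)%:E).
Proof.
move=> [mf fy]; apply/integrableP; split; first exact: measurable_sq.
rewrite (le_lt_trans _ fy)//; apply: ge0_le_integral => //=.
- by apply/measurable_EFinP/measurableT_comp => //; exact: measurable_funX.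
- exact: measurable_sq.
- by move=> x _; rewrite ger0_norm ?sqr_ge0.
Qed.

Lemma sqi_mul f h : sqi f -> sqi h -> mu.-integrable D (fun x => (f x * h x)%:E).
Proof.
move=> sf sh.
apply: (@le_integrable _ _ _ mu D mD _ (fun x => (f x ^+ 2 + h x ^+ 2)%:E)).
- by apply/measurable_EFinP; apply: measurable_funM; [exact: sf.1|exact: sh.1].
- move=> x _ /=; rewrite lee_fin (ger0_norm (addr_ge0 (sqr_ge0 _) (sqr_ge0 _))).
  rewrite normrM -(real_normK (num_real (f x))) -(real_normK (num_real (h x))).
  have := normr_ge0 (f x); have := normr_ge0 (h x).
  by move: `|f x| `|h x| => a b a0 b0; nra.
- have := integrableD mD (sqi_integrable sf) (sqi_integrable sh).
  by apply: eq_integrable.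
Qed.

Lemma sqE f : sqi f -> sq f = (ip f f)%:E.
Proof.
move=> sf; rewrite /ip /Rintegral fineK; last exact: integrable_fin_num (sqi_mul sf sf).
by apply: eq_integral => x _; rewrite expr2.
Qed.

Lemma ip_ge0 f : 0 <= ip f f.
Proof. by apply: Rintegral_ge0 => x _; rewrite -expr2 sqr_ge0. Qed.

Lemma nrm_ge0 f : 0 <= nrm f. Proof. exact: sqrtr_ge0. Qed.

Lemma nrm_sqr f : nrm f ^+ 2 = ip f f. Proof. by rewrite sqr_sqrtr ?ip_ge0. Qed.

Lemma sq_nrm f : sqi f -> sq f = (nrm f ^+ 2)%:E.
Proof. by move=> sf; rewrite nrm_sqr sqE. Qed.

Lemma sqiZ a f : sqi f -> sqi (fun x => a * f x).
Proof.
move=> sf; split; first by apply: measurable_funM => //; exact: sf.1.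
have -> : sq (fun x => a * f x) = ((a ^+ 2)%:E * sq f)%E.
  rewrite -ge0_integralZl//; last by rewrite lee_fin sqr_ge0.
  - by apply: eq_integral => x _; rewrite exprMn EFinM.
  - exact: measurable_sq sf.1.
  - by move=> x _; rewrite lee_fin sqr_ge0.
by rewrite sqE// -EFinM ltry.
Qed.

Lemma sq_le_add f h : measurable_fun D f -> measurable_fun D h ->
  (sq (fun x => f x + h x)%R <= 2%:E * sq f + 2%:E * sq h)%E.
Proof.
move=> mf mh.
rewrite -!ge0_integralZl//; try exact: measurable_sq; try by
  move=> x _; rewrite lee_fin sqr_ge0.
rewrite -ge0_integralD//; last 4 first.
- by move=> x _; rewrite lee_fin mulr_ge0// sqr_ge0.
- by apply/measurable_EFinP/measurable_funM => //; exact: measurable_funX.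
- by move=> x _; rewrite lee_fin mulr_ge0// sqr_ge0.
- by apply/measurable_EFinP/measurable_funM => //; exact: measurable_funX.
apply: ge0_le_integral => //.
- by move=> x _; rewrite lee_fin sqr_ge0.
- by apply: measurable_sq; exact: measurable_funD.
- apply: emeasurable_funD.
    by apply/measurable_EFinP/measurable_funM => //; exact: measurable_funX.
  by apply/measurable_EFinP/measurable_funM => //; exact: measurable_funX.
- move=> x _; rewrite -!EFinM -EFinD lee_fin.
  by have := sqr_ge0 (f x - h x); nra.
Qed.

Lemma sqN f : sq (fun x => - f x) = sq f.
Proof. by apply: eq_integral => x _; rewrite sqrrN. Qed.

Lemma sq_le_sub f h : measurable_fun D f -> measurable_fun D h ->
  (sq (fun x => f x - h x)%R <= 2%:E * sq f + 2%:E * sq h)%E.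
Proof. by move=> mf mh; rewrite -(sqN h); apply: sq_le_add => //; exact: measurableT_comp. Qed.

Lemma sqiD f h : sqi f -> sqi h -> sqi (fun x => f x + h x).
Proof.
move=> sf sh; split; first by apply: measurable_funD; [exact: sf.1|exact: sh.1].
by rewrite (le_lt_trans (sq_le_add sf.1 sh.1))// (sqE sf) (sqE sh) -!EFinM -EFinD ltry.
Qed.

Lemma sqiN f : sqi f -> sqi (fun x => - f x).
Proof. by move=> [mf fy]; split; [exact: measurableT_comp|rewrite sqN]. Qed.

Lemma sqiB f h : sqi f -> sqi h -> sqi (fun x => f x - h x).
Proof. by move=> sf /sqiN sh; exact: sqiD. Qed.

Lemma ipC f h : ip f h = ip h f.
Proof. by apply: eq_Rintegral => x _; rewrite mulrC. Qed.

Lemma ipDl f1 f2 h : sqi f1 -> sqi f2 -> sqi h ->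
  ip (fun x => f1 x + f2 x) h = ip f1 h + ip f2 h.
Proof.
move=> s1 s2 sh; rewrite /ip -RintegralD//; [|exact: sqi_mul..].
by apply: eq_Rintegral => x _; rewrite mulrDl.
Qed.

Lemma ipZl a f h : sqi f -> sqi h -> ip (fun x => a * f x) h = a * ip f h.
Proof.
move=> sf sh; rewrite /ip -RintegralZl//; last exact: sqi_mul.
by apply: eq_Rintegral => x _; rewrite mulrA.
Qed.

Lemma ipNl f h : sqi f -> sqi h -> ip (fun x => - f x) h = - ip f h.
Proof.
move=> sf sh; rewrite -mulN1r -ipZl//.
by apply: eq_Rintegral => x _; rewrite mulN1r.
Qed.

Lemma ipBl f1 f2 h : sqi f1 -> sqi f2 -> sqi h ->
  ip (fun x => f1 x - f2 x) h = ip f1 h - ip f2 h.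
Proof. by move=> s1 s2 sh; rewrite ipDl ?ipNl//; exact: sqiN. Qed.

Lemma ipBr f h1 h2 : sqi f -> sqi h1 -> sqi h2 ->
  ip f (fun x => h1 x - h2 x) = ip f h1 - ip f h2.
Proof. by move=> s1 s2 sh; rewrite ipC ipBl// !(ipC f). Qed.

(** The squared norm of [f - t * h] is a nonnegative polynomial in [t]; a suitable [t] gives the
    bound. *)
Lemma cauchy_schwarz_sq f h : sqi f -> sqi h -> ip f h ^+ 2 <= ip f f * ip h h.
Proof.
move=> sf sh.
have H t : 0 <= ip f f - 2 * t * ip f h + t ^+ 2 * ip h h.
  have := ip_ge0 (fun x => f x - t * h x).
  have sth := sqiZ t sh.
  rewrite ipBl// ?ipBr//; last exact: sqiB.
  by rewrite (ipC f (fun x => t * h x)) !ipZl// (ipC h (fun x => t * h x)) ipZl// (ipC h f); nra.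
move: (ip_ge0 h) (ip_ge0 f); rewrite le_eqVlt => /predU1P[h0 f0|h0 _].
  rewrite -h0 mulr0.
  have [->|] := eqVneq (ip f h) 0; first by rewrite expr0n.
  (* With [ip h h = 0] the polynomial is affine in [t], and this [t] gives it the value -1. *)
  move=> fh; have := H ((ip f f + 1) / (2 * ip f h)); rewrite -h0 !mulr0 addr0.
  have -> : 2 * ((ip f f + 1) / (2 * ip f h)) * ip f h = ip f f + 1 by field.
  by lra.
(* The minimiser of the polynomial. *)
have := H (ip f h / ip h h).
have -> : ip f f - 2 * (ip f h / ip h h) * ip f h + (ip f h / ip h h) ^+ 2 * ip h h =
  (ip f f * ip h h - ip f h ^+ 2) / ip h h by field; rewrite gt_eqF.
by rewrite pmulr_lge0 ?invr_gt0// subr_ge0.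
Qed.

Lemma cauchy_schwarz f h : sqi f -> sqi h -> `|ip f h| <= nrm f * nrm h.
Proof.
move=> sf sh; rewrite -(@ler_pXn2r _ 2)//; last first.
  by rewrite nnegrE mulr_ge0// nrm_ge0.
by rewrite exprMn !nrm_sqr real_normK ?num_real// cauchy_schwarz_sq.
Qed.

Lemma nrmD f h : sqi f -> sqi h -> nrm (fun x => f x + h x) <= nrm f + nrm h.
Proof.
move=> sf sh; have sfh := sqiD sf sh; rewrite -(@ler_pXn2r _ 2)//; last 2 first.
- by rewrite nnegrE nrm_ge0.
- by rewrite nnegrE addr_ge0// nrm_ge0.
rewrite nrm_sqr ipDl// !(ipC _ (fun x => f x + h x)) !ipDl// (ipC h f) sqrrD !nrm_sqr.
have := cauchy_schwarz sf sh; move: (ler_norm (ip f h)).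
by move: (ip f h) (nrm f * nrm h) => a b; lra.
Qed.

Lemma nrmN f : nrm (fun x => - f x) = nrm f.
Proof. by congr Num.sqrt; apply: eq_Rintegral => x _; rewrite mulrNN. Qed.

Lemma nrmB f h : sqi f -> sqi h -> nrm (fun x => f x - h x) <= nrm f + nrm h.
Proof. by move=> sf sh; rewrite -(nrmN h) nrmD//; exact: sqiN. Qed.

Lemma sqi_near f h : measurable_fun D f -> sqi h -> (sq (fun x => f x - h x)%R < +oo)%E -> sqi f.
Proof.
move=> mf sh fh.
have /sqiD/(_ sh) : sqi (fun x => f x - h x).
  by split => //; apply: measurable_funB => //; exact: sh.1.
by rewrite (_ : (fun x => _) = f)//; apply/funext => x; rewrite subrK.
Qed.

End SquareIntegrable.

(** * Limits in L^2: inner products and completeness *)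

Section SquareLimits.
Context d (T : measurableType d) (R : realType).
Variables (mu : {measure set T -> \bar R}) (D : set T).
Hypothesis mD : measurable D.
Implicit Types f h : T -> R.
Local Notation sq := (sq mu D).
Local Notation sqi := (sqi mu D).
Local Notation ip := (ip mu D).
Local Notation nrm := (nrm mu D).

(** The functions are only assumed measurable, so finitely many of the values may be infinite; the
    epsilon form takes care of finiteness. *)
Lemma sq_cvg0P (fn : nat -> T -> R) : (forall n, measurable_fun D (fn n)) ->
  (fun n => sq (fn n)) @ \oo --> (0 : \bar R) <->
  forall eps : R, 0 < eps -> \forall n \near \oo, (sq (fn n) < eps%:E)%E.
Proof.
move=> mf; split => [f0 e e0|H].
  move/fine_cvgP : f0 => [fin f0].
  near=> n; rewrite -(@fineK _ (sq (fn n))); last by near: n.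
  rewrite lte_fin (le_lt_trans (ler_norm _))//; near: n.
  exact: (cvgr0Pnorm_lt _).1 f0 e e0.
apply/fine_cvgP; split.
  have := H 1 ltr01; apply: filterS => n f1.
  by rewrite ge0_fin_numE ?sq_ge0// (lt_trans f1)// ltry.
apply/cvgr0Pnorm_lt => e e0; have := H e e0; apply: filterS => n fe.
rewrite /= ger0_norm ?fine_ge0 ?sq_ge0// -lte_fin fineK//.
by rewrite ge0_fin_numE ?sq_ge0// (lt_trans fe)// ltry.
Unshelve. all: by end_near.
Qed.

Lemma nrm_lt f e : sqi f -> 0 < e -> (sq f < (e ^+ 2)%:E)%E -> nrm f < e.
Proof.
move=> sf e0; rewrite sq_nrm// lte_fin.
by rewrite ltr_pXn2r// nnegrE ?nrm_ge0// ltW.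
Qed.

(** The difference expands into [ip (fn - f) (hn - h)], [ip (fn - f) h] and [ip f (hn - h)], each
    bounded by Cauchy-Schwarz. The functions [fn n] and [hn n] are square integrable only for large
    [n], by proximity to the limits. *)
Lemma sq_cvg_ip (fn hn : nat -> T -> R) f h :
  (forall n, measurable_fun D (fn n)) -> (forall n, measurable_fun D (hn n)) ->
  sqi f -> sqi h ->
  (fun n => sq (fun x => fn n x - f x)) @ \oo --> (0 : \bar R) ->
  (fun n => sq (fun x => hn n x - h x)) @ \oo --> (0 : \bar R) ->
  (fun n => ip (fn n) (hn n)) @ \oo --> ip f h.
Proof.
move=> mf mh sf sh.
move=> /sq_cvg0P; move/(_ (fun n => measurable_funB (mf n) sf.1)) => cf.
move=> /sq_cvg0P; move/(_ (fun n => measurable_funB (mh n) sh.1)) => ch.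
apply/cvgrPdist_lt => /= e e0.
have key (r a a' b b' p1 p2 p3 : R) : r <= e -> r * (b + b' + 1 + e) * 2 = e ->
    0 <= a -> 0 <= a' -> 0 <= b -> 0 <= b' -> a < r -> a' < r ->
    p1 <= a * a' -> p2 <= a * b' -> p3 <= b * a' -> p1 + p2 + p3 < e.
  move=> re E a0 a'0 b0 b'0 ar a'r h1 h2 h3.
  have r0 : 0 <= r by rewrite (le_trans a0)// ltW.
  have g1 : a * a' <= r * r by rewrite ler_pM// ltW.
  have g2 : a * b' <= r * b' by rewrite ler_wpM2r// ltW.
  have g3 : b * a' <= b * r by rewrite ler_wpM2l// ltW.
  have g4 : r * r <= r * e by rewrite ler_wpM2l.
  lra.
(* The radius will be [r = e / c / 2]. The summand 1 gives [r <= e], and the summand [e] absorbs the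
   quadratic term through [r * r <= r * e]. *)
pose c := nrm f + nrm h + 1 + e.
have c0 : 0 < c by rewrite /c; have := nrm_ge0 mu D f; have := nrm_ge0 mu D h; lra.
have ec0 : 0 < e / c / 2 by rewrite !divr_gt0.
near=> n.
have Af : (sq (fun x => fn n x - f x)%R < ((e / c / 2) ^+ 2)%:E)%E.
  by near: n; apply: cf; rewrite exprn_gt0.
have Ah : (sq (fun x => hn n x - h x)%R < ((e / c / 2) ^+ 2)%:E)%E.
  by near: n; apply: ch; rewrite exprn_gt0.
have sfn : sqi (fn n) by apply: (sqi_near mD _ sf) => //; rewrite (lt_trans Af)// ltry.
have shn : sqi (hn n) by apply: (sqi_near mD _ sh) => //; rewrite (lt_trans Ah)// ltry.
have s1 := sqiB mD sfn sf; have s2 := sqiB mD shn sh.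
have nf := nrm_lt s1 ec0 Af; have nh := nrm_lt s2 ec0 Ah.
have -> : ip f h - ip (fn n) (hn n) =
    - (ip (fun x => fn n x - f x) (fun x => hn n x - h x)
       + ip (fun x => fn n x - f x) h + ip f (fun x => hn n x - h x)).
  by rewrite !(ipBl mD)// !(ipBr mD)//; ring.
rewrite normrN (le_lt_trans (ler_normD _ _))//.
rewrite (le_lt_trans (lerD (ler_normD _ _) (lexx _)))//.
have k1 := cauchy_schwarz mD s1 s2.
have k2 := cauchy_schwarz mD s1 sh.
have k3 := cauchy_schwarz mD sf s2.
have E : e / c / 2 * c * 2 = e by field; rewrite gt_eqF.
have c2 : e / c / 2 <= e.
  have c1 : 1 <= c by rewrite /c; have := nrm_ge0 mu D f; have := nrm_ge0 mu D h; lra.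
  by move: (ec0) => r0; nra.
have := key _ _ _ _ _ _ _ _ c2 E (nrm_ge0 _ _ _) (nrm_ge0 _ _ _) (nrm_ge0 _ _ f) (nrm_ge0 _ _ h)
  nf nh k1 k2 k3; exact.
Unshelve. all: by end_near.
Qed.

Lemma limn_einf_le_near (u : nat -> \bar R) (c : \bar R) (N : nat) :
  (forall k, (N <= k)%N -> (u k <= c)%E) -> (limn_einf u <= c)%E.
Proof.
move=> uc; rewrite limn_einf_lim; apply: lime_le; first exact: is_cvg_einfs.
apply: nearW => n; apply: (@le_trans _ _ (u (maxn n N))).
  by apply: ereal_inf_lbound; exists (maxn n N) => //=; exact: leq_maxl.
by apply: uc; exact: leq_maxr.
Qed.

(** An increment is at most [sqrt M * 2^-j <= (1 + M) * 2^-j], so the telescoping series converges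
    absolutely. *)
Lemma geometric_bound_cvg (a : nat -> R) (M : R) : 0 <= M ->
  (forall j, 4 ^+ j * (a j.+1 - a j) ^+ 2 <= M) -> cvgn a.
Proof.
move=> M0 aM.
have da j : `|a j.+1 - a j| <= (1 + M) * 2^-1 ^+ j.
  rewrite exprVn ler_pdivlMr ?exprn_gt0//.
  have := aM j; rewrite (_ : 4 = 2 ^+ 2); last by rewrite -natrX.
  rewrite -exprM mulnC exprM -exprMn.
  rewrite -[X in X <= _]real_normK ?num_real// normrM (ger0_norm (exprn_ge0 _ _))//.
  rewrite [X in X ^+ 2]mulrC.
  have : 0 <= `|a j.+1 - a j| * 2 ^+ j by rewrite mulr_ge0// exprn_ge0.
  by move: (_ * _) => y y0; nra.
have : cvgn (series (telescope a)).
  apply: normed_cvg; apply: (@series_le_cvg _ _ (geometric (1 + M) 2^-1)).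
  - by move=> n; exact: normr_ge0.
  - by move=> n; rewrite /geometric /= mulr_ge0// ?addr_ge0// exprn_ge0// invr_ge0.
  - by move=> n; exact: da.
  - by apply: is_cvg_geometric_series; rewrite ger0_norm ?invr_ge0// invf_lt1// ltr1n.
rewrite telescopeK => /cvg_ex[l al]; apply/cvg_ex; exists (l + a 0%N).
rewrite (_ : a = (fun n => a n - a 0%N) \+ (fun=> a 0%N)); last first.
  by apply/funext => n /=; rewrite subrK.
rewrite [X in l + X]subrK.
exact: (cvgD al (cvg_cst _)).
Qed.

(** Riesz-Fischer. Along a fast subsequence, the sum of the squared increments with weights [4 ^ j]
    has a finite integral, hence is finite almost everywhere, where it forces convergence. Fatou's
    lemma then gives convergence in L^2 of the whole sequence. *)
Lemma sq_complete (fn : nat -> T -> R) : (forall n, measurable_fun D (fn n)) ->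
  (forall eps : R, 0 < eps -> exists N : nat, forall n k : nat,
    (N <= n)%N -> (N <= k)%N -> (sq (fun x => fn n x - fn k x)%R < eps%:E)%E) ->
  exists2 f : T -> R, measurable_fun D f & (fun n => sq (fun x => fn n x - f x)) @ \oo --> (0 : \bar R).
Proof.
move=> mf cau.
pose eps j : R := (1 / (2 ^ (j + 1))%:R) / 4 ^+ j.
have eps0 j : 0 < eps j by rewrite /eps !divr_gt0// ?exprn_gt0// ltr0n expn_gt0.
have /choice[N NP] : forall j, exists N : nat, forall n k : nat,
    (N <= n)%N -> (N <= k)%N -> (sq (fun x => fn n x - fn k x)%R < (eps j)%:E)%E.
  by move=> j; exact: cau.
(* This index exceeds [N i] for every [i <= j], and also [j], so that it tends to infinity. *)
pose phi j := (j + \sum_(i < j.+1) N i)%N.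
have phiN j k : (j <= k)%N -> (N j <= phi k)%N.
  move=> jk; rewrite /phi (bigD1 (Ordinal (jk : j < k.+1)%N))//= addnCA; exact: leq_addr.
pose t j x : \bar R := (4 ^+ j * (fn (phi j.+1) x - fn (phi j) x) ^+ 2)%:E.
have mt j : measurable_fun D (t j).
  apply/measurable_EFinP/measurable_funM => //; apply: measurable_funX.
  by apply: measurable_funB.
have t0 j x : (0 <= t j x)%E by rewrite lee_fin mulr_ge0// ?sqr_ge0// exprn_ge0.
pose G x := (\sum_(j <oo) t j x)%E.
have mG : measurable_fun D G by apply: ge0_emeasurable_sum.
have G0 x : (0 <= G x)%E by apply: nneseries_ge0.
have iG : (\int[mu]_(x in D) G x <= 1%:E)%E.
  rewrite integral_nneseries//.
  have <- : (\sum_(j <oo) (1 / (2 ^ (j + 1))%:R)%:E = 1%:E :> \bar R)%E.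
    have := @cvg_geometric_eseries_half R 1 0.
    by rewrite expr0 divr1 => /cvg_lim; apply.
  apply: lee_nneseries => [j _ _|j _]; first by apply: integral_ge0 => x _; exact: t0.
  have -> : (\int[mu]_(x in D) t j x =
      (4 ^+ j)%:E * \int[mu]_(x in D) ((fn (phi j.+1) x - fn (phi j) x) ^+ 2)%:E)%E.
    rewrite -ge0_integralZl//.
    - by apply/measurable_EFinP/measurable_funX/measurable_funB.
    - by move=> x _; rewrite lee_fin sqr_ge0.
  have := NP j (phi j.+1) (phi j) (phiN _ _ (leqnSn j)) (phiN _ _ (leqnn j)) => /ltW.
  move=> /(lee_wpmul2l (_ : (0 <= (4 ^+ j)%:E)%E)) => /(_ _)/le_trans -> //.
  by rewrite -EFinM lee_fin /eps mulrC divfK// gt_eqF// exprn_gt0.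
have Gint : mu.-integrable D G.
  apply/integrableP; split => //; rewrite (le_lt_trans _ (ltry 1))//.
  by under eq_integral do rewrite gee0_abs//.
have aeG := integrable_ae mD Gint.
(* An upper limit is measurable without reference to the set of convergence; [fine] supplies a value
   where it is infinite. *)
pose f x := fine (limn_esup (fun j => (fn (phi j) x)%:E)).
have mf' : measurable_fun D f.
  apply: measurableT_comp => //; apply: measurable_fun_limn_esup => // j.
  exact/measurable_EFinP.
have fE x : D x -> G x \is a fin_num -> (fun j => fn (phi j) x) @ \oo --> f x.
  move=> Dx Gx.
  have : cvgn (fun j => fn (phi j) x).
    apply: (@geometric_bound_cvg _ (fine (G x))); first exact: fine_ge0.
    move=> j; rewrite -lee_fin fineK//.
    apply: le_trans (nneseries_lim_ge j.+1 _); last by move=> k _ _; exact: t0.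
    by rewrite big_nat_recr//= leeDr// sume_ge0.
  move=> /cvg_ex[l cl]; suff -> : f x = l by [].
  have cl' : (fun j => (fn (phi j) x)%:E) @ \oo --> l%:E by apply/fine_cvgP; split => //; exact: nearW.
  by rewrite /f is_cvg_limn_esupE; [rewrite (cvg_lim _ cl')|apply/cvg_ex; exists l%:E].
exists f => //; apply/sq_cvg0P; first by move=> n; exact: measurable_funB.
move=> e e0.
have [M MP] := cau (e / 2) (divr_gt0 e0 (ltr0n _ 2)).
exists M => // n /= Mn.
apply: (@le_lt_trans _ _ (e / 2)%:E); last by rewrite lte_fin; lra.
pose u k x : \bar R := ((fn n x - fn (phi k) x) ^+ 2)%:E.
have mu' k : measurable_fun D (u k) by apply/measurable_EFinP/measurable_funX/measurable_funB.
(* Fatou along the subsequence, with [n] fixed: each integral is small by the Cauchy condition. *)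
apply: (@le_trans _ _ (limn_einf (fun k => \int[mu]_(x in D) u k x)%E)); last first.
  apply: (@limn_einf_le_near _ _ M) => k Mk; apply: ltW; apply: MP => //.
  by rewrite (leq_trans Mk)// leq_addr.
apply: le_trans (fatou mu mD mu' _); last by move=> k x _; rewrite lee_fin sqr_ge0.
apply: ae_ge0_le_integral => //.
- by move=> x _; rewrite lee_fin sqr_ge0.
- by apply/measurable_EFinP/measurable_funX/measurable_funB.
- move=> x _; rewrite limn_einf_lim; apply: lime_ge; first exact: is_cvg_einfs.
  by apply: nearW => k; apply: le_ereal_inf_tmp => _ [i _ <-]; rewrite lee_fin sqr_ge0.
- have -> : (fun x => limn_einf (u ^~ x)) = (fun x => - limn_esup (fun k => - u k x))%E.
    by apply/funext => x; rewrite -limn_einfN; congr limn_einf; apply/funext => k; exact/esym/oppeK.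
  apply: measurableT_comp => //; apply: measurable_fun_limn_esup => // k.
  exact: measurableT_comp.
apply: filterS aeG => x Gx Dx; have {Gx} := Gx Dx => /(fE x Dx) cf.
have : (fun k => u k x) @ \oo --> ((fn n x - f x) ^+ 2)%:E.
  apply/fine_cvgP; split; first exact: nearW.
  apply: cvgM => /=; by apply: cvgB => //; exact: cvg_cst.
by move=> /cvg_limn_einf_sup[-> _].
Qed.

End SquareLimits.

(** * Functions whose integrals vanish on a generating class *)

Section VanishingIntegral.
Context d (T : measurableType d) (R : realType).
Variable mu : {measure set T -> \bar R}.

(** Dynkin's theorem carries the vanishing to all measurable sets. The whole space is treated by a
    separate hypothesis because it may lie outside [G], as with the bounded half-open intervals. The
    other application takes the L^2-open sets. *)
Lemma integral_pi_system_ae0 (G : set (set T)) (f : T -> R) :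
  @measurable _ T = <<s G >> -> setI_closed G ->
  mu.-integrable setT (EFin \o f) ->
  \int[mu]_x f x = 0 -> (forall A, G A -> \int[mu]_(x in A) f x = 0) ->
  {ae mu, forall x, f x = 0}.
Proof.
move=> mG GI intf fT fG.
have sub A : measurable A -> mu.-integrable A (EFin \o f).
  by move=> mA; apply: integrableS intf.
have fA A : measurable A -> \int[mu]_(x in A) f x = 0.
  rewrite mG; move: A.
  apply: (@dynkin_induction _ _ G (fun A => \int[mu]_(x in A) f x = 0)) => //.
  - move=> A mA A0; have := @Rintegral_setU _ _ _ mu A (~` A) f mA (measurableC mA).
    rewrite setUv A0 add0r fT => <- //.
      by apply/disj_setPS; rewrite setICr.
  - move=> F mF tF F0; rewrite /Rintegral integral_bigcup//; last first.
      by apply: sub; exact: bigcupT_measurable.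
    rewrite eseries0// => i _ _; rewrite -[LHS]fineK; first by have := F0 i; rewrite /Rintegral => ->.
    exact: integrable_fin_num (sub _ (mF i)).
have [N [mN N0 NP]] : ae_eq mu setT (EFin \o f) (cst 0%E).
  apply: integral_ae_eq => // E _ mE; rewrite integral_cst// mul0e.
  rewrite -[LHS]fineK; first by have := fA E mE; rewrite /Rintegral => ->.
  exact: integrable_fin_num (sub _ mE).
exists N; split => // x fx; apply: NP => /= /(_ Logic.I) [f0].
by apply: fx.
Qed.

End VanishingIntegral.

Section MeasurabilityTools.
Context d (T : measurableType d) (R : realType).

(** Strict sublevel sets suit this setting: for right continuous nondecreasing [g], the condition
    [g q < c] is open in [g]. *)
Lemma measurable_fun_lt (D : set T) (f : T -> R) : measurable D ->
  (forall c : R, measurable (D `&` [set x | f x < c])) -> measurable_fun D f.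
Proof.
move=> mD H; apply: (measurability _ (RGenInftyO.measurableE R)) => //.
move=> _ [_ [c ->] <-]; have := H c; congr (measurable (_ `&` _)).
Qed.

End MeasurabilityTools.

(** * Integrals over [0, 1] and uniform cells *)

Section UnitInterval.
Variable R : realType.
Local Notation leb := (@lebesgue_measure R).
Local Notation I01 := (@I01 R).

Lemma measurable_I01 : measurable (I01 : set (measurableTypeR R)).
Proof. exact: measurable_itv. Qed.
Hint Extern 0 (measurable _) => solve [exact: measurable_I01] : core.

Lemma I01P t : I01 t <-> 0 <= t <= 1.
Proof. by rewrite /Defs.I01 /= in_itv. Qed.

Lemma leb_I01 : leb I01 = 1%E.
Proof. by rewrite lebesgue_measure_itv/= lte_fin ltr01 oppr0 adde0. Qed.

Lemma bounded_integrable (f : R -> R) (M : R) : measurable_fun I01 f ->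
  (forall s, I01 s -> `|f s| <= M) -> leb.-integrable I01 (EFin \o f).
Proof.
move=> mf fM; apply: measurable_bounded_integrable => //.
  by rewrite [X in (X < _)%E]leb_I01 ltry.
exists M; split; first exact: num_real.
by move=> x Mx s s1; apply: (le_trans (fM s s1)); exact: ltW.
Qed.

Lemma bounded_sqi (f : R -> R) (M : R) : measurable_fun I01 f ->
  (forall s, I01 s -> `|f s| <= M) -> sqi leb I01 f.
Proof.
move=> mf fM; split => //.
have /integrableP[_] : leb.-integrable I01 (EFin \o (fun s => f s ^+ 2)).
  apply: (@bounded_integrable _ (M ^+ 2)); first exact: measurable_funX.
  move=> s /fM fs; rewrite ger0_norm ?sqr_ge0// -real_normK ?num_real//.
  by rewrite lerXn2r ?nnegrE// (le_trans _ fs).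
rewrite /sq; apply: le_lt_trans; rewrite le_eqVlt; apply/orP; left; apply/eqP.
by apply: eq_integral => s _ /=; rewrite ger0_norm ?sqr_ge0.
Qed.

Lemma Rint01_cst c : Rint01 (fun _ => c : R) = c.
Proof. by rewrite /Rint01 Rintegral_cst// [X in fine X]leb_I01 mulr1. Qed.

Lemma Rint01_le_cst (f : R -> R) (c : R) : measurable_fun I01 f ->
  (forall s, I01 s -> 0 <= f s <= c) -> 0 <= Rint01 f <= c.
Proof.
move=> mf fc; have c0 : 0 <= c.
  have /fc/andP[a b] : I01 0 by apply/I01P; rewrite lexx ler01.
  exact: le_trans b.
have intf : leb.-integrable I01 (EFin \o f).
  by apply: (@bounded_integrable _ c) => // s /fc/andP[f0 f1]; rewrite ger0_norm.
apply/andP; split; first by apply: Rintegral_ge0 => s /fc/andP[].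
rewrite -[leRHS]Rint01_cst; apply: le_Rintegral => //.
  by apply: (@bounded_integrable _ c) => // s _; rewrite ger0_norm.
by move=> s /fc/andP[].
Qed.

(** Index of the cell [[k/n, (k+1)/n[] that contains [t >= 0]. The point 1 gets the index [n], one
    more than the cells that fill the interval. *)
Definition cell (n : nat) (t : R) : nat := Num.trunc (n%:R * t).

Lemma cellP n t : (0 < n)%N -> 0 <= t ->
  (cell n t)%:R / n%:R <= t < (cell n t).+1%:R / n%:R.
Proof.
move=> n0 t0; rewrite ler_pdivrMr ?ltr0n// ltr_pdivlMr ?ltr0n// (mulrC t).
by apply: truncn_itv; rewrite mulr_ge0.
Qed.

Lemma cell_eq n t k : (0 < n)%N -> k%:R / n%:R <= t < k.+1%:R / n%:R -> cell n t = k.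
Proof.
move=> n0; rewrite ler_pdivrMr ?ltr0n// ltr_pdivlMr ?ltr0n// (mulrC t).
exact: truncn_def.
Qed.

Lemma cell_lt n t : (0 < n)%N -> 0 <= t < 1 -> (cell n t < n)%N.
Proof.
move=> n0 /andP[t0 t1]; rewrite /cell truncn_lt_nat ?mulr_ge0//.
by rewrite gtr_pMr// ltr0n.
Qed.

Lemma cell_le n s t : 0 <= s -> s <= t -> (cell n s <= cell n t)%N.
Proof. by move=> s0 st; apply: le_truncn; rewrite ler_wpM2l. Qed.

Lemma cell1 n : cell n 1 = n.
Proof. by rewrite /cell mulr1 natrK. Qed.

Lemma measurable_cell_fun n (c : nat -> R) : measurable_fun setT (fun t => c (cell n t)).
Proof.
move=> _ B mB; rewrite setTI.
have -> : (fun t => c (cell n t)) @^-1` B = \bigcup_(k in c @^-1` B) (cell n @^-1` [set k]).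
  by apply/seteqP; split => [t Bt|t [k Bk /= kt]]; [exists (cell n t)|rewrite /= kt].
apply: bigcup_measurable => k _; apply: is_interval_measurable => x y /= xk yk z /andP[xz zy].
apply/eqP; rewrite eqn_leq; apply/andP; split.
  by rewrite -yk; apply: le_truncn; rewrite ler_wpM2l.
by rewrite -xk; apply: le_truncn; rewrite ler_wpM2l.
Qed.

Lemma leb_cell n k : (0 < n)%N -> (k < n)%N ->
  leb (I01 `&` cell n @^-1` [set k]) = (n%:R^-1)%:E.
Proof.
move=> n0 kn.
have -> : I01 `&` cell n @^-1` [set k] = `[k%:R / n%:R, k.+1%:R / n%:R[%classic.
  apply/seteqP; split => [t [/I01P/andP[t0 t1] /= <-]|t]; rewrite /= in_itv/=.
    exact: cellP.
  move=> tk; split; last exact: cell_eq.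
  case/andP: tk => k1 k2; apply/I01P; rewrite (le_trans _ k1) ?divr_ge0//=.
  by rewrite ltW// (lt_le_trans k2)// ler_pdivrMr ?ltr0n// mul1r ler_nat.
rewrite lebesgue_measure_itv/= lte_fin ltr_pM2r ?invr_gt0 ?ltr0n// ltr_nat ltnSn.
by rewrite -EFinB -mulrBl -natrB ?subSnn ?mul1r.
Qed.

Lemma Rint01_cell n (c : nat -> R) : (0 < n)%N ->
  Rint01 (fun t => c (cell n t)) = n%:R^-1 * \sum_(k < n) c k.
Proof.
move=> n0.
have mk k : measurable (I01 `&` cell n @^-1` [set k]).
  apply: measurableI => //.
  have := @measurable_cell_fun n (fun i => (i == k)%:R) measurableT [set 1] (measurable_set1 _).
  rewrite setTI; congr measurable; apply/seteqP; split => t /=.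
    by case: eqP => // _ /esym/eqP; rewrite oner_eq0.
  by move=> ->; rewrite eqxx.
have -> : Rint01 (fun t => c (cell n t)) =
    (* The index [n] accounts for the point 1 alone, which has measure zero. *)
    \int[leb]_(t in I01) \sum_(k < n.+1) c k * \1_(I01 `&` cell n @^-1` [set (k : nat)]) t.
  apply: eq_Rintegral.
  move=> t /[!inE] /[dup] t01 /I01P/andP[t0 t1].
  have kn : (cell n t < n.+1)%N by rewrite ltnS -[leqRHS](cell1 n) cell_le.
  rewrite (bigD1 (Ordinal kn))//= indicE mem_set// mulr1 big1 ?addr0// => i ik.
  rewrite indicE memNset ?mulr0// => -[_ /= ki]; move/eqP: ik; apply.
  by apply: val_inj; rewrite /= ki.
have mi k : leb.-integrable I01 (EFin \o (fun t => c k * \1_(I01 `&` cell n @^-1` [set k]) t)).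
  apply: (@bounded_integrable _ `|c k|).
    by apply: measurable_funTS; apply: measurable_funM => //; exact: measurable_indic.
  by move=> s _; rewrite normrM ler_piMr// indicE; case: (_ \in _); rewrite ?normr1 ?normr0.
rewrite /Rintegral.
under eq_integral do rewrite -sumEFin.
rewrite integral_sum//.
have ik k : (\int[leb]_(x in I01) (c k * \1_(I01 `&` cell n @^-1` [set k]) x)%:E =
    (c k)%:E * leb (I01 `&` cell n @^-1` [set k]))%E.
  under eq_integral do rewrite EFinM.
  rewrite integralZl//; last first.
    apply: (@bounded_integrable _ 1); first by apply: measurable_funTS; exact: measurable_indic.
    by move=> s _; rewrite indicE; case: (_ \in _); rewrite ?normr1 ?normr0.
  congr (_ * _)%E; transitivity (leb ((I01 `&` cell n @^-1` [set k]) `&` I01)).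
    by apply: integral_indic => //; exact: mk.
  by congr (leb _); apply/seteqP; split => [x [[]]|x []].
rewrite big_ord_recr /= ik.
rewrite (_ : I01 `&` cell n @^-1` [set n] = [set 1]); last first.
  apply/seteqP; split => [t [/I01P/andP[t0 t1] /= tn]|t /= ->]; last first.
    by split; [apply/I01P; rewrite ler01 lexx|exact: cell1].
  apply/eqP; rewrite eq_le t1/= leNgt; apply/negP => t1'.
  by have := @cell_lt n t n0; rewrite t0 t1' tn ltnn => /(_ isT).
rewrite [leb _]lebesgue_measure_set1 mule0 adde0.
under eq_bigr => k _ do rewrite ik leb_cell// -EFinM.
  by rewrite sumEFin /= -mulr_suml mulrC.
by move=> k; exact: mi.
Qed.

End UnitInterval.
#[export] Hint Extern 0 (measurable _) => solve [exact: measurable_I01] : core.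
Arguments measurable_I01 {R}.

(** * The space [G0] *)

Section G0Facts.
Variable R : realType.
Local Notation leb := (@lebesgue_measure R).
Local Notation I01 := (@I01 R).
Implicit Types f g h : G0 R.

Lemma G0_lt0 g t : t < 0 -> g t = 0. Proof. by case: (gfunP g) => + _ _ _ _; apply. Qed.
Lemma G0_ge1 g t : 1 <= t -> g t = 1. Proof. by case: (gfunP g) => _ + _ _ _; apply. Qed.

Lemma G0_itv g t : 0 <= g t <= 1.
Proof.
have [t0|t0] := ltP t 0; first by rewrite G0_lt0// lexx ler01.
have [t1|t1] := leP 1 t; first by rewrite G0_ge1// lexx ler01.
by case: (gfunP g) => _ _ + _ _; apply; rewrite t0.
Qed.

Lemma G0_ge0 g t : 0 <= g t. Proof. by have /andP[] := G0_itv g t. Qed.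
Lemma G0_le1 g t : g t <= 1. Proof. by have /andP[] := G0_itv g t. Qed.

Lemma G0_nondecreasing g s t : s <= t -> g s <= g t.
Proof.
move=> st; have [s0|s0] := ltP s 0; first by rewrite (G0_lt0 _ s0) G0_ge0.
have [t1|t1] := leP 1 t; first by rewrite (G0_ge1 _ t1) G0_le1.
by case: (gfunP g) => _ _ _ + _; apply.
Qed.

Lemma G0_right_lt g s c : g s < c -> exists2 t, s < t & g t < c.
Proof.
move=> gc; have [s0|s0] := ltP s 0.
  exists (s / 2); first lra.
  by rewrite G0_lt0; [rewrite -(G0_lt0 g s0)|lra].
have [s1|s1] := leP 1 s.
  by exists (s + 1); [lra|rewrite G0_ge1; [rewrite -(G0_ge1 g s1)|lra]].
have : g x @[x --> s^'+] --> g s by case: (gfunP g) => _ _ _ _; apply; rewrite s0.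
move=> /cvgrPdist_lt/(_ _ (_ : 0 < c - g s)); rewrite subr_gt0 => /(_ gc) H.
have [t /= [st tc]] : exists t, s < t /\ `|g s - g t| < c - g s.
  near s^'+ => t; exists t; split; [by near: t; exact: nbhs_right_gt|by near: t].
exists t => //; move: tc; rewrite distrC => /(le_lt_trans (ler_norm _)); lra.
Unshelve. all: by end_near.
Qed.

Lemma measurable_G0 g D : measurable_fun D g.
Proof.
apply: measurable_funTS; apply: measurable_fun_lt => // c; rewrite setTI.
apply: is_interval_measurable => x y /= xc yc z /andP[xz zy].
by rewrite (le_lt_trans _ yc)// G0_nondecreasing.
Qed.
Hint Resolve measurable_G0 : core.

Lemma G0_dist_le1 f g s : `|f s - g s| <= 1.
Proof.
have /andP[a b] := G0_itv f s; have /andP[a' b'] := G0_itv g s.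
by rewrite ler_norml; apply/andP; split; lra.
Qed.

Lemma G0_sub_sqi f g : sqi leb I01 (fun s => f s - g s).
Proof.
apply: (@bounded_sqi _ _ 1); first exact: measurable_funB.
by move=> s _; exact: G0_dist_le1.
Qed.

Lemma L2distE f g : L2dist f g = nrm leb I01 (fun s => f s - g s).
Proof. by congr Num.sqrt; apply: eq_Rintegral => s _; rewrite expr2. Qed.

Lemma L2dist_ge0 f g : 0 <= L2dist f g. Proof. exact: sqrtr_ge0. Qed.

Lemma L2distC f g : L2dist f g = L2dist g f.
Proof.
by rewrite !L2distE -nrmN; congr nrm; apply/funext => s; rewrite opprB.
Qed.

Lemma L2dist_triangle f g h : L2dist f h <= L2dist f g + L2dist g h.
Proof.
rewrite !L2distE; have := nrmD (@measurable_I01 R) (G0_sub_sqi f g) (G0_sub_sqi g h).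
by congr (_ <= _); congr nrm; apply/funext => s; ring.
Qed.

Lemma L2dist_self f : L2dist f f = 0.
Proof.
rewrite /L2dist (@eq_Rintegral _ _ _ _ _ (fun _ => 0)); last by move=> s _; rewrite subrr expr0n.
by rewrite -[X in Num.sqrt X]/(Rint01 _) Rint01_cst sqrtr0.
Qed.

Lemma L2dist_sqr f g : L2dist f g ^+ 2 = Rint01 (fun s => (f s - g s) ^+ 2).
Proof. by rewrite sqr_sqrtr// Rintegral_ge0// => s _; rewrite sqr_ge0. Qed.

Lemma L2dist_le f g (c : R) : (forall s, I01 s -> `|f s - g s| <= c) -> L2dist f g <= c.
Proof.
move=> H; have c0 : 0 <= c by apply: le_trans (H 0 _) => //; apply/I01P; rewrite lexx ler01.
rewrite -(@ler_pXn2r _ 2)// ?nnegrE ?L2dist_ge0// L2dist_sqr.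
suff /andP[] : 0 <= Rint01 (fun s => (f s - g s) ^+ 2) <= c ^+ 2 by [].
apply: Rint01_le_cst; first by apply: measurable_funX; exact: measurable_funB.
move=> s s1; rewrite sqr_ge0/= -(real_normK (num_real (_ - _))) lerXn2r ?nnegrE//; exact: H.
Qed.

Lemma L2dist_le1 f g : L2dist f g <= 1.
Proof. by apply: L2dist_le => s _; exact: G0_dist_le1. Qed.

Lemma L2dist_sqr_le f g (b : R -> R) (M : R) : measurable_fun I01 b ->
  (forall s, I01 s -> `|b s| <= M) ->
  (forall s, I01 s -> `|f s - g s| <= b s) -> L2dist f g ^+ 2 <= Rint01 b.
Proof.
move=> mb bM H; rewrite L2dist_sqr; apply: le_Rintegral => //.
- apply: (@bounded_integrable _ _ (1 : R)); first by apply: measurable_funX; exact: measurable_funB.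
  by move=> s _; rewrite normrX exprn_ile1// G0_dist_le1.
- exact: bounded_integrable bM.
- move=> s /H; rewrite -(real_normK (num_real (_ - _))).
  have := G0_dist_le1 f g s; have := normr_ge0 (f s - g s).
  by move: `|_| => y; nra.
Qed.

Lemma L2ball_open f r : L2open (L2ball f r).
Proof.
move=> g /= fg; exists (r - L2dist f g); first by rewrite subr_gt0.
by move=> h; have := L2dist_triangle f g h; move: fg; rewrite /L2ball /=; lra.
Qed.

Lemma L2openI (A B : set (G0 R)) : L2open A -> L2open B -> L2open (A `&` B).
Proof.
move=> oA oB f [/oA[r r0 rA] /oB[s s0 sB]]; exists (Num.min r s); first by rewrite lt_min r0.
by move=> g; rewrite /L2ball /= lt_min => /andP[gr gs]; split; [exact: rA|exact: sB].
Qed.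

Lemma L2open_measurable (O : set (G0m R)) : L2open O -> measurable O.
Proof. by move=> oO; apply: sub_sigma_algebra. Qed.

Definition L2lip (W : G0m R -> R) (L : R) :=
  forall f g : G0 R, `|W f - W g| <= L * L2dist f g.

Lemma L2lip_measurable W L D : L2lip W L -> measurable_fun D W.
Proof.
move=> WL; apply: measurable_funTS; apply: measurable_fun_lt => // c; rewrite setTI.
apply: L2open_measurable => f /= fc; exists ((c - W f) / (`|L| + 1)).
  by rewrite divr_gt0 ?subr_gt0// ltr_wpDl.
have L1 : 0 < `|L| + 1 by rewrite ltr_wpDl.
move=> g; rewrite /L2ball /= ltr_pdivlMr// => fg.
have := WL f g; have := L2dist_ge0 f g; have := ler_norm L.
rewrite distrC => h1 h2 /(le_trans (ler_norm _)).
by move: `|L| (L2dist f g) fg h1 h2 => l e; nra.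
Qed.

(** By right continuity [g] stays below [c] by a margin [e] on some [[q, t]]. A nondecreasing [f]
    with [f q >= c] exceeds [g] by [e] there, so it lies at L^2 distance at least
    [e * sqrt (t - q)]. *)
Lemma G0_eval_open q (c : R) : 0 <= q < 1 -> L2open [set g : G0 R | g q < c].
Proof.
move=> /andP[q0 q1] g /= gc.
have [t0 qt0 gt0] := G0_right_lt gc.
pose t := Num.min t0 1.
have qt : q < t by rewrite lt_min qt0.
have t1 : t <= 1 by rewrite ge_min lexx orbT.
have gt : g t <= g t0 by apply: G0_nondecreasing; rewrite ge_min lexx.
pose e := c - g t0; have e0 : 0 < e by rewrite /e subr_gt0.
exists (e * Num.sqrt (t - q)); first by rewrite mulr_gt0// sqrtr_gt0 subr_gt0.
move=> f; rewrite /L2ball /= => fg; rewrite ltNge; apply/negP => cf.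
move: fg; rewrite ltNge => /negP; apply.
rewrite -(@ler_pXn2r _ 2)// ?nnegrE ?L2dist_ge0//; last first.
  by rewrite mulr_ge0 ?sqrtr_ge0// ltW.
rewrite exprMn sqr_sqrtr ?subr_ge0 ?(ltW qt)// L2dist_sqr.
have -> : e ^+ 2 * (t - q) = Rint01 (fun s => e ^+ 2 * \1_(`[q, t[%classic) s).
  rewrite /Rint01 RintegralZl//; last first.
    apply: (@bounded_integrable _ _ (1 : R)); first by apply: measurable_funTS; exact: measurable_indic.
    by move=> s _; rewrite indicE; case: (_ \in _); rewrite ?normr1 ?normr0.
  rewrite /Rintegral integral_indic//.
  rewrite (_ : _ `&` _ = `[q, t[%classic); last first.
    apply/setIidPl => s /=; rewrite in_itv/= => /andP[qs st]; apply/I01P.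
    by rewrite (le_trans q0)//= ltW// (lt_le_trans st).
  congr (_ * _); have := lebesgue_measure_itv `[q, t[; rewrite /= lte_fin qt => H.
  exact: esym (f_equal fine H).
apply: le_Rintegral => //.
- apply: (@bounded_integrable _ _ (e ^+ 2)).
    by apply: measurable_funTS; apply: measurable_funM => //; exact: measurable_indic.
  move=> s _; rewrite normrM (ger0_norm (sqr_ge0 _)) ler_piMr ?sqr_ge0//.
  by rewrite indicE; case: (_ \in _); rewrite ?normr1 ?normr0.
- apply: (@bounded_integrable _ _ (1 : R)); first by apply: measurable_funX; exact: measurable_funB.
  by move=> s _; rewrite normrX exprn_ile1// G0_dist_le1.
- move=> s s1; rewrite indicE; have [|_] := boolP (s \in _); last by rewrite mulr0 sqr_ge0.
  rewrite inE/= in_itv/= => /andP[qs st]; rewrite mulr1.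
  have h1 : g s <= g t0 by apply: (le_trans (G0_nondecreasing g (ltW st))).
  have h2 : c <= f s by apply: (le_trans cf); exact: G0_nondecreasing.
  have ee : e <= f s - g s by rewrite /e; lra.
  by rewrite -(sqrrN (g s - f s)) opprB lerXn2r// ?nnegrE ?(ltW e0)// (le_trans (ltW e0)).
Qed.

Lemma measurable_eval q D : measurable_fun D (fun g : G0m R => gfun g q).
Proof.
apply: measurable_funTS; have [q0|q0] := ltP q 0.
  by rewrite (_ : (fun g : G0m R => gfun g q) = cst 0)//; apply/funext => g; exact: G0_lt0.
have [q1|q1] := leP 1 q; first by rewrite (_ : (fun g : G0m R => gfun g q) = cst 1)//; apply/funext => g; exact: G0_ge1.
apply: measurable_fun_lt => // c; rewrite setTI.
by apply: L2open_measurable; apply: G0_eval_open; rewrite q0.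
Qed.

(** By monotonicity and right continuity, [g s < c] holds exactly when [g q < c] for some rational
    [q > s]: a countable union of rectangles. *)
Lemma measurable_G0_joint D : measurable_fun D (fun p : G0m R * R => gfun p.1 p.2).
Proof.
apply: measurable_funTS; apply: measurable_fun_lt => // c; rewrite setTI.
have -> : [set p : G0m R * R | gfun p.1 p.2 < c] =
   \bigcup_(q : rat) ([set g : G0m R | gfun g (ratr q) < c] `*` [set s | s < ratr q]).
  apply/seteqP; split => [[g s] /= gc|[g s] [q _ /= [gq sq]]].
    have [t st tc] := G0_right_lt gc.
    have [q] := rat_in_itvoo st; rewrite in_itv/= => /andP[sq qt].
    by exists q => //=; split => //; rewrite (le_lt_trans _ tc)// G0_nondecreasing// ltW.
  by rewrite (le_lt_trans _ gq)// G0_nondecreasing// ltW.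
apply: bigcupT_measurable_rat => q; apply: measurableX.
  have := @measurable_eval (ratr q) setT measurableT _ (measurable_itv `]-oo, c[).
  by rewrite setTI; congr measurable; apply/seteqP; split => g /=; rewrite in_itv.
by have := measurable_itv (`]-oo, (ratr q : R)[); congr measurable.
Qed.

Section Steps.
Variable n : nat.
Hypothesis n0 : (0 < n)%N.

Definition step (x : nat -> R) : R -> R :=
  fun t => if t < 0 then 0 else if 1 <= t then 1 else x (cell n t).

Definition step_ok (x : nat -> R) :=
  (forall k, (k < n)%N -> 0 <= x k <= 1) /\
  (forall k l, (k <= l)%N -> (l < n)%N -> x k <= x l).

Lemma step_inG0 x : step_ok x -> inG0 (step x).
Proof.
move=> [x01 xnd]; split; rewrite /step.
- by move=> t ->.
- by move=> t t1; rewrite t1 ltNge (le_trans ler01 t1).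
- move=> t /andP[t0 t1]; rewrite ltNge t0 (leNgt 1 t) t1/=.
  by apply: x01; apply: cell_lt; rewrite ?t0.
- move=> s t s0 st t1; have t0 := le_trans s0 st; have s1 := le_lt_trans st t1.
  rewrite (ltNge s) s0 (leNgt 1 s) s1 (ltNge t) t0 (leNgt 1 t) t1/=.
  by apply: xnd; [exact: cell_le|apply: cell_lt; rewrite ?t0].
- move=> t /andP[t0 t1]; rewrite (ltNge t) t0 (leNgt 1 t) t1/=.
  apply: cvg_near_cst; near=> s.
  have ts : t < s by near: s; exact: nbhs_right_gt.
  have s1 : s < 1 by near: s; exact: nbhs_right_lt.
  have sk : s < (cell n t).+1%:R / n%:R.
    by near: s; apply: nbhs_right_lt; have /andP[] := cellP n0 t0.
  rewrite ltNge (le_trans t0 (ltW ts)) (leNgt 1 s) s1/=; congr x.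
  apply: cell_eq => //; rewrite sk andbT (le_trans _ (ltW ts))//.
  by have /andP[] := cellP n0 t0.
Unshelve. all: by end_near.
Qed.

(** The index 0 carries 0 instead of [g 0], in agreement with [bnd]: the value at 0 is not among the
    coordinates of the finite dimensional laws. *)
Definition skel (g : G0 R) (k : nat) : R := if k == 0%N then 0 else g (k%:R / n%:R).

Lemma skel_nondecreasing g k l : (k <= l)%N -> skel g k <= skel g l.
Proof.
move=> kl; rewrite /skel; case: (eqVneq k 0%N) => [_|k0].
  by case: ifP => // _; exact: G0_ge0.
case: eqP => [l0|_]; first by move: kl; rewrite l0 leqn0 (negbTE k0).
by apply: G0_nondecreasing; rewrite ler_pM2r ?invr_gt0 ?ltr0n// ler_nat.
Qed.

Lemma skel_itv g k : 0 <= skel g k <= 1.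
Proof. by rewrite /skel; case: ifP => _; rewrite ?lexx ?ler01 ?G0_itv. Qed.

Lemma skel_ok g : step_ok (skel g).
Proof. by split => [k _|k l kl _]; [exact: skel_itv|exact: skel_nondecreasing]. Qed.

Definition dis (g : G0 R) : G0 R := MkG0 (step_inG0 (skel_ok g)).

Definition osc (g : G0 R) (t : R) : R := skel g (cell n t).+1 - skel g (cell n t).

Lemma osc_itv g t : 0 <= osc g t <= 1.
Proof.
rewrite /osc; have := @skel_nondecreasing g _ _ (leqnSn (cell n t)).
have /andP[_] := skel_itv g (cell n t).+1; have /andP[+ _] := skel_itv g (cell n t).
by move=> *; apply/andP; split; lra.
Qed.

Lemma skel_n g : skel g n = 1.
Proof. by rewrite /skel gtn_eqF// divff ?G0_ge1// pnatr_eq0 gtn_eqF. Qed.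

Lemma measurable_osc g D : measurable_fun D (osc g).
Proof. by apply: measurable_funTS; exact: (@measurable_cell_fun _ _ (fun k => skel g k.+1 - skel g k)). Qed.

(** The increments over the cells telescope to [1 - 0], so the integral is the same for all [g].
    Discretisation errors bounded by [osc] are therefore uniform in [g]. *)
Lemma Rint01_osc g : Rint01 (osc g) = n%:R^-1.
Proof.
rewrite (@Rint01_cell _ _ (fun k => skel g k.+1 - skel g k))//.
by rewrite -(big_mkord xpredT (fun k => skel g k.+1 - skel g k)) telescope_sumr// skel_n /skel eqxx subr0 mulr1.
Qed.

Lemma osc_bound g s t : I01 s -> I01 t -> cell n s = cell n t -> `|g s - g t| <= osc g s.
Proof.
move=> /I01P/andP[s0 s1] /I01P/andP[t0 t1] st.
have H u : 0 <= u -> cell n u = cell n s -> skel g (cell n s) <= g u <= skel g (cell n s).+1.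
  move=> u0 us; have := cellP n0 u0; rewrite us => /andP[u1 u2].
  rewrite /skel; apply/andP; split; last by rewrite /=; apply: G0_nondecreasing; exact: ltW.
  by case: ifP => _; [exact: G0_ge0|exact: G0_nondecreasing].
have /andP[a1 a2] := H s s0 erefl; have /andP[b1 b2] := H t t0 (esym st).
by rewrite /osc ler_norml; apply/andP; split; lra.
Qed.

Lemma dis_bound g s : I01 s -> `|dis g s - g s| <= osc g s.
Proof.
move=> /I01P/andP[s0 s1]; rewrite /= /step ltNge s0/=.
case: (leP 1 s) => [s1'|s1']; first by rewrite (G0_ge1 g s1') subrr normr0; have /andP[] := osc_itv g s.
have /andP[u1 u2] := cellP n0 s0.
have a1 : skel g (cell n s) <= g s.
  by rewrite /skel; case: ifP => _; [exact: G0_ge0|exact: G0_nondecreasing].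
have a2 : g s <= skel g (cell n s).+1 by apply: G0_nondecreasing; exact: ltW.
by rewrite /osc ler_norml; apply/andP; split; lra.
Qed.

Lemma dis_cvg g : L2dist (dis g) g ^+ 2 <= n%:R^-1.
Proof.
rewrite -(Rint01_osc g); apply: (@L2dist_sqr_le _ _ _ 1).
- exact: measurable_osc.
- by move=> s _; have /andP[a b] := osc_itv g s; rewrite ger0_norm.
- by move=> s; exact: dis_bound.
Qed.

Lemma L2dist_step x y (sx : step_ok x) (sy : step_ok y) (c : R) : 0 <= c ->
  (forall k, (k < n)%N -> `|x k - y k| <= c) ->
  L2dist (MkG0 (step_inG0 sx)) (MkG0 (step_inG0 sy)) <= c.
Proof.
move=> c0 H; apply: L2dist_le => s /I01P/andP[s0 s1]; rewrite /= /step ltNge s0/=.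
by case: (leP 1 s) => s1'; [rewrite subrr normr0|apply: H; apply: cell_lt; rewrite ?s0].
Qed.

End Steps.

Lemma invn_small (e : R) : 0 < e -> exists2 n, (0 < n)%N & n%:R^-1 < e.
Proof.
by move=> /ltr_add_invr[k]; rewrite add0r => ke; exists k.+1.
Qed.

(** A countable dense family: step functions on a uniform mesh with values in multiples of the mesh
    size. The index type is countable, and lists that do not describe an element of [G0] are sent to
    [point]. *)
Definition rstep (i : nat * seq nat) : G0 R :=
  if pselect (step_ok i.1.+1 (fun k => (nth 0%N i.2 k)%:R / i.1.+1%:R)) is left H
  then MkG0 (step_inG0 (ltn0Sn _) H) else point.

Lemma G0_separable g (e : R) : 0 < e -> exists i, L2dist (rstep i) g < e.
Proof.
(* The bound [e / 2] serves the rounding of the values, the bound [(e / 2) ^+ 2] the discretisation,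
   where [dis_cvg] controls the squared distance. *)
move=> e0; have e2 : 0 < Num.min (e / 2) ((e / 2) ^+ 2) by rewrite lt_min exprn_gt0 divr_gt0.
have [n n0] := invn_small e2; rewrite lt_min => /andP[ne' ne].
case: n n0 ne ne' => // n n0 ne ne'.
pose x := skel n.+1 g.
pose l := mkseq (fun k => Num.trunc (n.+1%:R * x k)) n.+1.
have x0 k : 0 <= n.+1%:R * x k by rewrite mulr_ge0//; have /andP[] := skel_itv n.+1 g k.
have nk k : (k < n.+1)%N -> (nth 0%N l k) = Num.trunc (n.+1%:R * x k).
  by move=> kn; rewrite nth_mkseq.
have ok : step_ok n.+1 (fun k => (nth 0%N l k)%:R / n.+1%:R).
  split=> [k kn|k m km mn].
    rewrite nk// divr_ge0//= ler_pdivrMr ?ltr0n// mul1r.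
    have /andP[h _] := truncn_itv (x0 k); rewrite (le_trans h)//.
    by rewrite ler_piMr//; have /andP[] := skel_itv n.+1 g k.
  rewrite !nk// ?(leq_ltn_trans km)// ler_pM2r ?invr_gt0 ?ltr0n// ler_nat.
  by apply: le_truncn; rewrite ler_wpM2l//; exact: skel_nondecreasing.
exists (n, l); rewrite /rstep; case: pselect => [H|//].
rewrite (le_lt_trans (L2dist_triangle _ (dis n0 g) _))//.
have : L2dist (dis n0 g) g < e / 2.
  rewrite -(@ltr_pXn2r _ 2)// ?nnegrE ?L2dist_ge0//; last by rewrite divr_ge0// ltW.
  exact: le_lt_trans (dis_cvg n0 g) ne.
have : L2dist (MkG0 (step_inG0 (ltn0Sn (n, l).1) H)) (dis n0 g) <= n.+1%:R^-1.
  rewrite /dis (Prop_irrelevance (ltn0Sn (n, l).1) n0).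
  apply: L2dist_step; first by rewrite invr_ge0.
  move=> k kn; rewrite nk//.
  have /andP[h1 h2] := truncn_itv (x0 k).
  have -> : (Num.trunc (n.+1%:R * x k))%:R / n.+1%:R - skel n.+1 g k =
     - ((n.+1%:R * x k - (Num.trunc (n.+1%:R * x k))%:R) / n.+1%:R).
    by rewrite /x; field.
  rewrite normrN ger0_norm ?divr_ge0 ?subr_ge0// ler_pdivrMr ?ltr0n// mulVf//.
  by rewrite lerBlDl natr1 ltW.
by move: ne'; set a := _^-1; lra.
Qed.

(** The sigma-algebra is generated by all open sets; writing them as countable unions of balls
    reduces measurability questions to balls. *)
Lemma L2open_lindelof (O : set (G0 R)) : L2open O ->
  exists (c : nat -> G0 R) (r : nat -> R), O = \bigcup_i L2ball (c i) (r i).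
Proof.
move=> oO.
pose dec (i : nat) : (nat * seq nat) * nat := odflt ((0%N, [::]), 0%N) (unpickle i).
(* Radius 0 gives the empty ball, for the candidates that do not fit inside [O]. *)
pose r i := if `[< L2ball (rstep (dec i).1) (dec i).2.+1%:R^-1 `<=` O >] then ((dec i).2.+1%:R^-1 : R) else 0.
exists (fun i => rstep (dec i).1), r; apply/seteqP; split=> [g Og|g [i _]]; last first.
  rewrite /r; case: asboolP => [H|_]; first exact: H.
  by rewrite /L2ball /= ltNge L2dist_ge0.
have [e e0 eO] := oO g Og.
have [m m0 me] := invn_small (divr_gt0 e0 (ltr0n _ 2)); case: m m0 me => // m _ me.
have [i ig] := @G0_separable g (m.+1%:R^-1) (ltac:(by rewrite invr_gt0 ltr0n)).
have di : dec (pickle (i, m)) = (i, m) by rewrite /dec pickleK.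
exists (pickle (i, m)) => //; rewrite /r di /=; case: asboolP => [_ //|[]].
move=> h hi; apply: eO; rewrite /L2ball /=; move: hi; rewrite /L2ball /=.
have K (a b c d : R) : a < e / 2 -> b < a -> c < a -> d <= b + c -> d < e by lra.
have := L2dist_triangle g (rstep i) h; rewrite (L2distC g (rstep i)) => h1 h2.
exact: K me ig h2 h1.
Qed.

End G0Facts.

(** * Measures with a density *)

Section Density.
Context d (T : measurableType d) (R : realType).
Variables (mu : {measure set T -> \bar R}) (w : T -> R).

(** The two proofs are arguments so that the measure structure attaches to the term itself. *)
Definition weighted (mw : measurable_fun setT w) (w0 : forall x, 0 <= w x)
  (A : set T) : \bar R := (\int[mu]_(x in A) (w x)%:E)%E.

Hypotheses (mw : measurable_fun setT w) (w0 : forall x, 0 <= w x).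

Let weighted0 : weighted mw w0 set0 = 0%E.
Proof. by rewrite /weighted integral_set0. Qed.

Let weighted_ge0 A : (0 <= weighted mw w0 A)%E.
Proof. by apply: integral_ge0 => x _; rewrite lee_fin. Qed.

Let weighted_sigma_additive : semi_sigma_additive (weighted mw w0).
Proof.
move=> /= F mF tF mUF; rewrite /weighted; apply: cvg_toP.
  apply: ereal_nondecreasing_is_cvgn => m n mn.
  apply: lee_sum_nneg_natr => // k _ _.
  by apply: integral_ge0 => /= x _; rewrite lee_fin.
rewrite ge0_integral_bigcup//=.
- by apply: measurable_funTS; exact/measurable_EFinP.
- by move=> x _; rewrite lee_fin.
Qed.

HB.instance Definition _ := isMeasure.Build _ _ _ (weighted mw w0)
  weighted0 weighted_ge0 weighted_sigma_additive.

Import HBNNSimple.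

Let integral_weighted_nnsfun (f : {nnsfun T >-> R}) :
  (\int[weighted mw w0]_x (f x)%:E = \int[mu]_x ((f x)%:E * (w x)%:E))%E.
Proof.
under [LHS]eq_integral do rewrite fimfunE -fsumEFin//.
rewrite [LHS]ge0_integral_fsum//; last 2 first.
  - by move=> r; exact/measurable_EFinP/measurableT_comp.
  - by move=> n x _; rewrite EFinM nnfun_muleindic_ge0.
under [RHS]eq_integral.
  move=> x xD; rewrite fimfunE -fsumEFin// muleC ge0_mule_fsumr; last first.
    by move=> r; rewrite EFinM nnfun_muleindic_ge0.
  over.
rewrite [RHS]ge0_integral_fsum//; last 2 first.
  - move=> r; apply: emeasurable_funM; first exact/measurable_EFinP.
    exact/measurable_EFinP/measurableT_comp.
  - by move=> n x _; apply: mule_ge0; [rewrite lee_fin|rewrite EFinM nnfun_muleindic_ge0].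
apply: eq_fsbigr => r rf; rewrite integralZl_indic_nnsfun//= integral_indic//= setIT.
have r0 : 0 <= r by move: rf; rewrite inE => -[x _ <-].
under [RHS]eq_integral do rewrite EFinM muleCA.
rewrite ge0_integralZl//; last 2 first.
- by apply: emeasurable_funM; apply/measurable_EFinP => //; exact: measurable_indic.
- by move=> x _; rewrite mule_ge0 ?lee_fin// indicE.
congr (_ * _)%E; rewrite /weighted integral_mkcond; apply: eq_integral => x _.
by rewrite patchE indicE; case: ifPn => _; rewrite ?mule1 ?mule0.
Qed.

Lemma integral_weighted (f : T -> \bar R) :
  measurable_fun setT f -> (forall x, 0 <= f x)%E ->
  (\int[weighted mw w0]_x f x = \int[mu]_x (f x * (w x)%:E))%E.
Proof.
move=> mf f0; pose f_ := nnsfun_approx measurableT mf.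
transitivity (lim (\int[weighted mw w0]_x (f_ n x)%:E @[n --> \oo])%E).
  rewrite -monotone_convergence//=.
  - apply: eq_integral => ? /[!inE] xD; apply/esym/cvg_lim => //=.
    exact: cvg_nnsfun_approx.
  - by move=> n; exact/measurable_EFinP/measurable_funTS.
  - by move=> n ? _; rewrite lee_fin.
  - by move=> ? _ ? ? mn; rewrite lee_fin; exact/lefP/nd_nnsfun_approx.
under [in LHS]eq_fun do rewrite integral_weighted_nnsfun.
rewrite -monotone_convergence//=.
- apply: eq_integral => x _; apply/cvg_lim => //.
  by apply: cvgeMr => //; exact: cvg_nnsfun_approx.
- by move=> n; apply: emeasurable_funM; exact/measurable_EFinP.
- by move=> n x _; rewrite mule_ge0// lee_fin.
- move=> x _ m n mn; apply: lee_wpmul2r; first by rewrite lee_fin.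
  by rewrite lee_fin; exact/lefP/nd_nnsfun_approx.
Qed.

End Density.

(** * Change of variables on the line *)

Section Substitution.
Variable R : realType.
Local Notation leb := (@lebesgue_measure R).
Variables (h dh k : R -> R).
Hypotheses (hD : forall x : R, is_derive x (1 : R) h (dh x)) (cdh : continuous dh)
  (dh0 : forall x, 0 <= dh x) (hk : cancel k h)
  (hlt : {mono h : x y / x < y}).

Lemma continuous_h : continuous h.
Proof. by move=> x; apply: differentiable_continuous; apply/derivable1_diffP; case: (hD x). Qed.

Lemma measurable_h : measurable_fun setT h.
Proof. by apply: continuous_measurable_fun; exact: continuous_h. Qed.

(** The image under [h] of the measure with density [dh] gives each half-open interval its length,
    by the fundamental theorem of calculus; hence it is Lebesgue measure. *)
Lemma ge0_substitution (f : R -> \bar R) : measurable_fun setT f -> (forall x, 0 <= f x)%E ->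
  (\int[leb]_x f x = \int[leb]_x (f (h x) * (dh x)%:E))%E.
Proof.
move=> mf f0.
have mdh : measurable_fun setT dh by exact: continuous_measurable_fun.
have mh := measurable_h.
pose nu := weighted leb mdh dh0.
pose m := pushforward nu (h : measurableTypeR R -> measurableTypeR R).
have hle : {mono h : x y / x <= y} by move=> x y; rewrite !leNgt hlt.
have lebm A : measurable A -> leb A = m A.
  apply: lebesgue_measure_unique => _ [[a b] _ <-].
  have E : h @^-1` `]a, b]%classic = `]k a, k b]%classic.
    by apply/seteqP; split => x /=; rewrite !in_itv/= -(hlt (k a)) -(hle x) !hk.
  transitivity (\int[leb]_(x in `]k a, k b]) (dh x)%:E)%E; last by rewrite -E.
  have [ab|ba] := ltP a b; last first.
    have kba : k b <= k a by rewrite -hle !hk.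
    by rewrite !set_itv_ge ?bnd_simp -?leNgt// measure0 integral_set0.
  have kab : k a < k b by rewrite -hlt !hk.
  rewrite integral_itv_obnd_cbnd; last first.
    by apply: measurable_funTS; exact/measurable_EFinP.
  rewrite (@continuous_FTC2 _ dh h)//.
  - by rewrite lebesgue_measure_itv/= lte_fin ab !hk.
  - by apply: continuous_subspaceT.
  - split.
    + by move=> x _; case: (hD x).
    + by apply: cvg_at_right_filter; exact: continuous_h.
    + by apply: cvg_at_left_filter; exact: continuous_h.
  - by move=> x _; rewrite derive1E; case: (hD x).
transitivity (\int[m]_x f x)%E.
  by apply: eq_measure_integral => A mA _; exact: lebm.
rewrite ge0_integral_pushforward//= preimage_setT.
rewrite integral_weighted//.
exact: measurableT_comp.
Qed.

End Substitution.

(** * Iterated integrals *)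

Section Sequences.
Variable R : realType.
Local Notation leb := (@lebesgue_measure R).

Definition coord_cyl : set (set (nat -> R)) :=
  [set A | exists i (B : set R), measurable B /\ A = (fun x : nat -> R => x i) @^-1` B].

(** All finite dimensional laws live on this one space of sequences, as in [iint], so that no type
    depends on the number of points. *)
Definition Om := g_sigma_algebraType coord_cyl.

Lemma measurable_coord i D : measurable_fun D (fun x : Om => x i).
Proof.
apply: measurable_funTS => _ B mB; rewrite setTI.
by apply: sub_sigma_algebra; exists i, B.
Qed.

Lemma measurable_to_Om d (T : measurableType d) (f : T -> Om) :
  (forall i, measurable_fun setT (fun t => f t i)) -> measurable_fun setT f.
Proof.
move=> mf; apply: (@measurability _ _ T Om setT f coord_cyl erefl).
move=> _ [_ [i [B [mB ->]]] <-].
exact: mf.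
Qed.

Lemma updE (x : nat -> R) i y j : upd x i y j = if j == i then y else x j.
Proof. by []. Qed.

Lemma updC (x : nat -> R) i j y z : i != j ->
  upd (upd x i y) j z = upd (upd x j z) i y.
Proof.
move=> ij; apply/funext => l; rewrite !updE.
by case: (eqVneq l j) => [->|//]; rewrite eq_sym (negbTE ij).
Qed.

Lemma measurable_upd k :
  measurable_fun setT (fun p : Om * measurableTypeR R => upd p.1 k p.2 : Om).
Proof.
apply: measurable_to_Om => i; rewrite /upd; case: (i == k).
  exact: measurable_snd.
exact: (measurableT_comp (@measurable_coord i setT) measurable_fst).
Qed.

(** The iterated integral [iint] with a base point: coordinates 1 to [k] are integrated and the
    others are read from [x]. The base point makes inductions on [k] possible. *)
Fixpoint J (k : nat) (f : Om -> \bar R) (x : Om) : \bar R :=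
  if k is k'.+1 then (\int[leb]_y J k' f (upd x k'.+1 y))%E else f x.

Lemma J_ge0 k f x : (forall x, 0 <= f x)%E -> (0 <= J k f x)%E.
Proof.
move=> f0; elim: k x => [|k IH] x /=; first exact: f0.
by apply: integral_ge0 => y _; exact: IH.
Qed.

Lemma measurable_J k f : (forall x, 0 <= f x)%E -> measurable_fun setT f ->
  measurable_fun setT (J k f).
Proof.
move=> f0 mf; elim: k => //= k IH.
apply: (measurable_fun_fubini_tonelli_F
  (fun p : Om * measurableTypeR R => J k f (upd p.1 k.+1 p.2))) => //.
- exact: (measurableT_comp IH (@measurable_upd k.+1)).
- by move=> x; exact: J_ge0.
Qed.

Lemma measurable_J_upd k f x : (forall x, 0 <= f x)%E -> measurable_fun setT f ->
  measurable_fun setT (fun y : measurableTypeR R => J k f (upd x k.+1 y)).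
Proof.
move=> f0 mf; have := measurable_J k f0 mf => mJ.
exact: (measurableT_comp mJ (measurableT_comp (@measurable_upd k.+1) (pair1_measurable (x : Om)))).
Qed.

Lemma J_upd k f z m y : (k < m)%N -> J k f (upd z m y) = J k (fun x => f (upd x m y)) z.
Proof.
elim: k z => //= k IH z km; apply: eq_integral => u _.
by rewrite updC ?gtn_eqF// IH// ltnW.
Qed.

Lemma iintE k f : iint k f = J k f (fun=> 0).
Proof.
elim: k f => //= k IH f; apply: eq_integral => y _.
by rewrite IH -J_upd.
Qed.

Lemma J_eq k f1 f2 z :
  (forall x, (forall j, ~~ (1 <= j <= k)%N -> x j = z j) -> f1 x = f2 x) ->
  J k f1 z = J k f2 z.
Proof.
elim: k z => [|k IH] z H /=.
  by apply: H.
apply: eq_integral => y _; apply: IH => x xz; apply: H => j jk.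
rewrite xz; last first.
  by apply: contra jk => /andP[-> jk]; exact: leqW.
by rewrite updE; case: eqP => // jk'; move: jk; rewrite jk' !leqnn.
Qed.

Lemma J_nneseries k (f : nat -> Om -> \bar R) x :
  (forall n x, 0 <= f n x)%E -> (forall n, measurable_fun setT (f n)) ->
  J k (fun x => \sum_(n <oo) f n x)%E x = (\sum_(n <oo) J k (f n) x)%E.
Proof.
move=> f0 mf; elim: k x => //= k IH x.
under eq_integral do rewrite IH.
rewrite integral_nneseries//.
- by move=> n; exact: measurable_J_upd.
- by move=> n y _; exact: J_ge0.
Qed.

(** A factor that ignores the integrated coordinates comes out of the integral. *)
Lemma J_scale k (c : Om -> R) f z : (forall x, 0 <= c x) ->
  (forall x j y, (j <= k)%N -> c (upd x j y) = c x) ->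
  (forall x, 0 <= f x)%E -> measurable_fun setT f ->
  J k (fun x => (c x)%:E * f x)%E z = ((c z)%:E * J k f z)%E.
Proof.
move=> c0 cu f0 mf; elim: k z cu => //= k IH z cu.
under eq_integral => y _.
  rewrite IH; last by move=> *; apply: cu; exact: leqW.
  rewrite cu//; over.
rewrite ge0_integralZl//; first exact: measurable_J_upd.
  by move=> y _; exact: J_ge0.
by rewrite lee_fin.
Qed.

Lemma J_le k f1 f2 z : (forall x, 0 <= f1 x)%E -> measurable_fun setT f1 ->
  measurable_fun setT f2 -> (forall x, f1 x <= f2 x)%E -> (J k f1 z <= J k f2 z)%E.
Proof.
move=> f10 mf1 mf2 f12.
have f20 x : (0 <= f2 x)%E by rewrite (le_trans (f10 x)).
elim: k z => //= k IH z; apply: ge0_le_integral => //.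
- by move=> y _; exact: J_ge0.
- exact: measurable_J_upd.
- exact: measurable_J_upd.
Qed.

Section Change.
Variables (h dh k : R -> R).
Hypotheses (hD : forall x : R, is_derive x (1 : R) h (dh x)) (cdh : continuous dh)
  (dh0 : forall x, 0 <= dh x) (hk : cancel k h)
  (hlt : {mono h : x y / x < y}).

Lemma measurable_comp_Om : measurable_fun setT (fun x : Om => (h \o x) : Om).
Proof.
apply: measurable_to_Om => i.
by apply: measurableT_comp; [exact: measurable_h|exact: measurable_coord].
Qed.

Lemma measurable_jac n : measurable_fun setT (fun x : Om => \prod_(i < n) dh (x i.+1)).
Proof.
elim: n => [|n IH].
  by rewrite (_ : (fun _ => _) = cst 1)//; apply/funext => x; rewrite big_ord0.
rewrite (_ : (fun _ => _) = (fun x : Om => (\prod_(i < n) dh (x i.+1)) * dh (x n.+1))); last first.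
  by apply/funext => x; rewrite big_ord_recr.
apply: measurable_funM => //; apply: measurableT_comp.
  exact: continuous_measurable_fun.
exact: measurable_coord.
Qed.

(** The outermost variable is substituted first. Its Jacobian factor involves coordinate [n.+1]
    alone, so [J_scale] moves it inside. The base point is transported along, which keeps the
    induction uniform. *)
Lemma J_subst n f z : (forall x, 0 <= f x)%E -> measurable_fun setT f ->
  J n f (h \o z) = J n (fun x => (\prod_(i < n) dh (x i.+1))%:E * f (h \o x))%E z.
Proof.
move=> f0 mf; elim: n z => [|n IH] z /=; first by rewrite big_ord0 mul1e.
rewrite (ge0_substitution hD cdh dh0 hk hlt); last 2 first.
- exact: measurable_J_upd.
- by move=> y; exact: J_ge0.
apply: eq_integral => y _.
have -> : upd (h \o z) n.+1 (h y) = h \o upd z n.+1 y.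
  by apply/funext => j /=; rewrite !updE; case: ifP.
rewrite IH muleC.
have := @J_scale n (fun x => dh (x n.+1))
  (fun x => (\prod_(i < n) dh (x i.+1))%:E * f (h \o x))%E (upd z n.+1 y).
have E : upd z n.+1 y n.+1 = y by rewrite updE eqxx.
rewrite E => <-.
- by apply: J_eq => x _; rewrite big_ord_recr /= mulrC EFinM muleA.
- by move=> x; exact: dh0.
- by move=> x j u jn; rewrite updE eq_sym ltn_eqF.
- by move=> x; rewrite mule_ge0// lee_fin prodr_ge0.
- apply: emeasurable_funM; first by apply/measurable_EFinP; exact: measurable_jac.
  exact: (measurableT_comp mf measurable_comp_Om).
Qed.

End Change.

End Sequences.

(** * Measures on sequences given by iterated integrals *)

Section SequenceMeasure.
Variable R : realType.
Local Notation leb := (@lebesgue_measure R).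
Local Notation Om := (Om R).

Lemma indic_bigcup_series (T : Type) (F : nat -> set T) (x : T) : trivIset setT F ->
  (\1_(\bigcup_n F n) x)%:E = (\sum_(n <oo) (\1_(F n) x)%:E)%E :> \bar R.
Proof.
move=> tF; rewrite indicE; have [|nx] := boolP (x \in _); last first.
  rewrite eseries0// => n _ _; rewrite indicE memNset// => Fx.
  by move/negP: nx; apply; rewrite inE; exists n.
rewrite inE => -[n _ Fn].
rewrite (nneseriesD1 (n := n))//= indicE mem_set//= eseries0 ?adde0// => m _ mn.
rewrite indicE memNset// => Fm; move/negP: mn; apply; apply/eqP.
by apply: (tF m n) => //; exists x.
Qed.

Definition Jmeas (N : nat) (w : Om -> R) (mw : measurable_fun setT w)
   (w0 : forall x, 0 <= w x) (A : set Om) : \bar R :=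
  J N (fun x => (\1_A x)%:E * (w x)%:E)%E (fun=> 0).

Section Instance.
Variables (N : nat) (w : Om -> R).
Hypotheses (mw : measurable_fun setT w) (w0 : forall x, 0 <= w x).

Lemma Jmeas_integrand_ge0 A x : (0 <= (\1_A x)%:E * (w x)%:E)%E.
Proof. by rewrite mule_ge0 ?lee_fin ?indicE. Qed.

Lemma measurable_Jmeas_integrand A : measurable A ->
  measurable_fun setT (fun x : Om => (\1_A x)%:E * (w x)%:E)%E.
Proof.
by move=> mA; apply: emeasurable_funM; apply/measurable_EFinP => //; exact: measurable_indic.
Qed.

Let Jmeas0 : Jmeas N mw w0 set0 = 0%E.
Proof.
have J0 k z : @J R k (fun=> 0%E) z = 0%E.
  by elim: k z => //= k IH z; under eq_integral do rewrite IH; rewrite integral0.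
rewrite -[RHS](J0 N (fun=> 0)); congr J; apply/funext => x.
by rewrite indic0 mul0e.
Qed.

Let Jmeas_ge0 A : (0 <= Jmeas N mw w0 A)%E.
Proof. by apply: J_ge0 => x; exact: Jmeas_integrand_ge0. Qed.

Let Jmeas_sigma_additive : semi_sigma_additive (Jmeas N mw w0).
Proof.
move=> F mF tF mUF; apply: cvg_toP.
  by apply: ereal_nondecreasing_is_cvgn => m n mn; apply: lee_sum_nneg_natr.
rewrite /Jmeas -J_nneseries; last 2 first.
- by move=> n x; exact: Jmeas_integrand_ge0.
- by move=> n; exact: measurable_Jmeas_integrand.
congr J; apply/funext => x.
rewrite indic_bigcup_series// muleC -nneseriesZl//.
- by apply: eq_eseriesr => n _; rewrite muleC.
Qed.

HB.instance Definition _ := isMeasure.Build _ _ _ (Jmeas N mw w0)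
  Jmeas0 Jmeas_ge0 Jmeas_sigma_additive.

End Instance.

Lemma le_bigmin_seq (s : seq (nat * R)) i (v : R) :
  (v <= \big[Num.min/1]_(p <- s | p.1 == i) p.2) =
  (v <= 1) && all (fun p => (p.1 == i) ==> (v <= p.2)) s.
Proof.
elim: s => [|p s IH]; first by rewrite big_nil andbT.
by rewrite big_cons /=; case: ifP => _ //=; rewrite le_min IH andbCA.
Qed.

(** A list of constraints rather than one bound per coordinate: intersection becomes concatenation,
    which gives the stability under intersection at once. *)
Definition half_boxes : set (set (nat -> R)) :=
  [set A | exists s : seq (nat * R),
    A = [set x : nat -> R | all (fun p => x p.1 <= p.2) s]].

Lemma half_boxesI : setI_closed half_boxes.
Proof.
move=> _ _ [s ->] [t ->]; exists (s ++ t); apply/seteqP; split => x /=.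
  by rewrite all_cat => -[-> ->].
by rewrite all_cat => /andP[].
Qed.

Lemma half_boxes_generate (A : set Om) : measurable A -> <<s half_boxes >> A.
Proof.
move=> mA; suff H : @coord_cyl R `<=` <<s half_boxes >>.
  by apply: (smallest_sub _ H) mA; exact: smallest_sigma_algebra.
move=> _ [i [B [mB ->]]].
pose T := g_sigma_algebraType half_boxes.
have : measurable_fun setT (fun x : T => x i).
  apply: measurable_fun_lt => // c; rewrite setTI.
  rewrite (_ : [set x | _] = \bigcup_(n : nat) [set x : T | x i <= c - n.+1%:R^-1]).
    by apply: bigcupT_measurable => n; apply: sub_sigma_algebra; exists [:: (i, c - n.+1%:R^-1)];
      apply/seteqP; split => x /=; rewrite andbT.
  apply/seteqP; split => [x /= xc|x [n _ /=]].
    by have [n] := ltr_add_invr xc => h; exists n => //=; rewrite lerBrDr ltW.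
  by move/le_lt_trans; apply; rewrite ltrBlDr ltrDl invr_gt0.
by move=> /(_ measurableT B mB); rewrite setTI.
Qed.

Lemma half_boxes_measurable A : half_boxes A -> measurable (A : set Om).
Proof.
move=> [s ->]; elim: s => [|p s IH].
  by rewrite (_ : [set x | _] = setT)//; apply/seteqP; split.
rewrite (_ : [set x | _] = [set x : Om | x p.1 <= p.2] `&` [set x : Om | all (fun p => x p.1 <= p.2) s]).
  apply: measurableI => //.
  have := @measurable_coord R p.1 setT measurableT _ (measurable_itv `]-oo, p.2]).
  by rewrite setTI; congr measurable; apply/seteqP; split => x /=; rewrite in_itv.
by apply/seteqP; split => x /=; [move=> /andP[]|move=> [-> ->]].
Qed.

End SequenceMeasure.

(** * The law of the values on a uniform mesh *)

Section Law.
Variables (R : realType) (beta : R) (Q : probability (G0m R) R).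
Hypotheses (beta0 : 0 < beta) (HQ : is_entropic beta Q).
Local Notation leb := (@lebesgue_measure R).
Local Notation Om := (Om R).
Variable N : nat.

Definition mesh (i : nat) : R := i%:R / N.+1%:R.

Lemma mesh_lt i j : (i < j)%N -> mesh i < mesh j.
Proof. by move=> ij; rewrite ltr_pM2r ?invr_gt0// ltr_nat. Qed.

Definition increasing_pts (x : nat -> R) := forall i, (i < N.+1)%N -> bnd N x i < bnd N x i.+1.

Definition dens (x : Om) : R := if `[< increasing_pts x >] then dirichlet_density beta N mesh x else 0.

Lemma GammaR_ge0 (s : R) : 0 <= GammaR s.
Proof.
by apply/fine_ge0/integral_ge0 => x _; rewrite lee_fin mulr_ge0// ?powR_ge0// expR_ge0.
Qed.

Definition dnorm : R := GammaR beta / (\prod_(i < N.+1) GammaR (beta * (mesh i.+1 - mesh i))).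

Lemma dnorm_ge0 : 0 <= dnorm.
Proof.
by rewrite /dnorm divr_ge0 ?GammaR_ge0// prodr_ge0// => i _; exact: GammaR_ge0.
Qed.

Definition dfactor (i : nat) (x : Om) : R :=
  if bnd N x i < bnd N x i.+1
  then (bnd N x i.+1 - bnd N x i) `^ (beta * (mesh i.+1 - mesh i) - 1) else 0.

(** The indicator of the simplex is distributed over the factors, so that measurability can be
    checked factor by factor. *)
Lemma densE x : dens x = dnorm * \prod_(i < N.+1) dfactor i x.
Proof.
rewrite /dens /dirichlet_density; case: asboolP => [H|/existsNP[i /not_implyP[iN xi]]].
  by congr (_ * _); apply: eq_bigr => i _; rewrite /dfactor H.
by rewrite (bigD1 (Ordinal iN))//= {1}/dfactor ifN ?mul0r ?mulr0//; exact/negP.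
Qed.

Lemma dfactor_ge0 i x : 0 <= dfactor i x.
Proof. by rewrite /dfactor; case: ifP => // _; exact: powR_ge0. Qed.

Lemma dens_ge0 x : 0 <= dens x.
Proof.
by rewrite densE mulr_ge0 ?dnorm_ge0// prodr_ge0// => i _; exact: dfactor_ge0.
Qed.

Lemma measurable_bnd i : measurable_fun setT (fun x : Om => bnd N x i).
Proof. by rewrite /bnd; case: (i == 0%N) => //; case: (i == N.+1) => //; exact: measurable_coord. Qed.

Lemma measurable_dfactor i : measurable_fun setT (dfactor i).
Proof.
apply: measurable_fun_ifT => //.
  by apply: measurable_fun_ltr; exact: measurable_bnd.
apply: (@measurableT_comp _ _ _ _ _ _ (@powR R ^~ (beta * (mesh i.+1 - mesh i) - 1)) setT (fun t : Om => bnd N t i.+1 - bnd N t i)).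
  exact: measurable_powR.
by apply: measurable_funB; exact: measurable_bnd.
Qed.

Lemma measurable_dens : measurable_fun setT dens.
Proof.
rewrite (_ : dens = (fun x : Om => dnorm * \prod_(i < N.+1) dfactor i x)); last exact/funext/densE.
apply: measurable_funM => //; elim: N.+1 => [|n IH].
  by rewrite (_ : (fun _ => _) = cst 1)//; apply/funext => x; rewrite big_ord0.
rewrite (_ : (fun _ => _) = (fun x : Om => (\prod_(i < n) dfactor i x) * dfactor n x)); last first.
  by apply/funext => x; rewrite big_ord_recr.
by apply: measurable_funM => //; exact: measurable_dfactor.
Qed.

(** The coordinates outside 1 to [N] are 0, as in the base point of [iint]. *)
Definition pts (g : G0m R) : Om := fun i => if (1 <= i <= N)%N then gfun g (mesh i) else 0.

Lemma measurable_pts : measurable_fun setT pts.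
Proof.
apply: measurable_to_Om => i; rewrite /pts; case: (_ <= _ <= _)%N => //.
exact: measurable_eval.
Qed.

Lemma J0 k z : @J R k (fun=> 0%E) z = 0%E.
Proof. by elim: k z => //= k IH z; under eq_integral do rewrite IH; rewrite integral0. Qed.

Lemma bnd_le1 x i : increasing_pts x -> (i <= N.+1)%N -> bnd N x i <= 1.
Proof.
move=> xi iN; have -> : 1 = bnd N x N.+1 by rewrite /bnd /= eqxx.
rewrite -(subKn iN); elim: (N.+1 - i)%N => [|k IH]; first by rewrite subn0.
apply: le_trans IH; have [kN|kN] := leqP N.+1 k.
  have -> : (N.+1 - k = 0)%N by apply/eqP; rewrite subn_eq0.
  by have -> : (N.+1 - k.+1 = 0)%N by apply/eqP; rewrite subn_eq0 leqW.
rewrite ltW//; have := xi (N.+1 - k.+1)%N; rewrite -subSn// subSS; apply.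
exact: leq_subr.
Qed.

(** The half boxes are a generating class stable under intersection, and on them the two measures
    agree by the definition of [is_entropic]. *)
Lemma pts_law A : measurable A -> Q (pts @^-1` A) = Jmeas N measurable_dens dens_ge0 A.
Proof.
move=> mA; have mp : measurable_fun setT pts := measurable_pts.
pose m1F : {measure set Om -> \bar R} := pushforward Q pts.
pose m1 := m1F mp.
suff : forall A, <<s @half_boxes R >> A -> m1 A = Jmeas N measurable_dens dens_ge0 A.
  by apply; exact: half_boxes_generate.
(* Half boxes that exhaust the space, with a constraint on the inert coordinate 0. *)
pose gg n : set Om := [set x : Om | all (fun p : nat * R => x p.1 <= p.2) [:: (0%N, n%:R)]].
apply: (@g_sigma_algebra_measure_unique _ R Om (@half_boxes R) _ gg _ _ m1 (Jmeas N measurable_dens dens_ge0)) => //.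
- exact: half_boxes_measurable.
- by move=> n; exists [:: (0%N, n%:R)].
- apply/seteqP; split => // x _; exists (Num.trunc (`|x 0%N|)).+1 => //=.
  by rewrite /gg /= andbT (le_trans (ler_norm _))// ltW// truncnS_gt.
- exact: half_boxesI.
- move=> _ [s ->].
  pose a i : R := \big[Num.min/1]_(p <- s | p.1 == i) p.2.
  (* A constraint on an index outside 1 to [N] reads [0 <= p.2]. If one of them fails, both measures
     vanish; otherwise these constraints hold automatically. *)
  have [outs|outs] := boolP (all (fun p => (1 <= p.1 <= N)%N || (0 <= p.2)) s); last first.
    have /allPn[p ps /norP[p1 p2]] := outs.
    have F (x : Om) : x p.1 = 0 -> all (fun p => x p.1 <= p.2) s = false.
      by move=> x0; apply/negbTE/allPn; exists p => //; rewrite x0.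
    rewrite /m1 /m1F /= /pushforward (_ : pts @^-1` _ = set0) ?measure0; last first.
      by apply/seteqP; split => // g /=; rewrite F// /pts (negbTE p1).
    rewrite /Jmeas -[LHS](J0 N (fun=> 0)); apply: J_eq => x xz.
    by rewrite indicE memNset ?mul0e//= F// xz.
  have key (x : Om) : (forall j, ~~ (1 <= j <= N)%N -> x j = 0) ->
     (forall j, (1 <= j <= N)%N -> x j <= 1) ->
     all (fun p => x p.1 <= p.2) s <-> forall i, (1 <= i <= N)%N -> x i <= a i.
    move=> x0 x1; split => [/allP H i iN|H].
      rewrite le_bigmin_seq x1//=; apply/allP => p ps; apply/implyP => /eqP pi.
      by rewrite -pi; exact: H.
    apply/allP => p ps; have [pN|pN] := boolP (1 <= p.1 <= N)%N.
      have := H _ pN; rewrite le_bigmin_seq => /andP[_ /allP/(_ p ps)].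
      by rewrite eqxx.
    by rewrite x0//; move/allP: outs => /(_ p ps); rewrite (negbTE pN).
  transitivity (Q [set g : G0 R | forall i, (1 <= i <= N)%N -> gfun g (mesh i) <= a i]).
    congr (Q _); apply/seteqP; split => g /=.
      move=> /(key (pts g)); rewrite /pts => H i iN.
      have := H _ _ i iN; rewrite iN; apply.
        by move=> j /negbTE ->.
      by move=> j ->; exact: G0_le1.
    move=> H; apply/key; rewrite /pts.
    + by move=> j /negbTE ->.
    + by move=> j ->; exact: G0_le1.
    + by move=> i iN; rewrite iN; exact: H.
  rewrite HQ.
  + rewrite iintE /Jmeas; apply: J_eq => x xz; rewrite indicE /dens.
    have [H|nH] := asboolP (increasing_pts x); last first.
      by rewrite mule0; case: asboolP => // -[].
    have x1 j : (1 <= j <= N)%N -> x j <= 1.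
      move=> /andP[j1 jN]; have := @bnd_le1 x j H; rewrite /bnd gtn_eqF// ltn_eqF//; apply.
      exact: leqW.
    case: asboolP => [[_ K]|K].
      by rewrite mem_set ?mul1e//=; apply/key.
    rewrite memNset ?mul0e//= => /key K'; apply: K; split => //.
    exact: K'.
  + by rewrite /mesh mul0r.
  + by rewrite /mesh divff.
  + by move=> i iN; exact: mesh_lt.
- move=> k; rewrite /m1 /m1F /= /pushforward (le_lt_trans (probability_le1 _ _)) ?ltry//.
  have := mp measurableT (gg k) => /(_ _); rewrite setTI; apply.
  by apply: half_boxes_measurable; exists [:: (0%N, k%:R)].
Qed.

End Law.

(** * From inequalities between measures to inequalities between integrals *)

Section MeasureComparison.
Context d (T : measurableType d) (R : realType).
Variables (m1 m2 : {measure set T -> \bar R}) (c : R).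
Hypothesis (m12 : forall A, measurable A -> (m1 A <= c%:E * m2 A)%E).

Import HBNNSimple.

Let le_nnsfun (f : {nnsfun T >-> R}) :
  (\int[m1]_x (f x)%:E <= c%:E * \int[m2]_x (f x)%:E)%E.
Proof.
have E (m : {measure set T -> \bar R}) :
    (\int[m]_x (f x)%:E = \sum_(r \in range f) r%:E * m (f @^-1` [set r]))%E.
  under eq_integral do rewrite fimfunE -fsumEFin//.
  rewrite ge0_integral_fsum//; last 2 first.
    - by move=> r; exact/measurable_EFinP/measurableT_comp.
    - by move=> n x _; rewrite EFinM nnfun_muleindic_ge0.
  by apply: eq_fsbigr => r _; rewrite integralZl_indic_nnsfun//= integral_indic//= setIT.
rewrite !E ge0_mule_fsumr; last first.
  move=> r; have [[x _ <-]|nr] := pselect (range f r).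
    by rewrite mule_ge0 ?lee_fin.
  rewrite (_ : f @^-1` _ = set0) ?measure0 ?mule0//.
  by apply/seteqP; split => // x /= fx; apply: nr; exists x.
apply: lee_fsum => // r [x _ <-]; rewrite muleCA.
by apply: lee_wpmul2l; [rewrite lee_fin|exact: m12].
Qed.

Lemma ge0_le_integral_measure (f : T -> \bar R) :
  measurable_fun setT f -> (forall x, 0 <= f x)%E ->
  (\int[m1]_x f x <= c%:E * \int[m2]_x f x)%E.
Proof.
move=> mf f0; pose f_ := nnsfun_approx measurableT mf.
have E (m : {measure set T -> \bar R}) :
    (\int[m]_x (f_ n x)%:E)%E @[n --> \oo] --> (\int[m]_x f x)%E.
  have -> : (\int[m]_x f x = \int[m]_x limn (EFin \o f_ ^~ x))%E.
    by apply: eq_integral => x _; apply/esym/cvg_lim => //; exact: cvg_nnsfun_approx.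
  apply: cvg_monotone_convergence => //.
  - by move=> n; exact/measurable_EFinP/measurable_funTS.
  - by move=> n ? _; rewrite lee_fin.
  - by move=> ? _ ? ? mn; rewrite lee_fin; exact/lefP/nd_nnsfun_approx.
have [cE1 cE2] := (E m1, cvgeZl (isT : c%:E \is a fin_num) (E m2)).
rewrite -(cvg_lim _ cE1)// -(cvg_lim _ cE2)//.
apply: lee_lim; [by apply/cvg_ex; eexists; exact: cE1|by apply/cvg_ex; eexists; exact: cE2|].
by apply: nearW => n; exact: le_nnsfun.
Qed.

End MeasureComparison.

(** * Multiplicative errors *)

Section NearOne.
Variable R : realType.

(** A bound [E] on the absolute value of the logarithm of [a]. Such errors add up in products, so
    products of arbitrary length are controlled by the sum of the errors. *)
Definition near1 (a E : R) := expR (- E) <= a <= expR E.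

Lemma near1_gt0 a E : near1 a E -> 0 < a.
Proof. by move=> /andP[h _]; rewrite (lt_le_trans (expR_gt0 _) h). Qed.

Lemma near1_1 : near1 1 0. Proof. by rewrite /near1 oppr0 expR0 lexx. Qed.

Implicit Types a b c x E F : R.

Lemma near1M a b E F : near1 a E -> near1 b F -> near1 (a * b) (E + F).
Proof.
move=> ha hb; have a0 := near1_gt0 ha; have b0 := near1_gt0 hb.
move: ha hb => /andP[a1 a2] /andP[b1 b2].
by rewrite /near1 opprD !expRD !ler_pM ?expR_ge0// ltW.
Qed.

Lemma near1V a E : near1 a E -> near1 a^-1 E.
Proof.
move=> ha; have a0 := near1_gt0 ha; move: ha => /andP[a1 a2].
rewrite /near1 expRN lef_pV2 ?posrE ?expR_gt0// a2/=.
by rewrite -(invrK (expR E)) lef_pV2 ?posrE ?invr_gt0 ?expR_gt0// -expRN.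
Qed.

Lemma near1_prod n (a E : nat -> R) : (forall i, (i < n)%N -> near1 (a i) (E i)) ->
  near1 (\prod_(i < n) a i) (\sum_(i < n) E i).
Proof.
elim: n => [|n IH] H; first by rewrite !big_ord0; exact: near1_1.
rewrite !big_ord_recr /=; apply: near1M; last exact: H.
by apply: IH => i iN; apply: H; exact: leqW.
Qed.

Lemma near1_powR a E c : 0 <= c -> near1 a E -> near1 (a `^ c) (c * E).
Proof.
move=> c0 /[dup] /near1_gt0 a0 /andP[a1 a2].
have e (x : R) : expR (c * x) = expR x `^ c.
  by rewrite /powR gt_eqF ?expR_gt0// expRK.
by rewrite /near1 -mulrN !e !ge0_ler_powR// nnegrE ?expR_ge0// ltW.
Qed.

Lemma near1_le a E F : E <= F -> near1 a E -> near1 a F.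
Proof.
move=> EF /andP[a1 a2]; rewrite /near1 (le_trans _ a1) ?ler_expR ?lerN2//=.
by rewrite (le_trans a2) ?ler_expR.
Qed.

(** With [b >= 1/2], [a / b = 1 + (a - b) / b <= 1 + 2 * E <= expR (2 * E)]; the lower bound follows
    by exchanging [a] and [b]. *)
Lemma near1_ratio (a b E : R) : 2^-1 <= a -> 2^-1 <= b -> `|a - b| <= E -> near1 (a / b) (2 * E).
Proof.
move=> a2 b2 ab.
have H x y : 2^-1 <= x -> 2^-1 <= y -> `|x - y| <= E -> x / y <= expR (2 * E).
  move=> x2 y2 xy; apply: le_trans (expR_ge1Dx _); have y0 : 0 < y by lra.
  rewrite ler_pdivrMr//; have := ler_norm (x - y); have := normr_ge0 (x - y); nra.
rewrite /near1 H// andbT.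
have := H b a b2 a2; rewrite distrC => /(_ ab).
have a0 : 0 < a by lra.
have b0 : 0 < b by lra.
by move=> h; rewrite expRN -[leRHS]invrK lef_pV2 ?posrE ?expR_gt0 ?invr_gt0 ?divr_gt0// invf_div.
Qed.

Lemma near1_1D (x E : R) : -2^-1 <= x -> `|x| <= E -> near1 (1 + x) (2 * E).
Proof.
move=> x2 xE; rewrite -[1 + x]divr1; apply: near1_ratio; [lra|lra|].
by rewrite (_ : 1 + x - 1 = x)//; ring.
Qed.

Lemma expR_le1D (E : R) : 0 <= E -> E <= 2^-1 -> expR E <= 1 + 2 * E.
Proof.
move=> E0 E1; have := expR_ge1Dx (- E); rewrite expRN => h.
have e0 := expR_gt0 E.
have : (1 - E) * expR E <= 1 by rewrite -ler_pdivlMr// mul1r.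
nra.
Qed.

End NearOne.

(** * Vector fields on [0, 1] and the maps x + e * phi x *)

Section Tangent.
Variable R : realType.

(** The field is defined on the whole line and vanishes outside ]0, 1[, so the maps below are
    bijections of the line fixing 0 and 1. The Lipschitz bound on the derivative makes the
    distortion between neighbouring mesh points proportional to their spacing. *)
Record tangent (phi dphi : R -> R) (K : R) : Prop := Tangent {
  tangent_derive : forall x : R, is_derive x (1 : R) phi (dphi x) ;
  tangent_lip : forall x y, `|dphi x - dphi y| <= K * `|x - y| ;
  tangent_dbound : forall x, `|dphi x| <= K ;
  tangent_bound : forall x, `|phi x| <= K ;
  tangent_le0 : forall x, x <= 0 -> phi x = 0 ;
  tangent_ge1 : forall x, 1 <= x -> phi x = 0 }.

Variables (phi dphi : R -> R) (K : R).
Hypothesis tphi : tangent phi dphi K.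

Lemma tangent_K0 : 0 <= K.
Proof. by rewrite (le_trans _ (tangent_bound tphi 0)). Qed.

Variable e : R.
Hypotheses (e0 : 0 <= e) (eK : e * K <= 2^-1).

Definition tshift (x : R) : R := x + e * phi x.
Definition dshift (x : R) : R := 1 + e * dphi x.

Lemma tshift_derive x : is_derive x (1 : R) tshift (dshift x).
Proof.
have H := tangent_derive tphi x.
by rewrite /tshift /dshift; apply: is_deriveD.
Qed.

Lemma dphi_continuous : continuous dphi.
Proof.
move=> x; apply/cvgrPdist_lt => /= eps eps0.
have K1 : 0 < K + 1 by rewrite ltr_wpDl ?tangent_K0.
near=> y; rewrite (le_lt_trans (tangent_lip tphi x y))//.
rewrite (@le_lt_trans _ _ ((K + 1) * `|x - y|))//.
  by rewrite ler_wpM2r// lerDl.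
rewrite mulrC -ltr_pdivlMr//; near: y.
by apply: (@cvgr_dist_lt _ _ _ _ _ id) => //; rewrite divr_gt0.
Unshelve. all: by end_near.
Qed.

Lemma dshift_continuous : continuous dshift.
Proof.
move=> x; apply: cvgD; first exact: cvg_cst.
by apply: cvgM; [exact: cvg_cst|exact: dphi_continuous].
Qed.

Lemma edphi_bound x : `|e * dphi x| <= e * K.
Proof. by rewrite normrM (ger0_norm e0) ler_wpM2l// (tangent_dbound tphi). Qed.

Lemma dshift_ge x : 2^-1 <= dshift x.
Proof. by have h := eK; have := edphi_bound x; rewrite ler_norml /dshift => /andP[h1 h2]; lra. Qed.

Lemma tshift_continuous : continuous tshift.
Proof.
by move=> x; apply: differentiable_continuous; apply/derivable1_diffP; case: (tshift_derive x).
Qed.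

Lemma tshift_slope x y : x < y ->
  exists2 c, x < c < y & tshift y - tshift x = dshift c * (y - x).
Proof.
move=> xy; have [|c] := @MVT R tshift dshift x y xy (fun z _ => tshift_derive z).
  by apply: continuous_subspaceT; exact: tshift_continuous.
by rewrite in_itv/= => cxy h; exists c.
Qed.

Lemma tshift_lt : {mono tshift : x y / x < y}.
Proof.
have H x y : x < y -> tshift x < tshift y.
  move=> xy; have [c _ h] := tshift_slope xy; rewrite -subr_gt0 h mulr_gt0 ?subr_gt0//.
  by rewrite (lt_le_trans _ (dshift_ge c)).
move=> x y; have [/H ->//|yx|->] := ltgtP x y; last by rewrite ltxx.
by apply/negbTE; rewrite -leNgt ltW// H.
Qed.

Lemma tshift_le : {mono tshift : x y / x <= y}.
Proof. by move=> x y; rewrite !leNgt tshift_lt. Qed.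

Lemma tshift0 : tshift 0 = 0. Proof. by rewrite /tshift (tangent_le0 tphi)// mulr0 addr0. Qed.
Lemma tshift1 : tshift 1 = 1. Proof. by rewrite /tshift (tangent_ge1 tphi)// mulr0 addr0. Qed.

Lemma tshift_dist x : `|tshift x - x| <= e * K.
Proof.
by rewrite /tshift addrAC subrr add0r normrM (ger0_norm e0) ler_wpM2l// (tangent_bound tphi).
Qed.

(** The map displaces points by at most 1/2, so the intermediate value theorem on [[y - 1, y + 1]]
    yields a preimage of [y]. *)
Lemma tshift_inverse : exists k : R -> R, cancel k tshift.
Proof.
suff /choice[k kP] : forall y, exists x, tshift x = y by exists k.
move=> y; have h := eK.
have h1 : tshift (y - 1) <= y.
  by have := tshift_dist (y - 1); rewrite ler_norml => /andP[h1 h2]; lra.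
have h2 : y <= tshift (y + 1).
  by have := tshift_dist (y + 1); rewrite ler_norml => /andP[h3 h4]; lra.
have [x _ hx] : exists2 x, x \in `[y - 1, y + 1] & tshift x = y; last by exists x.
apply: IVT; first lra.
- by apply: continuous_subspaceT; exact: tshift_continuous.
- by rewrite ge_min h1 le_max h2 orbT.
Qed.

Lemma tshift_G0 (g : G0 R) : inG0 (tshift \o g).
Proof.
split => /=.
- by move=> t t0; rewrite G0_lt0// tshift0.
- by move=> t t1; rewrite G0_ge1// tshift1.
- move=> t _; have := tshift_le 0 (g t); have := tshift_le (g t) 1; rewrite tshift0 tshift1 => -> ->.
  exact: G0_itv.
- by move=> s t _ st _; rewrite tshift_le G0_nondecreasing.
- move=> t t01; apply: continuous_cvg; first exact: tshift_continuous.
  by case: (gfunP g) => _ _ _ _; apply.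
Qed.

Definition push (g : G0 R) : G0 R := MkG0 (tshift_G0 g).

Lemma push_dist g : L2dist (push g) g <= e * K.
Proof. by apply: L2dist_le => s _; exact: tshift_dist. Qed.

End Tangent.

(** * Distortion of the Dirichlet density, uniformly in the mesh *)

Section DensityRatio.
Variables (R : realType) (beta : R).
Hypotheses (beta0 : 0 < beta).
Local Notation Om := (Om R).
Variables (phi dphi : R -> R) (K : R).
Hypothesis tphi : tangent phi dphi K.
Variable e : R.
Hypotheses (e0 : 0 <= e) (eK : e * K <= 2^-1).
Local Notation h := (tshift phi e).
Local Notation dh := (dshift dphi e).
Variable N : nat.

Lemma bnd_shift x i : bnd N (h \o x) i = h (bnd N x i).
Proof. by rewrite /bnd; case: ifP => _; [rewrite (tshift0 tphi)|case: ifP => // _; rewrite (tshift1 tphi)]. Qed.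

Lemma increasing_pts_shift x : increasing_pts N (h \o x) <-> increasing_pts N x.
Proof.
by split => H i iN; have := H i iN; rewrite !bnd_shift (tshift_lt tphi).
Qed.

Lemma mesh_step i : mesh R N i.+1 - mesh R N i = N.+1%:R^-1.
Proof. by rewrite /mesh -mulrBl -natrB// subSnn mul1r. Qed.

(** Three contributions: [2 * (e * K)] from the quotients of derivatives by slopes, the same from
    the slope without partner, and [beta] times as much from the small powers of the slopes. *)
Definition ratio_err := 2 * (e * K) * (2 + beta).

(** Each spacing is multiplied by a mean slope [s i], so the density acquires the factors
    [s i ^ (beta / N.+1 - 1)]. The Jacobian factors cancel all but one of the [(s i)^-1], up to
    errors proportional to the spacings; the remaining powers have total exponent [beta]. Off the
    simplex both sides vanish. *)
Lemma dens_ratio x : exists2 r, near1 r ratio_err &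
  (\prod_(i < N) dh (x i.+1)) * dens beta N (h \o x) = r * dens beta N x.
Proof.
have K0 := tangent_K0 tphi; have ek := eK; have b0 := beta0.
have [inc|ninc] := asboolP (increasing_pts N x); last first.
  exists 1.
    apply: near1_le (near1_1 R); rewrite /ratio_err !mulr_ge0//.
    by rewrite addr_ge0// ltW.
  rewrite /dens !asboolF ?mulr0//; by move/increasing_pts_shift.
pose b := bnd N x.
(* Mean value points: [dh (c i)] is the slope of the map between the neighbours [b i] and
   [b i.+1]. *)
have /choice[c cP] : forall i, exists c, (i < N.+1)%N ->
    b i < c < b i.+1 /\ h (b i.+1) - h (b i) = dh c * (b i.+1 - b i).
  move=> i; have [iN|] := boolP (i < N.+1)%N; last by exists 0.
  by have [c cb hc] := tshift_slope tphi e (inc i iN); exists c.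
pose s i := dh (c i).
have s2 i : 2^-1 <= s i by exact: (dshift_ge tphi e0 eK).
have s0 i : 0 < s i by rewrite (lt_le_trans _ (s2 i)).
pose q : R := beta * N.+1%:R^-1.
have q0 : 0 <= q by rewrite mulr_ge0// ltW.
(* The [N] derivatives are paired with the slopes [s 1] to [s N]; the slope [s 0] is left over. *)
exists ((\prod_(i < N) (dh (b i.+1) / s i.+1)) * (s 0%N)^-1 * \prod_(i < N.+1) (s i `^ q)).
  have n1 i : (i < N)%N -> near1 (dh (b i.+1) / s i.+1) (2 * (e * K) * (b i.+2 - b i.+1)).
    move=> iN; rewrite -mulrA; apply: near1_ratio; [exact: (dshift_ge tphi e0 eK)|by []|].
    rewrite /s /dshift.
    rewrite (_ : 1 + _ - _ = e * (dphi (b i.+1) - dphi (c i.+1))); last by ring.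
    rewrite normrM (ger0_norm e0) -mulrA ler_wpM2l// (le_trans (tangent_lip tphi _ _))//.
    rewrite ler_wpM2l//; have [/andP[c1 c2] _] := cP i.+1 iN.
    by rewrite ltr0_norm ?subr_lt0// opprB lerB// ltW.
  have n2 i : near1 (s i) (2 * (e * K)).
    have eb := edphi_bound tphi e0 (c i).
    by apply: near1_1D => //; move: eb; rewrite ler_norml => /andP[h1 h2]; lra.
  have := near1M (near1M (near1_prod n1) (near1V (n2 0%N)))
    (near1_prod (n := N.+1) (a := fun i => s i `^ q) (E := fun=> q * (2 * (e * K)))
      (fun i _ => near1_powR q0 (n2 i))).
  apply: near1_le.
  rewrite sumr_const card_ord -mulr_sumr.
  rewrite -(big_mkord xpredT (fun i => b i.+2 - b i.+1)) telescope_sumr//.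
  rewrite {1}/b {1}/bnd /= eqxx /ratio_err.
  have b1 : 0 <= b 1%N.
    by have := inc 0%N isT; rewrite /b /bnd /= => /ltW.
  have -> : q * (2 * (e * K)) *+ N.+1 = beta * (2 * (e * K)).
    by rewrite -mulr_natr /q; field.
  have : 0 <= e * K by rewrite mulr_ge0.
  nra.
rewrite /dens !asboolT//; last exact/increasing_pts_shift.
rewrite /dirichlet_density.
set C := _ / _; rewrite !(mulrCA _ C); congr (C * _).
have -> : \prod_(i < N.+1) (bnd N (h \o x) i.+1 - bnd N (h \o x) i) `^ (beta * (mesh R N i.+1 - mesh R N i) - 1) =
   (\prod_(i < N.+1) (s i)^-1) * (\prod_(i < N.+1) (s i `^ q)) *
     \prod_(i < N.+1) (b i.+1 - b i) `^ (beta * (mesh R N i.+1 - mesh R N i) - 1).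
  rewrite -!big_split /=; apply: eq_bigr => i _.
  rewrite !bnd_shift; have [_ ->] := cP i (ltn_ord i).
  rewrite powRM ?(ltW (s0 _))//; last by rewrite subr_ge0 ltW// inc.
  have si0 : dh (c i) != 0 by rewrite -/(s i) gt_eqF.
  congr (_ * _); rewrite mesh_step -/q powRB; last by rewrite si0 implybT.
  by rewrite powRr1 ?(ltW (s0 _))// mulrC.
rewrite -/b.
have -> : \prod_(i < N.+1) (s i)^-1 = (s 0%N)^-1 * \prod_(i < N) (s i.+1)^-1 by rewrite big_ord_recl.
rewrite [\prod_(i < N) (dh (b i.+1) / s i.+1)]big_split /=.
have -> : \prod_(i < N) dh (x i.+1) = \prod_(i < N) dh (b i.+1).
  by apply: eq_bigr => i _; rewrite /b /bnd /= eqSS ltn_eqF.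
by ring.
Qed.

End DensityRatio.

(** * Expectations of bounded and Lipschitz functions *)

Section Expectation.
Variables (R : realType) (Q : probability (G0m R) R).
Implicit Types W : G0m R -> R.

Lemma prob_bounded_integrable W (M : R) : measurable_fun setT W ->
  (forall g, `|W g| <= M) -> Q.-integrable setT (EFin \o W).
Proof.
move=> mW WM; apply: measurable_bounded_integrable => //.
  exact: le_lt_trans (probability_le1 _ _) (ltry _).
exists M; split; first exact: num_real.
by move=> x Mx g _; apply: (le_trans (WM g)); exact: ltW.
Qed.

Lemma L2lip_bounded W (L : R) : L2lip W L -> forall g, `|W g| <= `|W point| + `|L|.
Proof.
move=> WL g; have := WL g point; have := L2dist_le1 g point; have := L2dist_ge0 g point.
move: (L2dist _ _) => l l0 l1 h.
have : `|W g| <= `|W g - W point| + `|W point| by rewrite -{1}(subrK (W point) (W g)) ler_normD.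
move=> /le_trans; apply; rewrite addrC lerD2l (le_trans h)//.
by rewrite (le_trans (ler_norm _))// normrM (ger0_norm l0) ler_piMr.
Qed.

Lemma L2lip_integrable W (L : R) : L2lip W L -> Q.-integrable setT (EFin \o W).
Proof.
move=> WL; apply: prob_bounded_integrable (L2lip_bounded WL).
exact: L2lip_measurable WL.
Qed.

Lemma RintegralQ_cst (c : R) : \int[Q]_g c = c.
Proof. by rewrite Rintegral_cst// [X in fine X]probability_setT mulr1. Qed.

End Expectation.

(** * Measurability of maps into G_0 and of the discretisation *)

Section G0Maps.
Variable R : realType.

Lemma L2dist_mul_le (f f' g g' : G0 R) (c : R) : 0 <= c ->
  (forall s, I01 s -> `|f' s - g' s| <= c * `|f s - g s|) -> L2dist f' g' <= c * L2dist f g.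
Proof.
move=> c0 H; rewrite -(@ler_pXn2r _ 2)// ?nnegrE ?mulr_ge0 ?L2dist_ge0// exprMn !L2dist_sqr.
rewrite /Rint01 -RintegralZl//; last first.
  apply: (@bounded_integrable _ _ (1 : R)); first by apply: measurable_funX; apply: measurable_funB; exact: measurable_G0.
  by move=> s _; rewrite normrX exprn_ile1// G0_dist_le1.
apply: le_Rintegral => //.
- apply: (@bounded_integrable _ _ (1 : R)); first by apply: measurable_funX; apply: measurable_funB; exact: measurable_G0.
  by move=> s _; rewrite normrX exprn_ile1// G0_dist_le1.
- apply: (@bounded_integrable _ _ (c ^+ 2)).
    by apply: measurable_funM => //; apply: measurable_funX; apply: measurable_funB; exact: measurable_G0.
  move=> s _; rewrite normrM (ger0_norm (sqr_ge0 c)) ler_piMr ?sqr_ge0//.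
  by rewrite normrX exprn_ile1// G0_dist_le1.
- move=> s s1; rewrite -exprMn -(real_normK (num_real (f' s - g' s))).
  rewrite -[leRHS]real_normK ?num_real// normrM (ger0_norm c0).
  by rewrite lerXn2r ?nnegrE ?mulr_ge0//; exact: H.
Qed.

Lemma measurable_to_G0 d (T : measurableType d) (F : T -> G0m R) :
  (forall O : set (G0 R), L2open O -> measurable (F @^-1` O)) -> measurable_fun setT F.
Proof.
move=> H; apply: (@measurability _ _ T (G0m R) setT F (@L2open R) erefl).
by move=> _ [U oU <-]; rewrite setTI; exact: H.
Qed.

(** The event that a step function lies in an L^2 ball, expressed by its coordinates. It is
    measurable because a partial integral of a jointly measurable function is. *)
Lemma measurable_ball_bnd (N : nat) (f : G0 R) (r : R) : 0 < r ->
  measurable [set x : Om R | (\int[lebesgue_measure]_(s in @I01 R)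
     ((f s - bnd N x (cell N.+1 s)) ^+ 2)%:E < (r ^+ 2)%:E)%E].
Proof.
move=> r0.
pose F (p : Om R * measurableTypeR R) : \bar R :=
  ((f p.2 - bnd N p.1 (cell N.+1 p.2)) ^+ 2 * \1_(@I01 R) p.2)%:E.
have mb : measurable_fun setT (fun p : Om R * measurableTypeR R => bnd N p.1 (cell N.+1 p.2)).
  apply: measurable_fun_lt => // c; rewrite setTI.
  rewrite (_ : [set p | _] = \bigcup_k ([set x : Om R | bnd N x k < c] `*` [set s | cell N.+1 s = k])).
    apply: bigcupT_measurable => k; apply: measurableX.
      have := @measurable_bnd R N k measurableT _ (measurable_itv `]-oo, c[).
      by rewrite setTI; congr measurable; apply/seteqP; split => x /=; rewrite in_itv.
    have := @measurable_cell_fun R N.+1 (fun i => (i == k)%:R) measurableT [set 1] (measurable_set1 _).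
    rewrite setTI; congr measurable; apply/seteqP; split => t /=.
      by case: eqP => // _ /esym/eqP; rewrite oner_eq0.
    by move=> ->; rewrite eqxx.
  apply/seteqP; split => [[x s] /= h|[x s] [k _ /= [h sk]]]; last by rewrite /= sk.
  by exists (cell N.+1 s).
have mF : measurable_fun setT F.
  apply/measurable_EFinP/measurable_funM; last first.
    have mi : measurable_fun setT (\1_(@I01 R) : measurableTypeR R -> R) by exact: measurable_indic.
    exact: (measurableT_comp mi measurable_snd).
  apply: measurable_funX; apply: measurable_funB => //.
  have mf : measurable_fun setT (gfun f : measurableTypeR R -> R) by exact: measurable_G0.
  exact: (measurableT_comp mf measurable_snd).
have F0 p : (0 <= F p)%E by rewrite lee_fin mulr_ge0 ?sqr_ge0// indicE.
have := @measurable_fun_fubini_tonelli_F _ _ _ _ _ (@lebesgue_measure R) F mF F0.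
move=> /(_ measurableT _ (emeasurable_itv `]-oo, (r ^+ 2)%:E[)); rewrite setTI.
congr measurable; apply/seteqP.
have Eq x : fubini_F (@lebesgue_measure R) F x =
    (\int[lebesgue_measure]_(s in @I01 R) ((f s - bnd N x (cell N.+1 s)) ^+ 2)%:E)%E.
  rewrite [RHS]integral_mkcond; apply: eq_integral => y _; rewrite patchE /F /= indicE.
  by case: ifPn => _; rewrite ?mulr1 ?mulr0.
by split => x /=; rewrite in_itv/= Eq.
Qed.

Lemma dis_cell (N : nat) (g : G0 R) s : I01 s ->
  dis (ltn0Sn N) g s = bnd N (pts N g) (cell N.+1 s).
Proof.
move=> /I01P/andP[s0 s1]; rewrite /= /step ltNge s0/=.
have [s1'|s1'] := leP 1 s.
  have -> : s = 1 by apply/eqP; rewrite eq_le s1.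
  by rewrite cell1 /bnd /= eqxx.
have cN := @cell_lt R N.+1 s (ltn0Sn N); rewrite s0 s1' in cN; have {}cN := cN isT.
rewrite /skel /bnd; case: (eqVneq (cell N.+1 s) 0%N) => // c0.
rewrite (ltn_eqF cN) /pts.
by have -> : (1 <= cell N.+1 s <= N)%N by rewrite lt0n c0.
Qed.

(** Events about the discretised function are events about finitely many values of [g], whose law is
    known. The sets with this property form a sigma-algebra that contains the balls, hence their
    countable unions, the open sets. *)
Lemma dis_class (N : nat) (A : set (G0m R)) : measurable A ->
  exists2 B : set (Om R), measurable B & forall g, A (dis (ltn0Sn N) g) <-> B (pts N g).
Proof.
move=> mA.
pose cls := [set A : set (G0m R) | exists2 B : set (Om R), measurable B &
  forall g, A (dis (ltn0Sn N) g) <-> B (pts N g)].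
suff H : @L2open R `<=` cls.
  apply: (smallest_sub _ H) mA; split.
  - by exists set0.
  - move=> U [B mB UB]; exists (~` B); first exact: measurableC.
    by move=> g; have [u1 u2] := UB g; split => [[_ h] /u2 //|h]; split => // /u1.
  - move=> F FB; have /choice[B BP] : forall n, exists B : set (Om R), measurable B /\
       forall g, F n (dis (ltn0Sn N) g) <-> B (pts N g).
      by move=> n; have [B mB hB] := FB n; exists B.
    exists (\bigcup_n B n); first by apply: bigcupT_measurable => n; exact: (BP n).1.
    by move=> g; split => -[n _ /(BP n).2 h]; exists n.
move=> U oU; have [c [r ->]] := L2open_lindelof oU.
pose Bi i : set (Om R) := if 0 < r i then [set x : Om R | (\int[lebesgue_measure]_(s in @I01 R)
     ((c i s - bnd N x (cell N.+1 s)) ^+ 2)%:E < (r i ^+ 2)%:E)%E] else set0.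
exists (\bigcup_i Bi i).
  apply: bigcupT_measurable => i; rewrite /Bi; case: ifP => // ri.
  exact: measurable_ball_bnd.
have key i g : L2ball (c i) (r i) (dis (ltn0Sn N) g) <-> Bi i (pts N g).
  rewrite /L2ball /Bi /=; case: ifPn => [ri|]; last first.
    by rewrite -leNgt => ri; split => //; rewrite ltNge (le_trans ri)// L2dist_ge0.
  rewrite -(@ltr_pXn2r _ 2)// ?nnegrE ?L2dist_ge0 ?(ltW ri)// L2dist_sqr /=.
  rewrite -lte_fin /Rint01 /Rintegral fineK.
    set I1 := (X in (X < _)%E <-> _); set I2 := (X in _ <-> (X < _)%E).
    suff -> : I1 = I2 by [].
    by apply: eq_integral => s /[!inE] s1; rewrite -(dis_cell N g s1).
  apply: integrable_fin_num => //; apply: (@bounded_integrable _ _ (1 : R)).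
    apply: measurable_funX; apply: measurable_funB; first exact: measurable_G0.
    exact: (measurable_G0 (dis (ltn0Sn N) g)).
  by move=> s _; rewrite normrX exprn_ile1// (G0_dist_le1 (c i) (dis (ltn0Sn N) g)).
by move=> g; split => -[i _ /key h]; exists i.
Qed.

Lemma measurable_dis N : measurable_fun setT (dis (ltn0Sn N) : G0m R -> G0m R).
Proof.
apply: measurable_to_G0 => U oU; have [B mB UB] := dis_class N (L2open_measurable oU).
rewrite (_ : _ @^-1` _ = pts N @^-1` B); last by apply/seteqP; split => g /UB.
by have := @measurable_pts R N measurableT B mB; rewrite setTI.
Qed.

End G0Maps.

(** * Quasi-invariance of the measure *)

Section QuasiInvariance.
Variables (R : realType) (beta : R) (Q : probability (G0m R) R).
Hypotheses (beta0 : 0 < beta) (HQ : is_entropic beta Q).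
Local Notation Om := (Om R).
Variables (phi dphi : R -> R) (K : R).
Hypothesis tphi : tangent phi dphi K.
Variable e : R.
Hypotheses (e0 : 0 <= e) (eK : e * K <= 2^-1).
Local Notation h := (tshift phi e).
Local Notation dh := (dshift dphi e).
Local Notation H := (push tphi e0 eK).
Local Notation E := (ratio_err beta K e).

Lemma pts_push N (g : G0m R) : pts N (H g) = h \o pts N g :> (nat -> R).
Proof.
by apply/funext => i; rewrite /pts /=; case: ifP => // _; rewrite (tshift0 tphi).
Qed.

Let hD := tshift_derive tphi e.
Let cdh := dshift_continuous tphi (e := e).
Let dh0 x : 0 <= dh x.
Proof. by rewrite (le_trans _ (dshift_ge tphi e0 eK x)). Qed.
Let hlt := tshift_lt tphi e0 eK.

(** The substitution formula at the base point 0, a fixed point of the map, turns the measure of [A]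
    into an integral over [A'], and [dens_ratio] compares the integrands pointwise. *)
Lemma Jmeas_shift N (A : set Om) : measurable A ->
  let A' := (fun x : Om => h \o x : Om) @^-1` A in
  let m := Jmeas N (measurable_dens beta N) (@dens_ge0 R beta N) in
  (m A <= (expR E)%:E * m A')%E /\ (m A' <= (expR E)%:E * m A)%E.
Proof.
move=> mA A' m; have [k hk] := tshift_inverse tphi e0 eK.
have mA' : measurable A'.
  by rewrite -[A']setTI; apply: measurable_comp_Om => //; exact: hD.
have md := measurable_dens beta N; have d0 := @dens_ge0 R beta N.
pose I1 (x : Om) : \bar R := ((\prod_(i < N) dh (x i.+1))%:E *
  ((\1_A (h \o x))%:E * (dens beta N (h \o x))%:E))%E.
have mAE : m A = J N I1 (fun=> 0).
  transitivity (J N (fun x : Om => (\1_A x)%:E * (dens beta N x)%:E)%E (h \o (fun=> 0))).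
    by congr J; apply/funext => i /=; rewrite (tshift0 tphi).
  apply: (J_subst hD cdh dh0 hk hlt).
  - by move=> x; exact: Jmeas_integrand_ge0.
  - exact: measurable_Jmeas_integrand.
pose I2 (x : Om) : \bar R := ((\1_A' x)%:E * (dens beta N x)%:E)%E.
have mI2 : measurable_fun setT I2 by exact: measurable_Jmeas_integrand.
have I20 x : (0 <= I2 x)%E by exact: Jmeas_integrand_ge0.
have mI1 : measurable_fun setT I1.
  apply: emeasurable_funM; first by apply/measurable_EFinP; exact: measurable_jac.
  exact: (measurableT_comp (measurable_Jmeas_integrand md mA) (measurable_comp_Om hD)).
have I10 x : (0 <= I1 x)%E by rewrite mule_ge0 ?lee_fin ?prodr_ge0//; exact: Jmeas_integrand_ge0.
have I12 x : exists2 r, near1 r E & I1 x = (r%:E * I2 x)%E.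
  have [r rE H] := dens_ratio beta0 tphi e0 eK N x; exists r => //.
  rewrite /I1 /I2 muleCA -EFinM H EFinM muleCA; congr (_ * _)%E.
have sc (u : Om -> \bar R) : (forall x, 0 <= u x)%E -> measurable_fun setT u ->
    J N (fun x => (expR E)%:E * u x)%E (fun=> 0) = ((expR E)%:E * J N u (fun=> 0%R))%E.
  by move=> u0 mu; apply: (J_scale (c := fun=> expR E)) => // x; exact: expR_ge0.
rewrite mAE; split.
- rewrite -sc//; apply: J_le => //; first exact: emeasurable_funM.
  move=> x; have [r /andP[_ r2] ->] := I12 x.
  by apply: lee_wpmul2r => //; rewrite lee_fin.
- rewrite -sc//; apply: J_le => //; first exact: emeasurable_funM.
  move=> x; have [r /andP[r1 _] ->] := I12 x.
  rewrite muleA -EFinM -[leLHS]mul1e; apply: lee_wpmul2r; first exact: I20.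
  rewrite lee_fin -(expRxMexpNx_1 E) ler_wpM2l ?expR_ge0//.
Qed.

Lemma pts_shift N (A : set Om) : measurable A ->
  (Q (pts N @^-1` A) <= (expR E)%:E * Q ((fun g => pts N (H g)) @^-1` A))%E /\
  (Q ((fun g => pts N (H g)) @^-1` A) <= (expR E)%:E * Q (pts N @^-1` A))%E.
Proof.
move=> mA; pose A' := (fun x : Om => h \o x : Om) @^-1` A.
have mA' : measurable A'.
  by rewrite -[A']setTI; apply: measurable_comp_Om => //; exact: hD.
have -> : (fun g => pts N (H g)) @^-1` A = pts N @^-1` A'.
  by apply/seteqP; split => g; rewrite /A' /preimage /= pts_push.
rewrite !(pts_law HQ)//.
exact: Jmeas_shift.
Qed.

Lemma dis_push_le N (A : set (G0m R)) : measurable A ->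
  (Q [set g | A (dis (ltn0Sn N) g)] <= (expR E)%:E * Q [set g | A (dis (ltn0Sn N) (H g))])%E /\
  (Q [set g | A (dis (ltn0Sn N) (H g))] <= (expR E)%:E * Q [set g | A (dis (ltn0Sn N) g)])%E.
Proof.
move=> mA; have [B mB AB] := dis_class N mA; have := pts_shift N mB.
rewrite (_ : [set g | A _] = pts N @^-1` B); last by apply/seteqP; split => g /AB.
rewrite (_ : [set g | A _] = (fun g => pts N (H g)) @^-1` B)//.
by apply/seteqP; split => g /AB.
Qed.

Lemma push_dist2 f g : L2dist (H f) (H g) <= 2 * L2dist f g.
Proof.
have ek := eK.
apply: L2dist_mul_le => // s _ /=.
have K0 := tangent_K0 tphi.
have D (x y : R) : x < y -> h y - h x <= 2 * (y - x).
  move=> xy; have [c _ ->] := tshift_slope tphi e xy.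
  rewrite ler_wpM2r ?subr_ge0 ?(ltW xy)// /dshift.
  by have := edphi_bound tphi e0 c; rewrite ler_norml => /andP[h1 h2]; lra.
have [xy|xy|->] := ltgtP (f s) (g s).
- rewrite !ltr0_norm ?subr_lt0// ?(tshift_lt tphi e0 eK)// !opprB; exact: D.
- rewrite !gtr0_norm ?subr_gt0// ?(tshift_lt tphi e0 eK)//; exact: D.
- by rewrite !subrr normr0 mulr0.
Qed.

Lemma measurable_push : measurable_fun setT (H : G0m R -> G0m R).
Proof.
apply: measurable_to_G0 => U oU; apply: L2open_measurable => g /oU[r r0 rU].
exists (r / 2); first by rewrite divr_gt0.
move=> f; rewrite /L2ball /= => fg; apply: rU; rewrite /L2ball /=.
by rewrite (le_lt_trans (push_dist2 _ _))// mulrC -ltr_pdivlMr.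
Qed.

(** The comparison holds for the discretised functions with a constant independent of the mesh. As
    [W] is Lipschitz and the discretisation converges uniformly over [G0], the mesh size can tend to
    0. *)
Lemma quasi_invariance W (L : R) : 0 <= L -> L2lip W L -> (forall g, 0 <= W g) ->
  \int[Q]_g W g <= expR E * \int[Q]_g W (H g) /\
  \int[Q]_g W (H g) <= expR E * \int[Q]_g W g.
Proof.
move=> L0 WL W0.
have mW : measurable_fun setT W := L2lip_measurable WL.
have mH := measurable_push.
have bW := L2lip_bounded WL.
have int (F : G0m R -> G0m R) : measurable_fun setT F -> Q.-integrable setT (EFin \o (fun g => W (F g))).
  move=> mF; apply: (@prob_bounded_integrable _ _ _ (`|W point| + `|L|)) => //.
  exact: measurableT_comp.
have pf (F : G0m R -> G0m R) (mF : measurable_fun setT F) :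
   exists m : {measure set (G0m R) -> \bar R}, (forall A, m A = Q (F @^-1` A)) /\
     (\int[m]_g (W g)%:E = (\int[Q]_g W (F g))%:E)%E.
  pose m : {measure set (G0m R) -> \bar R} := pushforward Q F.
  exists (m mF); split => //; rewrite /m.
  rewrite ge0_integral_pushforward//; first last.
  - by move=> g _; rewrite lee_fin.
  - exact/measurable_EFinP.
  by rewrite /Rintegral fineK//; exact: (integrable_fin_num measurableT (int _ mF)).
have cmp (F1 F2 : G0m R -> G0m R) : measurable_fun setT F1 -> measurable_fun setT F2 ->
   (forall A, measurable A -> Q (F1 @^-1` A) <= (expR E)%:E * Q (F2 @^-1` A))%E ->
   \int[Q]_g W (F1 g) <= expR E * \int[Q]_g W (F2 g).
  move=> m1 m2 Hle; have [n1 [n1E i1]] := pf _ m1; have [n2 [n2E i2]] := pf _ m2.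
  rewrite -lee_fin EFinM -i1 -i2; apply: ge0_le_integral_measure.
  - by move=> A mA; rewrite n1E n2E; exact: Hle.
  - exact/measurable_EFinP.
  - by move=> g; rewrite lee_fin.
have near (F : G0m R -> G0m R) (N : nat) (dl : R) : measurable_fun setT F ->
    0 < dl -> N.+1%:R^-1 < dl ^+ 2 ->
    `|\int[Q]_g W (dis (ltn0Sn N) (F g)) - \int[Q]_g W (F g)| <= L * dl.
  move=> mF dl0 Nd; have mD := @measurable_dis R N.
  have mDF : measurable_fun setT (fun g => dis (ltn0Sn N) (F g) : G0m R) by exact: (measurableT_comp mD mF).
  rewrite -RintegralB//; [|exact: int|exact: int].
  rewrite (le_trans (le_normr_Rintegral _ _))//.
    by apply: (integrableB _ (int _ mDF) (int _ mF)).
  rewrite -[leRHS](RintegralQ_cst Q); apply: le_Rintegral => //.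
  - apply: (integrable_norm (D := setT) (f := fun g => W (dis (ltn0Sn N) (F g)) - W (F g))).
    by apply: (integrableB _ (int _ mDF) (int _ mF)).
  - by apply: (@prob_bounded_integrable _ _ _ `|L * dl|).
  - move=> g _; rewrite (le_trans (WL _ _))// ler_wpM2l//.
    rewrite -(@ler_pXn2r _ 2)// ?nnegrE ?L2dist_ge0 ?(ltW dl0)//.
    exact: le_trans (dis_cvg (ltn0Sn N) (F g)) (ltW Nd).
have main (F1 F2 : G0m R -> G0m R) : measurable_fun setT F1 -> measurable_fun setT F2 ->
   (forall N (A : set (G0m R)), measurable A -> (Q [set g | A (dis (ltn0Sn N) (F1 g))] <=
      (expR E)%:E * Q [set g | A (dis (ltn0Sn N) (F2 g))])%E) ->
   \int[Q]_g W (F1 g) <= expR E * \int[Q]_g W (F2 g).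
  move=> m1 m2 Hle; apply/ler_addgt0Pr => eta eta0.
  have c0 : 0 < L * (expR E + 1) + 1 by rewrite ltr_wpDl// mulr_ge0// addr_ge0// expR_ge0.
  (* The discretisation errors amount to [dl * L * (expR E + 1)]; the added 1 keeps the denominator
     positive. *)
  pose dl := eta / (L * (expR E + 1) + 1).
  have dl0 : 0 < dl by rewrite divr_gt0.
  have [n n0 nd] := invn_small (exprn_gt0 2 dl0).
  case: n n0 nd => // N _ nd.
  have mD := @measurable_dis R N.
  have A1 := near _ _ _ m1 dl0 nd; have A2 := near _ _ _ m2 dl0 nd.
  have A3 := cmp (fun g => dis (ltn0Sn N) (F1 g)) (fun g => dis (ltn0Sn N) (F2 g))
    (measurableT_comp mD m1) (measurableT_comp mD m2) (Hle N).
  have dE : dl * (L * (expR E + 1) + 1) = eta by rewrite /dl divfK// gt_eqF.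
  have key (a1 a2 y1 y2 ex l d : R) : 0 <= ex -> `|a1 - y1| <= l * d -> `|a2 - y2| <= l * d ->
      a1 <= ex * a2 -> 0 < d -> y1 <= ex * y2 + d * (l * (ex + 1) + 1).
    move=> ex0 /ler_normlP[h1 _] /ler_normlP[_ h2] h3 d0.
    have h4 : ex * a2 <= ex * (y2 + l * d) by rewrite ler_wpM2l//; lra.
    have -> : d * (l * (ex + 1) + 1) = ex * (l * d) + l * d + d by ring.
    rewrite mulrDr in h4; lra.
  by rewrite -dE; exact: (key _ _ _ _ _ _ _ (expR_ge0 E) A1 A2 A3 dl0).
split.
- apply: (main id H) => // N A mA; exact: (dis_push_le N mA).1.
- apply: (main H id) => // N A mA; exact: (dis_push_le N mA).2.
Qed.

End QuasiInvariance.

Lemma Rintegral_dominated_cvg d (T : measurableType d) (R : realType)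
    (mu : {measure set T -> \bar R}) (D : set T) (fn : nat -> T -> R) (f h : T -> R) :
  measurable D -> (forall n, measurable_fun D (fn n)) -> measurable_fun D f ->
  mu.-integrable D (EFin \o h) -> (forall n x, D x -> `|fn n x| <= h x) ->
  {ae mu, forall x, D x -> (fn ^~ x) @ \oo --> f x} ->
  (fun n => \int[mu]_(x in D) fn n x) @ \oo --> \int[mu]_(x in D) f x.
Proof.
move=> mD mfn mf ih fnh fnf.
have [|||||h1 _ H] := @dominated_convergence _ _ _ mu D mD (fun n x => (fn n x)%:E)
  (fun x => (f x)%:E) (EFin \o h).
- by move=> n; exact/measurable_EFinP.
- exact/measurable_EFinP.
- by apply: filterS fnf => x xf Dx; apply/cvg_EFin; [exact: nearW|exact: xf].
- exact: ih.
- by apply: aeW => x n Dx /=; rewrite lee_fin fnh.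
apply: (fine_cvg (f := fun n => (\int[mu]_(x in D) (fn n x)%:E)%E)).
rewrite /Rintegral fineK//; exact: integrable_fin_num.
Qed.

(** * Square integrable functions on G_0 x [0, 1] *)

Section Product.
Variables (R : realType) (Q : probability (G0m R) R).
Local Notation leb := (@lebesgue_measure R).
Local Notation I01 := (@I01 R).
Implicit Types F H : G0m R -> R -> R.

Definition GI : set (G0m R * measurableTypeR R) := setT `*` I01.
Local Notation QI := (Q \x leb)%E.
Local Notation unc F := (fun p : G0m R * measurableTypeR R => F p.1 p.2).

Lemma measurable_GI : measurable GI.
Proof. exact: measurableX. Qed.
Hint Resolve measurable_GI : core.

Lemma patch_section (T : pointedType) (f : G0m R * measurableTypeR R -> T) g s :
  (f \_ GI) (g, s) = ((fun s => f (g, s)) \_ I01) s.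
Proof.
rewrite !patchE; have -> // : ((g, s) \in GI) = (s \in I01).
by apply/idP/idP; rewrite !inE => -[].
Qed.

Lemma measurable_section F g : measurable_fun GI (unc F) -> measurable_fun I01 (F g).
Proof.
move=> mF; have mFr : measurable_fun setT ((unc F) \_ GI).
  exact: (measurable_restrictT (unc F) measurable_GI).1.
suff h : measurable_fun setT ((F g : measurableTypeR R -> R) \_ I01).
  exact: ((measurable_restrictT (F g : measurableTypeR R -> R) (@measurable_I01 R)).2 h).
rewrite (_ : F g \_ I01 = ((unc F) \_ GI) \o pair g).
  exact: (measurableT_comp mFr (pair1_measurable g)).
by apply/funext => s /=; rewrite patch_section.
Qed.

Lemma sq_sectionE F : measurable_fun GI (unc F) ->
  measurable_fun setT (fun g => sq leb I01 (F g)) /\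
  sq QI GI (unc F) = (\int[Q]_g sq leb I01 (F g))%E.
Proof.
move=> mF; pose f p : \bar R := (unc F p ^+ 2)%:E.
have mf : measurable_fun setT (f \_ GI).
  exact: (measurable_restrictT f measurable_GI).1 (measurable_sq mF).
have f0 p : (0 <= (f \_ GI) p)%E.
  by rewrite patchE; case: ifP => // _; rewrite lee_fin sqr_ge0.
have E g : fubini_F leb (f \_ GI) g = sq leb I01 (F g).
  rewrite /sq [RHS]integral_mkcond; apply: eq_integral => s _; exact: patch_section.
split.
  have := measurable_fun_fubini_tonelli_F (m2 := leb) (f \_ GI) mf f0.
  by congr measurable_fun; apply/funext.
transitivity (\int[QI]_p (f \_ GI) p)%E; first exact: integral_mkcond.
rewrite (fubini_tonelli1 (m1 := Q) (m2 := leb) (f \_ GI) mf f0).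
by apply: eq_integral => g _; exact: E.
Qed.

Lemma sqi_section_ae F : sqi QI GI (unc F) -> {ae Q, forall g, sqi leb I01 (F g)}.
Proof.
move=> [mF Foo]; have [ms sE] := sq_sectionE mF.
have : Q.-integrable setT (fun g => sq leb I01 (F g)).
  apply/integrableP; split => //.
  under eq_integral do rewrite (gee0_abs (sq_ge0 _ _ _)).
  by rewrite -sE.
move/integrable_ae => /(_ measurableT); apply: filterS => g /(_ I) h.
split; first exact: measurable_section.
by have := ltey_eq; rewrite ltey_eq h.
Qed.

(** The real number [ip] is the finite part of the inner integral, so its identification with the
    integral in Fubini's theorem holds only where the latter is finite, that is almost
    everywhere. *)
Lemma ip_section F H : sqi QI GI (unc F) -> sqi QI GI (unc H) ->
  Q.-integrable setT (EFin \o (fun g => ip leb I01 (F g) (H g))) /\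
  \int[Q]_g ip leb I01 (F g) (H g) = ip QI GI (unc F) (unc H).
Proof.
move=> sF sH; pose f p : \bar R := (F p.1 p.2 * H p.1 p.2)%:E.
have fi : QI.-integrable setT (f \_ GI).
  have h : QI.-integrable GI f by exact: (sqi_mul measurable_GI sF sH).
  exact: ((integrable_mkcond (mu := QI) f measurable_GI).1 h).
have E g : fubini_F leb (f \_ GI) g = (\int[leb]_(s in I01) (F g s * H g s)%:E)%E.
  rewrite [RHS]integral_mkcond; apply: eq_integral => s _; exact: patch_section.
have iF := integrable_fubini_F fi.
have Ef g : ip leb I01 (F g) (H g) = fine (fubini_F leb (f \_ GI) g) by rewrite E.
have iff : Q.-integrable setT (EFin \o (fun g => ip leb I01 (F g) (H g))).
  apply: (le_integrable measurableT _ _ iF).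
    apply/measurable_EFinP; rewrite (_ : (fun _ => _) = fine \o fubini_F leb (f \_ GI)).
      by apply: measurableT_comp (measurable_int _ iF); exact: fine_measurable.
    by apply/funext => g; exact: Ef.
  by move=> g _; rewrite /= Ef; case: (fubini_F _ _ _) => [r||] //=; rewrite normr0 leey.
split=> //; rewrite /Rintegral [RHS]/ip /Rintegral [in RHS]integral_mkcond.
rewrite -(integral12_prod_meas1 fi); congr fine; apply: ae_eq_integral => //.
- by apply: measurable_int iff.
- by apply: measurable_int iF.
- have := integrable_ae measurableT iF; apply: filterS => g /(_ I) h _ /=.
  by rewrite Ef fineK.
Qed.

Lemma bounded_sqi_GI F (M : R) : measurable_fun GI (unc F) ->
  (forall g s, I01 s -> `|F g s| <= M) -> sqi QI GI (unc F).
Proof.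
move=> mF FM; split => //; have [_ ->] := sq_sectionE mF.
apply: (@le_lt_trans _ _ (\int[Q]_g (M ^+ 2)%:E)%E); last first.
  by rewrite integral_cst// [X in (_ * X)%E]probability_setT mule1 ltry.
apply: ge0_le_integral => //.
- by move=> g _; exact: sq_ge0.
- exact: (sq_sectionE mF).1.
- move=> g _; have [mg _] := bounded_sqi (measurable_section g mF) (FM g).
  apply: (@le_trans _ _ (\int[leb]_(s in I01) (M ^+ 2)%:E)%E); last first.
    by rewrite integral_cst// [X in (_ * X)%E]leb_I01 mule1.
  apply: ge0_le_integral => //.
  + by move=> s _; rewrite lee_fin sqr_ge0.
  + exact: measurable_sq.
  + move=> s s1; rewrite lee_fin -(real_normK (num_real (F g s))).
    have h := FM g s s1; rewrite ler_pXn2r// nnegrE//; exact: le_trans h.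
Qed.

End Product.

(** * Strict monotonicity and smooth cutoffs *)

Section StrictIncrease.
Variables (R : realType) (beta : R) (Q : probability (G0m R) R).
Hypotheses (beta0 : 0 < beta) (HQ : is_entropic beta Q).

Lemma increasing_pts_ae N : {ae Q, forall g, increasing_pts N (pts N g)}.
Proof.
pose A := [set x : Om R | increasing_pts N x].
have mA : measurable A.
  rewrite (_ : A = \bigcap_(i in [set i | (i < N.+1)%N]) [set x : Om R | bnd N x i < bnd N x i.+1]).
    apply: bigcap_measurableType => i _; rewrite -[X in measurable X]setTI.
    by apply: measurable_fun_ltr => //; exact: measurable_bnd.
  by apply/seteqP; split => x.
exists (pts N @^-1` (~` A)); split.
- have := @measurable_pts R N measurableT _ (measurableC mA).
  by rewrite setTI.
- rewrite (pts_law HQ); last exact: measurableC.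
  rewrite /Jmeas -[RHS](@J0 R N (fun=> 0)); congr J; apply/funext => x.
  rewrite indicE /dens; have [xA|xA] := pselect (increasing_pts N x).
    by rewrite memNset ?mul0e//= => /(_ xA).
  by rewrite asboolF// mule0.
- by move=> g /= h1 h2; apply: h1.
Qed.

(** The density vanishes off the ordered points, so for each mesh almost every [g] increases
    strictly along it. When the mesh size is below half of [t - s], two consecutive mesh points fit
    between [s] and [t]; countably many meshes give one null set. *)
Lemma strictly_increasing_ae :
  {ae Q, forall g : G0m R, forall s t : R, 0 <= s -> s < t -> t <= 1 -> gfun g s < gfun g t}.
Proof.
have /ae_foralln : forall N, {ae Q, forall g, increasing_pts N (pts N g)} by exact: increasing_pts_ae.
apply: filterS => g H; move=> s t; move: s t => s t s0 st t1.
have [n n0 nst] : exists2 n, (0 < n)%N & n%:R^-1 < (t - s) / 2.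
  by apply: invn_small; rewrite divr_gt0// subr_gt0.
case: n n0 nst => // N _ nst.
have N0 : 0 < N.+1%:R :> R by rewrite ltr0n.
pose i := cell N.+1 s.
have /andP[i1 i2] : i%:R / N.+1%:R <= s < i.+1%:R / N.+1%:R by exact: cellP.
have i3 : i.+2%:R / N.+1%:R < t.
  have -> : i.+2%:R / N.+1%:R = i%:R / N.+1%:R + 2 * N.+1%:R^-1 :> R by rewrite -addn2 natrD mulrDl.
  have key (a c u v : R) : a <= u -> c < (v - u) / 2 -> a + 2 * c < v by move=> *; lra.
  exact: key i1 nst.
have iN : (i.+2 < N.+1)%N.
  by rewrite -(ltr_nat R) -[ltRHS]mul1r -ltr_pdivrMr//; exact: lt_le_trans i3 t1.
have := H N i.+1 (ltnW iN); have iN2 : (i.+2 <= N)%N by rewrite -ltnS.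
rewrite /bnd /= !eqSS !ltn_eqF//; last exact: ltnW.
rewrite /pts /= iN2 (ltnW iN2) /mesh => h; apply: le_lt_trans (lt_le_trans h _); apply: G0_nondecreasing; exact: ltW.
Qed.

End StrictIncrease.

Section Cutoffs.
Variable R : realType.
Implicit Types x y : R.

(** Differentiability from a quadratic remainder. This covers squares of positive parts, whose two
    pieces meet at 0, by inequalities alone. *)
Lemma is_derive_quadratic (f : R -> R) (d C x : R) :
  (forall y, `|f y - f x - d * (y - x)| <= C * (y - x) ^+ 2) -> is_derive x (1 : R) f d.
Proof.
move=> H; have key : (fun h : R => h^-1 *: ((f \o shift x) (h *: (1 : R)) - f x)) @ 0^' --> d.
  apply/cvgrPdist_lt => /= eps eps0.
  have C0 : 0 < `|C| + 1 by rewrite ltr_wpDl.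
  near=> h.
  have h0 : h != 0 by near: h; exact: nbhs_dnbhs_neq.
  rewrite /GRing.scale /= mulr1; have := H (h + x); rewrite addrK => Hh.
  rewrite distrC (_ : _ - d = h^-1 * (f (h + x) - f x - d * h)); last first.
    by rewrite [RHS]mulrBr [d * h]mulrC [in RHS]mulrA mulVf// mul1r.
  rewrite normrM normfV ltr_pdivrMl ?normr_gt0//.
  apply: (le_lt_trans Hh); rewrite -(real_normK (num_real h)) expr2 mulrA mulrC ltr_pM2l ?normr_gt0//.
  apply: (@le_lt_trans _ _ ((`|C| + 1) * `|h|)).
    by rewrite ler_wpM2r// (le_trans (ler_norm C))// lerDl.
  rewrite -ltr_pdivlMl//; near: h; apply: dnbhs0_lt; rewrite mulr_gt0// invr_gt0//.
have dv : derivable f x 1 by apply/cvg_ex; exists d.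
apply: DeriveDef => //; exact: cvg_lim key.
Unshelve. all: by end_near. Qed.

Definition pos x : R := Num.max x 0.

Lemma posP x : (0 <= x /\ pos x = x) \/ (x <= 0 /\ pos x = 0).
Proof. by rewrite /pos; case: (ltP x 0) => h; [right; split => //; exact: ltW|left]. Qed.

Lemma pos_lip x y : `|pos x - pos y| <= `|x - y|.
Proof.
have := ler_norm (x - y); have := ler_norm (y - x); rewrite (distrC y x).
by case: (posP x) => -[h1 ->]; case: (posP y) => -[h2 ->]; rewrite ler_norml; lra.
Qed.

Lemma pos_sqr_quadratic x y : `|pos y ^+ 2 - pos x ^+ 2 - 2 * pos x * (y - x)| <= (y - x) ^+ 2.
Proof.
case: (posP x) => -[h1 ->]; case: (posP y) => -[h2 ->].
- rewrite (_ : _ - _ - _ = (y - x) ^+ 2); last by ring.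
  by rewrite ger0_norm ?sqr_ge0.
- have h : 0 <= x * - y by rewrite mulr_ge0// oppr_ge0.
  have h' := sqr_ge0 y; have h'' := sqr_ge0 x.
  rewrite (_ : _ - _ - _ = x ^+ 2 + 2 * (x * - y)); last by ring.
  rewrite ger0_norm; last lra.
  rewrite (_ : (y - x) ^+ 2 = x ^+ 2 + 2 * (x * - y) + y ^+ 2); last by ring.
  lra.
- have h : 0 <= - x * y by rewrite mulr_ge0// oppr_ge0.
  have h' := sqr_ge0 y; have h'' := sqr_ge0 x.
  rewrite (_ : _ - _ - _ = y ^+ 2); last by ring.
  rewrite ger0_norm//.
  rewrite (_ : (y - x) ^+ 2 = x ^+ 2 + 2 * (- x * y) + y ^+ 2); last by ring.
  lra.
- by rewrite (_ : _ - _ - _ = 0) ?normr0 ?sqr_ge0//; ring.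
Qed.

(** Half the second difference of [pos ^ 2]: a C^1 step from 0 at -1 to 1 at 1, whose derivative is
    the hat function [tent]. *)
Definition chi y : R := (pos (y + 1) ^+ 2 - 2 * pos y ^+ 2 + pos (y - 1) ^+ 2) / 2.

Definition tent y : R := pos (y + 1) - 2 * pos y + pos (y - 1).

Lemma chi_derive y : is_derive y (1 : R) chi (tent y).
Proof.
apply: (@is_derive_quadratic _ _ 2) => z.
have h1 := pos_sqr_quadratic (y + 1) (z + 1); have h2 := pos_sqr_quadratic y z.
have h3 := pos_sqr_quadratic (y - 1) (z - 1).
rewrite (_ : z + 1 - (y + 1) = z - y) in h1; last by ring.
rewrite (_ : z - 1 - (y - 1) = z - y) in h3; last by ring.
move: h1 h2 h3; rewrite /chi /tent.
move: (pos (y + 1)) (pos (y - 1)) (pos (z + 1)) (pos (z - 1)) (pos y) (pos z) => a b c d e f.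
rewrite !ler_norml; lra.
Qed.

Lemma tent_lip x y : `|tent x - tent y| <= 4 * `|x - y|.
Proof.
have h1 := pos_lip (x + 1) (y + 1); have h2 := pos_lip x y; have h3 := pos_lip (x - 1) (y - 1).
rewrite (_ : x + 1 - (y + 1) = x - y) in h1; last by ring.
rewrite (_ : x - 1 - (y - 1) = x - y) in h3; last by ring.
move: h1 h2 h3; rewrite /tent; move: `|x - y| => l; rewrite !ler_norml; lra.
Qed.

Lemma tent_itv y : 0 <= tent y <= 1.
Proof. by rewrite /tent; case: (posP (y + 1)) => -[h1 ->]; case: (posP y) => -[h2 ->]; case: (posP (y - 1)) => -[h3 ->]; lra. Qed.

Lemma tent0 y : 1 <= `|y| -> tent y = 0.
Proof.
by rewrite /tent ler_normr => /orP[] h; case: (posP (y + 1)) => -[h1 ->]; case: (posP y) => -[h2 ->]; case: (posP (y - 1)) => -[h3 ->]; lra.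
Qed.

Lemma chi_le0 y : y <= -1 -> chi y = 0.
Proof. by move=> h; rewrite /chi; case: (posP (y + 1)) => -[h1 ->]; case: (posP y) => -[h2 ->]; case: (posP (y - 1)) => -[h3 ->]; nra. Qed.

Lemma chi_ge1 y : 1 <= y -> chi y = 1.
Proof. by move=> h; rewrite /chi; case: (posP (y + 1)) => -[h1 ->]; case: (posP y) => -[h2 ->]; case: (posP (y - 1)) => -[h3 ->]; nra. Qed.

Lemma chi_itv y : 0 <= chi y <= 1.
Proof. by rewrite /chi; case: (posP (y + 1)) => -[h1 ->]; case: (posP y) => -[h2 ->]; case: (posP (y - 1)) => -[h3 ->]; nra. Qed.

(** The translated hats form a partition of unity: each is a difference of two ramps [dl], and the
    sum telescopes. *)
Lemma sum_tent (n : nat) x : 0 <= x <= n%:R -> \sum_(k < n.+1) tent (k%:R - x) = 1.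
Proof.
move=> /andP[x0 xn]; pose dl y : R := pos y - pos (y - 1).
have E m : \sum_(k < m.+1) tent (k%:R - x) = dl (m%:R - x + 1) - dl (- x).
  elim: m => [|m IH].
    by rewrite big_ord1 /tent /dl add0r addrK; ring.
  rewrite big_ord_recr /= IH /tent /dl -[m.+1%:R]natr1 addrK.
  rewrite (_ : m%:R + 1 - x = m%:R - x + 1); last by ring.
  by rewrite !addrK; ring.
rewrite E /dl; case: (posP (n%:R - x + 1)) => -[h1 ->]; case: (posP (n%:R - x + 1 - 1)) => -[h2 ->];
  case: (posP (- x)) => -[h3 ->]; case: (posP (- x - 1)) => -[h4 ->]; lra.
Qed.

(** A bump that rises from 0 to 1 on [[0, 1/j]] and falls back to 0 on [[p/j, (p+1)/j]]; it vanishes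
    at 1 when [p < j]. These countably many fields suffice to determine gradients. *)
Definition field (j p : nat) x : R := chi (2 * (j%:R * x) - 1) - chi (2 * (j%:R * x - p%:R) - 1).
Definition dfield (j p : nat) x : R :=
  2 * j%:R * (tent (2 * (j%:R * x) - 1) - tent (2 * (j%:R * x - p%:R) - 1)).

(** The constant is the Lipschitz constant of [dfield]: a factor [2 * j] in front, and two hats of
    slope at most 4 composed with maps of slope [2 * j]. It dominates the other bounds. *)
Lemma field_tangent j p : (0 < p < j)%N ->
  tangent (field j p) (dfield j p) (32 * j%:R ^+ 2).
Proof.
move=> /andP[p0 pj].
have j1 : 1 <= j%:R :> R by rewrite ler1n (leq_trans _ pj).
have p1 : 1 <= p%:R :> R by rewrite ler1n.
have pj1 : p%:R + 1 <= j%:R :> R by rewrite natr1 ler_nat.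
have j2 : j%:R <= j%:R ^+ 2 :> R by nra.
split.
- move=> x.
  have d1 : is_derive x (1 : R) (chi \o (fun x => 2 * (j%:R * x) - 1)) (tent (2 * (j%:R * x) - 1) * (2 * j%:R)).
    apply: is_derive1_comp; first exact: chi_derive.
    by apply: (@is_derive_quadratic _ _ 0) => y; rewrite (_ : _ - _ - _ = 0) ?normr0 ?mul0r//; ring.
  have d2 : is_derive x (1 : R) (chi \o (fun x => 2 * (j%:R * x - p%:R) - 1))
      (tent (2 * (j%:R * x - p%:R) - 1) * (2 * j%:R)).
    apply: is_derive1_comp; first exact: chi_derive.
    by apply: (@is_derive_quadratic _ _ 0) => y; rewrite (_ : _ - _ - _ = 0) ?normr0 ?mul0r//; ring.
  by apply: (is_derive_eq (is_deriveB d1 d2)); rewrite /dfield; ring.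
- move=> x y; rewrite /dfield -mulrBr normrM ger0_norm ?mulr_ge0//.
  have h1 := tent_lip (2 * (j%:R * x) - 1) (2 * (j%:R * y) - 1).
  have h2 := tent_lip (2 * (j%:R * x - p%:R) - 1) (2 * (j%:R * y - p%:R) - 1).
  rewrite (_ : 2 * (j%:R * x) - 1 - (2 * (j%:R * y) - 1) = 2 * j%:R * (x - y)) in h1; last by ring.
  rewrite (_ : 2 * (j%:R * x - p%:R) - 1 - (2 * (j%:R * y - p%:R) - 1) = 2 * j%:R * (x - y)) in h2; last by ring.
  rewrite normrM (@ger0_norm _ (2 * j%:R)) ?mulr_ge0// in h1 h2.
  rewrite (_ : 32 * j%:R ^+ 2 * `|x - y| = 2 * j%:R * (16 * (j%:R * `|x - y|))); last by ring.
  rewrite ler_wpM2l ?mulr_ge0//; move: h1 h2; rewrite !ler_norml; lra.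
- move=> x; rewrite normrM ger0_norm ?mulr_ge0//.
  have t1 := tent_itv (2 * (j%:R * x) - 1); have t2 := tent_itv (2 * (j%:R * x - p%:R) - 1).
  rewrite (_ : 32 * j%:R ^+ 2 = 2 * j%:R * (16 * j%:R)); last by ring.
  rewrite ler_wpM2l ?mulr_ge0// ler_norml; lra.
- move=> x; rewrite /field.
  have t1 := chi_itv (2 * (j%:R * x) - 1); have t2 := chi_itv (2 * (j%:R * x - p%:R) - 1).
  rewrite ler_norml; lra.
- move=> x x0; have jx : j%:R * x <= 0 by rewrite mulr_ge0_le0.
  by rewrite /field !chi_le0 ?subrr//; lra.
- move=> x x1; have jx : j%:R <= j%:R * x by rewrite ler_peMr.
  by rewrite /field !chi_ge1 ?subrr//; lra.
Qed.

Lemma field_le1 j p x : `|field j p x| <= 1.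
Proof.
rewrite /field.
have t1 := chi_itv (2 * (j%:R * x) - 1); have t2 := chi_itv (2 * (j%:R * x - p%:R) - 1).
rewrite ler_norml; lra.
Qed.

End Cutoffs.

(** * Operations on Lipschitz functions *)

Section Lipschitz.
Variable R : realType.
Implicit Types W : G0m R -> R.

Lemma L2lipM W1 W2 (M1 M2 L1 L2 : R) : (forall g, `|W1 g| <= M1) -> (forall g, `|W2 g| <= M2) ->
  L2lip W1 L1 -> L2lip W2 L2 -> L2lip (fun g => W1 g * W2 g) (M1 * L2 + L1 * M2).
Proof.
move=> b1 b2 l1 l2 f g.
rewrite (_ : _ - _ = W1 f * (W2 f - W2 g) + (W1 f - W1 g) * W2 g); last by ring.
apply: (le_trans (ler_normD _ _)); rewrite [leRHS]mulrDl !normrM; apply: lerD.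
  by rewrite -mulrA ler_pM//; exact: l2.
by rewrite mulrAC ler_pM//; exact: l1.
Qed.

Lemma L2lip_pos W (L : R) : L2lip W L -> L2lip (fun g => pos (W g)) L.
Proof. by move=> WL f g; rewrite (le_trans (pos_lip _ _))//; exact: WL. Qed.

Lemma L2lipN W (L : R) : L2lip W L -> L2lip (fun g => - W g) L.
Proof. by move=> WL f g; rewrite -opprD normrN; exact: WL. Qed.

Lemma L2lip_norm W (L : R) : L2lip W L -> L2lip (fun g => `|W g|) L.
Proof. by move=> WL f g; rewrite (le_trans (ler_dist_dist _ _))//; exact: WL. Qed.

End Lipschitz.

Lemma near_divn_lt (R : realType) (m d : R) : 0 < m -> 0 < d -> \forall n \near \oo, m / n.+1%:R < d.
Proof.
move=> m0 d0; exists (Num.bound (m / d)) => //= n kn.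
rewrite ltr_pdivrMr// -ltr_pdivrMl// mulrC (@lt_le_trans _ _ (Num.bound (m / d))%:R)//.
  by rewrite archi_boundP// ltW// divr_gt0.
by rewrite ler_nat leqW.
Qed.

Lemma cvg_normr_le (R : realType) (x : nat -> R) (l M : R) : x @ \oo --> l ->
  (forall n, `|x n| <= M) -> `|l| <= M.
Proof.
move=> xl xM; have h : (fun n => `|x n|) @ \oo --> `|l| by exact: cvg_norm.
rewrite -(cvg_lim (@Rhausdorff R) h); apply: limr_le; last exact: nearW.
by apply/cvg_ex; exists `|l|.
Qed.

(** * Integration by parts along flows *)

Section FlowSmooth.
Variables (R : realType).
Local Notation leb := (@lebesgue_measure R).
Local Notation I01 := (@I01 R).
Implicit Types (u w : G0m R -> R) (F H : G0m R -> R -> R).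

Local Notation along F phi := (fun g : G0m R => ip leb I01 (F g) (fun s => phi (gfun g s))).
Local Notation unc F := (fun p : G0m R * measurableTypeR R => F p.1 p.2).

(* [F] represents the L^2-gradient of [u] at least along the flows
   [g |-> g + e * phi o g], which is all that the integration by parts uses *)
Record flow_smooth u F (C : R) : Prop := FlowSmooth {
  flow_bound : forall g, `|u g| <= C ;
  flow_lip : L2lip u C ;
  flow_measurable : measurable_fun (@GI R) (unc F) ;
  flow_grad : forall g, (sq leb I01 (F g) <= C%:E)%E ;
  flow_deriv : forall phi dphi K (tphi : tangent phi dphi K) (g : G0m R) (eps : R), 0 < eps ->
    exists2 d : R, 0 < d & forall e (e0 : 0 <= e) (eK : e * K <= 2^-1), e < d ->
      `|u (push tphi e0 eK g) - u g - e * along F phi g| <= eps * e }.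

Lemma flow_C0 u F C : flow_smooth u F C -> 0 <= C.
Proof. by move=> /flow_bound /(_ point); apply: le_trans. Qed.

Lemma flow_sqi u F C : flow_smooth u F C -> forall g, sqi leb I01 (F g).
Proof.
move=> uF g; split; first exact: measurable_section (flow_measurable uF).
exact: le_lt_trans (flow_grad uF g) (ltry _).
Qed.

Lemma measurable_tangent phi dphi K D : tangent phi dphi K -> measurable_fun D (phi : R -> R).
Proof.
move=> tp; apply: measurable_funTS; apply: continuous_measurable_fun => x.
by apply: differentiable_continuous; apply/derivable1_diffP; case: (tangent_derive tp x).
Qed.

Lemma tangent_sqi phi dphi K (g : G0m R) : tangent phi dphi K -> sqi leb I01 (fun s => phi (gfun g s)).
Proof.
move=> tp; apply: (@bounded_sqi _ _ K); last by move=> s _; exact: (tangent_bound tp).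
by apply: measurableT_comp; [exact: measurable_tangent tp|exact: measurable_G0].
Qed.

(** The factor 2 in the constant is required by the squared norm of the difference of the
    gradients. *)
Lemma flow_smoothB u w F H C C' : flow_smooth u F C -> flow_smooth w H C' ->
  flow_smooth (fun g => u g - w g) (fun g s => F g s - H g s) (2 * (C + C')).
Proof.
move=> uF wH; have c0 := flow_C0 uF; have c0' := flow_C0 wH.
split.
- move=> g; rewrite (le_trans (ler_normB _ _))//.
  have := flow_bound uF g; have := flow_bound wH g; lra.
- move=> f g; rewrite (_ : _ - _ = (u f - u g) - (w f - w g)); last by ring.
  apply: (le_trans (ler_normB _ _)).
  apply: le_trans (lerD (flow_lip uF f g) (flow_lip wH f g)) _.
  by rewrite -mulrDl ler_wpM2r ?L2dist_ge0// ler_peMl ?addr_ge0// ler1n.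
- by apply: measurable_funB; [exact: flow_measurable uF|exact: flow_measurable wH].
- move=> g; apply: (le_trans (sq_le_sub leb (@measurable_I01 R) (flow_sqi uF g).1 (flow_sqi wH g).1)).
  rewrite (_ : (2 * (C + C'))%:E = 2%:E * C%:E + 2%:E * C'%:E)%E; last by rewrite -!EFinM -EFinD mulrDr.
  by apply: leeD; apply: lee_wpmul2l; rewrite ?lee_fin//; [exact: (flow_grad uF)|exact: (flow_grad wH)].
- move=> phi dphi K tp g eps eps0; have e2 : 0 < eps / 2 by rewrite divr_gt0.
  have [d d0 h] := flow_deriv uF tp g e2; have [d' d0' h'] := flow_deriv wH tp g e2.
  exists (Num.min d d'); first by rewrite lt_min d0.
  move=> e e0 eK; rewrite lt_min => /andP[ed ed'].
  have := h e e0 eK ed; have := h' e e0 eK ed'.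
  rewrite (ipBl _ (flow_sqi uF g) (flow_sqi wH g) (tangent_sqi g tp))//.
  move: (along F phi g) (along H phi g) (u (push _ _ _ _)) (w (push _ _ _ _)) (u g) (w g) => a b x y x' y'.
  rewrite (_ : x - y - (x' - y') - e * (a - b) = (x - x' - e * a) - (y - y' - e * b)); last by ring.
  move=> h1 h2; rewrite (le_trans (ler_normB _ _))//; lra.
Qed.

Lemma flow_smooth_shift u F C c : flow_smooth u F C -> flow_smooth (fun g => u g - c) F (C + `|c|).
Proof.
move=> uF; split.
- by move=> g; rewrite (le_trans (ler_normB _ _))// lerD2r (flow_bound uF).
- move=> f g; rewrite opprB addrA subrK (le_trans (flow_lip uF f g))// ler_wpM2r ?L2dist_ge0//.
  by rewrite lerDl.
- exact: flow_measurable uF.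
- by move=> g; rewrite (le_trans (flow_grad uF g))// lee_fin lerDl.
- move=> phi dphi K tp g eps eps0; have [d d0 h] := flow_deriv uF tp g eps0.
  exists d => // e e0 eK ed; have := h e e0 eK ed.
  by rewrite (_ : u (push _ _ _ _) - c - (u g - c) = u (push tp e0 eK g) - u g)//; ring.
Qed.

End FlowSmooth.

Section IntegrationByParts.
Variables (R : realType) (beta : R) (Q : probability (G0m R) R).
Hypotheses (beta0 : 0 < beta) (HQ : is_entropic beta Q).
Local Notation leb := (@lebesgue_measure R).
Local Notation I01 := (@I01 R).
Implicit Types (u W : G0m R -> R) (F : G0m R -> R -> R).
Local Notation along F phi := (fun g : G0m R => ip leb I01 (F g) (fun s => phi (gfun g s))).
Local Notation unc F := (fun p : G0m R * measurableTypeR R => F p.1 p.2).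
Local Notation QI := (Q \x leb)%E.

Section OnePush.
Variables (phi dphi : R -> R) (K : R).
Hypothesis tphi : tangent phi dphi K.
Variable e : R.
Hypotheses (e0 : 0 <= e) (eK : e * K <= 2^-1).
Local Notation H := (push tphi e0 eK).
Local Notation E := (ratio_err beta K e).
Hypothesis E2 : E <= 2^-1.

Let E0 : 0 <= E.
Proof.
have b0 := beta0; have K0 := tangent_K0 tphi.
by rewrite /ratio_err !mulr_ge0// addr_ge0// ltW.
Qed.

Lemma quasi_invariance_diff W (L : R) : 0 <= L -> L2lip W L -> (forall g, 0 <= W g) ->
  `|\int[Q]_g W (H g) - \int[Q]_g W g| <= 4 * E * \int[Q]_g W g.
Proof.
move=> L0 WL W0; have [h1 h2] := quasi_invariance beta0 HQ tphi e0 eK L0 WL W0.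
have x0 : 0 <= \int[Q]_g W g by apply: Rintegral_ge0.
have y0 : 0 <= \int[Q]_g W (H g) by apply: Rintegral_ge0 => g _; exact: W0.
have ee := expR_le1D E0 E2.
move: h1 h2 x0 y0; move: (\int[Q]_g W g) (\int[Q]_g W (H g)) => x y.
move: (expR E) ee E0 E2 => X.
(* One side is [b - a <= 2 t a]. The other is [a - b <= 2 t b <= 2 t (1 + 2 t) a], which is at most
   [4 t a] because [t <= 1/2]. *)
have key (a b c t : R) : c <= 1 + 2 * t -> 0 <= t -> t <= 2^-1 -> a <= c * b -> b <= c * a -> 0 <= a -> 0 <= b ->
   `|b - a| <= 4 * t * a.
  move=> h1 h2 h3 h4 h5 h6 b0.
  have h7 : c * a <= (1 + 2 * t) * a by rewrite ler_wpM2r.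
  have h8 : c * b <= (1 + 2 * t) * b by rewrite ler_wpM2r.
  have ta : 0 <= t * a by rewrite mulr_ge0.
  have tta : t * (t * a) <= 2^-1 * (t * a) by rewrite ler_wpM2r.
  have tb : t * b <= t * ((1 + 2 * t) * a) by rewrite ler_wpM2l//; lra.
  rewrite ler_norml; apply/andP; split; lra.
by move=> h1 h2 h3 h4 h5 h6 h7; exact: key h4 h5 h6 h7.
Qed.

(** With [W = w * u], the integrand is [W (H g) - W g] plus [(w g - w (H g)) * u (H g)].
    Quasi-invariance bounds the first difference. The second term is at most [L * e * K * |u (H g)|]
    and vanishes unless [w2 (H g) = 1], since [H] moves [g] by at most [r]; quasi-invariance then
    brings [|u| * w2] back from [H g] to [g]. *)
Lemma push_increment u w w2 (C L r : R) : L2lip u C -> (forall g, `|u g| <= C) ->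
  L2lip w L -> L2lip w2 L -> 0 <= L -> (forall g, 0 <= w g) -> (forall g, w g <= w2 g) ->
  (forall g, w2 g <= 1) ->
  (forall f g : G0 R, L2dist f g <= r -> w f <> w g -> w2 f = 1) -> e * K <= r ->
  `|\int[Q]_g (w g * (u (H g) - u g))| <=
    e * (8 * K * (2 + beta) + 2 * L * K) * \int[Q]_g (`|u g| * w2 g).
Proof.
move=> uC ub wL w2L L0 w0 ww2 w21 far er.
have K0 := tangent_K0 tphi; have C0 : 0 <= C by apply: le_trans (ub point).
have w20 g : 0 <= w2 g by exact: le_trans (ww2 g).
have w1 g : w g <= 1 by exact: le_trans (w21 g).
have nw g : `|w g| <= 1 by rewrite ger0_norm.
have nw2 g : `|w2 g| <= 1 by rewrite ger0_norm.
have mH := measurable_push tphi e0 eK.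
have mu : measurable_fun setT u by exact: L2lip_measurable uC.
have mw : measurable_fun setT w by exact: L2lip_measurable wL.
have mw2 : measurable_fun setT w2 by exact: L2lip_measurable w2L.
pose W g := w g * u g.
have WL : L2lip W (1 * C + L * C) by exact: L2lipM.
have V0 g : 0 <= `|u g| * w2 g by rewrite mulr_ge0.
have VL : L2lip (fun g => `|u g| * w2 g) (C * L + C * 1).
  by apply: L2lipM => //; [move=> g; rewrite normr_id|exact: L2lip_norm].
have LW0 : 0 <= 1 * C + L * C by rewrite addr_ge0// mulr_ge0.
have LV0 : 0 <= C * L + C * 1 by rewrite addr_ge0// mulr_ge0.
have Wb g : `|W g| <= C by rewrite /W normrM -[C]mul1r ler_pM.
have mW : measurable_fun setT W by exact: measurable_funM.
have iV : Q.-integrable setT (EFin \o (fun g => `|u g| * w2 g)) by exact: (L2lip_integrable Q VL).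
have mVH : measurable_fun setT (fun g : G0m R => `|u (H g)| * w2 (H g)).
  exact: (measurableT_comp (L2lip_measurable VL) mH).
have iVH : Q.-integrable setT (EFin \o (fun g : G0m R => `|u (H g)| * w2 (H g))).
  apply: (@prob_bounded_integrable _ _ _ C) => // g.
  by rewrite normrM normr_id -[C]mulr1 ler_pM.
have iWH : Q.-integrable setT (EFin \o (fun g : G0m R => W (H g))).
  by apply: (@prob_bounded_integrable _ _ _ C) => //; exact: (measurableT_comp mW mH).
have iW : Q.-integrable setT (EFin \o W) by exact: (@prob_bounded_integrable _ _ _ C).
pose D (g : G0m R) := (w g - w (H g)) * u (H g).
have mD : measurable_fun setT D.
  apply: measurable_funM; last exact: (measurableT_comp mu mH).
  by apply: measurable_funB => //; exact: (measurableT_comp mw mH).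
have Db g : `|D g| <= L * (e * K) * (`|u (H g)| * w2 (H g)).
  rewrite /D; have [->|/eqP ne] := eqVneq (w (H g)) (w g).
    by rewrite subrr mul0r normr0 !mulr_ge0.
  rewrite (far (H g) g)//; last by rewrite (le_trans (push_dist _ _ _ _))//.
  rewrite mulr1 normrM ler_wpM2r// distrC (le_trans (wL _ _))// ler_wpM2l//.
  exact: push_dist.
have DC g : `|D g| <= L * (e * K) * C.
  rewrite (le_trans (Db g))// ler_wpM2l ?mulr_ge0//.
  by rewrite -[C]mulr1 ler_pM.
have iD : Q.-integrable setT (EFin \o D) by exact: (@prob_bounded_integrable _ _ _ (L * (e * K) * C)).
have -> : \int[Q]_g (w g * (u (H g) - u g)) =
    (\int[Q]_g W (H g) - \int[Q]_g W g) + \int[Q]_g D g.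
  rewrite -RintegralB// -RintegralD//; last exact: (integrableB _ iWH iW).
  by apply: eq_Rintegral => g _; rewrite /W /D; ring.
pose X := \int[Q]_g (`|u g| * w2 g).
have X0 : 0 <= X by exact: Rintegral_ge0.
(* Quasi-invariance concerns nonnegative functions, so it is applied to the positive and the
   negative part of [W]. *)
have S1 : `|\int[Q]_g W (H g) - \int[Q]_g W g| <= 4 * E * X.
  have pW := L2lip_pos WL; have nW := L2lip_pos (L2lipN WL).
  have p0 (x : R) : 0 <= pos x by case: (posP x) => -[h ->].
  have q1 := quasi_invariance_diff LW0 pW (fun g => p0 _).
  have q2 := quasi_invariance_diff LW0 nW (fun g => p0 _).
  have pb (x c : R) : `|x| <= c -> `|pos x| <= c.
    by case: (posP x) => -[_ ->]// h; rewrite normr0 (le_trans _ h).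
  have ip1 : Q.-integrable setT (EFin \o (fun g => pos (W g))) by exact: L2lip_integrable pW.
  have ip2 : Q.-integrable setT (EFin \o (fun g => pos (- W g))) by exact: L2lip_integrable nW.
  have ip3 : Q.-integrable setT (EFin \o (fun g : G0m R => pos (W (H g)))).
    apply: (@prob_bounded_integrable _ _ _ C); first exact: (measurableT_comp (L2lip_measurable pW) mH).
    by move=> g; exact: pb.
  have ip4 : Q.-integrable setT (EFin \o (fun g : G0m R => pos (- W (H g)))).
    apply: (@prob_bounded_integrable _ _ _ C); first exact: (measurableT_comp (L2lip_measurable nW) mH).
    by move=> g; apply: pb; rewrite normrN.
  have pm (x : R) : pos x - pos (- x) = x /\ pos x + pos (- x) = `|x|.
    case: (posP x) => -[h1 ->]; case: (posP (- x)) => -[h2 ->].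
    - have -> : x = 0 by apply/eqP; rewrite eq_le h1 -oppr_ge0 h2.
      by rewrite normr0; split; ring.
    - by rewrite ger0_norm// subr0 addr0.
    - by rewrite ler0_norm//; split; rewrite ?opprK add0r.
    - have -> : x = 0 by apply/eqP; rewrite eq_le h1 -oppr_le0 h2.
      by rewrite normr0; split; ring.
  have e1 : \int[Q]_g W (H g) = \int[Q]_g pos (W (H g)) - \int[Q]_g pos (- W (H g)).
    by rewrite -RintegralB//; apply: eq_Rintegral => g _; rewrite (pm _).1.
  have e2 : \int[Q]_g W g = \int[Q]_g pos (W g) - \int[Q]_g pos (- W g).
    by rewrite -RintegralB//; apply: eq_Rintegral => g _; rewrite (pm _).1.
  have e3 : \int[Q]_g pos (W g) + \int[Q]_g pos (- W g) <= X.
    rewrite -RintegralD//; apply: le_Rintegral => //.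
      exact: (integrableD measurableT ip1 ip2).
    move=> g _; rewrite (pm _).2 /W normrM mulrC ler_wpM2l// ger0_norm//.
  have e4 : 4 * E * (\int[Q]_g pos (W g) + \int[Q]_g pos (- W g)) <= 4 * E * X.
    by rewrite ler_wpM2l// mulr_ge0// E0.
  rewrite e1 e2; apply: le_trans e4; move: q1 q2.
  move: (\int[Q]_g pos (W (H g))) (\int[Q]_g pos (- W (H g))) (\int[Q]_g pos (W g)) (\int[Q]_g pos (- W g)) => a b c d h1 h2.
  rewrite (_ : a - b - (c - d) = (a - c) - (b - d)); last by ring.
  by rewrite mulrDr (le_trans (ler_normB _ _))// lerD.
have S2 : `|\int[Q]_g D g| <= L * (e * K) * (2 * X).
  rewrite (le_trans (le_normr_Rintegral _ iD))//.
  have [_ q] := quasi_invariance beta0 HQ tphi e0 eK LV0 VL V0.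
  apply: (@le_trans _ _ (L * (e * K) * \int[Q]_g (`|u (H g)| * w2 (H g)))).
    rewrite -RintegralZl//; apply: le_Rintegral => //.
    - exact: integrable_norm iD.
    - exact: (integrableZl measurableT (L * (e * K)) iVH).
  rewrite ler_wpM2l ?mulr_ge0// (le_trans q)// ler_wpM2r//.
  have key (a b : R) : a <= 1 + 2 * b -> b <= 2^-1 -> a <= 2 by lra.
  exact: key (expR_le1D E0 E2) E2.
rewrite (le_trans (ler_normD _ _))// -/X.
rewrite (_ : e * _ * X = 4 * E * X + L * (e * K) * (2 * X)); first exact: lerD.
by rewrite /ratio_err; ring.
Qed.

End OnePush.

Variables (phi dphi : R -> R) (K : R).
Hypothesis tphi : tangent phi dphi K.

Lemma measurable_along D : measurable_fun D (fun p : G0m R * measurableTypeR R => phi (gfun p.1 p.2)).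
Proof.
have m1 : measurable_fun setT (phi : measurableTypeR R -> R) by exact: measurable_tangent tphi.
by apply: measurable_funTS; apply: (measurableT_comp m1); exact: measurable_G0_joint.
Qed.

Lemma tangent_kernel_sqi (w : G0m R -> R) (M : R) : measurable_fun setT w -> (forall g, `|w g| <= M) ->
  sqi QI (@GI R) (fun p => w p.1 * phi (gfun p.1 p.2)).
Proof.
move=> mw wM; apply: (@bounded_sqi_GI _ _ (fun g s => w g * phi (gfun g s)) (M * K)).
  apply: measurable_funM; last exact: measurable_along.
  exact: (measurableT_comp mw (measurable_funTS measurable_fst)).
by move=> g s _; rewrite normrM ler_pM// (tangent_bound tphi).
Qed.

Lemma flow_sqi_prod u F C : flow_smooth u F C -> sqi QI (@GI R) (unc F).
Proof.
move=> uF; have mF := flow_measurable uF; split => //.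
rewrite (sq_sectionE Q mF).2.
apply: (@le_lt_trans _ _ (\int[Q]_g C%:E)%E); last first.
  by rewrite integral_cst// [X in (_ * X)%E]probability_setT mule1 ltry.
apply: ge0_le_integral => //.
- by move=> g _; exact: sq_ge0.
- exact: (sq_sectionE Q mF).1.
- by move=> g _; exact: flow_grad uF g.
Qed.

Lemma along_prod F (w : G0m R -> R) (M : R) : sqi QI (@GI R) (unc F) -> measurable_fun setT w -> (forall g, `|w g| <= M) ->
  Q.-integrable setT (EFin \o (fun g => w g * along F phi g)) /\
  \int[Q]_g (w g * along F phi g) = ip QI (@GI R) (unc F) (fun p => w p.1 * phi (gfun p.1 p.2)).
Proof.
move=> sF mw wM.
have sW := tangent_kernel_sqi mw wM.
have [h1 h2] := ip_section (H := fun g s => w g * phi (gfun g s)) sF sW.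
have ae_ : {ae Q, forall g, w g * along F phi g = ip leb I01 (F g) (fun s => w g * phi (gfun g s))}.
  have := sqi_section_ae sF; apply: filterS => g sg.
  by rewrite [RHS]ipC ipZl// 1?ipC//; exact: tangent_sqi tphi.
have iA : Q.-integrable setT (EFin \o along F phi).
  have n1 : forall g : G0m R, `|1 : R| <= 1 by move=> _; rewrite normr1.
  have s1 := tangent_kernel_sqi (measurable_cst (1 : R)) n1.
  have [i1 _] := ip_section (H := fun g s => 1 * phi (gfun g s)) sF s1.
  move: i1; congr integrable; apply/funext => g /=.
  by congr (ip _ _ _ _)%:E; apply/funext => s; rewrite mul1r.
have mA : measurable_fun setT (along F phi) by apply/measurable_EFinP; exact: measurable_int iA.
have mwA : measurable_fun setT (fun g => w g * along F phi g) by exact: measurable_funM.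
have E : (\int[Q]_g (w g * along F phi g)%:E = \int[Q]_g (ip leb I01 (F g) (fun s => w g * phi (gfun g s)))%:E)%E.
  apply: ae_eq_integral => //.
  - exact/measurable_EFinP.
  - exact: measurable_int h1.
  - by apply: filterS ae_ => g -> .
split; last by rewrite -h2 /Rintegral E.
apply: (le_integrable measurableT _ _ (integrableZl measurableT M iA)).
  exact/measurable_EFinP.
move=> g _ /=; rewrite lee_fin !normrM ler_wpM2r//.
by rewrite (le_trans (wM g))// ler_norm.
Qed.

(** The bound of [push_increment] is divided by [e], and [e] tends to 0 under dominated convergence.
    The constant [B] depends on the field, [beta] and the cutoffs, but not on [u], [F] or [C]: this
    makes the inequality stable under limits. *)
Lemma flow_integration_by_parts w w2 (L r : R) :
  L2lip w L -> L2lip w2 L -> 0 <= L -> (forall g, 0 <= w g) -> (forall g, w g <= w2 g) ->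
  (forall g, w2 g <= 1) -> 0 < r ->
  (forall f g : G0 R, L2dist f g <= r -> w f <> w g -> w2 f = 1) ->
  exists2 B, 0 <= B & forall u F C, flow_smooth u F C ->
    `|\int[Q]_g (w g * along F phi g)| <= B * \int[Q]_g (`|u g| * w2 g).
Proof.
move=> wL w2L L0 w0 ww2 w21 r0 far.
have K0 := tangent_K0 tphi; have b0 := beta0.
pose B := 8 * K * (2 + beta) + 2 * L * K.
exists B; first by rewrite /B !(addr_ge0, mulr_ge0)// ltW.
move=> u F C uF.
have C0 := flow_C0 uF.
(* Small enough that for all [e <= m] both [e * K <= min r 1/2] and [ratio_err <= 1/2] hold. *)
pose m := Num.min r (2^-1) / (4 * (2 + beta)) / (K + 1).
have min0 : 0 < Num.min r (2^-1 : R) by rewrite lt_min r0 invr_gt0 ltr0n.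
have K1 : 0 < K + 1 by rewrite ltr_wpDl.
have m0 : 0 < m by rewrite /m !divr_gt0// mulr_gt0// addr_gt0.
pose e n := m / n.+1%:R : R.
have ep n : 0 < e n by rewrite divr_gt0.
have em n : e n <= m by rewrite ler_pdivrMr// ler_peMr ?ler1n// ltW.
have mK : m * K * (4 * (2 + beta)) <= Num.min r (2^-1).
  rewrite (_ : m * K * (4 * (2 + beta)) = Num.min r (2^-1) * (K / (K + 1))).
    by rewrite ler_piMr ?(ltW min0)// ler_pdivrMr// mul1r lerDl.
  have key (a b c k : R) : b != 0 -> c != 0 -> a / (4 * b) / c * k * (4 * b) = a * (k / c).
    by move=> bn cn; field; rewrite bn cn.
  by rewrite /m; apply: key; rewrite gt_eqF// addr_gt0.
have eKn n : e n * K * (4 * (2 + beta)) <= Num.min r (2^-1).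
  apply: le_trans mK; rewrite ler_wpM2r ?mulr_ge0 ?addr_ge0// ?(ltW b0)//.
  by rewrite ler_wpM2r.
have eK0 n : 0 <= e n * K by rewrite mulr_ge0// ltW.
have eK1 n : e n * K <= Num.min r (2^-1).
  apply: le_trans (eKn n); rewrite ler_peMr//; lra.
have eK2 n : e n * K <= 2^-1 by apply: le_trans (eK1 n) _; rewrite ge_min lexx orbT.
have eKr n : e n * K <= r by apply: le_trans (eK1 n) _; rewrite ge_min lexx.
have eE n : ratio_err beta K (e n) <= 2^-1.
  apply: (@le_trans _ _ (e n * K * (4 * (2 + beta)))).
    rewrite /ratio_err -[leRHS]mulrA; have := mulr_ge0 (eK0 n) (addr_ge0 (ler0n R 2) (ltW b0)); lra.
  by apply: le_trans (eKn n) _; rewrite ge_min lexx orbT.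
have mu : measurable_fun setT u by exact: L2lip_measurable (flow_lip uF).
have mw : measurable_fun setT w by exact: L2lip_measurable wL.
have nw g : `|w g| <= 1 by rewrite ger0_norm//; exact: le_trans (w21 g).
have [iA EA] := along_prod (flow_sqi_prod uF) mw nw.
pose H n := push tphi (ltW (ep n)) (eK2 n).
pose q n g := (e n)^-1 * (w g * (u (H n g) - u g)).
have mH n : measurable_fun setT (H n : G0m R -> G0m R) by exact: measurable_push.
have mq n : measurable_fun setT (q n).
  apply: measurable_funM => //; apply: measurable_funM => //; apply: measurable_funB => //.
  exact: (measurableT_comp mu (mH n)).
have qb n g : `|q n g| <= C * K.
  rewrite /q normrM gtr0_norm ?invr_gt0// ler_pdivrMl// normrM.
  apply: (@le_trans _ _ (1 * `|u (H n g) - u g|)); first by rewrite ler_wpM2r.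
  rewrite mul1r (le_trans (flow_lip uF _ _))// mulrCA ler_wpM2l//; exact: push_dist.
have qc g : (fun n => q n g) @ \oo --> w g * along F phi g.
  apply/cvgrPdist_le => /= eps eps0.
  have [d d0 hd] := flow_deriv uF tphi g eps0.
  near=> n.
  have ed : e n < d.
    by near: n; exact: near_divn_lt.
  have := hd _ (ltW (ep n)) (eK2 n) ed; rewrite -/(H n) => h.
  rewrite /q mulrCA -mulrBr normrM; apply: (@le_trans _ _ (1 * eps)); last by rewrite mul1r.
  rewrite ler_pM// distrC.
  rewrite (_ : _ - _ = (e n)^-1 * (u (H n g) - u g - e n * along F phi g)); last first.
    by rewrite [RHS]mulrBr mulKf// gt_eqF.
  by rewrite normrM gtr0_norm ?invr_gt0// ler_pdivrMl// [leRHS]mulrC.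
have cv : (fun n => \int[Q]_g q n g) @ \oo --> \int[Q]_g (w g * along F phi g).
  apply: (Rintegral_dominated_cvg (h := fun=> C * K)) => //.
  - by apply/measurable_EFinP; exact: measurable_int iA.
  - exact: (@prob_bounded_integrable _ _ _ `|C * K|).
  - by apply: aeW => g _; exact: qc.
apply: (cvg_normr_le cv) => n; rewrite RintegralZl//; last first.
  apply: (@prob_bounded_integrable _ _ _ (e n * (C * K))).
    apply: measurable_funM => //; apply: measurable_funB => //.
    exact: (measurableT_comp mu (mH n)).
  by move=> g; have := qb n g; rewrite /q normrM gtr0_norm ?invr_gt0// ler_pdivrMl.
rewrite normrM gtr0_norm ?invr_gt0// ler_pdivrMl//.
have := push_increment tphi (ltW (ep n)) (eK2 n) (eE n) (flow_lip uF) (flow_bound uF) wL w2L L0 w0 ww2 w21 far (eKr n).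
by rewrite -/(H n) -/B mulrA.
Unshelve. all: by end_near. Qed.

End IntegrationByParts.

(** * Lipschitz cutoffs inside an open set *)

Section DistanceToComplement.
Variable R : realType.
Variable O : set (G0 R).
Implicit Types f g : G0 R.

(** The element 1, an upper bound for all distances, keeps the infimum meaningful when [O] is the
    whole space. *)
Let S f := [set x : R | x = 1 \/ exists2 h, ~ O h & x = L2dist f h].

Definition cdist f : R := inf (S f).

Let S_lb f : lbound (S f) 0.
Proof. by move=> x [->|[h _ ->]]; rewrite ?ler01 ?L2dist_ge0. Qed.

Lemma cdist_ge0 f : 0 <= cdist f.
Proof. by apply: lb_le_inf; [exists 1; left|exact: S_lb]. Qed.

Lemma cdist_le1 f : cdist f <= 1.
Proof. by apply: ge_inf; [exists 0; exact: S_lb|left]. Qed.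

Lemma cdist_out f : ~ O f -> cdist f = 0.
Proof.
move=> nO; apply/eqP; rewrite eq_le cdist_ge0 andbT.
by apply: ge_inf; [exists 0; exact: S_lb|right; exists f => //; rewrite L2dist_self].
Qed.

Lemma cdist_in f : L2open O -> O f -> 0 < cdist f.
Proof.
move=> oO /oO[r r0 rO]; apply: (@lt_le_trans _ _ (Num.min 1 r)); first by rewrite lt_min ltr01.
apply: lb_le_inf; first by exists 1; left.
move=> x [->|[h nO ->]]; first by rewrite ge_min lexx.
rewrite ge_min; apply/orP; right; rewrite leNgt; apply/negP => fh; exact/nO/rO.
Qed.

Lemma cdist_lip : L2lip (cdist : G0m R -> R) 1.
Proof.
have H f g : cdist f <= cdist g + L2dist f g.
  rewrite -lerBlDr; apply: lb_le_inf; first by exists 1; left.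
  move=> x [->|[h nO ->]]; rewrite lerBlDr.
    by rewrite (le_trans (cdist_le1 f))// lerDl L2dist_ge0.
  apply: (@le_trans _ _ (L2dist f h)).
    by apply: ge_inf; [exists 0; exact: S_lb|right; exists h].
  by rewrite addrC; exact: L2dist_triangle.
move=> f g; rewrite mul1r ler_norml; have h1 := H f g; have h2 := H g f.
rewrite (L2distC g f) in h2; apply/andP; split; [rewrite lerNl opprB|]; rewrite lerBlDl//.
Qed.

Definition clip (x : R) : R := Num.max 0 (Num.min 1 x).

Lemma clip_itv x : 0 <= clip x <= 1.
Proof. by rewrite /clip le_max lexx/= ge_max ler01/= ge_min lexx. Qed.

Lemma clip_lip x y : `|clip x - clip y| <= `|x - y|.
Proof.
have h1 := ler_norm (x - y); have h2 := ler_norm (y - x); rewrite (distrC y x) in h2.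
have spec z : (z <= 0 /\ clip z = 0) \/ ((0 <= z <= 1 /\ clip z = z) \/ (1 <= z /\ clip z = 1)).
  rewrite /clip; have [z0|z0] := leP z 0.
    by left; split => //; rewrite min_r ?max_l// (le_trans z0).
  have [z1|z1] := leP z 1; right.
    by left; rewrite (ltW z0) max_r ?(ltW z0).
  by right; rewrite (ltW z1) max_r.
case: (spec x) => [[a ->]|[[a ->]|[a ->]]]; case: (spec y) => [[b ->]|[[b ->]|[b ->]]];
 rewrite ler_norml; lra.
Qed.

Lemma clip_homo x y : x <= y -> clip x <= clip y.
Proof. by move=> xy; rewrite /clip; apply: le_max2 => //; exact: le_min2. Qed.

Lemma clip_le0 x : x <= 0 -> clip x = 0.
Proof. by move=> x0; rewrite /clip max_l// ge_min x0 orbT. Qed.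

Lemma clip_ge1 x : 1 <= x -> clip x = 1.
Proof. by move=> x1; rewrite /clip min_l// max_r. Qed.

Lemma clip_far x y : `|x - y| <= 2^-1 -> clip (x - 1) <> clip (y - 1) -> 1 <= 2 * x.
Proof.
rewrite ler_norml => /andP[h1 h2] ne; have [x1|x1] := leP 1 (2 * x); first by [].
by case: ne; rewrite !clip_le0//; lra.
Qed.

Lemma clip_shift_le x : 0 <= x -> clip (x - 1) <= clip (2 * x).
Proof. by move=> x0; apply: clip_homo; lra. Qed.

(** This cutoff is positive only where [cdist g > 1/n], while the outer one already equals 1 where
    [cdist g >= 1/(2n)]. The gap leaves room for a displacement of [1/(2n)]. *)
Definition cutoff (n : nat) (g : G0m R) : R := clip (n%:R * cdist g - 1).
Definition outer_cutoff (n : nat) (g : G0m R) : R := clip (2 * n%:R * cdist g).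

Lemma cutoff_lip n : L2lip (cutoff n) (2 * n%:R).
Proof.
move=> f g; apply: (le_trans (clip_lip _ _)).
rewrite opprB addrA subrK -mulrBr.
rewrite normrM ger0_norm// -mulrA (le_trans (ler_wpM2l _ (cdist_lip f g)))//.
by rewrite mul1r ler_peMl ?mulr_ge0 ?L2dist_ge0// ler1n.
Qed.

Lemma outer_cutoff_lip n : L2lip (outer_cutoff n) (2 * n%:R).
Proof.
move=> f g; apply: (le_trans (clip_lip _ _)).
rewrite -mulrBr.
by rewrite normrM ger0_norm ?mulr_ge0// ler_wpM2l ?mulr_ge0//; have := cdist_lip f g; rewrite mul1r.
Qed.

Lemma cutoff_le_outer n g : cutoff n g <= outer_cutoff n g.
Proof.
by rewrite /outer_cutoff -mulrA; apply: clip_shift_le; rewrite mulr_ge0// cdist_ge0.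
Qed.

Lemma outer_cutoff_out n g : ~ O g -> outer_cutoff n g = 0.
Proof. by move=> /cdist_out d0; rewrite /outer_cutoff d0 mulr0 clip_le0. Qed.

(** If the cutoff changes, one of the two points has [n * cdist > 1], hence the other has
    [n * cdist >= 1/2], where the outer cutoff is 1. *)
Lemma cutoff_far n (f g : G0 R) : (0 < n)%N -> L2dist f g <= (2 * n%:R)^-1 ->
  cutoff n f <> cutoff n g -> outer_cutoff n f = 1.
Proof.
move=> n0 fg ne; apply: clip_ge1; rewrite -mulrA; apply: clip_far ne.
rewrite -mulrBr normrM ger0_norm//; apply: (@le_trans _ _ (n%:R * (2 * n%:R)^-1)).
  by apply: ler_wpM2l => //; apply: le_trans fg; rewrite -[leRHS]mul1r; exact: cdist_lip.
by rewrite invfM mulrCA divff ?mulr1// pnatr_eq0 -lt0n.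
Qed.

Lemma cutoff_cvg (g : G0m R) : L2open O -> (fun n => cutoff n.+1 g) @ \oo --> (\1_O g : R).
Proof.
move=> oO; rewrite indicE; have [Og|nOg] := pselect (O g).
  rewrite mem_set//; have d0 := cdist_in oO Og.
  apply: cvg_near_cst; near=> n; apply: clip_ge1.
  have : 2 / n.+1%:R < cdist g by near: n; exact: near_divn_lt.
  by rewrite ltr_pdivrMr// mulrC; lra.
rewrite memNset//; apply: cvg_near_cst; apply: nearW => n.
by rewrite /cutoff (cdist_out nOg) mulr0 clip_le0//; lra.
Unshelve. all: by end_near. Qed.

End DistanceToComplement.

(** * The fields phi o g determine an element of L^2([0, 1]) *)

Section FieldsDetermine.
Variable R : realType.
Local Notation leb := (@lebesgue_measure R).
Local Notation I01 := (@I01 R).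
Variable g : G0 R.
Hypothesis g_incr : forall s t : R, 0 <= s -> s < t -> t <= 1 -> g s < g t.

Lemma near_mul_gt (c y : R) : 0 < c -> 0 < y -> \forall j \near \oo, c < j%:R * y.
Proof.
move=> c0 y0; near=> j.
have j0 : (0 < j)%N by near: j; exact: nbhs_infty_gt.
have : c / j%:R < y by near: j; apply/(near_inftyS (fun j => c / j%:R < y)); exact: near_divn_lt.
by rewrite ltr_pdivrMr ?ltr0n// mulrC.
Unshelve. all: by end_near. Qed.

(** The choice of [p] places the descent of the bump just to the right of [b], so the limit on ]0,
    1[ is the indicator of [x <= b]. *)
Lemma field_cvg (b x : R) : 0 <= b < 1 -> 0 < x < 1 ->
  (fun j => field j (Num.trunc (j%:R * b)).+1 x) @ \oo --> ((x <= b)%R%:R : R).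
Proof.
move=> /andP[b0 b1] /andP[x0 x1]; apply: cvg_near_cst.
have H1 : \forall j \near \oo, 1 < j%:R * x by exact: near_mul_gt.
have T j : (Num.trunc (j%:R * b))%:R <= j%:R * b < (Num.trunc (j%:R * b))%:R + 1.
  by rewrite natr1; apply: trunc_itv; rewrite mulr_ge0.
have [xb|bx] := leP x b.
  apply: filterS H1 => j jx; have h : j%:R * x <= j%:R * b by rewrite ler_wpM2l.
  have /andP[_ t] := T j; rewrite /field -natr1 chi_ge1 ?chi_le0 ?subr0//; last lra.
  by move: t h; move: (_%:R) => p; lra.
have H2 : \forall j \near \oo, 2 < j%:R * (x - b) by apply: near_mul_gt; rewrite ?subr_gt0.
near=> j; have jx : 1 < j%:R * x by near: j.
have : 2 < j%:R * (x - b) by near: j.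
rewrite mulrBr => h; have /andP[t _] := T j; rewrite /field -natr1.
by rewrite !chi_ge1 ?subrr//; lra.
Unshelve. all: by end_near. Qed.

Lemma last_field_cvg (x : R) : 0 < x < 1 -> (fun j => field j j.-1 x) @ \oo --> (1 : R).
Proof.
move=> /andP[x0 x1]; apply: cvg_near_cst.
have H2 : \forall j \near \oo, 1 < j%:R * (1 - x) by apply: near_mul_gt; rewrite ?subr_gt0.
have H1 : \forall j \near \oo, 1 < j%:R * x by exact: near_mul_gt.
near=> j.
have j0 : (0 < j)%N by near: j; exact: nbhs_infty_gt.
have jx : 1 < j%:R * x by near: j.
have : 1 < j%:R * (1 - x) by near: j.
rewrite mulrBr mulr1 => h; rewrite /field -subn1 natrB//.
by rewrite chi_ge1 ?chi_le0 ?subr0//; lra.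
Unshelve. all: by end_near. Qed.

Variable F : R -> R.
Hypothesis sF : sqi leb I01 F.
Hypothesis F0 : forall j p, (0 < p < j)%N -> ip leb I01 F (fun s => field j p (g s)) = 0.

Let iF : leb.-integrable I01 (EFin \o (fun s => `|F s|)).
Proof.
apply: integrable_norm; have s1 : sqi leb I01 (fun=> 1 : R).
  by apply: (@bounded_sqi _ _ 1) => // s _; rewrite normr1.
by have := sqi_mul (@measurable_I01 R) sF s1; under eq_fun do rewrite mulr1.
Qed.

Let ae_inner : {ae leb, forall s, I01 s -> 0 < s < 1}.
Proof.
exists ([set 0] `|` [set 1]); split.
- exact: measurableU.
- by apply: null_set_setU => //; exact: lebesgue_measure_set1.
- move=> s /= /not_implyP[/I01P/andP[s0 s1]]; rewrite !lt_neqAle s0 s1 !andbT.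
  by move=> /negP; rewrite negb_and !negbK => /orP[/eqP|/eqP]; [left|right].
Qed.

(** Since [g] is strictly increasing, [g s <= g s0] means [s <= s0]: fields composed with [g] that
    fall just above the level [g s0] converge to the indicator of [s <= s0]. *)
Lemma integral_below0 (s0 : R) : \int[leb]_(s in I01) (F s * (s <= s0)%R%:R) = 0.
Proof.
have [p [pj pc]] : exists p : nat -> nat, (\forall j \near \oo, (0 < p j < j)%N) /\
    forall s, 0 < s < 1 -> (fun j => field j (p j) (g s)) @ \oo --> ((s <= s0)%R%:R : R).
  have gs s : 0 < s < 1 -> 0 < g s < 1.
    move=> /andP[a b]; rewrite (le_lt_trans (G0_ge0 g 0)) ?g_incr ?(ltW b)//=.
    by rewrite -(G0_ge1 g (lexx 1)) g_incr// ltW.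
  (* For [s0 >= 1] the level is [g s0 = 1], where the index [trunc (j * g s0) + 1] is not below [j];
     the largest admissible index [j - 1] gives the constant limit 1. *)
  have [s1|s1] := leP 1 s0.
    exists predn; split.
      by exists 2%N => // -[|[|j]]//= _; rewrite ltnSn.
    move=> s s01; have /andP[_ /ltW/le_trans/(_ s1) ->] := s01.
    exact/last_field_cvg/gs.
  have b01 : 0 <= g s0 < 1.
    rewrite G0_ge0/=; have [s0'|s0'] := ltP s0 0; first by rewrite G0_lt0.
    by rewrite -(G0_ge1 g (lexx 1)) g_incr.
  exists (fun j => (Num.trunc (j%:R * g s0)).+1); split.
    have H2 : \forall j \near \oo, 1 < j%:R * (1 - g s0).
      by apply: near_mul_gt; rewrite ?subr_gt0//; case/andP: b01.
    near=> j; have : 1 < j%:R * (1 - g s0) by near: j.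
    have /andP[t1 _] := trunc_itv (mulr_ge0 (ler0n R j) (G0_ge0 g s0)).
    rewrite mulrBr mulr1 => h; rewrite /= -(ltr_nat R) -natr1; lra.
  move=> s s01; have := field_cvg b01 (gs _ s01).
  suff -> : (g s <= g s0) = (s <= s0) by [].
  apply/idP/idP; last exact: G0_nondecreasing.
  move=> h; rewrite leNgt; apply/negP => s0s; move: h; apply/negP; rewrite -ltNge.
  have [n0|p0] := ltP s0 0; last by apply: g_incr => //; case/andP: s01 => _ /ltW.
  by rewrite (G0_lt0 g n0); case/andP: (gs _ s01).
have mfield j : measurable_fun I01 (fun s => field j (p j) (g s)).
  have mc : measurable_fun setT (@chi R).
    apply: continuous_measurable_fun => x; apply: differentiable_continuous.
    by apply/derivable1_diffP; case: (chi_derive x).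
  have mg := @measurable_G0 R g I01.
  apply: measurable_funB; apply: (measurableT_comp mc).
    by apply: measurable_funB => //; apply: measurable_funM => //; exact: measurable_funM.
  by apply: measurable_funB => //; apply: measurable_funM => //; apply: measurable_funB => //; exact: measurable_funM.
have cv : (fun j => \int[leb]_(s in I01) (F s * field j (p j) (g s))) @ \oo -->
    \int[leb]_(s in I01) (F s * (s <= s0)%R%:R).
  apply: (Rintegral_dominated_cvg (mu := leb) (D := I01) (fn := fun j s => F s * field j (p j) (g s))
     (f := fun s => F s * (s <= s0)%R%:R) (h := fun s => `|F s|)) => //.
  - by move=> j; apply: measurable_funM; [exact: sF.1|exact: mfield].
  - apply: measurable_funM; first exact: sF.1.
    have := @measurable_indic _ (measurableTypeR R) R I01 `]-oo, s0]%classic (measurable_itv _).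
    by congr measurable_fun; apply/funext => s; rewrite indicE mem_setE/= in_itv.
  - by move=> j s _; rewrite normrM ler_piMr// field_le1.
  - have [N [mN N0 NP]] := ae_inner; exists N; split => // s ns; apply: NP => si.
    by apply: ns => s1; apply: cvgM; [exact: cvg_cst|exact/pc/si].
apply: (@cvg_unique _ (@Rhausdorff R) _ _ _ _ cv); apply: cvg_near_cst.
by apply: filterS pj => j pj; exact: F0.
Unshelve. all: by end_near. Qed.

(** On a half-open interval the integral of [F] is a difference of two integrals from
    [integral_below0], and these intervals form a generating class. *)
Lemma fields_determine : sq leb I01 F = 0%E.
Proof.
pose Fr : measurableTypeR R -> R := F \_ I01.
have iF1 : leb.-integrable I01 (EFin \o F).
  apply: (le_integrable (@measurable_I01 R) _ _ iF); first by apply/measurable_EFinP; exact: sF.1.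
  by move=> s _ /=; rewrite normr_id.
have Fr0 : {ae leb, forall s, Fr s = 0}.
  apply: (@integral_pi_system_ae0 _ (measurableTypeR R) R leb (@ocitv R)) => //.
  - exact: ocitvI.
  - have := (integrable_mkcond (mu := leb) (EFin \o F) (@measurable_I01 R)).1 iF1.
    rewrite (_ : (EFin \o F) \_ I01 = EFin \o Fr)//.
    by apply/funext => s; rewrite /Fr /= !patchE /=; case: ifP.
  - rewrite /Fr -Rintegral_mkcond -(integral_below0 1); apply: eq_Rintegral => s.
    by rewrite inE => /I01P/andP[_ ->]; rewrite mulr1.
  - move=> A [[a b] _ <-] /=; have [ab|ba] := leP a b; last first.
      by rewrite set_itv_ge ?Rintegral_set0// bnd_simp -leNgt ltW.
    rewrite /Fr Rintegral_mkcond.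
    transitivity (\int[leb]_(s in I01) (F s * (s <= b)%R%:R - F s * (s <= a)%R%:R)).
      rewrite [RHS]Rintegral_mkcond; apply: eq_Rintegral => s _.
      rewrite !patchE mem_setE /= in_itv /=; case: (s \in I01) => /=; last by case: ifP.
      case: (ltP a s) => as_ /=; last by rewrite (le_trans as_ ab) subrr.
      by case: ifP => _; rewrite ?mulr1 ?mulr0 subr0.
    have iI c : leb.-integrable I01 (EFin \o (fun s => F s * (s <= c)%R%:R)).
      apply: (le_integrable (@measurable_I01 R) _ _ iF).
        apply/measurable_EFinP; apply: measurable_funM; first exact: sF.1.
        have := @measurable_indic _ (measurableTypeR R) R I01 `]-oo, c]%classic (measurable_itv _).
        by congr measurable_fun; apply/funext => s; rewrite indicE mem_setE/= in_itv.
      by move=> s _ /=; rewrite lee_fin normr_id normrM ler_piMr//; case: (s <= c); rewrite ?normr1 ?normr0.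
    by rewrite RintegralB// !integral_below0 subrr.
rewrite /sq -(@integral0 _ _ _ leb I01); apply: ae_eq_integral => //.
- exact: measurable_sq sF.1.
- by apply: filterS Fr0 => s + s1; rewrite /Fr patchE mem_set// => ->; rewrite expr0n.
Qed.

End FieldsDetermine.

(** * Local closability *)

Section Closability.
Variables (R : realType) (beta : R) (Q : probability (G0m R) R).
Hypotheses (beta0 : 0 < beta) (HQ : is_entropic beta Q).
Local Notation leb := (@lebesgue_measure R).
Local Notation I01 := (@I01 R).
Local Notation along F phi := (fun g : G0m R => ip leb I01 (F g) (fun s => phi (gfun g s))).
Local Notation unc F := (fun p : G0m R * measurableTypeR R => F p.1 p.2).
Local Notation QI := (Q \x leb)%E.

Variables (un : nat -> G0m R -> R) (Fn : nat -> G0m R -> R -> R) (Cn : nat -> R).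
Variables (v : G0m R -> R) (F : G0m R -> R -> R) (O : set (G0m R)).
Hypotheses (uFn : forall n, flow_smooth (un n) (Fn n) (Cn n)) (mv : measurable_fun setT v)
  (mF : measurable_fun (@GI R) (unc F))
  (unv : (fun n => sq Q setT (fun g => un n g - v g)%R) @ \oo --> (0 : \bar R))
  (FnF : (fun n => sq QI (@GI R) (fun p => Fn n p.1 p.2 - F p.1 p.2)%R) @ \oo --> (0 : \bar R))
  (oO : L2open O) (vO : {ae Q, forall g, O g -> v g = 0}).

Let mun n : measurable_fun setT (un n).
Proof. exact: L2lip_measurable (flow_lip (uFn n)). Qed.

Lemma limit_sqi : sqi QI (@GI R) (unc F).
Proof.
have mFn n := flow_measurable (uFn n).
have mD n : measurable_fun (@GI R) (fun p : G0m R * measurableTypeR R => Fn n p.1 p.2 - F p.1 p.2).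
  exact: measurable_funB.
have [/(_ FnF) /(_ _ ltr01)[N _ /(_ N (leqnn N)) h] _] := sq_cvg0P QI mD.
apply: (sqi_near (@measurable_GI R) mF (flow_sqi_prod Q (uFn N))).
rewrite -(sqN QI (@GI R)); apply: le_lt_trans (ltry 1); apply: ltW; apply: le_lt_trans h.
by rewrite le_eqVlt; apply/orP; left; apply/eqP; congr sq; apply/funext => p; rewrite opprB.
Qed.

Lemma limit_value_sqi : sqi Q setT v.
Proof.
have sun n : sqi Q setT (un n).
  split=> //; rewrite (@le_lt_trans _ _ (\int[Q]_g (Cn n ^+ 2)%:E)%E)//; last first.
    by rewrite integral_cst// [X in (_ * X)%E]probability_setT mule1 ltry.
  apply: ge0_le_integral => //.
  - by move=> g _; rewrite lee_fin sqr_ge0.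
  - exact: measurable_sq.
  - move=> g _; rewrite lee_fin -(real_normK (num_real (un n g))).
    by rewrite ler_pXn2r ?nnegrE ?(flow_C0 (uFn n))// (flow_bound (uFn n)).
have mD n : measurable_fun setT (fun g => un n g - v g) by exact: measurable_funB.
have [/(_ unv) /(_ _ ltr01)[N _ /(_ N (leqnn N)) h] _] := sq_cvg0P Q mD.
apply: (sqi_near measurableT mv (sun N)).
rewrite -(sqN Q setT); apply: le_lt_trans (ltry 1); apply: ltW; apply: le_lt_trans h.
by rewrite le_eqVlt; apply/orP; left; apply/eqP; congr sq; apply/funext => p; rewrite opprB.
Qed.

(** The left side of the integration by parts inequality converges with the gradients. On the right,
    [|un n| * w2] equals [|un n - v| * w2] almost everywhere, since [v] vanishes on [O] and [w2] off
    [O]; its integral tends to 0. *)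
Lemma vanishing_along phi dphi K (w w2 : G0m R -> R) (L r : R) : tangent phi dphi K ->
  L2lip w L -> L2lip w2 L -> 0 <= L -> (forall g, 0 <= w g) -> (forall g, w g <= w2 g) ->
  (forall g, w2 g <= 1) -> 0 < r ->
  (forall f g : G0 R, L2dist f g <= r -> w f <> w g -> w2 f = 1) ->
  (forall g, ~ O g -> w2 g = 0) ->
  \int[Q]_g (w g * along F phi g) = 0.
Proof.
move=> tphi wL w2L L0 w0 ww2 w21 r0 far w2O.
have [B B0 HB] := flow_integration_by_parts beta0 HQ tphi wL w2L L0 w0 ww2 w21 r0 far.
have mw : measurable_fun setT w := L2lip_measurable wL.
have mw2 : measurable_fun setT w2 := L2lip_measurable w2L.
have nw g : `|w g| <= 1 by rewrite ger0_norm//; exact: le_trans (w21 g).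
have w20 g : 0 <= w2 g by exact: le_trans (ww2 g).
have [_ EA] := along_prod tphi limit_sqi mw nw.
have EAn n := (along_prod tphi (flow_sqi_prod Q (uFn n)) mw nw).2.
have mFn n := flow_measurable (uFn n).
have sk := tangent_kernel_sqi Q tphi mw nw.
have cv : (fun n => \int[Q]_g (w g * along (Fn n) phi g)) @ \oo --> \int[Q]_g (w g * along F phi g).
  rewrite EA; under eq_fun do rewrite EAn.
  apply: (sq_cvg_ip (@measurable_GI R)) => //; [by move=> n; exact: sk.1|exact: limit_sqi|].
  apply: cvg_near_cst; apply: nearW => n.
  by rewrite /sq integral0_eq// => p _; rewrite subrr expr0n.
pose an n g := `|un n g - v g|.
have man n : measurable_fun setT (an n).
  by apply: measurableT_comp => //; exact: measurable_funB.
have s0 : sqi Q setT (fun=> 0 : R).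
  by split => //; rewrite /sq integral0_eq ?ltry// => g _; rewrite expr0n.
have s1 : sqi Q setT (fun=> 1 : R).
  split => //; rewrite /sq integral_cst// [X in (_ * X)%E]probability_setT mule1.
  by rewrite ltry.
have cva : (fun n => ip Q setT (an n) (fun=> 1)) @ \oo --> (0 : R).
  have := sq_cvg_ip measurableT man (fun n => measurable_cst (1 : R)) s0 s1.
  rewrite (_ : ip Q setT (fun=> 0) (fun=> 1) = 0); last first.
    by rewrite /ip /Rintegral integral0_eq// => g _; rewrite mul0r.
  apply.
    apply: cvg_trans unv; apply: near_eq_cvg; apply: nearW => n; congr (integral _ _ _).
    by apply/funext => g; rewrite subr0 /an real_normK// num_real.
  apply: cvg_near_cst; apply: nearW => n.
  by rewrite /sq integral0_eq// => p _; rewrite subrr expr0n.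
have bnd n : `|\int[Q]_g (w g * along (Fn n) phi g)| <= B * ip Q setT (an n) (fun=> 1).
  apply: (le_trans (HB _ _ _ (uFn n))); rewrite ler_wpM2l//.
  have muw : measurable_fun setT (fun g => `|un n g| * w2 g).
    by apply: measurable_funM => //; exact: measurableT_comp.
  have bun g : `|un n g| <= Cn n by exact: (flow_bound (uFn n)).
  have iuw : Q.-integrable setT (EFin \o (fun g => `|un n g| * w2 g)).
    apply: (@prob_bounded_integrable _ _ _ (Cn n)) => // g.
    by rewrite normrM normr_id -[Cn n]mulr1 ler_pM// ger0_norm.
  have maw : measurable_fun setT (fun g => an n g * w2 g) by exact: measurable_funM.
  have E : (\int[Q]_g (`|un n g| * w2 g)%:E = \int[Q]_g (an n g * w2 g)%:E)%E.
    apply: ae_eq_integral => //; [exact/measurable_EFinP|exact/measurable_EFinP|].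
    apply: filterS vO => g vg _; have [Og|nOg] := pselect (O g).
      by rewrite /an (vg Og) subr0.
    by rewrite (w2O _ nOg) !mulr0.
  have ia : Q.-integrable setT (EFin \o an n).
    have sa : sqi Q setT (fun g => un n g - v g).
      apply: sqiB => //; last exact: limit_value_sqi.
      have bs := @prob_bounded_integrable _ Q (fun g => un n g ^+ 2) (Cn n ^+ 2).
      split=> //; have /integrableP[_] : Q.-integrable setT (EFin \o (fun g => un n g ^+ 2)).
        apply: bs; first exact: measurable_funX.
        by move=> g; rewrite normrX ler_pXn2r ?nnegrE ?(flow_C0 (uFn n)).
      apply: le_lt_trans; apply: ge0_le_integral => //.
      - by move=> g _; rewrite lee_fin sqr_ge0.
      - exact: measurable_sq.
      - by apply: measurableT_comp => //; exact: measurable_sq.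
      - by move=> g _; rewrite /= lee_fin ler_norm.
    apply: (le_integrable measurableT _ _ (sqi_mul measurableT sa s1)).
      exact/measurable_EFinP.
    by move=> g _ /=; rewrite /an mulr1 lee_fin normr_id.
  rewrite /Rintegral E -/(Rintegral _ _ _) /ip; apply: le_Rintegral => //.
  - apply: (le_integrable measurableT _ _ ia); first exact/measurable_EFinP.
    by move=> g _ /=; rewrite lee_fin normrM ler_piMr// ger0_norm.
  - by rewrite (_ : EFin \o _ = EFin \o an n)//; apply/funext => g /=; rewrite mulr1.
  - by move=> g _; rewrite ler_wpM2l// /an.
apply/eqP; rewrite -normr_le0.
have cB : (fun n => B * ip Q setT (an n) (fun=> 1)) @ \oo --> (B * 0 : R).
  by apply: cvgM => //; exact: cvg_cst.
rewrite mulr0 in cB; apply: (ler_cvg_to _ cB); first exact: (cvg_norm cv).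
exact: nearW.
Qed.

(** The cutoffs of [O'] converge to its indicator, under the dominating function [|along F phi|]. *)
Lemma vanishing_along_open phi dphi K (O' : set (G0m R)) : tangent phi dphi K ->
  L2open O' -> O' `<=` O -> \int[Q]_g (\1_O' g * along F phi g) = 0.
Proof.
move=> tphi oO' O'O.
have cut_abs n g : `|cutoff O' n g| <= 1.
  by rewrite ger0_norm; case/andP: (clip_itv (n%:R * cdist O' g - 1)).
have mcut n : measurable_fun setT (cutoff O' n) := L2lip_measurable (@cutoff_lip _ O' n).
have z n : \int[Q]_g (cutoff O' n.+1 g * along F phi g) = 0.
  apply: (vanishing_along tphi (@cutoff_lip _ O' n.+1) (@outer_cutoff_lip _ O' n.+1)
     (r := (2 * n.+1%:R)^-1)) => //.
  - by move=> g; case/andP: (clip_itv (n.+1%:R * cdist O' g - 1)).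
  - exact: cutoff_le_outer.
  - by move=> g; case/andP: (clip_itv (2 * n.+1%:R * cdist O' g)).
  - by move=> f g fg ne; exact: cutoff_far fg ne.
  - by move=> g nO; apply: outer_cutoff_out => /O'O.
have n1 : forall g : G0m R, `|1 : R| <= 1 by move=> _; rewrite normr1.
have [iA _] := along_prod tphi limit_sqi (measurable_cst (1 : R)) n1.
have {}iA : Q.-integrable setT (EFin \o along F phi).
  have E : (fun g : G0m R => cst 1 g * along F phi g) = along F phi by apply/funext => g; rewrite /= mul1r.
  by rewrite E in iA.
have mA : measurable_fun setT (along F phi) by apply/measurable_EFinP; exact: measurable_int iA.
have mO' : measurable O' := L2open_measurable oO'.
have cv : (fun n => \int[Q]_g (cutoff O' n.+1 g * along F phi g)) @ \oo -->
   \int[Q]_g (\1_O' g * along F phi g).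
  apply: (Rintegral_dominated_cvg (mu := Q) (D := setT)
    (fn := fun n g => cutoff O' n.+1 g * along F phi g) (h := fun g => `|along F phi g|)) => //.
  - by move=> n; exact: measurable_funM.
  - by apply: measurable_funM => //; exact: measurable_indic.
  - exact: (integrable_norm iA).
  - by move=> n g _; rewrite normrM ler_piMl.
  - by apply: aeW => g _; apply: cvgM; [exact: cutoff_cvg|exact: cvg_cst].
by apply: (cvg_unique (@Rhausdorff R) cv); apply: cvg_near_cst; apply: nearW => n; exact: z.
Qed.

(** The integrals of [along F phi] vanish over all open subsets of [O], a generating class for its
    measurable subsets, so the function is zero almost everywhere on [O]. The null set depends on
    the field; the countable family [field j p] leaves a single one, off which [fields_determine]
    applies. *)
Lemma local_closability : {ae Q, forall g, O g -> sq leb I01 (F g) = 0%E}.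
Proof.
have mO : measurable O := L2open_measurable oO.
have A phi dphi K : tangent phi dphi K -> {ae Q, forall g, O g -> along F phi g = 0}.
  move=> tphi.
  have n1 : forall g : G0m R, `|\1_O g : R| <= 1.
    by move=> g; rewrite indicE; case: (g \in O); rewrite ?normr1 ?normr0.
  have m1 : measurable_fun setT (\1_O : G0m R -> R) by exact: measurable_indic.
  have [iA _] := along_prod tphi limit_sqi m1 n1.
  suff : {ae Q, forall g, \1_O g * along F phi g = 0}.
    by apply: filterS => g + Og; rewrite indicE mem_set// mul1r.
  apply: (@integral_pi_system_ae0 _ (G0m R) R Q (@L2open R)) => //.
  - by move=> B C; exact: L2openI.
  - exact: (vanishing_along_open tphi oO (@subset_refl _ O)).
  - move=> B oB; rewrite Rintegral_mkcond.
    rewrite -(vanishing_along_open tphi (L2openI oB oO) (@subIsetr _ B O)).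
    apply: eq_Rintegral => g _; rewrite patchE !indicE in_setI.
    by case: (g \in B) => //=; rewrite mul0r.
have /ae_foralln B : forall j, {ae Q, forall g, forall p, (0 < p < j)%N -> O g ->
    along F (@field R j p) g = 0}.
  move=> j; suff /ae_foralln : forall p, {ae Q, forall g, (0 < p < j)%N -> O g ->
    along F (@field R j p) g = 0} by [].
  move=> p; have [pj|npj] := boolP (0 < p < j)%N; last by apply: aeW.
  by apply: filterS (A _ _ _ (field_tangent R pj)) => g h _ /h.
have S := strictly_increasing_ae HQ.
have T := sqi_section_ae limit_sqi.
apply: filterS3 B S T => g Bg Sg Tg Og.
by apply: (fields_determine Sg Tg) => j p pj; exact: Bg.
Qed.

End Closability.

(** * Cylinder functions *)

Section C1Functions.
Variable R : realType.

Lemma C1real_is_derive (a : R -> R) : C1real a -> forall x, is_derive x (1 : R) a (derive1 a x).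
Proof. by move=> [da _] x; apply: DeriveDef; rewrite ?derive1E. Qed.

Lemma C1real_continuous (a : R -> R) : C1real a -> continuous a.
Proof. by move=> [da _] x; apply: differentiable_continuous; exact/derivable1_diffP. Qed.

Lemma is_derive_C1real (a da : R -> R) : (forall x, is_derive x (1 : R) a (da x)) -> continuous da ->
  C1real a /\ derive1 a = da.
Proof.
move=> H cda; have E : derive1 a = da by apply/funext => x; rewrite derive1E; case: (H x).
by rewrite /C1real E; split=> //; split => // x; case: (H x).
Qed.

Lemma segment_bounded (a b : R) (f : R -> R) : continuous f ->
  exists2 M : R, 0 <= M & forall x, a <= x <= b -> `|f x| <= M.
Proof.
move=> cf; have [ab|ba] := leP a b; last first.
  by exists 0 => // x /andP[h1 h2]; have := le_lt_trans (le_trans h1 h2) ba; rewrite ltxx.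
have cf' : {within `[a, b], continuous (fun x => `|f x|)}.
  by apply: continuous_subspaceT => x; apply: continuous_comp; [exact: cf|exact: norm_continuous].
have [c _ H] := EVT_max ab cf'.
by exists `|f c| => // x xab; apply: H; rewrite in_itv.
Qed.

(** Compactness of the segment, used as a near-covering property with the modulus [d] tending to 0
    as parameter. *)
Lemma segment_uniformly_continuous (a b : R) (f : R -> R) (e : R) : continuous f -> 0 < e ->
  exists2 d : R, 0 < d & forall x y, a <= x <= b -> a <= y <= b -> `|x - y| < d -> `|f x - f y| < e.
Proof.
move=> cf e0; have e2 : 0 < e / 2 by rewrite divr_gt0.
have := (@compact_near_coveringP R `[a, b]%classic).1 (@segment_compact R a b).
move=> /(_ R (nbhs (0 : R)^'+) (fun d x => forall y, `|x - y| < d -> `|f x - f y| < e) _)[].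
  move=> x _; have /cvgrPdist_lt/(_ _ e2)/nbhs_ballP[r /= r0 H] := cf x.
  have r2 : 0 < r / 2 by rewrite divr_gt0.
  exists (ball x (r / 2), [set d | d < r / 2]); first split => /=.
  - exact: nbhsx_ballx.
  - exact: nbhs_right_lt.
  - move=> [x' d] /= [xx' dr] y x'y.
    have h1 : `|f x - f x'| < e / 2.
      by apply: H; apply: le_ball xx'; rewrite ler_pdivrMr// ler_peMr ?ltW//; lra.
    have h2 : `|f x - f y| < e / 2.
      apply: H; rewrite /ball /=; rewrite /ball /= in xx'.
      rewrite (_ : x - y = (x - x') + (x' - y)); last by ring.
      rewrite (le_lt_trans (ler_normD _ _))// (_ : r = r / 2 + r / 2); last by rewrite -splitr.
      by rewrite ltrD// (lt_trans x'y).
    rewrite (_ : f x' - f y = (f x - f y) - (f x - f x')); last by ring.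
    by rewrite (le_lt_trans (ler_normB _ _))// [e]splitr ltrD.
move=> d /= d0 H; exists (d / 2); first by rewrite divr_gt0.
move=> x y xab _ xy; apply: (H (d / 2)) => //=.
- by rewrite sub0r normrN gtr0_norm ?divr_gt0// ltr_pdivrMr// ltr_pMr// ltr1n.
- by rewrite divr_gt0.
Qed.

Variable m : nat.
Implicit Types (U : 'rV[R]_m -> R) (x y z v : 'rV[R]_m).

Lemma derive_combination U x v : differentiable U x ->
  'D_v U x = \sum_i v 0 i * 'D_(delta_mx 0 i) U x.
Proof.
move=> dU; rewrite deriveE// {1}(row_sum_delta v) linear_sum; apply: eq_bigr => i _.
by rewrite linearZ /= deriveE.
Qed.

Lemma C1fun_mvt U y z : C1fun U -> exists2 t, 0 < t < 1 &
  U z - U y = \sum_i (z 0 i - y 0 i) * 'D_(delta_mx 0 i) U (y + t *: (z - y)).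
Proof.
move=> [dU _]; pose h (t : R) := U (y + t *: (z - y)).
have dh t : is_derive t (1 : R) h ('D_(z - y) U (y + t *: (z - y))).
  have E s : s^-1 *: ((h \o shift t) (s *: (1 : R)) - h t) =
      s^-1 *: ((U \o shift (y + t *: (z - y))) (s *: (z - y)) - U (y + t *: (z - y))).
    rewrite /h /= /GRing.scale /= mulr1; congr (_ * (U _ - _)).
    by rewrite [s *: _ + _]addrC -addrA -scalerDl [s + t]addrC.
  have EF : (fun s => s^-1 *: ((h \o shift t) (s *: (1 : R)) - h t)) =
      (fun s => s^-1 *: ((U \o shift (y + t *: (z - y))) (s *: (z - y)) - U (y + t *: (z - y)))).
    by apply/funext => s; exact: E.
  have D := @diff_derivable _ _ _ U (y + t *: (z - y)) (z - y) (dU _).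
  by apply: DeriveDef; rewrite /derivable /derive EF.
have ch : {within `[0, 1], continuous h}.
  apply: continuous_subspaceT => t; apply: differentiable_continuous.
  by apply/derivable1_diffP; case: (dh t).
have [t t01 E] := MVT ltr01 (fun (s : R) _ => dh s) ch.
exists t; first by rewrite in_itv in t01.
have h1 : h 1 = U z by rewrite /h scale1r addrC subrK.
have h0 : h 0 = U y by rewrite /h scale0r addr0.
move: E; rewrite h1 h0 subr0 mulr1 => ->.
rewrite derive_combination//; apply: eq_bigr => i _.
by rewrite !mxE.
Qed.

Lemma box_bound (f : 'rV[R]_m -> R) (A : R) : continuous f ->
  exists2 C, 0 <= C & forall y, (forall i, `|y 0 i| <= A) -> `|f y| <= C.
Proof.
move=> cf.
have cK : compact [set y : 'rV[R]_m | forall i, (`[- A, A]%classic : set R) (y ord0 i)].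
  by apply: (@rV_compact _ _ (fun=> `[- A, A]%classic)) => i; exact: segment_compact.
(* A negative [A] makes the box empty, except in dimension 0, where it is the single point 0. *)
have [A0|A0] := ltP A 0.
  have [m0|mp] := posnP m; last first.
    by exists 0 => // y /(_ (Ordinal mp)) /(le_trans (normr_ge0 _)); rewrite leNgt A0.
  exists `|f 0| => // y _; suff -> : y = 0 by [].
  by apply/rowP => -[i im]; exfalso; move: im; rewrite {1}m0.
have := @EVT_max_rV R m (fun y => `|f y|) _ _ cK.
case.
- by exists 0 => /= i; rewrite mxE in_itv /= oppr_le0 A0.
- by apply: continuous_subspaceT => y; apply: continuous_comp; [exact: cf|exact: norm_continuous].
move=> c _ H; exists `|f c| => // y yA; apply: H; rewrite inE /= => i.
by rewrite in_itv /= -ler_norml; exact: yA.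
Qed.

Lemma C1fun_continuous U : C1fun U -> continuous U.
Proof. by move=> [dU _] x; exact: differentiable_continuous. Qed.

Lemma C1fun_box U (A : R) : C1fun U -> exists2 C, 0 <= C & forall y, (forall i, `|y 0 i| <= A) ->
  `|U y| <= C /\ forall i, `|'D_(delta_mx 0 i) U y| <= C.
Proof.
move=> [dU cU]; have [C0 C00 H0] := box_bound A (C1fun_continuous (conj dU cU)).
have /choice[C CP] : forall i : 'I_m, exists C, 0 <= C /\ forall y, (forall i, `|y 0 i| <= A) ->
    `|'D_(delta_mx 0 i) U y| <= C.
  by move=> i; have [C C0' H] := box_bound A (cU i); exists C.
have s0 : 0 <= \sum_i C i by apply: sumr_ge0 => i _; case: (CP i).
exists (C0 + \sum_i C i); first exact: addr_ge0.
move=> y yA; split; first by rewrite (le_trans (H0 _ yA))// lerDl.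
move=> i; rewrite (le_trans ((CP i).2 _ yA))// (bigD1 i)//= addrCA lerDl addr_ge0// sumr_ge0//.
by move=> j _; case: (CP j).
Qed.

Lemma box_convex y z t (A : R) i : 0 < t < 1 -> (forall i, `|y 0 i| <= A) -> (forall i, `|z 0 i| <= A) ->
  `|(y + t *: (z - y)) 0 i| <= A.
Proof.
move=> /andP[t0 t1] /(_ i) yA /(_ i) zA; rewrite !mxE.
rewrite (_ : _ + _ = (1 - t) * y 0 i + t * z 0 i); last by ring.
rewrite (le_trans (ler_normD _ _))// !normrM (gtr0_norm t0) (@gtr0_norm _ (1 - t)) ?subr_gt0//.
rewrite (_ : A = (1 - t) * A + t * A); last by ring.
by rewrite lerD// ler_wpM2l// ?subr_ge0 ltW.
Qed.

Lemma C1fun_box_lip U (A : R) : C1fun U -> exists2 C, 0 <= C & forall y z,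
  (forall i, `|y 0 i| <= A) -> (forall i, `|z 0 i| <= A) ->
  `|U z - U y| <= C * \sum_i `|z 0 i - y 0 i|.
Proof.
move=> UC; have [C C0 H] := C1fun_box A UC; exists C => // y z yA zA.
have [t t01 ->] := C1fun_mvt y z UC.
rewrite (le_trans (ler_norm_sum _ _ _))// mulr_sumr; apply: ler_sum => i _.
rewrite normrM mulrC ler_wpM2r//; apply: (H _ _).2 => j.
exact: box_convex.
Qed.

(** The mean value theorem evaluates the partial derivatives on the segment from [y] to [z], where
    continuity keeps them within [eps] of their values at [y]. *)
Lemma C1fun_taylor U y (eps : R) : C1fun U -> 0 < eps -> exists2 d : R, 0 < d & forall z,
  (forall i, `|z 0 i - y 0 i| < d) ->
  `|U z - U y - \sum_i 'D_(delta_mx 0 i) U y * (z 0 i - y 0 i)| <= eps * \sum_i `|z 0 i - y 0 i|.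
Proof.
move=> UC eps0.
have /choice[d dP] : forall i : 'I_m, exists d : R, 0 < d /\ forall z, (forall j, `|z 0 j - y 0 j| < d) ->
    `|'D_(delta_mx 0 i) U z - 'D_(delta_mx 0 i) U y| <= eps.
  move=> i; have /cvgrPdist_le/(_ _ eps0)/nbhs_ballP[d /= d0 H] := UC.2 i y.
  exists d; split => // z zd; rewrite distrC; apply: H; split=> // a j /=.
  by rewrite ord1 /ball /= distrC.
pose D := \big[Num.min/1]_i d i.
have D0 : 0 < D by rewrite /D; elim/big_ind: _ => // [a b a0 b0|i _]; [rewrite lt_min a0|case: (dP i)].
have Dle i : D <= d i by rewrite /D (bigD1 i)//= ge_min lexx.
exists D => // z zD.
have [t /andP[t0 t1] ->] := C1fun_mvt y z UC.
rewrite -sumrB (le_trans (ler_norm_sum _ _ _))// mulr_sumr; apply: ler_sum => i _.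
rewrite (_ : _ - _ = ('D_(delta_mx 0 i) U (y + t *: (z - y)) - 'D_(delta_mx 0 i) U y) * (z 0 i - y 0 i)); last by ring.
rewrite normrM ler_wpM2r//; apply: (dP i).2 => j.
rewrite !mxE addrAC subrr add0r normrM (gtr0_norm t0).
by apply: le_lt_trans (lt_le_trans (zD j) (Dle i)); rewrite ler_piMl// ltW.
Qed.

Lemma C1fun_proj (i : 'I_m) (a : R -> R) : C1real a -> C1fun (fun z => a (z 0 i)) /\
  forall k z, 'D_(delta_mx 0 k) (fun z : 'rV[R]_m => a (z 0 i)) z = (i == k)%:R * derive1 a (z 0 i).
Proof.
move=> aC.
have dV z : differentiable (fun z : 'rV[R]_m => a (z 0 i)) z.
  apply: (@differentiable_comp _ _ _ _ (fun z : 'rV[R]_m => z 0 i) a).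
    exact: differentiable_coord.
  by apply/derivable1_diffP; exact: aC.1.
have E k z : 'D_(delta_mx 0 k) (fun z : 'rV[R]_m => a (z 0 i)) z = (i == k)%:R * derive1 a (z 0 i).
  case: eqVneq => [->|ik]; rewrite ?mul1r ?mul0r.
    rewrite /derive /derive1.
    suff -> : (fun h : R => h^-1 *: (((fun z0 : 'rV[R]_m => a (z0 0 k)) \o shift z) (h *: delta_mx 0 k) - a (z 0 k))) =
       (fun h => h^-1 *: (a (h + z 0 k) - a (z 0 k))) by [].
    by apply/funext => h; rewrite /= !mxE !eqxx mulr1.
  rewrite /derive (_ : (fun _ => _) = cst 0) ?lim_cst//.
  apply/funext => h; rewrite /= !mxE (negbTE ik) andbF mulr0 add0r subrr.
  by rewrite scaler0.
split=> //; split => // k z; rewrite (_ : 'D_(delta_mx 0 k) _ = fun z => (i == k)%:R * derive1 a (z 0 i)).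
  have c2 : {for z, continuous (fun z : 'rV[R]_m => derive1 a (z 0 i))}.
    by apply: continuous_comp; [exact: coord_continuous|exact: aC.2].
  exact: (cvgM (cvg_cst ((i == k)%:R : R)) c2).
by apply/funext => z'; exact: E.
Qed.

End C1Functions.

(** * Composition of U with sums of functions of one variable *)

Section Composite.
Variables (R : realType) (m n : nat) (U : 'rV[R]_m -> R) (a : 'I_m -> 'I_n -> R -> R).
Hypotheses (UC : C1fun U) (aC : forall i k, C1real (a i k)).

Let W (z : 'rV[R]_n) : 'rV[R]_m := \row_i \sum_k a i k (z 0 k).

Let W_coord i z : differentiable (fun z => W z 0 i) z.
Proof.
rewrite (_ : (fun z => W z 0 i) = \sum_k (fun z : 'rV[R]_n => a i k (z 0 k))).
  by apply: differentiable_sum => k; exact: (C1fun_proj k (aC i k)).1.1.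
by apply/funext => z'; rewrite mxE fct_sumE.
Qed.

Let W_diff z : differentiable W z.
Proof.
rewrite (_ : W = \sum_i (fun z => W z 0 i *: delta_mx 0 i)).
  by apply: differentiable_sum => i; apply: differentiableZl; exact: W_coord.
by apply/funext => z'; rewrite fct_sumE -row_sum_delta.
Qed.

Let W_partial k z i : ('D_(delta_mx 0 k) W z) 0 i = derive1 (a i k) (z 0 k).
Proof.
rewrite derive_mx; last by apply: diff_derivable; exact: W_diff.
rewrite mxE (_ : (fun z => W z 0 i) = \sum_j (fun z : 'rV[R]_n => a i j (z 0 j))); last first.
  by apply/funext => z'; rewrite mxE fct_sumE.
rewrite derive_sum; last by move=> j; apply: diff_derivable; exact: (C1fun_proj j (aC i j)).1.1.
rewrite (bigD1 k)//= big1 ?addr0 => [|j jk]; rewrite (C1fun_proj _ (aC i _)).2.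
  by rewrite eqxx mul1r.
by rewrite (negbTE jk) mul0r.
Qed.

(** The approximations of either cylinder class by the other are of this form; the lemma keeps them
    inside the approximating class. *)
Lemma C1fun_composite : C1fun (fun z => U (W z)) /\
  forall k z, 'D_(delta_mx 0 k) (fun z => U (W z)) z =
    \sum_i 'D_(delta_mx 0 i) U (W z) * derive1 (a i k) (z 0 k).
Proof.
have dV z : differentiable (fun z => U (W z)) z.
  exact: (@differentiable_comp _ _ _ _ W U z (W_diff z) (UC.1 _)).
have E k z : 'D_(delta_mx 0 k) (fun z => U (W z)) z =
    \sum_i 'D_(delta_mx 0 i) U (W z) * derive1 (a i k) (z 0 k).
  rewrite deriveE// (@diff_comp _ _ _ _ W U z (W_diff z) (UC.1 _)) /=.
  rewrite -(deriveE _ (UC.1 _)) -(deriveE _ (W_diff z)) (derive_combination _ (UC.1 _)).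
  by apply: eq_bigr => i _; rewrite W_partial mulrC.
split=> //; split=> // k z.
rewrite (_ : 'D_(delta_mx 0 k) _ = fun z => \sum_i 'D_(delta_mx 0 i) U (W z) * derive1 (a i k) (z 0 k)).
  rewrite (_ : (fun z0 : 'rV[R]_n => _) =
    \sum_i (fun z0 : 'rV[R]_n => 'D_(delta_mx 0 i) U (W z0) * derive1 (a i k) (z0 0 k))); last first.
    by apply/funext => z0; rewrite fct_sumE.
  elim/big_ind: _ => [|f g cf cg|i _]; [exact: cst_continuous|exact: continuousD|].
  have c1 : {for z, continuous (fun z0 : 'rV[R]_n => 'D_(delta_mx 0 i) U (W z0))}.
    exact: (@continuous_comp _ _ _ W ('D_(delta_mx 0 i) U) z (differentiable_continuous (W_diff z)) (UC.2 i _)).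
  have c2 : {for z, continuous (fun z0 : 'rV[R]_n => derive1 (a i k) (z0 0 k))}.
    by apply: continuous_comp; [exact: coord_continuous|exact: (aC i k).2].
  exact: (cvgM c1 c2).
by apply/funext => z'; exact: E.
Qed.

End Composite.

(** * Chain rule for flow smooth functions *)

Section ChainRule.
Variable R : realType.
Local Notation leb := (@lebesgue_measure R).
Local Notation I01 := (@I01 R).
Local Notation along F phi := (fun g : G0m R => ip leb I01 (F g) (fun s => phi (gfun g s))).
Local Notation unc F := (fun p : G0m R * measurableTypeR R => F p.1 p.2).

Lemma nrmZ (c : R) (f : R -> R) : sqi leb I01 f -> nrm leb I01 (fun s => c * f s) = `|c| * nrm leb I01 f.
Proof.
move=> sf; have mI := @measurable_I01 R; have scf := sqiZ mI c sf.
by rewrite /nrm (ipZl mI _ sf scf) ipC (ipZl mI _ sf sf) mulrA -expr2 sqrtrM ?sqr_ge0// sqrtr_sqr.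
Qed.

Lemma sqi_sum (m : nat) (E : 'I_m -> R -> R) : (forall i, sqi leb I01 (E i)) ->
  [/\ sqi leb I01 (fun s => \sum_i E i s),
      nrm leb I01 (fun s => \sum_i E i s) <= \sum_i nrm leb I01 (E i) &
      forall h, sqi leb I01 h -> ip leb I01 (fun s => \sum_i E i s) h = \sum_i ip leb I01 (E i) h].
Proof.
elim: m E => [|m IH] E sE.
  have -> : (fun s => \sum_(i < 0) E i s) = (fun=> 0) by apply/funext => s; rewrite big_ord0.
  have i0 h : ip leb I01 (fun=> 0) h = 0.
    by rewrite /ip /Rintegral integral0_eq// => s _; rewrite mul0r.
  split.
  - by apply: (@bounded_sqi _ _ 0) => // s _; rewrite normr0.
  - by rewrite big_ord0 /nrm i0 sqrtr0.
  - by move=> h _; rewrite big_ord0 i0.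
have -> : (fun s => \sum_(i < m.+1) E i s) = (fun s => \sum_(i < m) E (widen_ord (leqnSn m) i) s + E ord_max s).
  by apply/funext => s; rewrite big_ord_recr.
have [h1 h2 h3] := IH (fun i => E (widen_ord (leqnSn m) i)) (fun i => sE _).
split.
- by apply: sqiD => //; exact: measurable_I01.
- rewrite big_ord_recr /= (le_trans (nrmD (@measurable_I01 R) h1 (sE ord_max)))// lerD2r//.
- by move=> h sh; rewrite big_ord_recr /= (ipDl (@measurable_I01 R) h1 (sE ord_max) sh) h3.
Qed.

Lemma continuous_L2lip_measurable (m : nat) (h : 'rV[R]_m -> R) (Y : 'I_m -> G0m R -> R) (L : 'I_m -> R) :
  continuous h -> (forall i, L2lip (Y i) (L i)) ->
  measurable_fun setT (fun g => h (\row_i Y i g)).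
Proof.
move=> ch YL; apply: measurable_fun_lt => // c; rewrite setTI; apply: L2open_measurable.
move=> g /= hg; have /cvgrPdist_lt/(_ (c - h (\row_i Y i g))) := ch (\row_i Y i g).
rewrite subr_gt0 => /(_ hg)/nbhs_ballP[r /= r0 H].
pose A := 1 + \sum_i `|L i|.
have A0 : 0 < A by rewrite ltr_pwDl// sumr_ge0.
have LA i : `|L i| <= A by rewrite /A (bigD1 i)//= addrCA lerDl addr_ge0// sumr_ge0.
exists (r / A); first by rewrite divr_gt0.
move=> f; rewrite /L2ball /= ltr_pdivlMr// => fg.
have /H /= : ball (\row_i Y i g) r (\row_i Y i f).
  split => // a i; rewrite !mxE /ball /= (le_lt_trans (YL i g f))//.
  apply: le_lt_trans fg; rewrite mulrC ler_wpM2l ?L2dist_ge0//.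
  exact: le_trans (ler_norm _) (LA i).
by rewrite ltr_norml => /andP[h1 _]; move: h1; rewrite ltrBrDr opprB addrC; lra.
Qed.

Lemma sum_le_const (m : nat) (x : 'I_m -> R) (c : R) : (forall i, x i <= c) -> \sum_i x i <= m%:R * c.
Proof.
move=> xc; apply: (@le_trans _ _ (\sum_(i < m) c)); first by apply: ler_sum => i _; exact: xc.
by rewrite sumr_const card_ord mulr_natl.
Qed.

(** The expansion error is the Taylor remainder of [U] plus the errors of the [Y i] weighted by the
    partial derivatives, which are bounded on the box of side [A]. *)
Lemma flow_smooth_comp (m : nat) (U : 'rV[R]_m -> R) (Y : 'I_m -> G0m R -> R) (D : 'I_m -> G0m R -> R -> R) (A : R) :
  0 <= A -> C1fun U -> (forall i, flow_smooth (Y i) (D i) A) -> exists C,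
  flow_smooth (fun g => U (\row_i Y i g))
    (fun g s => \sum_i 'D_(delta_mx 0 i) U (\row_j Y j g) * D i g s) C.
Proof.
move=> A0 UC YD; pose y (g : G0m R) : 'rV[R]_m := \row_i Y i g.
have yA g i : `|y g 0 i| <= A by rewrite mxE; exact: flow_bound (YD i) g.
have [C C0 HC] := C1fun_box A UC; have [L L0 HL] := C1fun_box_lip A UC.
have sD i g : sqi leb I01 (D i g) by exact: flow_sqi (YD i) g.
have sE g i : sqi leb I01 (fun s => 'D_(delta_mx 0 i) U (y g) * D i g s).
  by apply: sqiZ => //; exact: measurable_I01.
have nD i g : nrm leb I01 (D i g) <= A + 1.
  rewrite -(@ler_pXn2r _ 2)// ?nnegrE ?nrm_ge0 ?addr_ge0// -lee_fin -(sq_nrm (@measurable_I01 R) (sD i g)).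
  by rewrite (le_trans (flow_grad (YD i) g))// lee_fin; nra.
(* The summands serve the gradient bound, the bound on [U] and the Lipschitz constant, in this
   order. *)
pose M := (m%:R * (C * (A + 1))) ^+ 2 + C + L * (m%:R * A).
exists M; split.
- move=> g; rewrite (le_trans (HC _ (yA g)).1)// /M addrAC lerDr addr_ge0 ?sqr_ge0// !mulr_ge0//.
- move=> f g; rewrite (le_trans (HL _ _ (yA g) (yA f)))//.
  apply: (@le_trans _ _ (L * (m%:R * A) * L2dist f g)); last first.
    by rewrite ler_wpM2r ?L2dist_ge0// /M lerDr addr_ge0// sqr_ge0.
  rewrite -mulrA ler_wpM2l// -mulrA; apply: sum_le_const => i.
  by rewrite !mxE; exact: flow_lip (YD i) f g.
- apply: measurable_sum => i; apply: measurable_funM; last exact: flow_measurable (YD i).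
  have := continuous_L2lip_measurable (UC.2 i) (fun j => flow_lip (YD j)).
  by move=> h; apply: measurable_funTS; exact: (measurableT_comp h measurable_fst).
- move=> g; have [h1 h2 _] := sqi_sum (sE g).
  rewrite (sq_nrm (@measurable_I01 R) h1) lee_fin.
  apply: (@le_trans _ _ ((m%:R * (C * (A + 1))) ^+ 2)); last first.
    by rewrite /M -addrA lerDl addr_ge0// !mulr_ge0.
  rewrite ler_pXn2r ?nnegrE ?nrm_ge0 ?mulr_ge0 ?addr_ge0// (le_trans h2)//.
  apply: sum_le_const => i.
  rewrite (nrmZ _ (sD i g)) ler_pM ?nrm_ge0//; exact: (HC _ (yA g)).2.
- move=> phi dphi K tp g eps eps0; have K0 := tangent_K0 tp.
  (* Each of the two errors gets half of [eps]; the added 1 keeps the denominators positive. *)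
  have den0 : 0 < 2 * (m%:R * (A * K)) + 1 by rewrite ltr_wpDl// !mulr_ge0.
  have e1 : 0 < eps / (2 * (m%:R * (A * K)) + 1) by rewrite divr_gt0.
  have [r r0 Hr] := C1fun_taylor (y g) UC e1.
  have den1 : 0 < 2 * (m%:R * C) + 1 by rewrite ltr_wpDl// !mulr_ge0.
  have e2 : 0 < eps / (2 * (m%:R * C) + 1) by rewrite divr_gt0.
  have /choice[d dP] : forall i : 'I_m, exists d : R, 0 < d /\ forall e (e0 : 0 <= e) (eK : e * K <= 2^-1), e < d ->
      `|Y i (push tp e0 eK g) - Y i g - e * along (D i) phi g| <= eps / (2 * (m%:R * C) + 1) * e.
    by move=> i; have [d d0 h] := flow_deriv (YD i) tp g e2; exists d.
  pose d0 := \big[Num.min/(r / (A * K + 1))]_i d i.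
  have AK : 0 < A * K + 1 by rewrite ltr_wpDl// mulr_ge0.
  have d00 : 0 < d0.
    by rewrite /d0; elim/big_ind: _ => [|a b a0 b0|i _]; [rewrite divr_gt0|rewrite lt_min a0|case: (dP i)].
  have d0i i : d0 <= d i by rewrite /d0 (bigD1 i)//= ge_min lexx.
  have d0r : d0 <= r / (A * K + 1).
    by rewrite /d0; elim/big_rec: _ => // i x _ h; rewrite ge_min h orbT.
  exists d0 => // e e0 eK ed.
  have incr i : `|y (push tp e0 eK g) 0 i - y g 0 i| <= A * K * e.
    rewrite !mxE (le_trans (flow_lip (YD i) _ _))// -mulrA ler_wpM2l// mulrC.
    exact: push_dist.
  have small i : `|y (push tp e0 eK g) 0 i - y g 0 i| < r.
    apply: (le_lt_trans (incr i)).
    apply: (@le_lt_trans _ _ ((A * K + 1) * e)); first by rewrite ler_wpM2r// lerDl.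
    by rewrite mulrC -ltr_pdivlMr// (lt_le_trans ed).
  have T1 := Hr _ small.
  have [_ _ ->] := sqi_sum (sE g); last exact: tangent_sqi tp.
  rewrite -/(y _) -/(y g).
  pose S1 := \sum_i 'D_(delta_mx 0 i) U (y g) * (y (push tp e0 eK g) 0 i - y g 0 i).
  rewrite (_ : _ - _ - _ = (U (y (push tp e0 eK g)) - U (y g) - S1) +
    (\sum_i 'D_(delta_mx 0 i) U (y g) * (y (push tp e0 eK g) 0 i - y g 0 i - e * along (D i) phi g))); last first.
    have -> : \sum_i ip leb I01 (fun s => 'D_(delta_mx 0 i) U (y g) * D i g s) (fun s => phi (g s)) =
        \sum_i 'D_(delta_mx 0 i) U (y g) * along (D i) phi g.
      by apply: eq_bigr => i _; exact: (ipZl (@measurable_I01 R) _ (sD i g) (tangent_sqi g tp)).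
    rewrite (_ : \sum_i 'D_(delta_mx 0 i) U (y g) * (_ - _ - _) =
        S1 - e * \sum_i 'D_(delta_mx 0 i) U (y g) * along (D i) phi g); first by rewrite addrA subrK.
    by rewrite /S1 mulr_sumr -sumrB; apply: eq_bigr => i _; ring.
  rewrite (le_trans (ler_normD _ _))// [eps]splitr mulrDl lerD//.
    apply: (le_trans T1).
    apply: (@le_trans _ _ (eps / (2 * (m%:R * (A * K)) + 1) * (m%:R * (A * K * e)))).
      by rewrite ler_wpM2l ?(ltW e1)//; exact: sum_le_const.
    have key (x c t : R) : 0 <= x -> 0 <= c -> 0 <= t -> c / (2 * x + 1) * (x * t) <= c / 2 * t.
      move=> x0 c0 t0; have x1 : 0 < 2 * x + 1 by lra.
      rewrite (_ : c / (2 * x + 1) * (x * t) = c * t * x / (2 * x + 1)); last by ring.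
      rewrite ler_pdivrMr// (_ : c / 2 * t * (2 * x + 1) = c * t * x + c * t / 2); last by field.
      have : 0 <= c * t by rewrite mulr_ge0.
      by lra.
    rewrite (_ : m%:R * (A * K * e) = m%:R * (A * K) * e); last by ring.
    by apply: key => //; rewrite ?mulr_ge0// ltW.
  rewrite (le_trans (ler_norm_sum _ _ _))//.
  apply: (@le_trans _ _ (m%:R * (C * (eps / (2 * (m%:R * C) + 1) * e)))).
    apply: sum_le_const => i; rewrite normrM ler_pM//; first exact: (HC _ (yA g)).2.
    by rewrite !mxE; apply: (dP i).2; exact: lt_le_trans ed (d0i i).
  rewrite (_ : m%:R * _ = eps * e * (m%:R * C) / (2 * (m%:R * C) + 1)); last by ring.
  rewrite ler_pdivrMr// (_ : eps / 2 * e * _ = eps * e * (m%:R * C) + eps * e / 2); last by field.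
  by rewrite lerDl divr_ge0// mulr_ge0// ltW.
Qed.

End ChainRule.

(** * Both cylinder classes are flow smooth *)

Section CylinderFunctions.
Variable R : realType.
Local Notation leb := (@lebesgue_measure R).
Local Notation I01 := (@I01 R).
Local Notation along F phi := (fun g : G0m R => ip leb I01 (F g) (fun s => phi (gfun g s))).
Local Notation unc F := (fun p : G0m R * measurableTypeR R => F p.1 p.2).

Lemma G0_sqi (g : G0 R) : sqi leb I01 g.
Proof.
apply: (@bounded_sqi _ _ 1); first exact: measurable_G0.
by move=> s _; rewrite ger0_norm ?G0_ge0 ?G0_le1.
Qed.

Lemma flow_smooth_weaken u F (C C' : R) : C <= C' -> flow_smooth u F C -> flow_smooth u F C'.
Proof.
move=> CC uF; split.
- by move=> g; exact: le_trans (flow_bound uF g) CC.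
- move=> f g; rewrite (le_trans (flow_lip uF f g))// ler_wpM2r ?L2dist_ge0//.
- exact: flow_measurable uF.
- by move=> g; rewrite (le_trans (flow_grad uF g))// lee_fin.
- exact: flow_deriv uF.
Qed.

Lemma flow_smooth_weight (f : R -> R) : sqi leb I01 f -> exists C,
  flow_smooth (fun g : G0m R => Rint01 (fun s => f s * g s)) (fun _ => f) C.
Proof.
move=> sf; have n0 := nrm_ge0 leb I01 f.
have mI := @measurable_I01 R.
have nle (g : R -> R) : sqi leb I01 g -> (forall s, I01 s -> `|g s| <= 1) -> nrm leb I01 g <= 1.
  move=> sg g1; rewrite -(@ler_pXn2r _ 2)// ?nnegrE ?nrm_ge0// nrm_sqr expr1n /ip -(Rint01_cst 1).
  apply: le_Rintegral => //; [exact: sqi_mul|by apply: (@bounded_integrable _ _ 1) => // s _; rewrite normr1|].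
  move=> s s1; rewrite -expr2 -real_normK ?num_real// exprn_ile1//; exact: g1.
exists (nrm leb I01 f ^+ 2 + nrm leb I01 f + 1); split.
- move=> g; apply: (le_trans (cauchy_schwarz mI sf (G0_sqi g))).
  have h1 : nrm leb I01 g <= 1 by apply: nle (G0_sqi g) _ => s _; rewrite ger0_norm ?G0_ge0 ?G0_le1.
  have : nrm leb I01 f * nrm leb I01 g <= nrm leb I01 f by rewrite ler_piMr// h1//.
  have key (x y : R) : 0 <= x -> y <= x -> y <= x ^+ 2 + x + 1 by move=> *; nra.
  exact: key.
- move=> g h; rewrite /Rint01.
  have -> : \int[leb]_(s in I01) (f s * g s) - \int[leb]_(s in I01) (f s * h s) =
     ip leb I01 f (fun s => g s - h s) by rewrite (ipBr mI sf (G0_sqi g) (G0_sqi h)).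
  rewrite (le_trans (cauchy_schwarz mI sf (G0_sub_sqi g h)))// -L2distE ler_wpM2r ?L2dist_ge0//.
  have key (x : R) : 0 <= x -> x <= x ^+ 2 + x + 1 by move=> *; nra.
  exact: key.
- have mfr : measurable_fun setT ((f : measurableTypeR R -> R) \_ I01).
    exact: ((measurable_restrictT (f : measurableTypeR R -> R) mI).1 sf.1).
  have h : measurable_fun (@GI R) (fun p : G0m R * measurableTypeR R => ((f : measurableTypeR R -> R) \_ I01) p.2).
    by apply: measurable_funTS; exact: (measurableT_comp mfr measurable_snd).
  apply: (eq_measurable_fun _ _ h) => p; rewrite inE => -[_ p2].
  by rewrite patchE mem_set.
- by move=> g; rewrite (sq_nrm mI sf) lee_fin -addrA lerDl addr_ge0.
(* The functional is linear in [g], so the first order expansion is exact and any threshold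
   works. *)
- move=> phi dphi K tp g eps eps0; exists 1 => // e e0 eK _.
  rewrite /Rint01.
  have -> : \int[leb]_(s in I01) (f s * push tp e0 eK g s) - \int[leb]_(s in I01) (f s * g s) =
     ip leb I01 f (fun s => e * phi (g s)).
    rewrite -[LHS](ipBr mI sf (G0_sqi (push tp e0 eK g)) (G0_sqi g)); congr ip; apply/funext => s /=.
    by rewrite /tshift addrAC subrr add0r.
  by rewrite ipC (ipZl mI _ (tangent_sqi g tp) sf) ipC subrr normr0 mulr_ge0// ltW.
Qed.

(** The mean value theorem under the integral gives [a'] at points within [e * K] of [g s]; uniform
    continuity of [a'] on [0, 1] makes the error small uniformly in [s]. *)
Lemma flow_smooth_potential (a : R -> R) : C1real a -> exists C,
  flow_smooth (fun g : G0m R => Rint01 (fun s => a (g s))) (fun g s => derive1 a (g s)) C.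
Proof.
move=> aC; have mI := @measurable_I01 R.
have [M M0 HM] := segment_bounded 0 1 (C1real_continuous aC).
have [M' M0' HM'] := segment_bounded 0 1 aC.2.
have mvt x y : exists c, [/\ 0 <= x <= 1 -> 0 <= y <= 1 -> 0 <= c <= 1, `|c - x| <= `|y - x| &
    a y - a x = derive1 a c * (y - x)].
  have ca b c : {within `[b, c], continuous a}.
    by apply: continuous_subspaceT; exact: C1real_continuous.
  have [xy|yx|->] := ltgtP x y.
  - have [c + E] := MVT xy (fun z _ => C1real_is_derive aC z) (ca _ _).
    rewrite in_itv /= => /andP[c1 c2]; exists c; split => //.
      by move=> /andP[x0 _] /andP[_ y1]; rewrite (le_trans x0 (ltW c1)) (le_trans (ltW c2)).
    by rewrite !gtr0_norm ?subr_gt0// lerD2r ltW.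
  - have [c + E] := MVT yx (fun z _ => C1real_is_derive aC z) (ca _ _).
    rewrite in_itv /= => /andP[c1 c2]; exists c; split => //.
      by move=> /andP[_ x1] /andP[y0 _]; rewrite (le_trans y0 (ltW c1)) (le_trans (ltW c2)).
    + by rewrite !ltr0_norm ?subr_lt0// lerN2 lerD2r ltW.
    + by rewrite -opprB E -mulrN opprB.
  - by exists y; rewrite !subrr mulr0 normr0.
have ma (h : R -> R) : continuous h -> measurable_fun setT h by move=> ch; exact: continuous_measurable_fun.
have mag (h : R -> R) (g : G0 R) : continuous h -> measurable_fun I01 (fun s => h (g s)).
  by move=> ch; apply: (measurableT_comp (ma _ ch)); exact: measurable_G0.
have sag (h : R -> R) (g : G0 R) (B : R) : continuous h -> (forall x, 0 <= x <= 1 -> `|h x| <= B) ->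
    sqi leb I01 (fun s => h (g s)).
  by move=> ch hB; apply: (@bounded_sqi _ _ B) => [|s _]; [exact: mag|apply: hB; exact: G0_itv].
have iag (g : G0 R) : leb.-integrable I01 (EFin \o (fun s => a (g s))).
  apply: (@bounded_integrable _ _ M); first by apply: mag; exact: C1real_continuous.
  by move=> s _; apply: HM; exact: G0_itv.
have c1 : sqi leb I01 (fun=> 1 : R) by apply: (@bounded_sqi _ _ 1) => // s _; rewrite normr1.
exists (M + M' + M' ^+ 2); split.
- move=> g; rewrite (le_trans (le_normr_Rintegral mI (iag g)))// -[leRHS](Rint01_cst).
  apply: le_Rintegral => //.
  + exact: integrable_norm (iag g).
  + by apply: (@bounded_integrable _ _ `|M + M' + M' ^+ 2|).
  + by move=> s _; rewrite (le_trans (HM _ (G0_itv g s)))// -addrA lerDl addr_ge0// sqr_ge0.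
- move=> f g; rewrite /Rint01 -RintegralB//.
  apply: (le_trans (le_normr_Rintegral mI (integrableB mI (iag f) (iag g)))).
  apply: (@le_trans _ _ (M' * nrm leb I01 (fun s => f s - g s))); last first.
    by rewrite L2distE ler_wpM2r ?nrm_ge0// (addrC M) -addrA lerDl addr_ge0// sqr_ge0.
  pose h s := `|f s - g s|.
  have sh : sqi leb I01 h.
    apply: (@bounded_sqi _ _ 1); last by move=> s _; rewrite normr_id G0_dist_le1.
    by apply: measurableT_comp => //; apply: measurable_funB; exact: measurable_G0.
  have nh : nrm leb I01 h = nrm leb I01 (fun s => f s - g s).
    by congr Num.sqrt; apply: eq_Rintegral => s _; rewrite /h -normrM -expr2 ger0_norm// sqr_ge0.
  have n1 : nrm leb I01 (fun=> 1 : R) = 1.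
    by rewrite /nrm /ip -/(Rint01 _) Rint01_cst mulr1 sqrtr1.
  apply: (@le_trans _ _ (M' * ip leb I01 h (fun=> 1))); last first.
    rewrite ler_wpM2l// -nh (le_trans (ler_norm _))// (le_trans (cauchy_schwarz mI sh c1))//.
    by rewrite n1 mulr1.
  rewrite /ip -RintegralZl//; last exact: sqi_mul.
  apply: le_Rintegral => //.
  + exact: integrable_norm (integrableB mI (iag f) (iag g)).
  + by have := integrableZl mI M' (sqi_mul mI sh c1).
  + move=> s _; have [c [c01 _ ->]] := mvt (g s) (f s).
    by rewrite normrM mulr1 ler_wpM2r// HM'// c01 ?G0_itv.
- have mj := @measurable_G0_joint R (@GI R).
  exact: (measurableT_comp (ma _ aC.2) mj).
- move=> g; have sg := sag _ g _ aC.2 HM'; rewrite (sqE mI sg) lee_fin /ip.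
  apply: (@le_trans _ _ (M' ^+ 2)); last by rewrite lerDr addr_ge0.
  rewrite -[leRHS]Rint01_cst; apply: le_Rintegral => //; first exact: sqi_mul.
    by apply: (@bounded_integrable _ _ (M' ^+ 2)) => // s _; rewrite ger0_norm// sqr_ge0.
  move=> s _; rewrite -expr2 -real_normK ?num_real// ler_pXn2r ?nnegrE//.
  by apply: HM'; exact: G0_itv.
- move=> phi dphi K tp g eps eps0; have K0 := tangent_K0 tp.
  have K1 : 0 < K + 1 by rewrite ltr_wpDl.
  have e1 : 0 < eps / (K + 1) by rewrite divr_gt0.
  have [d d0 Hd] := segment_uniformly_continuous 0 1 aC.2 e1.
  exists (d / (K + 1)); first by rewrite divr_gt0.
  move=> e e0 eK ed; rewrite /Rint01.
  have sd := sag _ g _ aC.2 HM'; have sp := tangent_sqi g tp.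
  have idp := sqi_mul mI sd sp.
  rewrite -RintegralB// /ip -RintegralZl// -RintegralB//; first last.
  - exact: (integrableZl mI e idp).
  - exact: (integrableB mI (iag (push tp e0 eK g)) (iag g)).
  have ii := integrableB mI (integrableB mI (iag (push tp e0 eK g)) (iag g)) (integrableZl mI e idp).
  rewrite (le_trans (le_normr_Rintegral mI ii))// -[leRHS]Rint01_cst.
  apply: le_Rintegral => //.
  + exact: integrable_norm ii.
  + exact: (@bounded_integrable _ _ `|eps * e|).
  move=> s _; have [c [c01 cx ->]] := mvt (g s) (push tp e0 eK g s).
  have {}c01 := c01 (G0_itv g s) (G0_itv (push tp e0 eK g) s).
  have E : push tp e0 eK g s - g s = e * phi (g s) by rewrite /= /tshift addrAC subrr add0r.
  rewrite E in cx *.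
  have pb : `|phi (g s)| <= K by exact: (tangent_bound tp).
  have cd : `|c - g s| < d.
    apply: (le_lt_trans cx); rewrite normrM ger0_norm//.
    apply: (@le_lt_trans _ _ (e * (K + 1))); first by rewrite ler_wpM2l// (le_trans pb)// lerDl.
    by rewrite -ltr_pdivlMr.
  rewrite (_ : _ - _ = (derive1 a c - derive1 a (g s)) * (e * phi (g s))); last by ring.
  rewrite normrM (normrM e) (ger0_norm e0).
  apply: (@le_trans _ _ (eps / (K + 1) * (e * (K + 1)))).
    rewrite ler_pM//; first by rewrite mulr_ge0.
      by apply: ltW; apply: Hd => //; exact: G0_itv.
    by rewrite ler_wpM2l// (le_trans pb)// lerDl.
  by rewrite mulrA mulrAC divfK ?gt_eqF.
Qed.

Lemma common_bound (m : nat) (Y : 'I_m -> G0m R -> R) (D : 'I_m -> G0m R -> R -> R) :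
  (forall i, exists C, flow_smooth (Y i) (D i) C) -> exists2 A, 0 <= A & forall i, flow_smooth (Y i) (D i) A.
Proof.
move=> /choice[C CP]; exists (\sum_i C i); first by apply: sumr_ge0 => j _; exact: flow_C0 (CP j).
move=> i; apply: (flow_smooth_weaken _ (CP i)).
by rewrite (bigD1 i)//= lerDl sumr_ge0// => j _; exact: flow_C0 (CP j).
Qed.

Lemma Zgraph_flow_smooth (u : G0m R -> R) F : Zgraph u F -> exists C, flow_smooth u F C.
Proof.
move=> [m [U [al [UC aC -> ->]]]].
have [A A0 HA] := common_bound (fun i => flow_smooth_potential (aC i)).
exact: flow_smooth_comp A0 UC HA.
Qed.

Lemma Cgraph_flow_smooth (u : G0m R -> R) F : Cgraph u F -> exists C, flow_smooth u F C.
Proof.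
move=> [m [U [f [UC fs -> ->]]]].
have [A A0 HA] := common_bound (fun i => flow_smooth_weight (fs i)).
exact: flow_smooth_comp A0 UC HA.
Qed.

End CylinderFunctions.

(** * Convergence in L^2: domination, sums, comparison *)

Section SquareDominated.
Context d (T : measurableType d) (R : realType).
Variables (mu : {measure set T -> \bar R}) (D : set T).
Hypothesis mD : measurable D.

Lemma sq_dominated_cvg (fn : nat -> T -> R) (f h : T -> R) :
  (forall n, measurable_fun D (fn n)) -> measurable_fun D f ->
  mu.-integrable D (EFin \o h) ->
  (forall n x, D x -> (fn n x - f x) ^+ 2 <= h x) ->
  {ae mu, forall x, D x -> (fn ^~ x) @ \oo --> f x} ->
  (fun n => sq mu D (fun x => fn n x - f x)) @ \oo --> (0 : \bar R).
Proof.
move=> mfn mf ih fnh fnf.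
have md n : measurable_fun D (fun x => (fn n x - f x) ^+ 2).
  by apply: measurable_funX; apply: measurable_funB.
have cv := @Rintegral_dominated_cvg _ _ _ mu D (fun n x => (fn n x - f x) ^+ 2) (cst 0) h mD md
  (measurable_cst _) ih _ _.
have i n : mu.-integrable D (EFin \o (fun x => (fn n x - f x) ^+ 2)).
  apply: (le_integrable mD _ _ ih); first exact/measurable_EFinP.
  move=> x Dx /=; rewrite lee_fin ger0_norm ?sqr_ge0//.
  exact: le_trans (fnh n x Dx) (ler_norm _).
have E n : sq mu D (fun x => fn n x - f x) = (\int[mu]_(x in D) ((fn n x - f x) ^+ 2))%:E.
  by rewrite /sq /Rintegral fineK//; exact: (integrable_fin_num mD (i n)).
apply/fine_cvgP; split; first by apply: nearW => n; rewrite E.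
rewrite (_ : fine \o _ = fun n => \int[mu]_(x in D) ((fn n x - f x) ^+ 2)); last first.
  by apply/funext => n; rewrite /= E.
have -> : (0 : R) = \int[mu]_(x in D) (cst 0 x : R).
  by rewrite /Rintegral integral0_eq.
apply: cv => [n x Dx|]; first by rewrite ger0_norm ?sqr_ge0 ?fnh.
apply: filterS fnf => x xf Dx; 
rewrite /cst (_ : (0 : R) = (f x - f x) * (f x - f x)); last by rewrite subrr mul0r.
apply: cvgM; apply: cvgB; by [exact: xf|exact: cvg_cst].
Qed.

Lemma sqB_C (f h : T -> R) : sq mu D (fun x => f x - h x) = sq mu D (fun x => h x - f x).
Proof. by rewrite -sqN; congr sq; apply/funext => x; rewrite opprB. Qed.

Lemma sq_cvg0_add (fn hn : nat -> T -> R) :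
  (forall n, measurable_fun D (fn n)) -> (forall n, measurable_fun D (hn n)) ->
  (fun n => sq mu D (fn n)) @ \oo --> (0 : \bar R) ->
  (fun n => sq mu D (hn n)) @ \oo --> (0 : \bar R) ->
  (fun n => sq mu D (fun x => fn n x + hn n x)) @ \oo --> (0 : \bar R).
Proof.
move=> mf mh /(sq_cvg0P mu mf) f0 /(sq_cvg0P mu mh) h0.
have mfh n : measurable_fun D (fun x => fn n x + hn n x) by exact: measurable_funD.
apply/(sq_cvg0P mu mfh) => e e0; have e4 : 0 < e / 4 by rewrite divr_gt0.
near=> n; apply: (le_lt_trans (sq_le_add mu mD (mf n) (mh n))).
have h1 : (sq mu D (fn n) < (e / 4)%:E)%E by near: n; exact: f0.
have h2 : (sq mu D (hn n) < (e / 4)%:E)%E by near: n; exact: h0.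
have -> : e%:E = (2%:E * (e / 4)%:E + 2%:E * (e / 4)%:E)%E.
  by rewrite -!EFinM -EFinD; congr EFin; field.
apply: lteD; rewrite lte_pmul2l//.
Unshelve. all: by end_near. Qed.

Lemma sq_cvg0_sum (m : nat) (fn : nat -> 'I_m -> T -> R) :
  (forall n i, measurable_fun D (fn n i)) ->
  (forall i, (fun n => sq mu D (fn n i)) @ \oo --> (0 : \bar R)) ->
  (fun n => sq mu D (fun x => \sum_i fn n i x)) @ \oo --> (0 : \bar R).
Proof.
elim: m fn => [|m IH] fn mfn f0.
  apply: cvg_near_cst; apply: nearW => n; rewrite /sq integral0_eq// => x _.
  by rewrite big_ord0 expr0n.
rewrite (_ : (fun n => _) = fun n => sq mu D (fun x => \sum_(i < m) fn n (widen_ord (leqnSn m) i) x + fn n ord_max x)).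
  apply: sq_cvg0_add => //; first by move=> n; exact: measurable_sum.
  by apply: (IH (fun n i => fn n (widen_ord (leqnSn m) i))).
by apply/funext => n; congr sq; apply/funext => x; rewrite big_ord_recr.
Qed.

Lemma sq_cvg0_le (fn hn : nat -> T -> R) (c : R) :
  (forall n, measurable_fun D (fn n)) -> (forall n, measurable_fun D (hn n)) ->
  (forall n x, D x -> `|fn n x| <= c * `|hn n x|) ->
  (fun n => sq mu D (hn n)) @ \oo --> (0 : \bar R) ->
  (fun n => sq mu D (fn n)) @ \oo --> (0 : \bar R).
Proof.
move=> mf mh fh /(sq_cvg0P mu mh) h0; apply/(sq_cvg0P mu mf) => e e0.
have c1 : 0 < c ^+ 2 + 1 by rewrite ltr_wpDl// sqr_ge0.
have e1 : 0 < e / (c ^+ 2 + 1) by rewrite divr_gt0.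
near=> n; have h : (sq mu D (hn n) < (e / (c ^+ 2 + 1))%:E)%E by near: n; exact: h0.
apply: (@le_lt_trans _ _ ((c ^+ 2 + 1)%:E * sq mu D (hn n))%E).
  rewrite /sq -ge0_integralZl//; first last.
  - by rewrite lee_fin ltW.
  - by move=> x _; rewrite lee_fin sqr_ge0.
  - exact: measurable_sq.
  apply: ge0_le_integral => //.
  - by move=> x _; rewrite lee_fin sqr_ge0.
  - exact: measurable_sq.
  - by apply: emeasurable_funM => //; exact: measurable_sq.
  - move=> x Dx; rewrite -EFinM lee_fin mulrDl mul1r.
    rewrite -(real_normK (num_real (fn n x))) -(real_normK (num_real (hn n x))).
    have := fh n x Dx; have := normr_ge0 (fn n x); have := normr_ge0 (hn n x).
    move: (Num.norm (fn n x)) (Num.norm (hn n x)) => a b b0 a0 ab.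
    have : a ^+ 2 <= (c * b) ^+ 2 by rewrite ler_pXn2r ?nnegrE// (le_trans a0).
    rewrite exprMn; have := sqr_ge0 b; lra.
have -> : e%:E = ((c ^+ 2 + 1)%:E * (e / (c ^+ 2 + 1))%:E)%E by rewrite -EFinM mulrC divfK// gt_eqF.
by rewrite lte_pmul2l.
Unshelve. all: by end_near. Qed.

End SquareDominated.

(** * Density of continuous derivatives in L^2([0, 1]) *)

Section Density.
Variable R : realType.
Local Notation leb := (@lebesgue_measure R).
Local Notation I01 := (@I01 R).

Definition tru (M x : R) : R := Num.max (- M) (Num.min M x).

Lemma truP (M x : R) : 0 <= M ->
  (x <= - M /\ tru M x = - M) \/ (- M <= x <= M /\ tru M x = x) \/ (M <= x /\ tru M x = M).
Proof.
move=> M0; rewrite /tru; have [xM|xM] := leP x (- M).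
  left; split => //; rewrite min_r ?max_l//; lra.
right; have [xM'|xM'] := leP x M; [left|right].
  by rewrite (ltW xM) max_r// ltW.
by split; [exact: ltW|rewrite max_r//; lra].
Qed.

Lemma tru_bound (M x : R) : 0 <= M -> `|tru M x| <= M.
Proof. by move=> M0; rewrite ler_norml; case: (truP x M0) => [[? ->]|[[? ->]|[? ->]]]; lra. Qed.

Lemma tru_id (M x : R) : `|x| <= M -> tru M x = x.
Proof.
move=> xM; have M0 : 0 <= M by exact: le_trans xM.
by move: xM; rewrite ler_norml; case: (truP x M0) => [[? ->]|[[? ->]|[? ->]]]; lra.
Qed.

Lemma tru_lip (M x y : R) : 0 <= M -> `|tru M x - tru M y| <= `|x - y|.
Proof.
move=> M0; have h1 := ler_norm (x - y); have h2 := ler_norm (y - x); rewrite (distrC y x) in h2.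
by case: (truP x M0) => [[? ->]|[[? ->]|[? ->]]]; case: (truP y M0) => [[? ->]|[[? ->]|[? ->]]];
  rewrite ler_norml; lra.
Qed.

Lemma tru_dist (M x : R) : 0 <= M -> `|tru M x - x| <= `|x|.
Proof.
move=> M0; have h1 := ler_norm x; have h2 := ler_norm (- x); rewrite normrN in h2.
by rewrite ler_norml; case: (truP x M0) => [[? ->]|[[? ->]|[? ->]]]; lra.
Qed.

Lemma tru_continuous (M : R) : 0 <= M -> continuous (tru M).
Proof.
move=> M0 x; apply/cvgrPdist_lt => /= e e0; near=> y.
apply: (le_lt_trans (tru_lip _ _ M0)); near: y; exact: cvgr_dist_lt.
Unshelve. all: by end_near. Qed.

(* The cutoff [chi (2 x + 1)] makes the function vanish below -1 without changing it on [0,1]. *)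
Lemma continuous_antiderivative (h : R -> R) : continuous h ->
  exists2 psi, C1real psi & forall s, I01 s -> derive1 psi s = h s.
Proof.
move=> ch; pose k x : R := h x * chi (2 * x + 1).
have cchi : continuous (@chi R).
  by move=> x; apply: differentiable_continuous; apply/derivable1_diffP; case: (chi_derive x).
have ck : continuous k.
  move=> x; have c1 : {for x, continuous (fun x : R => 2 * x + 1)}.
    by apply: cvgD; [apply: cvgM; [exact: cvg_cst|exact: cvg_id]|exact: cvg_cst].
  have c2 := continuous_comp c1 (cchi (2 * x + 1)).
  exact: (cvgM (ch x) c2).
have ik u : leb.-integrable `]-oo, u]%classic (EFin \o k).
  apply/(integrable_mkcond (mu := leb) (EFin \o k)) => //.
  have := (integrable_mkcond (mu := leb) (D := `[-1, u]%classic) (EFin \o k) (measurable_itv _)).1.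
  rewrite (_ : (EFin \o k) \_ `]-oo, u] = (EFin \o k) \_ `[-1, u]); last first.
    apply/funext => x; rewrite !patchE !mem_setE !in_itv /=.
    have [x1|x1] := leP (-1) x => //=.
    by rewrite /k chi_le0 ?mulr0 ?if_same//; lra.
  apply; apply: continuous_compact_integrable; first exact: segment_compact.
  exact: continuous_subspaceT.
pose psi x : R := \int[leb]_(t in `]-oo, x]) k t.
have D x : derivable psi x 1 /\ derive1 psi x = k x.
  apply: (@continuous_FTC1 R k -oo%O x (x + 1)); [by rewrite ltrDl|exact: ik|by rewrite ?bnd_simp ?ltNyr|exact: ck].
have E : derive1 psi = k by apply/funext => x; case: (D x).
exists psi; first by split; [move=> x; case: (D x)|rewrite E].
move=> s /I01P/andP[s0 _]; rewrite E /k chi_ge1 ?mulr1//; lra.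
Qed.

(** Truncation at level [M] costs little in L^2. The truncated function is approximated in L^1 by a
    continuous one, truncated in turn: for functions bounded by [M], the squared L^2 distance is at
    most [2 M] times the L^1 distance. *)
Lemma L2_density (f : R -> R) (e : R) : sqi leb I01 f -> 0 < e ->
  exists2 psi, C1real psi & (sq leb I01 (fun s => derive1 psi s - f s)%R < e%:E)%E.
Proof.
move=> sf e0; have mI := @measurable_I01 R; have mf := sf.1.
have e4 : 0 < e / 4 by rewrite divr_gt0.
have mtru M : 0 <= M -> measurable_fun setT (tru M).
  by move=> M0; apply: continuous_measurable_fun; exact: tru_continuous.
have mt n : measurable_fun I01 (fun s => tru n%:R (f s)).
  by apply: (measurableT_comp (mtru _ (ler0n R n))).
have cv : (fun n => sq leb I01 (fun s => tru n%:R (f s) - f s)) @ \oo --> (0 : \bar R).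
  apply: (@sq_dominated_cvg _ _ _ leb I01 mI (fun n s => tru n%:R (f s)) f (fun s => f s ^+ 2)) => //.
  - exact: sqi_integrable.
  - move=> n s _; rewrite -(real_normK (num_real (_ - _))) -[leRHS]real_normK ?num_real//.
    by rewrite ler_pXn2r ?nnegrE//; exact: tru_dist.
  - apply: aeW => s _; apply: cvg_near_cst; near=> n; apply: tru_id.
    by near: n; exact: nbhs_infty_ger.
have md n : measurable_fun I01 (fun s => tru n%:R (f s) - f s) by exact: measurable_funB.
have [M _ /(_ M (leqnn M)) HM] := (sq_cvg0P leb md).1 cv _ e4.
have M0 : 0 <= M%:R :> R by [].
pose fM s := tru M%:R (f s).
have ifM : leb.-integrable I01 (EFin \o fM).
  by apply: (@bounded_integrable _ fM (M%:R) (mt M)) => s _; exact: tru_bound.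
have lebfin : (leb I01 < +oo)%E by rewrite leb_I01 ltry.
have [g [cg ig]] := approximation_continuous_integrable mI lebfin ifM.
(* An L^1 error [c] of this size gives [2 M c <= e / 4]. *)
have c0 : 0 < e / (8 * (M%:R + 1)) by rewrite divr_gt0// mulr_gt0// ltr_wpDl.
case/fine_cvgP => -[m _ fgfin] /cvgrPdist_le/(_ _ c0)[p _ /(_ _ (leq_addr m p))].
set n := (p + m)%N; rewrite sub0r normrN /= => Hn.
have {fgfin} Fin : (\int[leb]_(z in I01) `|(fM z - g n z)%:E|)%E \is a fin_num.
  by apply: fgfin; rewrite /= leq_addl.
have ch : continuous (fun x => tru M%:R (g n x)).
  by move=> x; apply: continuous_comp; [exact: cg|exact: tru_continuous].
have [psi psiC psiE] := continuous_antiderivative ch; exists psi => //.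
pose h s := tru M%:R (g n s).
have mh : measurable_fun I01 h by apply: measurable_funTS; exact: continuous_measurable_fun.
have mhf : measurable_fun I01 (fun s => h s - fM s) by apply: measurable_funB => //; exact: mt.
have S1 : (sq leb I01 (fun s => h s - fM s)%R <= (e / 4)%:E)%E.
  apply: (@le_trans _ _ (\int[leb]_(z in I01) ((2 * M%:R)%:E * `|(fM z - g n z)%:E|))%E).
    have mfg : measurable_fun I01 (fun z => `|(fM z - g n z)%:E|%E).
      apply: measurableT_comp => //; apply/measurable_EFinP; apply: measurable_funB; first exact: mt.
      by apply: measurable_funTS; exact: continuous_measurable_fun.
    apply: ge0_le_integral => //.
    - by move=> s _; rewrite lee_fin sqr_ge0.
    - exact: measurable_sq.
    - exact: emeasurable_funM.
    - move=> s _; rewrite -EFinM lee_fin -(real_normK (num_real (h s - fM s))) expr2.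
      have hb := tru_bound (g n s) M0; have fb := tru_bound (f s) M0.
      rewrite ler_pM//; first by rewrite (le_trans (ler_normB _ _))// /h /fM; lra.
      rewrite distrC; have : fM s = tru M%:R (fM s) by rewrite tru_id.
      by move=> {1}->; exact: tru_lip.
  rewrite ge0_integralZl//; first last.
  - by apply: measurableT_comp => //; apply/measurable_EFinP; apply: measurable_funB; [exact: mt|
      by apply: measurable_funTS; exact: continuous_measurable_fun].
  rewrite -(fineK Fin) -EFinM lee_fin.
  have I0 : 0 <= fine (\int[leb]_(z in I01) `|(fM z - g n z)%:E|)%E.
    by apply: fine_ge0; exact: integral_ge0.
  rewrite ger0_norm// in Hn; apply: (@le_trans _ _ (2 * M%:R * (e / (8 * (M%:R + 1))))).
    by rewrite ler_wpM2l// mulr_ge0.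
  rewrite mulrA ler_pdivrMr ?mulr_gt0 ?ltr_wpDl//.
  rewrite (_ : e / 4 * _ = 2 * M%:R * e + 2 * e); last by field.
  by rewrite lerDl mulr_ge0// ltW.
have -> : sq leb I01 (fun s => derive1 psi s - f s)%R = sq leb I01 (fun s => (h s - fM s) + (fM s - f s))%R.
  apply: eq_integral => s; rewrite inE => s1; rewrite psiE//; congr (_ ^+ 2)%:E.
  by rewrite addrA subrK.
apply: (le_lt_trans (sq_le_add leb mI mhf (md M))).
have -> : e%:E = (2%:E * (e / 4)%:E + 2%:E * (e / 4)%:E)%E.
  by rewrite -!EFinM -EFinD; congr EFin; field.
apply: (le_lt_trans (leeD2r _ (lee_wpmul2l _ S1))); first by rewrite lee_fin.
by rewrite lteD2lE// lte_pmul2l.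
Unshelve. all: by end_near. Qed.

End Density.

(** * Limits of cylinder functions together with their gradients *)

Section CompositionLimit.
Variables (R : realType) (Q : probability (G0m R) R).
Local Notation leb := (@lebesgue_measure R).
Local Notation I01 := (@I01 R).
Local Notation unc F := (fun p : G0m R * measurableTypeR R => F p.1 p.2).
Local Notation QI := (Q \x leb)%E.

(** Joint measurability of a row of functions, tested on the continuous functions of the row; it
    will be applied to [U] and its partial derivatives. *)
Definition measurable_row (m : nat) (Y : 'I_m -> G0m R -> R) :=
  forall h : 'rV[R]_m -> R, continuous h -> measurable_fun setT (fun g => h (\row_i Y i g)).

Lemma row_cvg (T : Type) (G : set_system T) {FG : Filter G} (m : nat) (x : T -> 'I_m -> R) (l : 'I_m -> R) :
  (forall i, (fun n => x n i) @ G --> l i) ->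
  (fun n => (\row_i x n i : 'rV[R]_m)) @ G --> (\row_i l i : 'rV[R]_m).
Proof.
move=> xl; apply/cvg_ballP => e e0.
have /filter_forall : forall i, \forall n \near G, ball (l i) e (x n i).
  by move=> i; apply: (cvg_ball (xl i)).
apply: filterS => n h; split => // a i; rewrite !mxE; exact: h.
Qed.

Lemma ae_prod_fst (P : G0m R -> Prop) : {ae Q, forall g, P g} -> {ae QI, forall p, P p.1}.
Proof.
move=> [N [mN N0 NP]]; exists (N `*` setT); split.
- exact: measurableX.
- by rewrite product_measure1E// [X in (X * _)%E]N0 mul0e.
- by move=> [g s] /= h; split => //; exact: NP.
Qed.

(** The gradient error splits in two. The partials at [Yn] times [Dn - D] tend to 0 because partials
    are bounded on the box. The differences of partials times [D] are dominated by a multiple of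
    [D ^ 2] and tend to 0 almost everywhere. *)
Lemma comp_limit (m : nat) (U : 'rV[R]_m -> R) (Y : 'I_m -> G0m R -> R) (D : 'I_m -> G0m R -> R -> R)
    (Yn : nat -> 'I_m -> G0m R -> R) (Dn : nat -> 'I_m -> G0m R -> R -> R) (A : R) :
  C1fun U -> (forall i g, `|Y i g| <= A) -> (forall n i g, `|Yn n i g| <= A) ->
  measurable_row Y -> (forall n, measurable_row (Yn n)) ->
  (forall i, sqi QI (@GI R) (unc (D i))) -> (forall n i, measurable_fun (@GI R) (unc (Dn n i))) ->
  (forall i, {ae Q, forall g, (fun n => Yn n i g) @ \oo --> Y i g}) ->
  (forall i, (fun n => sq QI (@GI R) (fun p => Dn n i p.1 p.2 - D i p.1 p.2)) @ \oo --> (0 : \bar R)) ->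
  (fun n => sq Q setT (fun g => U (\row_i Yn n i g) - U (\row_i Y i g))) @ \oo --> (0 : \bar R) /\
  (fun n => sq QI (@GI R) (fun p =>
     \sum_i 'D_(delta_mx 0 i) U (\row_j Yn n j p.1) * Dn n i p.1 p.2 -
     \sum_i 'D_(delta_mx 0 i) U (\row_j Y j p.1) * D i p.1 p.2)) @ \oo --> (0 : \bar R).
Proof.
move=> UC YA YnA mY mYn sD mDn Ycv Dcv.
have [C C0 HC] := C1fun_box A UC; have mG := @measurable_GI R.
have hY g : `|U (\row_i Y i g)| <= C /\ forall i, `|'D_(delta_mx 0 i) U (\row_j Y j g)| <= C.
  by apply: HC => i; rewrite mxE.
have hYn n g : `|U (\row_i Yn n i g)| <= C /\ forall i, `|'D_(delta_mx 0 i) U (\row_j Yn n j g)| <= C.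
  by apply: HC => i; rewrite mxE.
have rcv : {ae Q, forall g, (fun n => (\row_i Yn n i g : 'rV[R]_m)) @ \oo --> (\row_i Y i g : 'rV[R]_m)}.
  have H1 : {ae Q, forall g, forall i, (fun n => Yn n i g) @ \oo --> Y i g}.
    exact: (@filter_forall _ 'I_m (fun i g => (fun n => Yn n i g) @ \oo --> Y i g) (almost_everywhere Q) _ Ycv).
  by apply: filterS H1 => g h; exact: (@row_cvg _ _ _ m (fun n i => Yn n i g) (fun i => Y i g) h).
have sqd (a b : R) : `|a| <= C -> `|b| <= C -> (a - b) ^+ 2 <= (2 * C) ^+ 2.
  move=> h1 h2; rewrite -(real_normK (num_real (a - b))) ler_pXn2r ?nnegrE ?mulr_ge0//.
  by rewrite (le_trans (ler_normB _ _))//; lra.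
split.
  apply: (@sq_dominated_cvg _ _ _ Q setT measurableT (fun n g => U (\row_i Yn n i g)) (fun g => U (\row_i Y i g)) (cst ((2 * C) ^+ 2))) => //.
  - by move=> n; apply: mYn; exact: C1fun_continuous.
  - by apply: mY; exact: C1fun_continuous.
  - by apply: (@prob_bounded_integrable _ _ _ `|(2 * C) ^+ 2|).
  - by move=> n g _; apply: sqd; [exact: (hYn n g).1|exact: (hY g).1].
  - by apply: filterS rcv => g h _; apply: continuous_cvg => //; exact: C1fun_continuous.
have mdU n i : measurable_fun (@GI R) (fun p : G0m R * measurableTypeR R => 'D_(delta_mx 0 i) U (\row_j Yn n j p.1)).
  by apply: measurable_funTS; exact: (measurableT_comp (mYn n _ (UC.2 i)) measurable_fst).
have mdU0 i : measurable_fun (@GI R) (fun p : G0m R * measurableTypeR R => 'D_(delta_mx 0 i) U (\row_j Y j p.1)).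
  by apply: measurable_funTS; exact: (measurableT_comp (mY _ (UC.2 i)) measurable_fst).
pose E1 n (i : 'I_m) (p : G0m R * measurableTypeR R) := 'D_(delta_mx 0 i) U (\row_j Yn n j p.1) * (Dn n i p.1 p.2 - D i p.1 p.2).
pose E2 n (i : 'I_m) (p : G0m R * measurableTypeR R) := 'D_(delta_mx 0 i) U (\row_j Yn n j p.1) * D i p.1 p.2 - 'D_(delta_mx 0 i) U (\row_j Y j p.1) * D i p.1 p.2.
have mE1 n i : measurable_fun (@GI R) (E1 n i).
  apply: measurable_funM => //; apply: measurable_funB => //; exact: (sD i).1.
have mE2 n i : measurable_fun (@GI R) (E2 n i).
  by apply: measurable_funB; apply: measurable_funM => //; exact: (sD i).1.
rewrite (_ : (fun n => _) = fun n => sq QI (@GI R) (fun p => \sum_i (E1 n i p + E2 n i p))); last first.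
  apply/funext => n; congr sq; apply/funext => p; rewrite -sumrB; apply: eq_bigr => i _.
  by rewrite /E1 /E2; ring.
apply: (sq_cvg0_sum mG) => [n i|i]; first exact: measurable_funD.
apply: (sq_cvg0_add mG) => //.
  apply: (@sq_cvg0_le _ _ _ QI _ mG _ (fun n p => Dn n i p.1 p.2 - D i p.1 p.2) C) => //.
  - by move=> n; apply: measurable_funB => //; exact: (sD i).1.
  - by move=> n p _; rewrite normrM ler_wpM2r//; exact: (hYn n p.1).2.
apply: (@sq_dominated_cvg _ _ _ QI _ mG
   (fun n p => 'D_(delta_mx 0 i) U (\row_j Yn n j p.1) * D i p.1 p.2)
   (fun p => 'D_(delta_mx 0 i) U (\row_j Y j p.1) * D i p.1 p.2)
   (fun p => (2 * C) ^+ 2 * (D i p.1 p.2) ^+ 2)).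
- by move=> n; apply: measurable_funM => //; exact: (sD i).1.
- by apply: measurable_funM => //; exact: (sD i).1.
- have := integrableZl mG ((2 * C) ^+ 2) (sqi_integrable mG (sD i)).
  by congr (is_true (integrable _ _ _)); apply/funext.
- move=> n p _; rewrite -mulrBl exprMn ler_wpM2r ?sqr_ge0//.
  by apply: sqd; [exact: (hYn n p.1).2|exact: (hY p.1).2].
- apply: filterS (ae_prod_fst rcv) => p h _; apply: cvgM; last exact: cvg_cst.
  have c := UC.2 i (\row_j Y j p.1); exact: (cvg_comp _ _ h c).
Qed.

End CompositionLimit.

(** * Composites stay in their cylinder class *)

Section GraphComposite.
Variable R : realType.
Local Notation leb := (@lebesgue_measure R).
Local Notation I01 := (@I01 R).

Section Composite.
Variables (m n : nat) (U : 'rV[R]_m -> R) (a : 'I_m -> 'I_n -> R -> R).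
Hypotheses (UC : C1fun U) (aC : forall i k, C1real (a i k)).

Lemma Zgraph_composite (al : 'I_n -> R -> R) : (forall k, C1real (al k)) ->
  let z (g : G0m R) k := Rint01 (fun s => al k (gfun g s)) in
  Zgraph (fun g => U (\row_i \sum_k a i k (z g k)))
    (fun g s => \sum_i 'D_(delta_mx 0 i) U (\row_i \sum_k a i k (z g k)) *
       \sum_k derive1 (a i k) (z g k) * derive1 (al k) (gfun g s)).
Proof.
move=> alC z; have [VC VD] := C1fun_composite UC aC.
exists n, (fun x => U (\row_i \sum_k a i k (x 0 k))), al.
have E g : \row_i \sum_k a i k ((\row_j z g j : 'rV[R]_n) 0 k) = \row_i \sum_k a i k (z g k).
  by apply/rowP => i; rewrite !mxE; apply: eq_bigr => k _; rewrite mxE.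
split => //; first by apply/funext => g; rewrite E.
apply/funext => g; apply/funext => s.
under [RHS]eq_bigr => k _.
  rewrite VD E mulr_suml.
  under eq_bigr => i _ do rewrite mxE -mulrA.
  over.
rewrite exchange_big; apply: eq_bigr => i _ /=; by rewrite mulr_sumr.
Qed.

Lemma Cgraph_composite (f : 'I_n -> R -> R) : (forall k, sqi leb I01 (f k)) ->
  let z (g : G0m R) k := Rint01 (fun s => f k s * gfun g s) in
  Cgraph (fun g => U (\row_i \sum_k a i k (z g k)))
    (fun g s => \sum_i 'D_(delta_mx 0 i) U (\row_i \sum_k a i k (z g k)) *
       \sum_k derive1 (a i k) (z g k) * f k s).
Proof.
move=> fs z; have [VC VD] := C1fun_composite UC aC.
exists n, (fun x => U (\row_i \sum_k a i k (x 0 k))), f.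
have E g : \row_i \sum_k a i k ((\row_j z g j : 'rV[R]_n) 0 k) = \row_i \sum_k a i k (z g k).
  by apply/rowP => i; rewrite !mxE; apply: eq_bigr => k _; rewrite mxE.
split => //; first by apply/funext => g; rewrite E.
apply/funext => g; apply/funext => s.
under [RHS]eq_bigr => k _.
  rewrite VD E mulr_suml.
  under eq_bigr => i _ do rewrite mxE -mulrA.
  over.
rewrite exchange_big; apply: eq_bigr => i _ /=; by rewrite mulr_sumr.
Qed.

End Composite.

Lemma continuous_sum_coord (n : nat) (a : 'I_n -> R -> R) : (forall k, continuous (a k)) ->
  continuous (fun x : 'rV[R]_n => \sum_k a k (x 0 k)).
Proof.
move=> ca x; rewrite (_ : (fun x => _) = \sum_k (fun x : 'rV[R]_n => a k (x 0 k))); last first.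
  by apply/funext => y; rewrite fct_sumE.
elim/big_ind: _ => [|f g cf cg|i _]; [exact: cst_continuous|exact: continuousD|].
by apply: continuous_comp; [exact: coord_continuous|exact: ca].
Qed.

Lemma measurable_row_composite (m n : nat) (a : 'I_m -> 'I_n -> R -> R) (z : 'I_n -> G0m R -> R) (L : 'I_n -> R) :
  (forall i k, continuous (a i k)) -> (forall k, L2lip (z k) (L k)) ->
  measurable_row (fun i g => \sum_k a i k (z k g)).
Proof.
move=> ca zL h ch.
have ch' : continuous (fun x : 'rV[R]_n => h (\row_i \sum_k a i k (x 0 k))).
  move=> x; apply: (@continuous_comp _ _ _ (fun x : 'rV[R]_n => (\row_i \sum_k a i k (x 0 k) : 'rV[R]_m)) h).
    apply: (@row_cvg R _ (nbhs x) _ m (fun (x : 'rV[R]_n) i => \sum_k a i k (x 0 k)) (fun i => \sum_k a i k (x 0 k))).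
    by move=> i; exact: (continuous_sum_coord (ca i)).
  exact: ch.
have := continuous_L2lip_measurable ch' zL; congr measurable_fun; apply/funext => g.
by congr h; apply/rowP => i; rewrite !mxE; apply: eq_bigr => k _; rewrite mxE.
Qed.

End GraphComposite.

(** * Elementary integrals over [0, 1] *)

Section UnitIntervalIntegrals.
Variable R : realType.
Local Notation leb := (@lebesgue_measure R).
Local Notation I01 := (@I01 R).
Implicit Types (f h : R -> R).

Definition int01 f := leb.-integrable I01 (EFin \o f).

Lemma Rint01_le f h : int01 f -> int01 h -> (forall s, I01 s -> f s <= h s) -> Rint01 f <= Rint01 h.
Proof. by move=> fi hi fh; apply: le_Rintegral. Qed.

Lemma Rint01_norm f : int01 f -> `|Rint01 f| <= Rint01 (fun s => `|f s|).
Proof. by move=> fi; apply: le_normr_Rintegral. Qed.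

Lemma Rint01_sum (m : nat) (f : 'I_m -> R -> R) : (forall i, int01 (f i)) ->
  int01 (fun s => \sum_i f i s) /\ Rint01 (fun s => \sum_i f i s) = \sum_i Rint01 (f i).
Proof.
elim: m f => [|m IH] f fi.
  have -> : (fun s => \sum_(i < 0) f i s) = (fun=> 0) by apply/funext => s; rewrite big_ord0.
  rewrite big_ord0 Rint01_cst; split => //.
  by apply: (@bounded_integrable _ _ 0) => // s _; rewrite normr0.
have -> : (fun s => \sum_(i < m.+1) f i s) = (fun s => \sum_(i < m) f (widen_ord (leqnSn m) i) s + f ord_max s).
  by apply/funext => s; rewrite big_ord_recr.
have [h1 h2] := IH (fun i => f (widen_ord (leqnSn m) i)) (fun i => fi _).
split; first exact: (integrableD (@measurable_I01 R) h1 (fi ord_max)).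
by rewrite big_ord_recr /= -h2 /Rint01 RintegralD//; exact: fi.
Qed.

Lemma measurable_ltr (c : R) D : measurable_fun D (fun s : R => (s < c)%R%:R : R).
Proof.
apply: measurable_funTS.
have := @measurable_indic _ (measurableTypeR R) R setT `]-oo, c[%classic (measurable_itv _).
by congr measurable_fun; apply/funext => s; rewrite indicE mem_setE/= in_itv.
Qed.

Lemma measurable_ler (c : R) D : measurable_fun D (fun s : R => (c <= s)%R%:R : R).
Proof.
apply: measurable_funTS.
have := @measurable_indic _ (measurableTypeR R) R setT `[c, +oo[%classic (measurable_itv _).
by congr measurable_fun; apply/funext => s; rewrite indicE mem_setE/= in_itv/= andbT.
Qed.

Lemma int01_bounded f (M : R) : measurable_fun I01 f -> (forall s, I01 s -> `|f s| <= M) -> int01 f.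
Proof. by move=> mf fM; apply: (@bounded_integrable _ _ M). Qed.

Lemma int01_bool (b : R -> bool) : measurable_fun I01 (fun s => (b s)%:R : R) -> int01 (fun s => (b s)%:R).
Proof. by move=> mb; apply: (int01_bounded (M := 1) mb) => s _; case: (b s); rewrite ?normr1 ?normr0. Qed.

Lemma Rint01_ltr (t : R) : I01 t -> Rint01 (fun s => (s < t)%R%:R) = t.
Proof.
move=> /I01P/andP[t0 t1].
rewrite (_ : (fun s => _) = \1_(`]-oo, t[%classic : set R)); last first.
  by apply/funext => s; rewrite indicE mem_setE/= in_itv.
rewrite /Rint01 /Rintegral integral_indic//.
rewrite (_ : `]-oo, t[ `&` I01 = `[0, t[%classic); last first.
  apply/seteqP; split => s /=; rewrite !in_itv /=.
    by move=> [st /I01P/andP[-> _]].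
  by move=> /andP[s0 st]; split => //; apply/I01P; rewrite s0 (le_trans (ltW st)).
have h : leb `[0, t[%classic = t%:E.
  rewrite lebesgue_measure_itv /= lte_fin; case: ltgtP t0 => // [t0|<-] _; last by [].
  by rewrite oppr0 adde0.
exact: (congr1 fine h).
Qed.

(** With [z] a quantile, summing this identity over the levels turns [psi 1 - psi z] into the
    integral of [psi'] against the number of quantiles below [t]. *)
Lemma FTC_indicator (psi : R -> R) (z : R) : C1real psi -> I01 z ->
  psi 1 - psi z = Rint01 (fun t => derive1 psi t * (z <= t)%R%:R).
Proof.
move=> psiC /I01P/andP[z0 z1].
have cd := psiC.2; have cp := C1real_continuous psiC.
rewrite /Rint01 (_ : (fun t => _) = (derive1 psi) \_ `[z, +oo[%classic); last first.
  apply/funext => t; rewrite patchE mem_setE/= in_itv/= andbT.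
  by case: (z <= t); rewrite ?mulr1 ?mulr0.
rewrite -Rintegral_mkcondr (_ : I01 `&` _ = `[z, 1]%classic); last first.
  apply/seteqP; split => s /=; rewrite !in_itv /= andbT.
    by move=> [/I01P/andP[_ ->] ->].
  by move=> /andP[zs s1]; split => //; apply/I01P; rewrite s1 (le_trans z0).
move: z1; rewrite le_eqVlt => /predU1P[->|z1].
  by rewrite subrr set_itv1 Rintegral_set1.
rewrite /Rintegral (@continuous_FTC2 R (derive1 psi) psi z 1)//.
- exact: continuous_subspaceT.
- split => //; first by move=> x _; exact: psiC.1.
  + by apply: cvg_at_right_filter; exact: cp.
  + by apply: cvg_at_left_filter; exact: cp.
Qed.

End UnitIntervalIntegrals.

(** * Smoothed quantiles *)

Section Quantiles.
Variable R : realType.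
Local Notation leb := (@lebesgue_measure R).
Local Notation I01 := (@I01 R).
Implicit Types (g : G0m R) (n k : nat).

Lemma tent_continuous : continuous (@tent R).
Proof.
move=> x; apply/cvgrPdist_lt => /= e e0; near=> y.
rewrite (le_lt_trans (tent_lip x y))// mulrC -ltr_pdivlMr//.
by near: y; apply: cvgr_dist_lt; rewrite ?divr_gt0.
Unshelve. all: by end_near. Qed.

(* A C^1 version of the indicator of [x < k / n.+1], so that [quant n k g] below
   is a smoothed measure of [{g < k / n.+1}]. *)
Definition lvl n k (x : R) : R := chi (k%:R - n.+1%:R * x).

Lemma lvl_C1 n k : C1real (lvl n k) /\
  derive1 (lvl n k) = fun x => - (n.+1%:R * tent (k%:R - n.+1%:R * x)).
Proof.
have aff x : {for x, continuous (fun x : R => k%:R - n.+1%:R * x)}.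
  by apply: cvgB; [exact: cvg_cst|apply: cvgM; [exact: cvg_cst|exact: cvg_id]].
apply: is_derive_C1real.
  move=> x; have d : is_derive x (1 : R) ((@chi R) \o (fun x : R => k%:R - n.+1%:R * x))
     (tent (k%:R - n.+1%:R * x) * (- n.+1%:R)).
    apply: is_derive1_comp; first exact: chi_derive.
    by apply: (@is_derive_quadratic _ _ _ 0) => y; rewrite (_ : _ - _ - _ = 0) ?normr0 ?mul0r//; ring.
  by apply: (is_derive_eq d); ring.
move=> x.
have c2 := @continuous_comp _ _ _ (fun x : R => k%:R - n.+1%:R * x) (@tent R) x (aff x) (@tent_continuous _).
by apply: cvgN; apply: (cvgM (cvg_cst (n.+1%:R : R)) c2).
Qed.

Definition quant n k g : R := Rint01 (fun s => lvl n k (gfun g s)).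

Lemma int01_lvl n k g : int01 (fun s => lvl n k (gfun g s)).
Proof.
apply: (@int01_bounded _ _ 1).
  apply: (measurableT_comp (continuous_measurable_fun (C1real_continuous (lvl_C1 n k).1))).
  exact: measurable_G0.
by move=> s _; rewrite /lvl; case/andP: (chi_itv (k%:R - n.+1%:R * g s)) => h1 h2; rewrite ger0_norm.
Qed.

Lemma quant_itv n k g : I01 (quant n k g).
Proof.
apply/I01P; apply: Rint01_le_cst; last by move=> s _; exact: chi_itv.
by apply/measurable_EFinP; exact: measurable_int (int01_lvl n k g).
Qed.

(** The smoothed indicator vanishes only from [n.+1 * x = k + 1] on, which accounts for the margin
    1. *)
Lemma quant_le n k g t : I01 t -> k%:R + 1 <= n.+1%:R * g t -> quant n k g <= t.
Proof.
move=> t01 kt; rewrite -[leRHS](Rint01_ltr t01); apply: Rint01_le.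
- exact: int01_lvl.
- by apply: int01_bool; exact: measurable_ltr.
move=> s _; have [st|ts] := ltP s t.
  by case/andP: (chi_itv (k%:R - n.+1%:R * g s)).
have h : n.+1%:R * g t <= n.+1%:R * g s by rewrite ler_wpM2l// G0_nondecreasing.
by rewrite /lvl chi_le0//; lra.
Qed.

Lemma quant_ge n k g t : I01 t -> n.+1%:R * g t <= k%:R - 1 -> t <= quant n k g.
Proof.
move=> t01 kt; rewrite -[leLHS](Rint01_ltr t01); apply: Rint01_le.
- by apply: int01_bool; exact: measurable_ltr.
- exact: int01_lvl.
move=> s _; have [st|ts] := ltP s t; last first.
  by case/andP: (chi_itv (k%:R - n.+1%:R * g s)).
have h : n.+1%:R * g s <= n.+1%:R * g t by rewrite ler_wpM2l// G0_nondecreasing// ltW.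
by rewrite /lvl chi_ge1//; lra.
Qed.

(** Here [b k] is true for [k <= x - 1] and false for [k > x + 1], so about [x] of its values are
    true. The count is squeezed between two sums of unit ramps [dl], which telescope. *)
Lemma count_bound (m : nat) (x : R) (b : nat -> bool) : 0 <= x <= m%:R ->
  (forall k, k%:R + 1 <= x -> b k) -> (forall k, (k <= m)%N -> b k -> k%:R - 1 <= x) ->
  `|\sum_(k < m.+1) (b k)%:R - x| <= 3.
Proof.
move=> /andP[x0 xm] h1 h2; pose dl (y : R) : R := pos y - pos (y - 1).
have E y : \sum_(k < m.+1) dl (y - k%:R) = pos y - pos (y - m.+1%:R).
  elim: m.+1 => [|p IH]; first by rewrite big_ord0 subr0 subrr.
  rewrite big_ord_recr /= IH /dl -natr1 (_ : y - (p%:R + 1) = y - p%:R - 1); last by ring.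
  by ring.
have dl_itv y : 0 <= dl y <= 1.
  by rewrite /dl; case: (posP y) => -[a ->]; case: (posP (y - 1)) => -[c ->]; lra.
have lo : pos (x - 1) <= \sum_(k < m.+1) (b k)%:R.
  have -> : pos (x - 1) = \sum_(k < m.+1) dl (x - 1 - k%:R).
    rewrite E; case: (posP (x - 1 - m.+1%:R)) => -[c ->]; last by rewrite subr0.
    by rewrite -natr1 in c *; case: (posP (x - 1)) => -[d ->]; lra.
  apply: ler_sum => k _; have [kx|kx] := leP (k%:R + 1) x.
    by rewrite (h1 _ kx); case/andP: (dl_itv (x - 1 - k%:R)).
  apply: (@le_trans _ _ 0); last by case: (b k).
  by rewrite /dl; case: (posP (x - 1 - k%:R)) => -[c ->]; case: (posP (x - 1 - k%:R - 1)) => -[d ->]; lra.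
have hi : \sum_(k < m.+1) (b k)%:R <= x + 2.
  apply: (@le_trans _ _ (\sum_(k < m.+1) dl (x + 2 - k%:R))).
    apply: ler_sum => k _; case bk : (b k); last by case/andP: (dl_itv (x + 2 - k%:R)).
    have := h2 k _ bk; rewrite -ltnS => /(_ (ltn_ord k)) h.
    rewrite (_ : true%:R = 1 :> R)// /dl.
    by case: (posP (x + 2 - k%:R)) => -[c ->]; case: (posP (x + 2 - k%:R - 1)) => -[d ->]; lra.
  rewrite E; case: (posP (x + 2)) => -[c ->]; case: (posP (x + 2 - m.+1%:R)) => -[d ->]; lra.
have h3 : x - 1 <= pos (x - 1) by case: (posP (x - 1)) => -[c ->]; lra.
rewrite ler_norml; lra.
Qed.

Variable psi : R -> R.
Hypothesis psiC : C1real psi.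

Definition tail n (z : R) : R := (psi 1 - psi z) / n.+1%:R.

Lemma tail_C1 n : C1real (tail n) /\ derive1 (tail n) = fun z => - (derive1 psi z / n.+1%:R).
Proof.
apply: is_derive_C1real => z.
  have d := is_deriveB (is_derive_cst (psi 1) z (1 : R)) (C1real_is_derive psiC z).
  have d2 := is_deriveZ (n.+1%:R^-1) d.
  rewrite (_ : tail n = (n.+1%:R^-1 : R) \*: (cst (psi 1) - psi)); last first.
    by apply/funext => y; rewrite /tail mulrC.
  by apply: (is_derive_eq d2); rewrite sub0r scalerN /GRing.scale /= mulrC.
apply: cvgN; apply: cvgM; [exact: psiC.2|exact: cvg_cst].
Qed.

Variable M : R.
Hypotheses (M0 : 0 <= M) (psiM : forall x, 0 <= x <= 1 -> `|derive1 psi x| <= M).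

Let mdpsi D : measurable_fun D (derive1 psi).
Proof. by apply: measurable_funTS; apply: continuous_measurable_fun; exact: psiC.2. Qed.

(** The sum is the integral of [psi'] against the number of quantiles at most [t], divided by
    [n.+1]. Quantiles and [g] being inverse to each other, this number is [n.+1 * g t] up to 3. *)
Lemma tail_sum_close n g :
  `|\sum_(k < n.+2) tail n (quant n k g) - Rint01 (fun t => derive1 psi t * g t)| <= M * (3 / n.+1%:R).
Proof.
pose b (t : R) (k : nat) : bool := quant n k g <= t.
pose f (k : 'I_n.+2) t := n.+1%:R^-1 * (derive1 psi t * (quant n k g <= t)%R%:R).
have fi (k : 'I_n.+2) : int01 (f k).
  apply: (@int01_bounded _ _ (n.+1%:R^-1 * M)).
    by apply: measurable_funM => //; apply: measurable_funM; [exact: mdpsi|exact: measurable_ler].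
  move=> t /I01P t01; rewrite /f normrM ger0_norm ?invr_ge0// ler_wpM2l ?invr_ge0//.
  by rewrite normrM; case: (quant _ _ _ <= _); rewrite ?normr1 ?normr0 ?mulr1 ?mulr0//; exact: psiM.
have gi : int01 (fun t => derive1 psi t * g t).
  apply: (@int01_bounded _ _ M); first by apply: measurable_funM; [exact: mdpsi|exact: measurable_G0].
  move=> t /I01P t01; rewrite normrM -[leRHS]mulr1 ler_pM//; first exact: psiM.
  by rewrite ger0_norm ?G0_ge0 ?G0_le1.
have [si sE] := Rint01_sum fi.
have -> : \sum_(k < n.+2) tail n (quant n k g) = Rint01 (fun t => \sum_k f k t).
  rewrite sE; apply: eq_bigr => k _; rewrite /tail (FTC_indicator psiC (quant_itv n k g)) mulrC.
  rewrite /Rint01 /f RintegralZl//; apply: (@int01_bounded _ _ M).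
    by apply: measurable_funM; [exact: mdpsi|exact: measurable_ler].
  move=> t /I01P t01; rewrite normrM.
  by case: (quant _ _ _ <= _); rewrite ?normr1 ?normr0 ?mulr1 ?mulr0//; exact: psiM.
have di : int01 (fun t => \sum_k f k t - derive1 psi t * g t).
  exact: (integrableB (@measurable_I01 R) si gi).
rewrite /Rint01 -RintegralB// -/(Rint01 _) (le_trans (Rint01_norm di))// -[leRHS]Rint01_cst.
apply: Rint01_le.
- exact: (integrable_norm di).
- by apply: (@int01_bounded _ _ `|M * (3 / n.+1%:R)|).
move=> t t01; rewrite -mulr_sumr -mulr_sumr.
rewrite (_ : _ - _ = derive1 psi t * (n.+1%:R^-1 * (\sum_(k < n.+2) (b t k)%:R - n.+1%:R * g t))); last first.
  by rewrite mulrBr mulKf// mulrBr mulrCA.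
have /I01P t01' := t01.
rewrite normrM ler_pM// ?psiM// normrM ger0_norm ?invr_ge0// mulrC ler_wpM2r ?invr_ge0//.
apply: count_bound.
- by rewrite mulr_ge0 ?G0_ge0//= ler_piMr ?G0_le1.
- by move=> k kt; exact: quant_le.
(* If [n.+1 * g t < k - 1], right continuity preserves this up to some [t2 > t], so the quantile is
   at least [t2], against [bk]. The case [t = 1] is excluded by [g 1 = 1] and [k <= n.+1]. *)
- move=> k kn bk; rewrite leNgt; apply/negP => lt.
  have t1 : t < 1.
    rewrite ltNge; apply/negP => t1; move: lt; rewrite (G0_ge1 g t1) mulr1 ltrBrDr natr1 ltr_nat.
    by move=> /leq_trans/(_ kn); rewrite ltnS ltnNge leqnSn.
  have : g t < (k%:R - 1) / n.+1%:R by rewrite ltr_pdivlMr// mulrC.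
  move=> /G0_right_lt[t' tt' gt'].
  pose t2 := Num.min t' 1.
  have h : t2 <= quant n k g.
    apply: quant_ge.
      apply/I01P; rewrite le_min ler01 ge_min lexx orbT !andbT.
      by case/andP: t01' => t0 _; rewrite (le_trans t0)// ltW.
    have : g t2 <= g t' by apply: G0_nondecreasing; rewrite ge_min lexx.
    rewrite ltr_pdivlMr// in gt'; move=> /(ler_wpM2l (ler0n R n.+1)); rewrite mulrC in gt' *.
    by move=> /le_trans; apply; exact: ltW.
  have : t < t2 by rewrite lt_min tt' t1.
  by move=> /lt_le_trans/(_ h)/lt_le_trans/(_ bk); rewrite ltxx.
Qed.

Definition dquant n g s : R :=
  \sum_(k < n.+2) derive1 (tail n) (quant n k g) * derive1 (lvl n k) (gfun g s).

(** The slope [n.+1] of the levels cancels the weight in [tail], and the two signs cancel: the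
    gradient is an average of values of [psi'], weighted by a partition of unity. *)
Lemma dquantE n g s : dquant n g s = \sum_(k < n.+2) derive1 psi (quant n k g) * tent (k%:R - n.+1%:R * g s).
Proof.
apply: eq_bigr => k _; rewrite (tail_C1 n).2 (lvl_C1 n k).2 mulrNN mulrACA.
have key (a b N : R) : N != 0 -> a * N^-1 * (N * b) = a * b by move=> N0; rewrite -mulrA mulKf.
by rewrite -[RHS](key _ _ n.+1%:R)// mulrACA [X in _ * X]mulrC mulrACA; congr (_ * _).
Qed.

Lemma tent_sum_G0 n g s : \sum_(k < n.+2) tent (k%:R - n.+1%:R * g s) = 1.
Proof. by apply: sum_tent; rewrite mulr_ge0 ?G0_ge0//= ler_piMr ?G0_le1. Qed.

Lemma dquant_bound n g s : `|dquant n g s| <= M.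
Proof.
rewrite dquantE (le_trans (ler_norm_sum _ _ _))//.
rewrite (_ : M = \sum_(k < n.+2) M * tent (k%:R - n.+1%:R * g s)); last by rewrite -mulr_sumr tent_sum_G0 mulr1.
apply: ler_sum => k _; case/andP: (tent_itv (k%:R - n.+1%:R * g s)) => t0 _.
rewrite normrM (ger0_norm t0) ler_wpM2r// psiM//; apply/I01P; exact: quant_itv.
Qed.

Lemma measurable_dquant n : measurable_fun (@GI R) (fun p : G0m R * measurableTypeR R => dquant n p.1 p.2).
Proof.
apply: measurable_sum => k; apply: measurable_funM.
  have mq : measurable_fun setT (fun g => derive1 (tail n) (quant n k g)).
    have [C qC] := flow_smooth_potential (lvl_C1 n k).1.
    have ch : continuous (fun x : 'rV[R]_1 => derive1 (tail n) (x 0 0)).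
      by move=> x; apply: continuous_comp; [exact: coord_continuous|exact: (tail_C1 n).1.2].
    have := continuous_L2lip_measurable ch (fun=> flow_lip qC).
    by congr measurable_fun; apply/funext => g; rewrite mxE.
  by apply: measurable_funTS; exact: (measurableT_comp mq measurable_fst).
have mh : measurable_fun setT (derive1 (lvl n k)) by apply: continuous_measurable_fun; exact: (lvl_C1 n k).1.2.
exact: (measurableT_comp mh (@measurable_G0_joint R (@GI R))).
Qed.

(** Only levels within 1 of [n.+1 * g s] have a nonzero weight. By strict monotonicity [g] gains
    more than [2 / n.+1] on each side within distance [r] of [s] for large [n], so the quantiles of
    these levels lie within [r] of [s]. *)
Lemma dquant_cvg g s : (forall s t : R, 0 <= s -> s < t -> t <= 1 -> g s < g t) -> 0 < s < 1 ->
  (fun n => dquant n g s) @ \oo --> derive1 psi s.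
Proof.
move=> gi /andP[s0 s1]; apply/cvgrPdist_le => /= e e0.
have /cvgrPdist_le/(_ _ e0)/nbhs_ballP[d /= d0 Hd] := psiC.2 s.
pose r := Num.min (d / 2) (Num.min (s / 2) ((1 - s) / 2)).
have r0 : 0 < r by rewrite /r !lt_min !divr_gt0// subr_gt0.
have rd : r < d by rewrite /r gt_min ltr_pdivrMr// ltr_pMr// ltr1n.
have rs : r <= s / 2 by rewrite /r ge_min ge_min lexx orbT.
have rs1 : r <= (1 - s) / 2 by rewrite /r ge_min ge_min lexx !orbT.
have gp : 0 < g (s + r) - g s by rewrite subr_gt0 gi//; lra.
have gm : 0 < g s - g (s - r) by rewrite subr_gt0 gi//; lra.
have Np : \forall n \near \oo, 2 / n.+1%:R < g (s + r) - g s by exact: near_divn_lt.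
have Nm : \forall n \near \oo, 2 / n.+1%:R < g s - g (s - r) by exact: near_divn_lt.
near=> n.
have hp : 2 / n.+1%:R < g (s + r) - g s by near: n.
have hm : 2 / n.+1%:R < g s - g (s - r) by near: n.
rewrite ltr_pdivrMr// mulrC mulrBr in hp; rewrite ltr_pdivrMr// mulrC mulrBr in hm.
rewrite dquantE (_ : derive1 psi s = \sum_(k < n.+2) derive1 psi s * tent (k%:R - n.+1%:R * g s)); last first.
  by rewrite -mulr_sumr tent_sum_G0 mulr1.
rewrite -sumrB.
apply: (le_trans (ler_norm_sum _ _ _)).
apply: (@le_trans _ _ (\sum_(k < n.+2) e * tent (k%:R - n.+1%:R * g s))); last by rewrite -mulr_sumr tent_sum_G0 mulr1.
apply: ler_sum => k _; case/andP: (tent_itv (k%:R - n.+1%:R * g s)) => t0 _.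
rewrite -mulrBl normrM (ger0_norm t0).
have [big|small] := leP 1 `|k%:R - n.+1%:R * g s|; first by rewrite tent0// !mulr0.
rewrite ler_wpM2r//; apply: Hd; rewrite /ball /=.
move: small; rewrite ltr_norml => /andP[k1 k2].
have q1 : quant n k g <= s + r by apply: quant_le; [apply/I01P|]; lra.
have q2 : s - r <= quant n k g by apply: quant_ge; [apply/I01P|]; lra.
by apply: (le_lt_trans _ rd); rewrite ler_norml; lra.
Unshelve. all: by end_near. Qed.

End Quantiles.

(** * Approximation of one cylinder class by the other *)

Section Approximation.
Variables (R : realType) (Q : probability (G0m R) R).
Local Notation leb := (@lebesgue_measure R).
Local Notation I01 := (@I01 R).
Local Notation QI := (Q \x leb)%E.
Local Notation unc F := (fun p : G0m R * measurableTypeR R => F p.1 p.2).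
Local Notation graph := ((G0m R -> R) -> (G0m R -> R -> R) -> Prop).
Implicit Types (u : G0m R -> R) (F : G0m R -> R -> R) (Gr : graph).

(** The epsilon form of membership in the closure of a graph; approximations can be iterated in it
    without extracting diagonal sequences. *)
Definition approachable Gr u F := forall e : R, 0 < e -> exists w H,
  [/\ Gr w H, (sq Q setT (fun g => w g - u g)%R < e%:E)%E &
      (sq QI (@GI R) (fun p => H p.1 p.2 - F p.1 p.2)%R < e%:E)%E].

Lemma graph_approachable Gr u F : Gr u F -> approachable Gr u F.
Proof.
move=> uF e e0; exists u, F; split => //; rewrite /sq.
  by under eq_integral => g _ do rewrite subrr expr0n; rewrite integral0 lte_fin.
by under eq_integral => g _ do rewrite subrr expr0n; rewrite integral0 lte_fin.
Qed.

Definition smooth_graph Gr := forall u F, Gr u F -> exists C, flow_smooth u F C.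

Lemma flow_smooth_measurable u F C : flow_smooth u F C -> measurable_fun setT u.
Proof. by move=> uF; exact: L2lip_measurable (flow_lip uF). Qed.

Lemma approachable_limit Gr u F (un : nat -> G0m R -> R) (Fn : nat -> G0m R -> R -> R) : smooth_graph Gr ->
  measurable_fun setT u -> measurable_fun (@GI R) (unc F) ->
  (forall n, measurable_fun setT (un n)) -> (forall n, measurable_fun (@GI R) (unc (Fn n))) ->
  (forall n, approachable Gr (un n) (Fn n)) ->
  (fun n => sq Q setT (fun g => un n g - u g)) @ \oo --> (0 : \bar R) ->
  (fun n => sq QI (@GI R) (fun p => Fn n p.1 p.2 - F p.1 p.2)) @ \oo --> (0 : \bar R) ->
  approachable Gr u F.
Proof.
move=> sG mu mF mun mFn unGr unu FnF e e0; have mG := @measurable_GI R.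
have e4 : 0 < e / 4 by rewrite divr_gt0.
have h1 := (sq_cvg0P Q (fun n => measurable_funB (mun n) mu)).1 unu _ e4.
have h2 := (sq_cvg0P QI (fun n => measurable_funB (mFn n) mF)).1 FnF _ e4.
have [n [{}h1 {}h2]] := filter_ex (filterI h1 h2).
have [w [H [wH h3 h4]]] := unGr n _ e4; have [C sw] := sG _ _ wH.
have mw := flow_smooth_measurable sw; have mH := flow_measurable sw.
have key (a b : \bar R) : (a < (e / 4)%:E)%E -> (b < (e / 4)%:E)%E -> (2%:E * a + 2%:E * b < e%:E)%E.
  move=> ae be; have -> : e = 2 * (e / 4) + 2 * (e / 4) by lra.
  have h x : (x < (e / 4)%:E)%E -> (2%:E * x < (2 * (e / 4))%:E)%E by move=> ?; rewrite EFinM lte_pmul2l.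
  exact: (lteD (h _ ae) (h _ be)).
exists w, H; split => //.
  have := sq_le_add Q measurableT (measurable_funB mw (mun n)) (measurable_funB (mun n) mu).
  rewrite [X in (sq Q setT X <= _)%E](_ : _ = fun g => w g - u g); last first.
    by apply/funext => g /=; rewrite addrA subrK.
  by move=> /le_lt_trans; apply; exact: key.
have := sq_le_add QI mG (measurable_funB mH (mFn n)) (measurable_funB (mFn n) mF).
rewrite [X in (sq QI _ X <= _)%E](_ : _ = fun p => H p.1 p.2 - F p.1 p.2); last first.
  by apply/funext => p /=; rewrite addrA subrK.
by move=> /le_lt_trans; apply; exact: key.
Qed.

Lemma approachable_seq Gr u F : smooth_graph Gr -> measurable_fun setT u -> measurable_fun (@GI R) (unc F) ->
  approachable Gr u F -> exists un Fn, [/\ forall n, Gr (un n) (Fn n),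
    (fun n => sq Q setT (fun g => un n g - u g)) @ \oo --> (0 : \bar R) &
    (fun n => sq QI (@GI R) (fun p => Fn n p.1 p.2 - F p.1 p.2)) @ \oo --> (0 : \bar R)].
Proof.
move=> sG mu mF uF.
have [wn wnP] : {wn : nat -> (G0m R -> R) * (G0m R -> R -> R) & forall n, [/\ Gr (wn n).1 (wn n).2,
   (sq Q setT (fun g => (wn n).1 g - u g)%R < (n.+1%:R^-1)%:E)%E &
   (sq QI (@GI R) (fun p => (wn n).2 p.1 p.2 - F p.1 p.2)%R < (n.+1%:R^-1)%:E)%E]}.
  apply: (@choice _ _ (fun n (w : (G0m R -> R) * (G0m R -> R -> R)) => [/\ Gr w.1 w.2,
   (sq Q setT (fun g => w.1 g - u g)%R < (n.+1%:R^-1)%:E)%E &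
   (sq QI (@GI R) (fun p => w.2 p.1 p.2 - F p.1 p.2)%R < (n.+1%:R^-1)%:E)%E])) => n.
  have n0 : 0 < n.+1%:R^-1 :> R by rewrite invr_gt0.
  by have [w [H h]] := uF _ n0; exists (w, H).
have mwn n : measurable_fun setT (wn n).1 /\ measurable_fun (@GI R) (unc (wn n).2).
  have [h _ _] := wnP n; have [C sw] := sG _ _ h.
  by split; [exact: flow_smooth_measurable sw|exact: flow_measurable sw].
exists (fun n => (wn n).1), (fun n => (wn n).2); split.
- by move=> n; case: (wnP n).
- apply/(sq_cvg0P Q (fun n => measurable_funB (mwn n).1 mu)) => e e0.
  have h := near_divn_lt ltr01 e0; apply: filterS h => n h.
  by have [_ h1 _] := wnP n; apply: (lt_trans h1); rewrite lte_fin -[_^-1]mul1r.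
- apply/(sq_cvg0P QI (fun n => measurable_funB (mwn n).2 mF)) => e e0.
  have h := near_divn_lt ltr01 e0; apply: filterS h => n h.
  by have [_ _ h1] := wnP n; apply: (lt_trans h1); rewrite lte_fin -[_^-1]mul1r.
Qed.

Lemma approachable_trans Gr Gr' u F : smooth_graph Gr -> smooth_graph Gr' ->
  measurable_fun setT u -> measurable_fun (@GI R) (unc F) ->
  (forall w H, Gr' w H -> approachable Gr w H) -> approachable Gr' u F -> approachable Gr u F.
Proof.
move=> sG sG' mu mF GG uF; have [un [Fn [Gn unu FnF]]] := approachable_seq sG' mu mF uF.
apply: (@approachable_limit Gr u F un Fn) => // n.
- by have [C h] := sG' _ _ (Gn n); exact: flow_smooth_measurable h.
- by have [C h] := sG' _ _ (Gn n); exact: flow_measurable h.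
- exact: GG.
Qed.

Lemma inner_ae_GI : {ae QI, forall p : G0m R * measurableTypeR R, @GI R p -> 0 < p.2 < 1}.
Proof.
exists (setT `*` [set 0; 1 : R]); split.
- apply: measurableX => //; apply: measurableU; exact: measurable_set1.
- rewrite product_measure1E//; last by apply: measurableU; exact: measurable_set1.
  rewrite [X in (_ * X)%E](_ : _ = 0%E) ?mule0//.
  have h : leb [set 0; 1] = 0%E by apply: null_set_setU => //; exact: lebesgue_measure_set1.
  exact: h.
- move=> [g s] /= h; split => //.
  have [s01|s01] := pselect (0 < s < 1); first by exfalso; apply: h => _.
  have [/I01P/andP[]|ns] := pselect (I01 s); last by exfalso; apply: h => -[_] /= /ns.
  rewrite !le_eqVlt => /predU1P[<- _|s0 /predU1P[->|s1]]; [by left|by right|].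
  by case: s01; rewrite s0.
Qed.

End Approximation.

(** * Functions of the integrals of f g as limits of functions of the integrals of alpha(g) *)

Section WeightsByPotentials.
Variables (R : realType) (beta : R) (Q : probability (G0m R) R).
Hypotheses (beta0 : 0 < beta) (HQ : is_entropic beta Q).
Local Notation leb := (@lebesgue_measure R).
Local Notation I01 := (@I01 R).
Local Notation QI := (Q \x leb)%E.

Lemma G0_nrm_le1 (g : G0 R) : nrm leb I01 g <= 1.
Proof.
rewrite -(@ler_pXn2r _ 2)// ?nnegrE ?nrm_ge0// nrm_sqr expr1n.
have h : 0 <= Rint01 (fun s => g s * g s) <= 1.
  apply: Rint01_le_cst; first by apply: measurable_funM; exact: measurable_G0.
  by move=> s _; rewrite mulr_ge0 ?G0_ge0//= mulr_ile1 ?G0_ge0 ?G0_le1.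
by case/andP: h.
Qed.

Lemma weight_bound (f : R -> R) (g : G0 R) : sqi leb I01 f ->
  `|Rint01 (fun s => f s * g s)| <= nrm leb I01 f.
Proof.
move=> sf; apply: (le_trans (cauchy_schwarz (@measurable_I01 R) sf (G0_sqi g))).
by rewrite ler_piMr ?nrm_ge0// G0_nrm_le1.
Qed.

Lemma measurable_row_weights (m : nat) (f : 'I_m -> R -> R) : (forall i, sqi leb I01 (f i)) ->
  measurable_row (fun i (g : G0m R) => Rint01 (fun s => f i s * g s)).
Proof.
move=> sf h ch.
have [A _ hA] := common_bound (fun i => flow_smooth_weight (sf i)).
exact: (continuous_L2lip_measurable ch (fun i => flow_lip (hA i))).
Qed.

Lemma derive_sqi (psi : R -> R) : C1real psi -> sqi leb I01 (derive1 psi).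
Proof.
move=> psiC; have [M _ hM] := segment_bounded 0 1 psiC.2.
apply: (@bounded_sqi _ _ M).
  by apply: measurable_funTS; apply: continuous_measurable_fun; exact: psiC.2.
by move=> s /I01P; exact: hM.
Qed.

Variables (m : nat) (U : 'rV[R]_m -> R).
Hypothesis UC : C1fun U.

(** For weights that are derivatives, the smoothed quantile sums converge together with their
    gradients; the latter need strict monotonicity, hence hold for almost every [g] only. *)
Lemma smooth_weights_approachable (psi : 'I_m -> R -> R) : (forall i, C1real (psi i)) ->
  approachable Q (@Zgraph R) (fun g => U (\row_i Rint01 (fun s => derive1 (psi i) s * g s)))
    (fun g s => \sum_i 'D_(delta_mx 0 i) U (\row_j Rint01 (fun s => derive1 (psi j) s * g s)) * derive1 (psi i) s).
Proof.
move=> psiC; have mG := @measurable_GI R; have sd i := derive_sqi (psiC i).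
have [M M0 psiM] : exists2 M : R, 0 <= M & forall i x, 0 <= x <= 1 -> `|derive1 (psi i) x| <= M.
  have h i : exists B : R, 0 <= B /\ forall x, 0 <= x <= 1 -> `|derive1 (psi i) x| <= B.
    by have [B B0 hB] := segment_bounded 0 1 (psiC i).2; exists B.
  have [B BP] := choice h; exists (\sum_i B i); first by apply: sumr_ge0 => i _; case: (BP i).
  move=> i x x01; apply: (le_trans ((BP i).2 x x01)).
  by rewrite (bigD1 i)//= lerDl sumr_ge0// => j _; case: (BP j).
pose Y (i : 'I_m) (g : G0m R) := Rint01 (fun s => derive1 (psi i) s * g s).
pose Yn (n : nat) (i : 'I_m) (g : G0m R) := \sum_(k < n.+2) tail (psi i) n (quant n k g).
pose D (i : 'I_m) (g : G0m R) s := derive1 (psi i) s.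
pose Dn n (i : 'I_m) (g : G0m R) s := dquant (psi i) n g s.
have YM i g : `|Y i g| <= M.
  apply: (le_trans (weight_bound g (sd i))).
  rewrite -(@ler_pXn2r _ 2)// ?nnegrE ?nrm_ge0// nrm_sqr -(Rint01_cst (M ^+ 2)).
  apply: le_Rintegral => //; [exact: sqi_mul|by apply: (@bounded_integrable _ _ `|M ^+ 2|)|].
  by move=> s /I01P s1; rewrite -expr2 -real_normK ?num_real// ler_pXn2r ?nnegrE// psiM.
have close n i g := tail_sum_close (psiC i) M0 (psiM i) n g.
(* [tail_sum_close] adds at most [3 * M] to the bound [M] for [Y]. *)
have YnM n i g : `|Yn n i g| <= 4 * M.
  rewrite -[Yn n i g](subrK (Y i g)) (le_trans (ler_normD _ _))//.
  have h1 := close n i g; have h2 := YM i g.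
  have h3 : M * (3 / n.+1%:R) <= M * 3.
    by rewrite ler_wpM2l// ler_pdivrMr// ler_peMr// ler1n.
  have -> : 4 * M = M * 3 + M by ring.
  by apply: lerD => //; exact: le_trans h1 h3.
have mqr n : measurable_row (Yn n).
  have [A _ hA] := common_bound (fun k : 'I_n.+2 => flow_smooth_potential (lvl_C1 R n k).1).
  apply: (@measurable_row_composite R m n.+2 (fun i _ => tail (psi i) n) (fun k => quant n k) (fun=> A)).
    by move=> i _; exact: C1real_continuous (tail_C1 (psiC i) n).1.
  by move=> k; exact: flow_lip (hA k).
have mD i : measurable_fun (@GI R) (fun p : G0m R * measurableTypeR R => D i p.1 p.2).
  by have [C h] := flow_smooth_weight (sd i); exact: flow_measurable h.
have mDn n i := measurable_dquant (psiC i) n.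
have YY := measurable_row_weights sd.
have [c1 c2] : 
  (fun n => sq Q setT (fun g => U (\row_i Yn n i g) - U (\row_i Y i g))) @ \oo --> (0 : \bar R) /\
  (fun n => sq QI (@GI R) (fun p =>
     \sum_i 'D_(delta_mx 0 i) U (\row_j Yn n j p.1) * Dn n i p.1 p.2 -
     \sum_i 'D_(delta_mx 0 i) U (\row_j Y j p.1) * D i p.1 p.2)) @ \oo --> (0 : \bar R).
  apply: (@comp_limit R Q m U Y D Yn Dn (4 * M)) => //.
  - by move=> i g; rewrite (le_trans (YM i g))//; lra.
  - by move=> i; apply: (bounded_sqi_GI Q (M := M)) => // g s /I01P; exact: psiM.
  - move=> i; apply: nearW => g; apply/cvgrPdist_lt => e e0.
    have h : \forall n \near \oo, (M * 3 + 1) / n.+1%:R < e by apply: near_divn_lt => //; lra.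
    apply: filterS h => n; apply: le_lt_trans; rewrite distrC (le_trans (close n i g))// mulrA.
    by rewrite ler_pM2r ?invr_gt0// lerDl.
  - move=> i; apply: (@sq_dominated_cvg _ _ _ QI _ mG (fun n p => Dn n i p.1 p.2) (fun p => D i p.1 p.2) (fun=> (2 * M) ^+ 2)) => //.
    + by move=> n; exact: mDn.
    + have h := bounded_sqi_GI Q (F := fun _ _ => 2 * M) (M := `|2 * M|) (measurable_cst _) (fun _ _ _ => lexx _).
      exact: (sqi_integrable mG h).
    + move=> n [g s] [_ /= /I01P s1]; rewrite -(real_normK (num_real _)) ler_pXn2r ?nnegrE ?mulr_ge0//.
      rewrite (le_trans (ler_normB _ _))// mulr_natl mulr2n lerD//; last exact: psiM.
      exact: (dquant_bound (psiC i) (psiM i)).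
    + have H1 := ae_prod_fst (strictly_increasing_ae HQ).
      apply: filterS2 H1 (inner_ae_GI Q) => p h1 h2 p1.
      by apply: (dquant_cvg (psiC i) h1); exact: h2.
have Cu : Cgraph (fun g => U (\row_i Y i g)) (fun g s => \sum_i 'D_(delta_mx 0 i) U (\row_j Y j g) * D i g s).
  by exists m, U, (fun i => derive1 (psi i)); split.
have [C uF] := Cgraph_flow_smooth Cu.
have Zn n : Zgraph (fun g => U (\row_i Yn n i g)) (fun g s => \sum_i 'D_(delta_mx 0 i) U (\row_j Yn n j g) * Dn n i g s).
  exact: (@Zgraph_composite R m n.+2 U (fun i _ => tail (psi i) n) UC
    (fun i _ => (tail_C1 (psiC i) n).1) (fun k => lvl n k) (fun k => (lvl_C1 R n k).1)).
apply: (@approachable_limit _ Q _ _ _ (fun n g => U (\row_i Yn n i g))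
  (fun n g s => \sum_i 'D_(delta_mx 0 i) U (\row_j Yn n j g) * Dn n i g s)
  (@Zgraph_flow_smooth R) (flow_smooth_measurable uF) (flow_measurable uF) _ _ _ c1 c2).
- by move=> n; have [C' h] := Zgraph_flow_smooth (Zn n); exact: flow_smooth_measurable h.
- by move=> n; have [C' h] := Zgraph_flow_smooth (Zn n); exact: flow_measurable h.
- by move=> n; apply: graph_approachable; exact: Zn.
Qed.

Lemma weights_approachable (f : 'I_m -> R -> R) : (forall i, sqi leb I01 (f i)) ->
  approachable Q (@Zgraph R) (fun g => U (\row_i Rint01 (fun s => f i s * g s)))
    (fun g s => \sum_i 'D_(delta_mx 0 i) U (\row_j Rint01 (fun s => f j s * g s)) * f i s).
Proof.
move=> sf; have mG := @measurable_GI R; have mI := @measurable_I01 R.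
(* The square makes the norm of the error smaller than [n.+1%:R^-1], which bounds the error of the
   integrals uniformly in [g]. *)
have [psi psiP] : {psi : nat * 'I_m -> R -> R & forall p, C1real (psi p) /\
    (sq leb I01 (fun s => derive1 (psi p) s - f p.2 s)%R < ((p.1.+1%:R^-1) ^+ 2)%:E)%E}.
  apply: (@choice _ _ (fun (p : nat * 'I_m) psi => C1real psi /\
    (sq leb I01 (fun s => derive1 psi s - f p.2 s)%R < ((p.1.+1%:R^-1) ^+ 2)%:E)%E)) => -[n i].
  have n0 : 0 < (n.+1%:R^-1) ^+ 2 :> R by rewrite exprn_gt0// invr_gt0.
  by have [psi h1 h2] := L2_density (sf i) n0; exists psi.
have sd n i : sqi leb I01 (derive1 (psi (n, i))) by apply: derive_sqi; exact: (psiP (n, i)).1.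
have nd n i : nrm leb I01 (fun s => derive1 (psi (n, i)) s - f i s) < n.+1%:R^-1.
  by apply: (nrm_lt mI); [exact: sqiB|rewrite invr_gt0|exact: (psiP (n, i)).2].
pose Y (i : 'I_m) (g : G0m R) := Rint01 (fun s => f i s * g s).
pose Yn (n : nat) (i : 'I_m) (g : G0m R) := Rint01 (fun s => derive1 (psi (n, i)) s * g s).
pose D (i : 'I_m) (g : G0m R) s := f i s.
pose Dn n (i : 'I_m) (g : G0m R) s := derive1 (psi (n, i)) s.
have close n i g : `|Yn n i g - Y i g| < n.+1%:R^-1.
  have -> : Yn n i g - Y i g = Rint01 (fun s => (derive1 (psi (n, i)) s - f i s) * g s).
    by rewrite /Rint01 -/(ip leb I01 (fun s => derive1 (psi (n, i)) s - f i s) g) ipBl//; exact: G0_sqi.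
  by apply: le_lt_trans (nd n i); apply: weight_bound; exact: sqiB.
pose A := \sum_i nrm leb I01 (f i) + 1.
have YA i g : `|Y i g| <= A - 1.
  rewrite /A addrK (le_trans (weight_bound g (sf i)))// (bigD1 i)//= lerDl sumr_ge0// => j _; exact: nrm_ge0.
have YnA n i g : `|Yn n i g| <= A.
  rewrite -[Yn n i g](subrK (Y i g)) (le_trans (ler_normD _ _))//.
  have h1 := close n i g; have h2 := YA i g.
  have h3 : n.+1%:R^-1 <= 1 :> R by rewrite invf_le1// ler1n.
  have key (a b c B : R) : a < c -> b <= B - 1 -> c <= 1 -> a + b <= B by move=> *; lra.
  exact: key h1 h2 h3.
have sD i : sqi QI (@GI R) (fun p => D i p.1 p.2).
  by have [C h] := flow_smooth_weight (sf i); exact: (flow_sqi_prod Q h).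
have sDn n i : sqi QI (@GI R) (fun p => Dn n i p.1 p.2).
  by have [C h] := flow_smooth_weight (sd n i); exact: (flow_sqi_prod Q h).
have [c1 c2] : 
  (fun n => sq Q setT (fun g => U (\row_i Yn n i g) - U (\row_i Y i g))) @ \oo --> (0 : \bar R) /\
  (fun n => sq QI (@GI R) (fun p =>
     \sum_i 'D_(delta_mx 0 i) U (\row_j Yn n j p.1) * Dn n i p.1 p.2 -
     \sum_i 'D_(delta_mx 0 i) U (\row_j Y j p.1) * D i p.1 p.2)) @ \oo --> (0 : \bar R).
  apply: (@comp_limit R Q m U Y D Yn Dn A) => //.
  - by move=> i g; rewrite (le_trans (YA i g))//; lra.
  - exact: measurable_row_weights.
  - by move=> n; apply: (measurable_row_weights (sd n)).
  - by move=> n i; exact: (sDn n i).1.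
  - move=> i; apply: nearW => g; apply/cvgrPdist_lt => e e0.
    have h := near_divn_lt ltr01 e0; apply: filterS h => n; apply: lt_trans.
    by rewrite distrC mul1r; exact: close.
  - move=> i; apply/(sq_cvg0P QI) => [n|e e0]; first by apply: measurable_funB; [exact: (sDn n i).1|exact: (sD i).1].
    have h := near_divn_lt ltr01 e0; apply: filterS h => n h.
    have md : measurable_fun (@GI R) (fun p : G0m R * measurableTypeR R => Dn n i p.1 p.2 - D i p.1 p.2).
      by apply: measurable_funB; [exact: (sDn n i).1|exact: (sD i).1].
    rewrite [ltLHS](sq_sectionE Q (F := fun g s => Dn n i g s - D i g s) md).2.
    rewrite [ltLHS](_ : _ = (\int[Q]_g (cst (sq leb I01 (fun s => derive1 (psi (n, i)) s - f i s)%R)) g)%E)//.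
    rewrite integral_cst// [X in (_ * X)%E]probability_setT mule1.
    apply: (lt_trans (psiP (n, i)).2); rewrite lte_fin; apply: le_lt_trans h.
    have n1 : n.+1%:R^-1 <= 1 :> R by rewrite invf_le1// ler1n.
    by rewrite mul1r expr2 ler_piMr// invr_ge0.
have Cu : Cgraph (fun g => U (\row_i Y i g)) (fun g s => \sum_i 'D_(delta_mx 0 i) U (\row_j Y j g) * D i g s).
  by exists m, U, f; split.
have [C uF] := Cgraph_flow_smooth Cu.
have Cn n : Cgraph (fun g => U (\row_i Yn n i g)) (fun g s => \sum_i 'D_(delta_mx 0 i) U (\row_j Yn n j g) * Dn n i g s).
  by exists m, U, (fun i => derive1 (psi (n, i))); split => // i; exact: (sd n i).
apply: (@approachable_limit _ Q _ _ _ (fun n g => U (\row_i Yn n i g))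
  (fun n g s => \sum_i 'D_(delta_mx 0 i) U (\row_j Yn n j g) * Dn n i g s)
  (@Zgraph_flow_smooth R) (flow_smooth_measurable uF) (flow_measurable uF) _ _ _ c1 c2).
- by move=> n; have [C' h] := Cgraph_flow_smooth (Cn n); exact: flow_smooth_measurable h.
- by move=> n; have [C' h] := Cgraph_flow_smooth (Cn n); exact: flow_measurable h.
- by move=> n; apply: smooth_weights_approachable => i; exact: (psiP (n, i)).1.
Qed.

End WeightsByPotentials.

Lemma Cgraph_approachable (R : realType) (beta : R) (Q : probability (G0m R) R) u F :
  0 < beta -> is_entropic beta Q -> Cgraph u F -> approachable Q (@Zgraph R) u F.
Proof.
move=> beta0 HQ [m [U [f [UC sf -> ->]]]].
exact: (weights_approachable HQ UC sf).
Qed.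

(** * Averages over cells *)

Section Averages.
Variable R : realType.
Local Notation leb := (@lebesgue_measure R).
Local Notation I01 := (@I01 R).
Implicit Types (f g : G0 R) (n k : nat).

Lemma C1real_scale (a : R -> R) (c : R) : C1real a ->
  C1real (fun x => c * a x) /\ derive1 (fun x => c * a x) = fun x => c * derive1 a x.
Proof.
move=> aC; apply: is_derive_C1real => [x|x].
  by have d := is_deriveZ c (C1real_is_derive aC x); apply: (is_derive_eq d).
by apply: cvgM; [exact: cvg_cst|exact: aC.2].
Qed.

(** The indicator of a cell divided by its length, so that integrating against it takes an
    average. *)
Definition cellfun n k (s : R) : R := n.+1%:R * (cell n.+1 s == k)%:R.

Lemma cellfun_le n k s : 0 <= cellfun n k s <= n.+1%:R.
Proof. by rewrite /cellfun; case: (_ == k); rewrite ?mulr1 ?mulr0 ?lexx ?ler0n. Qed.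

Lemma measurable_cellfun n k D : measurable_fun D (cellfun n k).
Proof.
apply: measurable_funTS; exact: (measurable_cell_fun n.+1 (fun j => n.+1%:R * (j == k)%:R)).
Qed.

Lemma cellfun_sqi n k : sqi leb I01 (cellfun n k).
Proof.
apply: (@bounded_sqi _ _ n.+1%:R); first exact: measurable_cellfun.
by move=> s _; case/andP: (cellfun_le n k s) => h1 h2; rewrite ger0_norm.
Qed.

Lemma Rint01_cellfun n k : Rint01 (cellfun n k) = (k < n.+1)%N%:R.
Proof.
rewrite (@Rint01_cell _ n.+1 (fun j => n.+1%:R * (j == k)%:R))//.
rewrite -mulr_sumr mulKf//.
have [kn|kn] := ltnP k n.+1.
  rewrite (bigD1 (Ordinal kn))//= eqxx big1 ?addr0// => j jk.
  by rewrite (_ : (val j == k) = false)//; apply/negbTE; apply: contra jk => /eqP h; apply/eqP/val_inj.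
rewrite big1// => j _; rewrite (_ : (val j == k) = false)//.
by apply/negbTE; rewrite neq_ltn (leq_trans (ltn_ord j) kn).
Qed.

Definition avg n g k : R := Rint01 (fun s => cellfun n k s * g s).

Lemma avg_itv n g k : 0 <= avg n g k <= 1.
Proof.
have h0 s : 0 <= cellfun n k s * g s <= cellfun n k s.
  case/andP: (cellfun_le n k s) => c0 _.
  by rewrite mulr_ge0 ?G0_ge0//= ler_piMr ?G0_le1.
have i1 : leb.-integrable I01 (EFin \o (fun s => cellfun n k s * g s)) := sqi_mul (@measurable_I01 R) (cellfun_sqi n k) (G0_sqi g).
apply/andP; split.
  by apply: Rintegral_ge0 => s _; case/andP: (h0 s).
apply: (@le_trans _ _ (Rint01 (cellfun n k))); last by rewrite Rint01_cellfun; case: (_ < _)%N.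
apply: le_Rintegral => //; last by move=> s _; case/andP: (h0 s).
apply: (@bounded_integrable _ _ n.+1%:R); first exact: measurable_cellfun.
by move=> s _; case/andP: (cellfun_le n k s) => h1 h2; rewrite ger0_norm.
Qed.

Lemma avg_osc n g s : 0 <= s < 1 -> `|avg n g (cell n.+1 s) - g s| <= osc n.+1 g s.
Proof.
move=> s01; have kn := cell_lt (ltn0Sn n) s01; set k := cell n.+1 s in kn *.
have mI := @measurable_I01 R.
have sc := cellfun_sqi n k.
have i0 : int01 (cellfun n k).
  apply: (@bounded_integrable _ _ n.+1%:R); first exact: measurable_cellfun.
  by move=> t _; case/andP: (cellfun_le n k t) => h1 h2; rewrite ger0_norm.
have sB : sqi leb I01 (fun t => g t - g s).
  by apply: sqiB => //; [exact: G0_sqi|apply: (@bounded_sqi _ _ `|g s|)].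
have i1 : int01 (fun t => cellfun n k t * (g t - g s)) := sqi_mul mI sc sB.
have -> : avg n g k - g s = Rint01 (fun t => cellfun n k t * (g t - g s)).
  have e1 : Rint01 (fun t => cellfun n k t * g s) = g s.
    rewrite (_ : (fun t => _) = (fun t => g s * cellfun n k t)); last by apply/funext => t; rewrite mulrC.
    by rewrite /Rint01 RintegralZl// -/(Rint01 _) Rint01_cellfun kn mulr1.
  rewrite -[X in _ - X]e1 /avg /Rint01 -RintegralB//.
  - by apply: eq_Rintegral => t _; rewrite mulrBr.
  - exact: (sqi_mul mI sc (G0_sqi g)).
  - by apply: (sqi_mul mI sc); apply: (@bounded_sqi _ _ `|g s|).
apply: (le_trans (Rint01_norm i1)).
have -> : osc n.+1 g s = Rint01 (fun t => osc n.+1 g s * cellfun n k t).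
  by rewrite /Rint01 RintegralZl// -/(Rint01 _) Rint01_cellfun kn mulr1.
apply: Rint01_le.
- exact: (integrable_norm i1).
- exact: (integrableZl mI (osc n.+1 g s) i0).
move=> t t01; case/andP: (cellfun_le n k t) => c0 _.
rewrite normrM (ger0_norm c0) mulrC /cellfun.
have [tk|] := eqVneq (cell n.+1 t) k; last by rewrite mulr0 !mulr0.
have s01' : I01 s by apply/I01P; case/andP: s01 => -> /ltW.
apply: ler_wpM2r; first by rewrite mulr_ge0.
by rewrite distrC; apply: osc_bound.
Qed.

(** The threshold for [n] is uniform in [g]. Where the oscillation over the cell is below [d],
    uniform continuity of [h] applies; elsewhere the squared error is at most [4 M ^ 2], and the
    integral of [osc] makes this set small. The value of [q] at 1 is only bounded, because the point
    1 belongs to none of the cells. *)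
Lemma average_close (h : R -> R) (M e : R) : continuous h ->
  (forall x, 0 <= x <= 1 -> `|h x| <= M) -> 0 < e -> \forall n \near \oo, forall g (q : R -> R),
  measurable_fun I01 q -> (forall s, 0 <= s < 1 -> q s = h (avg n g (cell n.+1 s))) -> `|q 1| <= M ->
  ip leb I01 (fun s => q s - h (g s)) (fun s => q s - h (g s)) <= e.
Proof.
move=> ch hM e0.
have M0 : 0 <= M by rewrite (le_trans (normr_ge0 _) (hM 0 _))// lexx ler01.
pose e1 := Num.min 1 (e / 2).
have e10 : 0 < e1 by rewrite lt_min ltr01 divr_gt0.
have e1e : e1 ^+ 2 <= e / 2.
  have h1 : e1 <= 1 by rewrite ge_min lexx.
  have h2 : e1 <= e / 2 by rewrite ge_min lexx orbT.
  have key (a b : R) : 0 < a -> a <= 1 -> a <= b -> a ^+ 2 <= b by move=> *; nra.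
  exact: key h2.
have [d d0 hd] := segment_uniformly_continuous 0 1 ch e10.
(* Chebyshev's inequality in pointwise form: [K * osc] exceeds [4 M ^ 2] wherever [osc >= d]. *)
pose K := 4 * M ^+ 2 / d.
have K0 : 0 <= K by rewrite divr_ge0 ?mulr_ge0 ?sqr_ge0// ltW.
have nn : \forall n \near \oo, (K + 1) / n.+1%:R < e / 2 by apply: near_divn_lt; [lra|rewrite divr_gt0].
apply: filterS nn => n hn g q mq qE q1; have mI := @measurable_I01 R.
have mhg : measurable_fun I01 (fun s => h (g s)).
  by apply: (measurableT_comp (continuous_measurable_fun ch)); exact: measurable_G0.
(* On [0, 1] this is 1 at the cell index of the point 1 only, so it absorbs the error there and has
   integral 0. *)
pose c (j : nat) : R := (n.+1 <= j)%N%:R.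
pose b s := e / 2 + K * osc n.+1 g s + 4 * M ^+ 2 * c (cell n.+1 s).
have qM s : I01 s -> `|q s| <= M.
  move=> /I01P/andP[s0]; rewrite le_eqVlt => /predU1P[->//|s1].
  by rewrite qE ?s0//; exact: hM (avg_itv n g _).
have mc : measurable_fun I01 (fun s => c (cell n.+1 s)).
  by apply: measurable_funTS; exact: (measurable_cell_fun n.+1 c).
have i1 : int01 (fun s => e / 2 + K * osc n.+1 g s).
  apply: (@int01_bounded _ _ (e / 2 + K)).
    by apply: measurable_funD => //; apply: measurable_funM => //; exact: measurable_osc.
  move=> s _; case/andP: (osc_itv (ltn0Sn n) g s) => o0 o1.
  have h1 : 0 <= e / 2 by rewrite divr_ge0// ltW.
  by rewrite ger0_norm; [rewrite lerD2l ler_piMr|rewrite addr_ge0// mulr_ge0].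
have i2 : int01 (fun s => 4 * M ^+ 2 * c (cell n.+1 s)).
  apply: (@int01_bounded _ _ (4 * M ^+ 2)); first by apply: measurable_funM.
  move=> s _; rewrite /c; case: (_ <= _)%N; rewrite ?mulr1 ?mulr0 ?normr0 ?mulr_ge0 ?sqr_ge0//.
  by rewrite ger0_norm ?mulr_ge0 ?sqr_ge0.
have Ib : Rint01 b <= e.
  rewrite /b /Rint01 RintegralD//.
  have -> : \int[leb]_(s in I01) (4 * M ^+ 2 * c (cell n.+1 s)) = 0.
    rewrite -/(Rint01 _) (@Rint01_cell _ n.+1 (fun j => 4 * M ^+ 2 * c j))// big1 ?mulr0// => j _.
    by rewrite /c leqNgt ltn_ord mulr0.
  have io : int01 (osc n.+1 g).
    apply: (@int01_bounded _ _ 1); first exact: measurable_osc.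
    by move=> s _; case/andP: (osc_itv (ltn0Sn n) g s) => o0 o1; rewrite ger0_norm.
  rewrite addr0 RintegralD//; last 2 first.
  - by apply: (@int01_bounded _ _ `|e / 2|).
  - exact: (integrableZl mI K io).
  rewrite -/(Rint01 (fun=> e / 2)) Rint01_cst RintegralZl// -/(Rint01 _) Rint01_osc//.
  have : K / n.+1%:R <= (K + 1) / n.+1%:R by rewrite ler_pM2r ?invr_gt0// lerDl.
  have key (x y z : R) : x <= y -> y < z / 2 -> z / 2 + x <= z by move=> *; lra.
  by move=> /key; apply.
have sq4 (x y : R) : `|x| <= M -> `|y| <= M -> (x - y) * (x - y) <= 4 * M ^+ 2.
  rewrite !ler_norml => /andP[h1 h2] /andP[h3 h4].
  have h5 : 0 <= (2 * M - (x - y)) by lra.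
  have h6 : 0 <= (2 * M + (x - y)) by lra.
  have h7 := mulr_ge0 h5 h6; rewrite -subr_ge0 (_ : _ - _ = (2 * M - (x - y)) * (2 * M + (x - y)))//; ring.
apply: le_trans Ib; apply: Rint01_le.
- have s1 : sqi leb I01 (fun s => q s - h (g s)).
    apply: (@bounded_sqi _ _ (2 * M)); first exact: measurable_funB.
    move=> s s01; rewrite (le_trans (ler_normB _ _))// mulr_natl mulr2n lerD//; first exact: qM.
    exact: hM (G0_itv g s).
  exact: (sqi_mul mI s1 s1).
- exact: (integrableD mI i1 i2).
move=> s s01; have := sq4 _ _ (qM _ s01) (hM _ (G0_itv g s)) => H4.
case/andP: (osc_itv (ltn0Sn n) g s) => o0 o1; rewrite /b.
have /I01P/andP[s0] := s01; rewrite le_eqVlt => /predU1P[s1|s1].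
  have -> : c (cell n.+1 s) = 1 by rewrite s1 cell1 /c leqnn.
  have h3 : 0 <= K * osc n.+1 g s by rewrite mulr_ge0.
  have key (a b2 x z : R) : a <= b2 -> 0 < x -> 0 <= z -> a <= x / 2 + z + b2 * 1 by move=> *; lra.
  exact: key.
have c0 : 0 <= 4 * M ^+ 2 * c (cell n.+1 s) by rewrite mulr_ge0 ?mulr_ge0 ?sqr_ge0// /c ler0n.
have s01' : 0 <= s < 1 by rewrite s0.
have [od|od] := ltP (osc n.+1 g s) d.
  have hlt : `|q s - h (g s)| < e1.
    rewrite qE//; apply: hd; [exact: avg_itv|exact: G0_itv|].
    exact: le_lt_trans (avg_osc n g s01') od.
  have h2 : (q s - h (g s)) * (q s - h (g s)) <= e1 ^+ 2.
    rewrite -expr2 -(real_normK (num_real (q s - _))) ler_pXn2r ?nnegrE//; first exact: ltW.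
    exact: ltW.
  have h3 : 0 <= K * osc n.+1 g s by rewrite mulr_ge0.
  have key (a b2 x z w : R) : a <= b2 -> b2 <= x / 2 -> 0 <= z -> 0 <= w -> a <= x / 2 + z + w by move=> *; lra.
  exact: key h2 e1e h3 c0.
have h3 : 4 * M ^+ 2 <= K * osc n.+1 g s.
  by rewrite /K -mulrA ler_peMr ?mulr_ge0 ?sqr_ge0// mulrC ler_pdivlMr// mul1r.
have key (a b2 x z w : R) : a <= b2 -> 0 < x -> b2 <= z -> 0 <= w -> a <= x / 2 + z + w by move=> *; lra.
exact: key H4 e0 h3 c0.
Qed.

Lemma Rint01_le_nrm (f : R -> R) : sqi leb I01 f -> `|Rint01 f| <= nrm leb I01 f.
Proof.
move=> sf; have mI := @measurable_I01 R.
have s1 : sqi leb I01 (fun=> 1 : R) by apply: (@bounded_sqi _ _ 1) => // s _; rewrite normr1.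
have := cauchy_schwarz mI sf s1; rewrite /ip /Rint01.
under eq_Rintegral => s _ do rewrite mulr1.
have -> : nrm leb I01 (fun=> 1 : R) = 1.
  by rewrite /nrm /ip (_ : (fun _ => _) = (fun=> 1)) ?mulr1 -?[Rintegral _ _ _]/(Rint01 _) ?Rint01_cst ?sqrtr1//; apply/funext => s; rewrite mulr1.
by rewrite mulr1.
Qed.

End Averages.

Section Cells.
Variable R : realType.
Local Notation leb := (@lebesgue_measure R).
Local Notation I01 := (@I01 R).
Implicit Types (f g : G0 R) (n k : nat).

(** The boolean factor is 0 at the point 1, where all the cell functions vanish. *)
Lemma sum_cellfun (c : nat -> R) n s :
  \sum_(k < n.+1) (n.+1%:R^-1 * c k) * cellfun n k s = (cell n.+1 s < n.+1)%N%:R * c (cell n.+1 s).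
Proof.
have h k : (n.+1%:R^-1 * c k) * cellfun n k s = (cell n.+1 s == k)%:R * c k.
  by rewrite /cellfun mulrACA mulVf// mul1r mulrC.
under eq_bigr => k _ do rewrite h.
have [kn|kn] := ltnP (cell n.+1 s) n.+1.
  rewrite (bigD1 (Ordinal kn))//= eqxx big1 ?addr0// => j jk.
  rewrite (_ : (cell n.+1 s == j) = false) ?mul0r//; apply/negbTE; apply: contra jk => /eqP h'.
  by apply/eqP/val_inj.
rewrite mul0r big1// => j _; rewrite (_ : (cell n.+1 s == j) = false) ?mul0r//.
by apply/negbTE; rewrite neq_ltn (leq_trans (ltn_ord j) kn) orbT.
Qed.

Lemma Rint01_bound (h : R -> R) (M : R) : measurable_fun I01 h -> (forall s, I01 s -> `|h s| <= M) ->
  `|Rint01 h| <= M.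
Proof.
move=> mh hM; have hi := int01_bounded mh hM.
rewrite (le_trans (Rint01_norm hi))// -[leRHS]Rint01_cst; apply: Rint01_le => //.
- exact: (integrable_norm hi).
- by apply: (@int01_bounded _ _ `|M|).
Qed.

Lemma nrm_le (h : R -> R) (e : R) : 0 <= e -> ip leb I01 h h <= e ^+ 2 -> nrm leb I01 h <= e.
Proof. by move=> e0 he; rewrite -(@ler_pXn2r _ 2)// ?nnegrE ?nrm_ge0// nrm_sqr. Qed.

Lemma avg_flow n k : exists C, flow_smooth (fun g : G0m R => avg n g k) (fun _ => cellfun n k) C.
Proof. exact: (flow_smooth_weight (cellfun_sqi R n k)). Qed.

End Cells.

(** * Functions of the integrals of alpha(g) as limits of functions of the integrals of f g *)

Section PotentialsByAverages.
Variables (R : realType) (Q : probability (G0m R) R).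
Local Notation leb := (@lebesgue_measure R).
Local Notation I01 := (@I01 R).
Local Notation QI := (Q \x leb)%E.
Variables (m : nat) (U : 'rV[R]_m -> R) (al : 'I_m -> R -> R).
Hypotheses (UC : C1fun U) (alC : forall i, C1real (al i)).

(** The Riemann sum of [al] over the cell averages is a sum of functions of linear functionals. Its
    gradient is [derive1 al] of the average on each cell, so [average_close] serves for the values
    and, with [al] replaced by its derivative, for the gradients. *)
Lemma potentials_approachable :
  approachable Q (@Cgraph R) (fun g => U (\row_i Rint01 (fun s => al i (gfun g s))))
    (fun g s => \sum_i 'D_(delta_mx 0 i) U (\row_j Rint01 (fun s => al j (gfun g s))) * derive1 (al i) (gfun g s)).
Proof.
have mG := @measurable_GI R; have mI := @measurable_I01 R.
have cal i := C1real_continuous (alC i).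
have [M M0 alM] : exists2 M : R, 0 <= M & forall i x, 0 <= x <= 1 -> `|al i x| <= M /\ `|derive1 (al i) x| <= M.
  have h i : exists B : R, 0 <= B /\ forall x, 0 <= x <= 1 -> `|al i x| <= B /\ `|derive1 (al i) x| <= B.
    have [B B0 hB] := segment_bounded 0 1 (cal i).
    have [B' B'0 hB'] := segment_bounded 0 1 (alC i).2.
    exists (B + B'); split; first exact: addr_ge0.
    by move=> x x01; rewrite (le_trans (hB x x01)) ?(le_trans (hB' x x01))// ?lerDl ?lerDr.
  have [B BP] := choice h; exists (\sum_i B i); first by apply: sumr_ge0 => i _; case: (BP i).
  have le i : B i <= \sum_i B i by rewrite (bigD1 i)//= lerDl sumr_ge0// => j _; case: (BP j).
  move=> i x x01; have [h1 h2] := (BP i).2 x x01.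
  by rewrite (le_trans h1 (le i)) (le_trans h2 (le i)).
pose Y (i : 'I_m) (g : G0m R) := Rint01 (fun s => al i (g s)).
pose Yn (n : nat) (i : 'I_m) (g : G0m R) := \sum_(k < n.+1) n.+1%:R^-1 * al i (avg n g k).
pose D (i : 'I_m) (g : G0m R) s := derive1 (al i) (g s).
pose Dn n (i : 'I_m) (g : G0m R) s :=
  \sum_(k < n.+1) derive1 (fun x => n.+1%:R^-1 * al i x) (avg n g k) * cellfun n k s.
have DnE n i g s : Dn n i g s = (cell n.+1 s < n.+1)%N%:R * derive1 (al i) (avg n g (cell n.+1 s)).
  rewrite -(sum_cellfun (fun k => derive1 (al i) (avg n g k))); apply: eq_bigr => k _.
  by rewrite (C1real_scale _ (alC i)).2.
have mal i (g : G0m R) : measurable_fun I01 (fun s => al i (g s)).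
  by apply: (measurableT_comp (continuous_measurable_fun (cal i))); exact: measurable_G0.
have mav i n (g : G0m R) : measurable_fun I01 (fun s => al i (avg n g (cell n.+1 s))).
  by apply: measurable_funTS; exact: (measurable_cell_fun n.+1 (fun k => al i (avg n g k))).
have YnE n i g : Yn n i g = Rint01 (fun s => al i (avg n g (cell n.+1 s))).
  by rewrite (@Rint01_cell _ n.+1 (fun k => al i (avg n g k)))// mulr_sumr.
have YM i g : `|Y i g| <= M by apply: Rint01_bound => // s _; exact: (alM i _ (G0_itv g s)).1.
have YnM n i g : `|Yn n i g| <= M.
  by rewrite YnE; apply: Rint01_bound => // s _; exact: (alM i _ (avg_itv n g _)).1.
have mqr n : measurable_row (Yn n).
  have [A _ hA] := common_bound (fun k : 'I_n.+1 => @avg_flow R n k).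
  apply: (@measurable_row_composite R m n.+1 (fun i _ x => n.+1%:R^-1 * al i x) (fun k g => avg n g k) (fun=> A)).
    by move=> i _; exact: C1real_continuous (C1real_scale _ (alC i)).1.
  by move=> k; exact: flow_lip (hA k).
have [A A0 hA] := common_bound (fun i => flow_smooth_potential (alC i)).
have sD i : sqi QI (@GI R) (fun p => D i p.1 p.2) := flow_sqi_prod Q (hA i).
have mDn n i : measurable_fun (@GI R) (fun p : G0m R * measurableTypeR R => Dn n i p.1 p.2).
  apply: measurable_sum => k; apply: measurable_funM; apply: measurable_funTS.
    have [C hC] := @avg_flow R n k.
    have mc : measurable_fun setT (derive1 (fun x => n.+1%:R^-1 * al i x)).
      by apply: continuous_measurable_fun; exact: (C1real_scale _ (alC i)).1.2.
    have ma := measurableT_comp mc (flow_smooth_measurable hC).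
    exact: (measurableT_comp ma measurable_fst).
  exact: (measurableT_comp (@measurable_cellfun R n k setT) measurable_snd).
have [c1 c2] :
  (fun n => sq Q setT (fun g => U (\row_i Yn n i g) - U (\row_i Y i g))) @ \oo --> (0 : \bar R) /\
  (fun n => sq QI (@GI R) (fun p =>
     \sum_i 'D_(delta_mx 0 i) U (\row_j Yn n j p.1) * Dn n i p.1 p.2 -
     \sum_i 'D_(delta_mx 0 i) U (\row_j Y j p.1) * D i p.1 p.2)) @ \oo --> (0 : \bar R).
  apply: (@comp_limit R Q m U Y D Yn Dn M) => //.
  - by move=> h ch; exact: (continuous_L2lip_measurable ch (fun i => flow_lip (hA i))).
  - move=> i; apply: nearW => g; apply/cvgrPdist_le => e e0.
    have e20 : 0 < e ^+ 2 by rewrite exprn_gt0.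
    have h := average_close (cal i) (fun x x01 => (alM i x x01).1) e20.
    apply: filterS h => n h; rewrite distrC YnE /Y /Rint01 -RintegralB//; last 2 first.
    + by apply: (int01_bounded (M := M)) => // s _; exact: (alM i _ (avg_itv n g _)).1.
    + by apply: (int01_bounded (M := M)) => // s _; exact: (alM i _ (G0_itv g s)).1.
    rewrite (le_trans (Rint01_le_nrm _))//.
      apply: (@bounded_sqi _ _ (M + M)); first exact: measurable_funB.
      move=> s _; rewrite (le_trans (ler_normB _ _))// lerD//; first exact: (alM i _ (avg_itv n g _)).1.
      exact: (alM i _ (G0_itv g s)).1.
    apply: nrm_le; first exact: ltW.
    by apply: h => //; exact: (alM i _ (avg_itv n g _)).1.
  - move=> i; have mB n : measurable_fun (@GI R) (fun p : G0m R * measurableTypeR R => Dn n i p.1 p.2 - D i p.1 p.2).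
      by apply: measurable_funB => //; exact: (sD i).1.
    apply/(sq_cvg0P QI mB) => e e0; have e20 : 0 < e / 2 by rewrite divr_gt0.
    have h := average_close (alC i).2 (fun x x01 => (alM i x x01).2) e20.
    apply: filterS h => n h.
    rewrite [ltLHS](sq_sectionE Q (F := fun g s => Dn n i g s - D i g s) (mB n)).2.
    apply: (@le_lt_trans _ _ (\int[Q]_g (e / 2)%:E)%E); last first.
      rewrite integral_cst// [X in (_ * X)%E]probability_setT mule1 lte_fin ltr_pdivrMr// ltr_pMr// ltr1n//.
    apply: ge0_le_integral => //.
    + by move=> g _; exact: sq_ge0.
    + exact: (sq_sectionE Q (F := fun g s => Dn n i g s - D i g s) (mB n)).1.
    + move=> g _.
      have mDg : measurable_fun I01 (Dn n i g) := measurable_section g (mDn n i).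
      have DM s : I01 s -> `|Dn n i g s| <= M.
        move=> _; rewrite DnE normrM; case: (_ < _)%N; rewrite ?normr1 ?normr0 ?mul1r ?mul0r//.
        exact: (alM i _ (avg_itv n g _)).2.
      have sB : sqi leb I01 (fun s => Dn n i g s - D i g s).
        apply: sqiB => //; first exact: (bounded_sqi mDg DM).
        exact: flow_sqi (hA i) g.
      rewrite sqE// lee_fin; apply: h => //.
        by move=> s s01; rewrite DnE (cell_lt (ltn0Sn n) s01) mul1r.
      by apply: DM; apply/I01P; rewrite ler01 lexx.
have Zu : Zgraph (fun g => U (\row_i Y i g)) (fun g s => \sum_i 'D_(delta_mx 0 i) U (\row_j Y j g) * D i g s).
  by exists m, U, al; split.
have [C uF] := Zgraph_flow_smooth Zu.
have Cn n : Cgraph (fun g => U (\row_i Yn n i g)) (fun g s => \sum_i 'D_(delta_mx 0 i) U (\row_j Yn n j g) * Dn n i g s).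
  exact: (@Cgraph_composite R m n.+1 U (fun i _ x => n.+1%:R^-1 * al i x) UC
    (fun i _ => (C1real_scale _ (alC i)).1) (fun k => cellfun n k) (fun k => cellfun_sqi R n k)).
apply: (@approachable_limit _ Q _ _ _ (fun n g => U (\row_i Yn n i g))
  (fun n g s => \sum_i 'D_(delta_mx 0 i) U (\row_j Yn n j g) * Dn n i g s)
  (@Cgraph_flow_smooth R) (flow_smooth_measurable uF) (flow_measurable uF) _ _ _ c1 c2).
- by move=> n; have [C' h] := Cgraph_flow_smooth (Cn n); exact: flow_smooth_measurable h.
- by move=> n; have [C' h] := Cgraph_flow_smooth (Cn n); exact: flow_measurable h.
- by move=> n; apply: graph_approachable; exact: Cn.
Qed.

End PotentialsByAverages.

Lemma Zgraph_approachable (R : realType) (Q : probability (G0m R) R) u F :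
  Zgraph u F -> approachable Q (@Cgraph R) u F.
Proof. by move=> [m [U [al [UC alC -> ->]]]]; exact: potentials_approachable. Qed.

(** * The distance function *)

Section FourthRoot.
Variable R : realType.

(* C^1 on the whole line and convergent to the square root on the half line;
   [root4 n q >= Num.sqrt q] keeps the gradient of [smooth_dist] below 1. *)
Definition root4 (n : nat) (q : R) : R := Num.sqrt (Num.sqrt (q ^+ 2 + n.+1%:R^-1 ^+ 2)).

Lemma root4_radicand_gt0 n (q : R) : 0 < q ^+ 2 + n.+1%:R^-1 ^+ 2.
Proof. by rewrite ltr_wpDl ?sqr_ge0// exprn_gt0// invr_gt0. Qed.

Lemma root4_gt0 n q : 0 < root4 n q.
Proof. by rewrite !sqrtr_gt0 root4_radicand_gt0. Qed.

Lemma root4_expr4 n q : root4 n q ^+ 4 = q ^+ 2 + n.+1%:R^-1 ^+ 2.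
Proof.
by rewrite (exprM _ 2 2) !sqr_sqrtr ?sqrtr_ge0// ltW// root4_radicand_gt0.
Qed.

Lemma root4_continuous n : continuous (root4 n).
Proof.
move=> x.
have c1 : {for x, continuous (fun q : R => q ^+ 2 + n.+1%:R^-1 ^+ 2)}.
  by apply: cvgD; [exact: exprn_continuous|exact: cvg_cst].
have c2 := @continuous_comp _ _ _ (fun q : R => q ^+ 2 + n.+1%:R^-1 ^+ 2) (@Num.sqrt R) x c1 (@sqrt_continuous R _).
exact: (@continuous_comp _ _ _ (fun q : R => Num.sqrt (q ^+ 2 + n.+1%:R^-1 ^+ 2)) (@Num.sqrt R) x c2 (@sqrt_continuous R _)).
Qed.

Lemma root4_C1 n : C1real (root4 n) /\ derive1 (root4 n) = fun q => q / (2 * root4 n q ^+ 3).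
Proof.
apply: is_derive_C1real => x; last first.
  apply: cvgM; first exact: cvg_id.
  apply: cvgV; first by rewrite mulf_neq0// expf_neq0// gt_eqF// root4_gt0.
  apply: cvgM; first exact: cvg_cst.
  have c := @continuous_comp _ _ _ (root4 n) (fun y : R => y ^+ 3) x (@root4_continuous n x) (@exprn_continuous R 3 _).
  exact: c.
have p0 := root4_radicand_gt0 n x.
have s0 : 0 < Num.sqrt (x ^+ 2 + n.+1%:R^-1 ^+ 2) by rewrite sqrtr_gt0.
have d1 : is_derive x (1 : R) (fun q : R => q ^+ 2 + n.+1%:R^-1 ^+ 2) (2 * x).
  apply: (@is_derive_quadratic _ _ _ 1) => y; rewrite mul1r.
  by rewrite (_ : _ - _ - _ = (y - x) ^+ 2) ?ger0_norm ?sqr_ge0//; ring.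
have d2 : is_derive x (1 : R) (Num.sqrt \o (fun q : R => q ^+ 2 + n.+1%:R^-1 ^+ 2))
   ((2 * Num.sqrt (x ^+ 2 + n.+1%:R^-1 ^+ 2))^-1 * (2 * x)).
  by apply: is_derive1_comp; exact: is_derive1_sqrt.
have d3 : is_derive x (1 : R) (Num.sqrt \o (Num.sqrt \o (fun q : R => q ^+ 2 + n.+1%:R^-1 ^+ 2)))
   ((2 * Num.sqrt (Num.sqrt (x ^+ 2 + n.+1%:R^-1 ^+ 2)))^-1 * ((2 * Num.sqrt (x ^+ 2 + n.+1%:R^-1 ^+ 2))^-1 * (2 * x))).
  by apply: is_derive1_comp; exact: is_derive1_sqrt.
apply: (is_derive_eq d3); rewrite -/(root4 n x).
have -> : Num.sqrt (x ^+ 2 + n.+1%:R^-1 ^+ 2) = root4 n x ^+ 2 by rewrite sqr_sqrtr// ltW.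
have r0 : root4 n x != 0 by rewrite gt_eqF// root4_gt0.
by field.
Qed.

Lemma sqr_le4 (a b c : R) : 0 <= c -> c <= a + b -> a <= 1 -> b <= 1 -> c ^+ 2 <= 4.
Proof. by move=> c0 ca a1 b1; nra. Qed.

End FourthRoot.

Section DistanceFunction.
Variables (R : realType) (Q : probability (G0m R) R).
Local Notation leb := (@lebesgue_measure R).
Local Notation I01 := (@I01 R).
Local Notation QI := (Q \x leb)%E.
Variable f : G0m R.
Implicit Types g : G0m R.

(* Equals 0 when [L2dist f g = 0], since [0^-1 = 0]. *)
Definition dist_grad g (s : R) : R := (L2dist f g)^-1 * (g s - f s).

Lemma measurable_distance : measurable_fun setT (fun g : G0m R => L2dist f g).
Proof.
apply: (@L2lip_measurable _ _ 1) => g h; rewrite mul1r.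
have := L2dist_triangle f g h; have := L2dist_triangle f h g; rewrite (L2distC h g) ler_norml.
by move=> h1 h2; apply/andP; split; lra.
Qed.

Lemma dist_grad_measurable : measurable_fun (@GI R) (fun p : G0m R * measurableTypeR R => dist_grad p.1 p.2).
Proof.
apply: measurable_funM.
  have mi : measurable_fun setT (fun g : G0m R => (L2dist f g)^-1).
    have := measurableT_comp (measurable_powR (-1)) measurable_distance; congr measurable_fun.
    by apply/funext => g /=; rewrite powR_inv1// L2dist_ge0.
  by apply: measurable_funTS; exact: (measurableT_comp mi measurable_fst).
apply: measurable_funB; first exact: measurable_G0_joint.
by apply: measurable_funTS; exact: (measurableT_comp (@measurable_G0 R f setT) measurable_snd).
Qed.

Lemma dist_grad_sqi_section g : sqi leb I01 (dist_grad g).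
Proof. exact: (sqiZ (@measurable_I01 R) _ (G0_sub_sqi g f)). Qed.

Lemma nrm_dist_grad g : nrm leb I01 (dist_grad g) <= 1.
Proof.
rewrite /dist_grad nrmZ; last exact: G0_sub_sqi.
rewrite -(L2distE g f) (L2distC g f) ger0_norm ?invr_ge0 ?L2dist_ge0//.
by have [->|d0] := eqVneq (L2dist f g) 0; rewrite ?mulr0 ?ler01// mulVf.
Qed.

Lemma dist_grad_sqi : sqi QI (@GI R) (fun p => dist_grad p.1 p.2).
Proof.
have mF := dist_grad_measurable; split => //; rewrite (sq_sectionE Q (F := dist_grad) mF).2.
apply: (@le_lt_trans _ _ (\int[Q]_g 1%:E)%E); last first.
  by rewrite integral_cst// [X in (_ * X)%E]probability_setT mule1 ltry.
apply: ge0_le_integral => //.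
- by move=> g _; exact: sq_ge0.
- exact: (sq_sectionE Q (F := dist_grad) mF).1.
- move=> g _; rewrite (sq_nrm _ (dist_grad_sqi_section g))// lee_fin expr_le1//; [exact: nrm_dist_grad|exact: nrm_ge0].
Qed.

Definition avg_diff n g (s : R) : R :=
  (cell n.+1 s < n.+1)%N%:R * (avg n g (cell n.+1 s) - avg n f (cell n.+1 s)).

Definition smooth_dist n g : R := root4 n (nrm leb I01 (avg_diff n g) ^+ 2).
Definition smooth_dist_grad n g (s : R) : R :=
  nrm leb I01 (avg_diff n g) ^+ 2 / smooth_dist n g ^+ 3 * avg_diff n g s.

Lemma measurable_avg_diff n g D : measurable_fun D (avg_diff n g).
Proof.
apply: measurable_funTS.
exact: (measurable_cell_fun n.+1 (fun k => (k < n.+1)%N%:R * (avg n g k - avg n f k))).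
Qed.

Lemma avg_diff_le1 n g s : `|avg_diff n g s| <= 1.
Proof.
rewrite /avg_diff normrM; case: (_ < _)%N; rewrite ?normr1 ?normr0 ?mul1r ?mul0r ?ler01//.
case/andP: (avg_itv n g (cell n.+1 s)) => h1 h2; case/andP: (avg_itv n f (cell n.+1 s)) => h3 h4.
by rewrite ler_norml; apply/andP; split; lra.
Qed.

Lemma avg_diff_sqi n g : sqi leb I01 (avg_diff n g).
Proof. by apply: (@bounded_sqi _ _ 1) => [|s _]; [exact: measurable_avg_diff|exact: avg_diff_le1]. Qed.

Lemma nrm_avg_diff_le1 n g : nrm leb I01 (avg_diff n g) <= 1.
Proof.
apply: nrm_le => //; rewrite expr1n -(Rint01_cst 1); apply: Rint01_le.
- exact: (sqi_mul (@measurable_I01 R) (avg_diff_sqi n g) (avg_diff_sqi n g)).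
- by apply: (@int01_bounded _ _ 1) => // s _; rewrite normr1.
- move=> s _; rewrite -expr2 -(real_normK (num_real _)) expr_le1//; exact: avg_diff_le1.
Qed.

(** The squared norm of [avg_diff] is the mean of the squares [(avg n g k - avg n f k) ^ 2]: a sum
    of functions of one linear functional each, as [Cgraph_composite] requires. *)
Lemma smooth_dist_Cgraph n : Cgraph (smooth_dist n) (smooth_dist_grad n).
Proof.
pose U (z : 'rV[R]_1) := root4 n (z 0 0).
have [UC UD] := @C1fun_proj R 1 0 (root4 n) (root4_C1 R n).1.
pose a (i : 'I_1) (k : 'I_n.+1) (y : R) := n.+1%:R^-1 * (y - avg n f k) ^+ 2.
have aC i k : C1real (a i k) /\ derive1 (a i k) = fun y => n.+1%:R^-1 * (2 * (y - avg n f k)).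
  apply: is_derive_C1real => y.
    apply: (@is_derive_quadratic _ _ _ (n.+1%:R^-1)) => x.
    rewrite (_ : _ - _ - _ = n.+1%:R^-1 * (x - y) ^+ 2); last by rewrite /a; ring.
    by rewrite ger0_norm// mulr_ge0 ?sqr_ge0.
  by apply: cvgM; [exact: cvg_cst|apply: cvgM; [exact: cvg_cst|apply: cvgB; [exact: cvg_id|exact: cvg_cst]]].
have q2 g : nrm leb I01 (avg_diff n g) ^+ 2 = \sum_(k < n.+1) a 0 k (avg n g k).
  pose c k : R := ((k < n.+1)%N%:R * (avg n g k - avg n f k)) * ((k < n.+1)%N%:R * (avg n g k - avg n f k)).
  rewrite nrm_sqr /ip -/(Rint01 _) (@Rint01_cell _ n.+1 c)// mulr_sumr; apply: eq_bigr => k _.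
  by rewrite /c ltn_ord !mul1r -expr2.
have := @Cgraph_composite R 1 n.+1 U a UC (fun i k => (aC i k).1) (fun k => cellfun n k) (fun k => cellfun_sqi R n k).
congr Cgraph.
  apply/funext => g; rewrite /U mxE /smooth_dist q2; congr root4.
apply/funext => g; apply/funext => s; rewrite big_ord_recl big_ord0 addr0 UD eqxx mul1r mxE (root4_C1 R n).2.
rewrite /smooth_dist_grad /smooth_dist q2.
rewrite (_ : \sum_k derive1 (a 0 k) _ * _ = 2 * avg_diff n g s); last first.
  rewrite -[RHS]mulrC -mulrA (_ : _ * 2 = 2 * (avg n g (cell n.+1 s) - avg n f (cell n.+1 s))); last by rewrite mulrC.
  rewrite -(sum_cellfun (fun k => 2 * (avg n g k - avg n f k))); apply: eq_bigr => k _.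
  by rewrite (aC 0 k).2.
have r0 : root4 n (\sum_(k < n.+1) a 0 k (avg n g k)) != 0 by rewrite gt_eqF// root4_gt0.
rewrite -/(avg n g _); set q := \sum_k _; set r := root4 _ _ in r0 *.
by rewrite /avg_diff; field.
Qed.

Lemma avg_diff_cvg g : (fun n => nrm leb I01 (fun s => avg_diff n g s - (g s - f s))) @ \oo --> (0 : R).
Proof.
have mI := @measurable_I01 R.
pose q (h : G0m R) (n : nat) (s : R) : R := (cell n.+1 s < n.+1)%N%:R * avg n h (cell n.+1 s).
have sq1 h n : sqi leb I01 (q h n).
  apply: (@bounded_sqi _ _ 1).
    by apply: measurable_funTS; exact: (measurable_cell_fun n.+1 (fun k => (k < n.+1)%N%:R * avg n h k)).
  move=> s _; case/andP: (avg_itv n h (cell n.+1 s)) => h1 h2; rewrite /q.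
  by case: (_ < _)%N; rewrite ?mul1r ?mul0r ?normr0 ?ler01// ger0_norm.
have cl (h : G0m R) (e : R) : 0 < e -> \forall n \near \oo, nrm leb I01 (fun s => q h n s - h s) <= e.
  move=> e0; have e20 : 0 < e ^+ 2 by rewrite exprn_gt0.
  have id1 (x : R) : 0 <= x <= 1 -> `|x| <= 1 by case/andP => x0; rewrite ger0_norm.
  have := average_close (fun x => @cvg_id _ _) id1 e20.
  apply: filterS => n hn; apply: nrm_le; first exact: ltW.
  apply: hn.
  - exact: (sq1 h n).1.
  - by move=> s s01; rewrite /q (cell_lt (ltn0Sn n) s01) mul1r.
  - by rewrite /q cell1 ltnn mul0r normr0.
apply/cvgrPdist_le => e e0; have e20 : 0 < e / 2 by rewrite divr_gt0.
apply: filterS2 (cl g _ e20) (cl f _ e20) => n h1 h2.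
rewrite sub0r normrN ger0_norm ?nrm_ge0//.
rewrite (_ : (fun s => _) = fun s => (q g n s - g s) - (q f n s - f s)); last first.
  by apply/funext => s; rewrite /avg_diff /q; ring.
rewrite (le_trans (nrmB mI _ _))//.
- exact: (sqiB mI (sq1 g n) (G0_sqi g)).
- exact: (sqiB mI (sq1 f n) (G0_sqi f)).
by rewrite (splitr e) lerD.
Qed.

Lemma nrm_avg_diff_cvg g : (fun n => nrm leb I01 (avg_diff n g)) @ \oo --> L2dist f g.
Proof.
have mI := @measurable_I01 R; have sd := G0_sub_sqi g f.
have /cvgrPdist_le H := @avg_diff_cvg g; apply/cvgrPdist_le => e e0.
apply: filterS (H _ e0) => n; rewrite sub0r normrN ger0_norm ?nrm_ge0// => h.
apply: le_trans h; rewrite L2distC L2distE ler_norml.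
have sB := sqiB mI (avg_diff_sqi n g) sd.
have h1 : nrm leb I01 (avg_diff n g) <= nrm leb I01 (fun s => avg_diff n g s - (g s - f s)) + nrm leb I01 (fun s => g s - f s).
  have := nrmD mI sB sd; congr (nrm _ _ _ <= _); apply/funext => s; by rewrite subrK.
have h2 : nrm leb I01 (fun s => g s - f s) <= nrm leb I01 (avg_diff n g) + nrm leb I01 (fun s => avg_diff n g s - (g s - f s)).
  have := nrmB mI (avg_diff_sqi n g) sB; congr (nrm _ _ _ <= _); apply/funext => s; ring.
have key (a b c : R) : a <= c + b -> b <= a + c -> - c <= b - a <= c by move=> *; apply/andP; split; lra.
exact: key.
Qed.

Lemma smooth_dist_cvg g : (fun n => smooth_dist n g) @ \oo --> L2dist f g.
Proof.
have d0 := L2dist_ge0 f g.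
have c0 : (fun n => n.+1%:R^-1 : R) @ \oo --> (0 : R).
  apply/cvgrPdist_lt => e e0; have h := near_divn_lt ltr01 e0; apply: filterS h => n.
  by rewrite mul1r sub0r normrN ger0_norm ?invr_ge0.
have -> : L2dist f g = Num.sqrt (Num.sqrt ((L2dist f g ^+ 2) ^+ 2 + 0 ^+ 2)).
  by rewrite expr0n addr0 sqrtr_sqr ger0_norm ?sqr_ge0// sqrtr_sqr ger0_norm.
have c1 : (fun n => (nrm leb I01 (avg_diff n g) ^+ 2) ^+ 2 + n.+1%:R^-1 ^+ 2) @ \oo --> (L2dist f g ^+ 2) ^+ 2 + 0 ^+ 2.
  apply: cvgD; last exact: (cvgM c0 c0).
  have h (x : nat -> R) (l : R) : x @ \oo --> l -> (fun n => x n ^+ 2) @ \oo --> l ^+ 2 by move=> xl; exact: (cvgM xl xl).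
  exact: (h _ _ (h _ _ (@nrm_avg_diff_cvg g))).
have c2 := cvg_comp _ _ c1 (@sqrt_continuous R _).
exact: (cvg_comp _ _ c2 (@sqrt_continuous R _)).
Qed.

Lemma nrm_le_smooth_dist n g : nrm leb I01 (avg_diff n g) <= smooth_dist n g.
Proof.
rewrite -(@ler_pXn2r _ 4)// ?nnegrE ?nrm_ge0//; last by rewrite ltW// root4_gt0.
by rewrite root4_expr4 -exprM lerDl sqr_ge0.
Qed.

Lemma smooth_dist_grad_sqi n g : sqi leb I01 (smooth_dist_grad n g).
Proof. exact: (sqiZ (@measurable_I01 R) _ (avg_diff_sqi n g)). Qed.

(** The norm is the cube of the quotient of [nrm (avg_diff n g)] by [smooth_dist n g], and this
    quotient is at most 1. *)
Lemma nrm_smooth_dist_grad n g : nrm leb I01 (smooth_dist_grad n g) <= 1.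
Proof.
have r0 : 0 < smooth_dist n g := root4_gt0 n _.
have x0 := nrm_ge0 leb I01 (avg_diff n g).
rewrite /smooth_dist_grad nrmZ; last exact: avg_diff_sqi.
rewrite ger0_norm; last by rewrite divr_ge0 ?sqr_ge0// exprn_ge0// ltW.
rewrite mulrAC -exprSr ler_pdivrMr ?exprn_gt0// mul1r ler_pXn2r ?nnegrE//; last exact: ltW.
exact: nrm_le_smooth_dist.
Qed.

Lemma avg_diff0 n g s : L2dist f g = 0 -> avg_diff n g s = 0.
Proof.
move=> d0; have mI := @measurable_I01 R.
have h k : avg n g k - avg n f k = 0.
  have -> : avg n g k - avg n f k = ip leb I01 (cellfun n k) (fun s => g s - f s).
    by rewrite (ipBr mI (cellfun_sqi R n k) (G0_sqi g) (G0_sqi f)).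
  apply/eqP; rewrite -normr_le0 (le_trans (cauchy_schwarz mI (cellfun_sqi R n k) (G0_sub_sqi g f)))//.
  by rewrite -L2distE L2distC d0 mulr0.
by rewrite /avg_diff h mulr0.
Qed.

Lemma smooth_dist_grad_cvg g :
  (fun n => nrm leb I01 (fun s => smooth_dist_grad n g s - dist_grad g s)) @ \oo --> (0 : R).
Proof.
have mI := @measurable_I01 R; have sd := G0_sub_sqi g f.
(* At zero distance all the averages agree, so both gradients vanish. *)
have [d0|d0] := eqVneq (L2dist f g) 0.
  rewrite (_ : (fun n => _) = fun=> 0); first exact: cvg_cst.
  apply/funext => n; rewrite (_ : (fun s => _) = fun s => 0 * (g s - f s)).
    by rewrite nrmZ// normr0 mul0r.
  by apply/funext => s; rewrite /smooth_dist_grad /dist_grad avg_diff0// d0 invr0 mulr0 !mul0r subrr.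
pose c n := nrm leb I01 (avg_diff n g) ^+ 2 / smooth_dist n g ^+ 3.
have cc : c @ \oo --> (L2dist f g)^-1.
  have -> : (L2dist f g)^-1 = L2dist f g ^+ 2 / L2dist f g ^+ 3 by field.
  apply: cvgM; first exact: (cvgM (@nrm_avg_diff_cvg g) (@nrm_avg_diff_cvg g)).
  apply: cvgV; first by rewrite expf_neq0.
  have h := @smooth_dist_cvg g; exact: (cvgM h (cvgM h h)).
have lim : (fun n => `|c n| * nrm leb I01 (fun s => avg_diff n g s - (g s - f s)) +
    `|c n - (L2dist f g)^-1| * nrm leb I01 (fun s => g s - f s)) @ \oo --> (0 : R).
  have -> : 0 = `|(L2dist f g)^-1| * 0 + `|(L2dist f g)^-1 - (L2dist f g)^-1| * nrm leb I01 (fun s => g s - f s) :> R.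
    by rewrite mulr0 subrr normr0 mul0r addr0.
  apply: cvgD; first by apply: cvgM (@avg_diff_cvg g); exact: (cvg_norm cc).
  apply: cvgM; last exact: cvg_cst.
  by apply: cvg_norm; apply: cvgB => //; exact: cvg_cst.
apply: (squeeze_cvgr _ (cvg_cst 0) lim); apply: nearW => n; rewrite nrm_ge0 /=.
rewrite (_ : (fun s => _) = fun s => c n * (avg_diff n g s - (g s - f s)) + (c n - (L2dist f g)^-1) * (g s - f s)); last first.
  by apply/funext => s; rewrite /smooth_dist_grad /dist_grad -/(c n); ring.
have sB := sqiB mI (avg_diff_sqi n g) sd.
by rewrite (le_trans (nrmD mI (sqiZ mI _ sB) (sqiZ mI _ sd)))// !nrmZ.
Qed.

(** The gradients converge in L^2([0, 1]) for every [g] and have norm at most 1, so dominated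
    convergence in [g] suffices; the constant 4 is the square of the sum of the two norm bounds. *)
Lemma distance_approachable : approachable Q (@Cgraph R) (fun g => L2dist f g) dist_grad.
Proof.
have mI := @measurable_I01 R; have mG := @measurable_GI R.
have md := measurable_distance.
have sm n := Cgraph_flow_smooth (smooth_dist_Cgraph n).
have mu n : measurable_fun setT (smooth_dist n) by have [C h] := sm n; exact: flow_smooth_measurable h.
have sF n : sqi QI (@GI R) (fun p => smooth_dist_grad n p.1 p.2) by have [C h] := sm n; exact: (flow_sqi_prod Q h).
have sB n : sqi QI (@GI R) (fun p => smooth_dist_grad n p.1 p.2 - dist_grad p.1 p.2).
  by apply: sqiB => //; exact: dist_grad_sqi.
apply: (@approachable_limit _ Q _ _ _ smooth_dist smooth_dist_grad (@Cgraph_flow_smooth R)) => //.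
- exact: dist_grad_measurable.
- by move=> n; exact: (sF n).1.
- by move=> n; apply: graph_approachable; exact: smooth_dist_Cgraph.
- apply: (@sq_dominated_cvg _ _ _ Q setT measurableT smooth_dist (fun g => L2dist f g) (cst 4)) => //.
  + by apply: (@prob_bounded_integrable _ _ _ 4) => // g; rewrite ger0_norm.
  + move=> n g _; have d0 := L2dist_ge0 f g; have d1 := L2dist_le1 f g.
    have r0 : 0 < smooth_dist n g := root4_gt0 n _.
    have r2 : smooth_dist n g <= 2.
      rewrite -(@ler_pXn2r _ 4)// ?nnegrE; [|exact: ltW|by []].
      rewrite root4_expr4 -exprM.
      have h1 : nrm leb I01 (avg_diff n g) ^+ (2 * 2) <= 1 by rewrite exprn_ile1 ?nrm_ge0// nrm_avg_diff_le1.
      have h2 : n.+1%:R^-1 ^+ 2 <= 1 :> R by rewrite exprn_ile1 ?invr_ge0// invf_le1// ler1n.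
      have : (2 : R) ^+ 4 = 16 by ring.
      move=> ->; move: h1 h2; set a := _ ^+ (2 * 2); set b := _ ^+ 2 => h1 h2; lra.
    have key (a b : R) : 0 <= a -> a <= 1 -> 0 < b -> b <= 2 -> (b - a) ^+ 2 <= 4 by move=> *; nra.
    exact: key.
  + by apply: nearW => g _; exact: (@smooth_dist_cvg g).
have E n : sq QI (@GI R) (fun p => smooth_dist_grad n p.1 p.2 - dist_grad p.1 p.2) =
   (\int[Q]_g ip leb I01 (fun s => smooth_dist_grad n g s - dist_grad g s) (fun s => smooth_dist_grad n g s - dist_grad g s))%:E.
  rewrite (sqE mG (sB n)); congr EFin.
  by rewrite (@ip_section _ Q (fun g s => smooth_dist_grad n g s - dist_grad g s) (fun g s => smooth_dist_grad n g s - dist_grad g s) (sB n) (sB n)).2.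
rewrite (_ : (fun n => _) = EFin \o (fun n => \int[Q]_g ip leb I01 (fun s => smooth_dist_grad n g s - dist_grad g s) (fun s => smooth_dist_grad n g s - dist_grad g s))); last first.
  by apply/funext => n; exact: E.
have sS n g : sqi leb I01 (fun s => smooth_dist_grad n g s - dist_grad g s).
  by apply: sqiB => //; [exact: smooth_dist_grad_sqi|exact: dist_grad_sqi_section].
apply: cvg_EFin; first exact: nearW.
have -> : 0 = \int[Q]_g (0 : R) by rewrite /Rintegral integral0.
apply: (@Rintegral_dominated_cvg _ _ _ Q setT _ (fun=> 0) (cst 4)) => //.
- move=> n; have := (@ip_section _ Q (fun g s => smooth_dist_grad n g s - dist_grad g s) (fun g s => smooth_dist_grad n g s - dist_grad g s) (sB n) (sB n)).1.
  by move=> /measurable_int/measurable_EFinP.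
- by apply: (@prob_bounded_integrable _ _ _ 4) => // g; rewrite ger0_norm.
- move=> n g _; rewrite -nrm_sqr ger0_norm ?sqr_ge0//.
  have h := nrmB mI (smooth_dist_grad_sqi n g) (dist_grad_sqi_section g).
  have h1 := nrm_smooth_dist_grad n g; have h2 := nrm_dist_grad g.
  have h3 := nrm_ge0 leb I01 (fun s => smooth_dist_grad n g s - dist_grad g s).
  exact: sqr_le4 h3 h h1 h2.
- apply: nearW => g _.
  rewrite (_ : (fun n => _) = fun n => nrm leb I01 (fun s => smooth_dist_grad n g s - dist_grad g s) * nrm leb I01 (fun s => smooth_dist_grad n g s - dist_grad g s)); last first.
    by apply/funext => n; rewrite -nrm_sqr expr2.
  rewrite -[X in _ --> X](mulr0 0); have h := @smooth_dist_grad_cvg g; exact: (cvgM h h).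
Qed.

End DistanceFunction.

Lemma ip_congr d (T : measurableType d) (R : realType) (mu : {measure set T -> \bar R}) (D : set T)
    (f f' h h' : T -> R) : measurable D -> sqi mu D f -> sqi mu D f' -> sqi mu D h -> sqi mu D h' ->
  sq mu D (fun x => f x - f' x) = 0%E -> sq mu D (fun x => h x - h' x) = 0%E -> ip mu D f h = ip mu D f' h'.
Proof.
move=> mD sf sf' sh sh' ff hh.
have z k : sqi mu D k -> sq mu D k = 0%E -> nrm mu D k = 0.
  by move=> sk; rewrite (sq_nrm mD sk) => -[] /eqP; rewrite sqrf_eq0 => /eqP.
have zl k k' : sqi mu D k -> sqi mu D k' -> nrm mu D k = 0 -> ip mu D k k' = 0.
  move=> sk sk' k0; apply/eqP; rewrite -normr_le0 (le_trans (cauchy_schwarz mD sk sk'))//.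
  by rewrite k0 mul0r.
have e1 : ip mu D f h = ip mu D f' h.
  by apply/eqP; rewrite -subr_eq0 -ipBl// zl//; [exact: sqiB|exact: z (sqiB mD sf sf') ff].
have e2 : ip mu D f' h = ip mu D f' h'.
  by apply/eqP; rewrite -subr_eq0 -ipBr// ipC zl//; [exact: sqiB|exact: z (sqiB mD sh sh') hh].
by rewrite e1.
Qed.

(** * Closures of the operator and of the form *)

Section Closures.
Variables (R : realType) (Q : probability (G0m R) R).
Local Notation leb := (@lebesgue_measure R).
Local Notation I01 := (@I01 R).
Local Notation QI := (Q \x leb)%E.
Local Notation unc F := (fun p : G0m R * measurableTypeR R => F p.1 p.2).
Local Notation graph := ((G0m R -> R) -> (G0m R -> R -> R) -> Prop).
Implicit Types (u w : G0m R -> R) (F H : G0m R -> R -> R) (Gr : graph).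

Let mI := @measurable_I01 R.
Let mG := @measurable_GI R.

Lemma jmeas_GI F : jmeas F -> measurable_fun (@GI R) (unc F).
Proof. by move=> mF; exact: (measurable_funTS mF). Qed.

Lemma NN2E F : measurable_fun (@GI R) (unc F) -> NN2 Q F = sq QI (@GI R) (unc F).
Proof. by move=> mF; rewrite (sq_sectionE Q (F := F) mF).2. Qed.

(** Membership in [op_closure] asks for measurability on the whole product with the line, while
    gradients are controlled on [0, 1]; the extension by 0 reconciles the two. *)
Definition on01 F : G0m R -> R -> R := fun g s => ((unc F) \_ (@GI R)) (g, s).

Lemma on01E F g s : I01 s -> on01 F g s = F g s.
Proof. by move=> s1; rewrite /on01 patchE mem_set//; split. Qed.

Lemma jmeas_on01 F : measurable_fun (@GI R) (unc F) -> jmeas (on01 F).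
Proof.
move=> mF; have := (measurable_restrictT (unc F) mG).1 mF.
by congr measurable_fun; apply/funext => -[g s].
Qed.

Lemma approachable_eq Gr u F F' : (forall g s, I01 s -> F g s = F' g s) ->
  approachable Q Gr u F -> approachable Q Gr u F'.
Proof.
move=> FF uF e e0; have [w [H [wH h1 h2]]] := uF _ e0; exists w, H; split => //.
rewrite (_ : sq _ _ _ = sq QI (@GI R) (fun p => H p.1 p.2 - F p.1 p.2))//.
by apply: eq_integral => p; rewrite inE => -[_ p2]; rewrite FF.
Qed.

Lemma seq_approachable Gr u F (un : nat -> G0m R -> R) (Fn : nat -> G0m R -> R -> R) : smooth_graph Gr ->
  measurable_fun setT u -> measurable_fun (@GI R) (unc F) -> (forall n, Gr (un n) (Fn n)) ->
  (fun n => sq Q setT (fun g => un n g - u g)) @ \oo --> (0 : \bar R) ->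
  (fun n => sq QI (@GI R) (fun p => Fn n p.1 p.2 - F p.1 p.2)) @ \oo --> (0 : \bar R) ->
  approachable Q Gr u F.
Proof.
move=> sG mu mF Gn; apply: approachable_limit => // n.
- by have [C h] := sG _ _ (Gn n); exact: flow_smooth_measurable h.
- by have [C h] := sG _ _ (Gn n); exact: flow_measurable h.
- exact: graph_approachable.
Qed.

Lemma approachable_sqi Gr u F : smooth_graph Gr -> measurable_fun (@GI R) (unc F) ->
  approachable Q Gr u F -> sqi QI (@GI R) (unc F).
Proof.
move=> sG mF uF; have [w [H [wH _ h]]] := uF 1 ltr01.
have [C sw] := sG _ _ wH; apply: (sqi_near mG mF (flow_sqi_prod Q sw)).
by rewrite sqB_C; apply: (lt_trans h); rewrite ltry.
Qed.

Lemma L2IcvgE Gr (un : nat -> G0m R -> R) (Fn : nat -> G0m R -> R -> R) F : smooth_graph Gr ->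
  measurable_fun (@GI R) (unc F) -> (forall n, Gr (un n) (Fn n)) ->
  L2Icvg Q Fn F <-> (fun n => sq QI (@GI R) (fun p => Fn n p.1 p.2 - F p.1 p.2)) @ \oo --> (0 : \bar R).
Proof.
move=> sG mF Gn; rewrite /L2Icvg.
rewrite (_ : (fun n => NN2 Q _) = fun n => sq QI (@GI R) (fun p => Fn n p.1 p.2 - F p.1 p.2))//.
apply/funext => n; have [C h] := sG _ _ (Gn n).
by rewrite -(@NN2E (fun g s => Fn n g s - F g s))//; apply: measurable_funB => //; exact: flow_measurable h.
Qed.

Lemma op_closureP Gr u F : smooth_graph Gr ->
  op_closure Q Gr u F <-> [/\ measurable_fun setT u, jmeas F & approachable Q Gr u F].
Proof.
move=> sG; split => -[mu jF].
  move=> [un [Fn [Gn unu FnF]]]; split => //; have mF := jmeas_GI jF.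
  by apply: (@seq_approachable _ _ _ un Fn) => //; exact/(L2IcvgE sG mF Gn).
move=> uF; have mF := jmeas_GI jF; split => //.
have [un [Fn [Gn unu FnF]]] := approachable_seq sG mu mF uF; exists un, Fn; split => //.
exact/(L2IcvgE sG mF Gn).
Qed.

Lemma L2Icauchy_limit (Fn : nat -> G0m R -> R -> R) : (forall n, measurable_fun (@GI R) (unc (Fn n))) ->
  L2Icauchy Q Fn -> exists2 F : G0m R -> R -> R, measurable_fun (@GI R) (unc F) &
    (fun n => sq QI (@GI R) (fun p => Fn n p.1 p.2 - F p.1 p.2)) @ \oo --> (0 : \bar R).
Proof.
move=> mFn cF; have [f mf fc] : exists2 f : G0m R * measurableTypeR R -> R, measurable_fun (@GI R) f &
    (fun n => sq QI (@GI R) (fun p => Fn n p.1 p.2 - f p)) @ \oo --> (0 : \bar R).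
  apply: (@sq_complete _ _ _ QI _ mG (fun n => unc (Fn n)) mFn) => e e0.
  have [N hN] := cF _ e0; exists N => n k Nn Nk.
  by rewrite -(@NN2E (fun g s => Fn n g s - Fn k g s)); [exact: hN|exact: measurable_funB].
exists (fun g s => f (g, s)).
  by apply: (eq_measurable_fun f _ mf) => -[g s].
rewrite (_ : (fun n => _) = fun n => sq QI (@GI R) (fun p => Fn n p.1 p.2 - f p))//.
by apply/funext => n; congr sq; apply/funext => -[g s].
Qed.

Lemma cvg_L2Icauchy (Fn : nat -> G0m R -> R -> R) F : (forall n, measurable_fun (@GI R) (unc (Fn n))) ->
  measurable_fun (@GI R) (unc F) ->
  (fun n => sq QI (@GI R) (fun p => Fn n p.1 p.2 - F p.1 p.2)) @ \oo --> (0 : \bar R) -> L2Icauchy Q Fn.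
Proof.
move=> mFn mF FnF e e0; have e4 : 0 < e / 4 by rewrite divr_gt0.
have [N _ hN] := (sq_cvg0P QI (fun n => measurable_funB (mFn n) mF)).1 FnF _ e4.
exists N => n k Nn Nk; have h1 := hN _ Nn; have h2 := hN _ Nk.
rewrite (@NN2E (fun g s => Fn n g s - Fn k g s)); last exact: measurable_funB.
have := sq_le_sub QI mG (measurable_funB (mFn n) mF) (measurable_funB (mFn k) mF).
rewrite [X in (sq QI _ X <= _)%E -> _](_ : _ = fun p => Fn n p.1 p.2 - Fn k p.1 p.2); last first.
  by apply/funext => p /=; ring.
move=> /le_lt_trans; apply; have -> : e = 2 * (e / 4) + 2 * (e / 4) by lra.
rewrite EFinD; have h x : (x < (e / 4)%:E)%E -> (2%:E * x < (2 * (e / 4))%:E)%E by move=> ?; rewrite EFinM lte_pmul2l.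
exact: (lteD (h _ h1) (h _ h2)).
Qed.

Lemma integral_inner01 F H : sqi QI (@GI R) (unc F) -> sqi QI (@GI R) (unc H) ->
  (\int[Q]_g (inner01 F H g)%:E)%E = (ip QI (@GI R) (unc F) (unc H))%:E.
Proof.
move=> sF sH; have [i1 i2] := ip_section sF sH.
by rewrite -i2 /Rintegral fineK//; exact: (integrable_fin_num measurableT i1).
Qed.

(** Cauchy sequences of gradients converge by completeness, and the energy, an inner product of
    gradients, passes to the limit. The form is thereby described through the closure of the
    operator. *)
Lemma form_closureP Gr u w (e : R) : smooth_graph Gr ->
  form_closure Q Gr u w e <-> [/\ measurable_fun setT u, measurable_fun setT w & exists F H,
    [/\ measurable_fun (@GI R) (unc F), measurable_fun (@GI R) (unc H), approachable Q Gr u F,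
        approachable Q Gr w H & e = ip QI (@GI R) (unc F) (unc H)]].
Proof.
move=> sG; split => -[mu mw].
  move=> [un [wn [Fn [Hn [Gn unu wnw [cF cH] ce]]]]]; split => //.
  have mFn n : measurable_fun (@GI R) (unc (Fn n)) by have [C h] := sG _ _ (Gn n).1; exact: flow_measurable h.
  have mHn n : measurable_fun (@GI R) (unc (Hn n)) by have [C h] := sG _ _ (Gn n).2; exact: flow_measurable h.
  have [F mF FnF] := L2Icauchy_limit mFn cF; have [H mH HnH] := L2Icauchy_limit mHn cH.
  have uF : approachable Q Gr u F := seq_approachable sG mu mF (fun n => (Gn n).1) unu FnF.
  have wH : approachable Q Gr w H := seq_approachable sG mw mH (fun n => (Gn n).2) wnw HnH.
  exists F, H; split => //.
  have sF := approachable_sqi sG mF uF; have sH := approachable_sqi sG mH wH.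
  have c := @sq_cvg_ip _ _ _ QI _ mG (fun n => unc (Fn n)) (fun n => unc (Hn n)) _ _ mFn mHn sF sH FnF HnH.
  have c' : (fun n => ip QI (@GI R) (unc (Fn n)) (unc (Hn n))) @ \oo --> e.
    have E : (fun n => (\int[Q]_g (inner01 (Fn n) (Hn n) g)%:E)%E) = EFin \o (fun n => ip QI (@GI R) (unc (Fn n)) (unc (Hn n))).
      apply/funext => n; have [C h] := sG _ _ (Gn n).1; have [C' h'] := sG _ _ (Gn n).2.
      exact: (integral_inner01 (flow_sqi_prod Q h) (flow_sqi_prod Q h')).
    by move: ce; rewrite E => /fine_cvgP[].
  exact: (cvg_unique (@Rhausdorff R) c' c).
move=> [F [H [mF mH uF wH ->]]]; split => //.
have sF := approachable_sqi sG mF uF; have sH := approachable_sqi sG mH wH.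
have [un [Fn [Gn unu FnF]]] := approachable_seq sG mu mF uF.
have [wn [Hn [Gn' wnw HnH]]] := approachable_seq sG mw mH wH.
have mFn n : measurable_fun (@GI R) (unc (Fn n)) by have [C h] := sG _ _ (Gn n); exact: flow_measurable h.
have mHn n : measurable_fun (@GI R) (unc (Hn n)) by have [C h] := sG _ _ (Gn' n); exact: flow_measurable h.
exists un, wn, Fn, Hn; split => //.
  by split; [exact: (cvg_L2Icauchy mFn mF FnF)|exact: (cvg_L2Icauchy mHn mH HnH)].
have c := @sq_cvg_ip _ _ _ QI _ mG (fun n => unc (Fn n)) (fun n => unc (Hn n)) _ _ mFn mHn sF sH FnF HnH.
rewrite (_ : (fun n => _) = EFin \o (fun n => ip QI (@GI R) (unc (Fn n)) (unc (Hn n)))); last first.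
  apply/funext => n; have [C h] := sG _ _ (Gn n); have [C' h'] := sG _ _ (Gn' n).
  exact: (integral_inner01 (flow_sqi_prod Q h) (flow_sqi_prod Q h')).
by apply: cvg_EFin => //; exact: nearW.
Qed.

(** Differences are again flow smooth, even when the two terms come from different cylinder classes.
    Uniqueness of the gradient reduces to the fact that limits of such differences have gradient 0
    when their values tend to 0. *)
Definition diff_graph Gr Gr' : graph := fun v K => exists u F w H,
  [/\ Gr u F, Gr' w H, v = (fun g => u g - w g) & K = (fun g s => F g s - H g s)].

Lemma smooth_diff_graph Gr Gr' : smooth_graph Gr -> smooth_graph Gr' -> smooth_graph (diff_graph Gr Gr').
Proof.
move=> sG sG' v K [u [F [w [H [uF wH -> ->]]]]].
have [C h] := sG _ _ uF; have [C' h'] := sG' _ _ wH.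
by exists (2 * (C + C')); exact: flow_smoothB.
Qed.

Lemma approachableB Gr Gr' u w F H : smooth_graph Gr -> smooth_graph Gr' ->
  measurable_fun setT u -> measurable_fun (@GI R) (unc F) ->
  measurable_fun setT w -> measurable_fun (@GI R) (unc H) ->
  approachable Q Gr u F -> approachable Q Gr' w H ->
  approachable Q (diff_graph Gr Gr') (fun g => u g - w g) (fun g s => F g s - H g s).
Proof.
move=> sG sG' mu mF mw mH uF wH e e0; have e4 : 0 < e / 4 by rewrite divr_gt0.
have [u1 [F1 [G1 h1 h2]]] := uF _ e4; have [w1 [H1 [G2 h3 h4]]] := wH _ e4.
have [C1 f1] := sG _ _ G1; have [C2 f2] := sG' _ _ G2.
have h x : (x < (e / 4)%:E)%E -> (2%:E * x < (2 * (e / 4))%:E)%E by move=> ?; rewrite EFinM lte_pmul2l.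
have key (a b : \bar R) : (a < (e / 4)%:E)%E -> (b < (e / 4)%:E)%E -> (2%:E * a + 2%:E * b < e%:E)%E.
  move=> ae be; have -> : e = 2 * (e / 4) + 2 * (e / 4) by lra.
  by rewrite EFinD; exact: (lteD (h _ ae) (h _ be)).
exists (fun g => u1 g - w1 g), (fun g s => F1 g s - H1 g s); split; first by exists u1, F1, w1, H1.
  have := sq_le_sub Q measurableT (measurable_funB (flow_smooth_measurable f1) mu) (measurable_funB (flow_smooth_measurable f2) mw).
  rewrite [X in (sq Q _ X <= _)%E -> _](_ : _ = fun g => u1 g - w1 g - (u g - w g)); last first.
    by apply/funext => g /=; ring.
  by move=> /le_lt_trans; apply; exact: key.
have := sq_le_sub QI mG (measurable_funB (flow_measurable f1) mF) (measurable_funB (flow_measurable f2) mH).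
rewrite [X in (sq QI _ X <= _)%E -> _](_ : _ = fun p => F1 p.1 p.2 - H1 p.1 p.2 - (F p.1 p.2 - H p.1 p.2)); last first.
  by apply/funext => p /=; ring.
by move=> /le_lt_trans; apply; exact: key.
Qed.

(** * Uniqueness of the gradient and closability *)

Section Locality.
Variable beta : R.
Hypotheses (beta0 : 0 < beta) (HQ : is_entropic beta Q).

(** Subtracting [c] from the approximating functions leaves their gradients unchanged and reduces to
    the case of the value 0. *)
Lemma approachable_vanish Gr u F (O : set (G0m R)) (c : R) : smooth_graph Gr ->
  measurable_fun setT u -> measurable_fun (@GI R) (unc F) -> approachable Q Gr u F ->
  L2open O -> {ae Q, forall g, O g -> u g = c} -> {ae Q, forall g, O g -> sq leb I01 (F g) = 0%E}.
Proof.
move=> sG mu mF uF oO uO.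
have [un [Fn [Gn unu FnF]]] := approachable_seq sG mu mF uF.
have [C hC] := choice (fun n => sG _ _ (Gn n)).
apply: (local_closability beta0 HQ (un := fun n g => un n g - c) (Fn := Fn) (Cn := fun n => C n + `|c|)
  (v := fun g => u g - c)) => //.
- by move=> n; exact: flow_smooth_shift.
- exact: measurable_funB.
- rewrite (_ : (fun n => _) = fun n => sq Q setT (fun g => un n g - u g))//.
  by apply/funext => n; congr sq; apply/funext => g; ring.
- by apply: filterS uO => g h Og; rewrite h// subrr.
Qed.

Lemma approachable_unique Gr Gr' u F F' : smooth_graph Gr -> smooth_graph Gr' ->
  measurable_fun setT u -> measurable_fun (@GI R) (unc F) -> measurable_fun (@GI R) (unc F') ->
  approachable Q Gr u F -> approachable Q Gr' u F' ->
  {ae Q, forall g, sq leb I01 (fun s => F g s - F' g s) = 0%E}.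
Proof.
move=> sG sG' mu mF mF' uF uF'.
have d := approachableB sG sG' mu mF mu mF' uF uF'.
have oT : L2open (setT : set (G0 R)) by move=> f _; exists 1.
have uT : {ae Q, forall g, setT g -> u g - u g = 0} by apply: nearW => g _; rewrite subrr.
have h := approachable_vanish (smooth_diff_graph sG sG') (measurable_funB mu mu) (measurable_funB mF mF') d oT uT.
by apply: filterS h => g; apply.
Qed.

Lemma sq_zero F : measurable_fun (@GI R) (unc F) -> {ae Q, forall g, sq leb I01 (F g) = 0%E} ->
  sq QI (@GI R) (unc F) = 0%E.
Proof.
move=> mF F0; have [m1 ->] := sq_sectionE Q (F := F) mF.
rewrite (ae_eq_integral (cst 0%E))//; first by rewrite integral0.
by apply: filterS F0 => g h _.
Qed.

Lemma inner_unique Gr u w F F' H H' : smooth_graph Gr ->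
  measurable_fun setT u -> measurable_fun (@GI R) (unc F) -> measurable_fun (@GI R) (unc F') ->
  measurable_fun setT w -> measurable_fun (@GI R) (unc H) -> measurable_fun (@GI R) (unc H') ->
  approachable Q Gr u F -> approachable Q Gr u F' -> approachable Q Gr w H -> approachable Q Gr w H' ->
  {ae Q, forall g, inner01 F H g = inner01 F' H' g} /\
  ip QI (@GI R) (unc F) (unc H) = ip QI (@GI R) (unc F') (unc H').
Proof.
move=> sG mu mF mF' mw mH mH' uF uF' wH wH'.
have sF := approachable_sqi sG mF uF; have sF' := approachable_sqi sG mF' uF'.
have sH := approachable_sqi sG mH wH; have sH' := approachable_sqi sG mH' wH'.
have zF := approachable_unique sG sG mu mF mF' uF uF'.
have zH := approachable_unique sG sG mw mH mH' wH wH'.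
split; last first.
  apply: ip_congr => //.
    exact: (@sq_zero (fun g s => F g s - F' g s) (measurable_funB mF mF') zF).
  exact: (@sq_zero (fun g s => H g s - H' g s) (measurable_funB mH mH') zH).
have h1 : {ae Q, forall g, sqi leb I01 (F g) /\ sqi leb I01 (F' g)}.
  by apply: filterS2 (sqi_section_ae sF) (sqi_section_ae sF') => g.
have h2 : {ae Q, forall g, sqi leb I01 (H g) /\ sqi leb I01 (H' g)}.
  by apply: filterS2 (sqi_section_ae sH) (sqi_section_ae sH') => g.
have h3 : {ae Q, forall g, sq leb I01 (fun s => F g s - F' g s) = 0%E /\ sq leb I01 (fun s => H g s - H' g s) = 0%E}.
  by apply: filterS2 zF zH => g.
apply: filterS3 h1 h2 h3 => g [a1 a2] [a3 a4] [a5 a6].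
exact: (ip_congr mI a1 a2 a3 a4 a5 a6).
Qed.

Lemma smooth_op_closable Gr : smooth_graph Gr -> op_closable Q Gr.
Proof.
move=> sG un Fn F Gn un0 jF FnF; have mF := jmeas_GI jF.
have oT : L2open (setT : set (G0 R)) by move=> f _; exists 1.
have uF : approachable Q Gr (fun=> 0) F.
  by apply: (@seq_approachable _ _ _ un Fn) => //; exact/(L2IcvgE sG mF Gn).
have u0 : {ae Q, forall g, setT g -> (fun=> 0) g = 0 :> R} by apply: nearW.
have h := approachable_vanish sG (measurable_cst _) mF uF oT u0.
by rewrite (NN2E mF); apply: sq_zero => //; apply: filterS h => g; apply.
Qed.

Lemma smooth_form_closable Gr : smooth_graph Gr -> form_closable Q Gr.
Proof.
move=> sG un Fn Gn un0 cF.
have mFn n : measurable_fun (@GI R) (unc (Fn n)) by have [C h] := sG _ _ (Gn n); exact: flow_measurable h.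
have [F mF FnF] := L2Icauchy_limit mFn cF.
have oT : L2open (setT : set (G0 R)) by move=> f _; exists 1.
have uF : approachable Q Gr (fun=> 0) F := seq_approachable sG (measurable_cst _) mF Gn un0 FnF.
have u0 : {ae Q, forall g, setT g -> (fun=> 0) g = 0 :> R} by apply: nearW.
have h := approachable_vanish sG (measurable_cst _) mF uF oT u0.
have z : sq QI (@GI R) (unc F) = 0%E by apply: sq_zero => //; apply: filterS h => g; apply.
have sF := approachable_sqi sG mF uF.
have ip0 : ip QI (@GI R) (unc F) (unc F) = 0 by move: z; rewrite (sqE mG sF) => -[].
have c := @sq_cvg_ip _ _ _ QI _ mG (fun n => unc (Fn n)) (fun n => unc (Fn n)) _ _ mFn mFn sF sF FnF FnF.
rewrite (_ : (fun n => _) = EFin \o (fun n => ip QI (@GI R) (unc (Fn n)) (unc (Fn n)))); last first.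
  apply/funext => n; have [C h'] := sG _ _ (Gn n).
  by rewrite (NN2E (mFn n)) (sqE mG (flow_sqi_prod Q h')).
by apply: cvg_EFin; [exact: nearW|rewrite -[X in _ --> X]ip0].
Qed.

End Locality.

Lemma measurable_nonzero u : measurable_fun setT u -> measurable [set g | u g != 0].
Proof.
move=> mu; rewrite (_ : [set g | _] = setT `&` u @^-1` (~` [set 0])).
  by apply: mu => //; apply: measurableC; exact: measurable_set1.
by rewrite setTI; apply/seteqP; split => g /= /eqP.
Qed.

Lemma Qsupp_complement_open u : measurable_fun setT u -> L2open (~` Qsupp Q u).
Proof.
move=> mu f /existsNP[r /not_implyP[r0 /negP]]; rewrite -leNgt => h.
exists (r / 2); first by rewrite divr_gt0.
move=> g fg /(_ (r / 2)); rewrite divr_gt0// => /(_ isT); rewrite ltNge => /negP; apply.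
apply: le_trans h; apply: le_measure; rewrite ?inE.
- by apply: measurableI; [apply: L2open_measurable; exact: L2ball_open|exact: measurable_nonzero].
- by apply: measurableI; [apply: L2open_measurable; exact: L2ball_open|exact: measurable_nonzero].
- move=> k [gk uk]; split => //; rewrite /L2ball /= in fg gk *.
  by rewrite (le_lt_trans (L2dist_triangle f g k))// (splitr r) ltrD.
Qed.

(** Each point off the support lies in a ball of a countable family on which [u] vanishes almost
    everywhere: the centre comes from the dense family and the radius is below half of that of a
    null ball around the point. The union of the exceptional sets is null. *)
Lemma ae_zero_off_Qsupp u : measurable_fun setT u -> {ae Q, forall g, (~` Qsupp Q u) g -> u g = 0}.
Proof.
move=> mu; pose good (p : (nat * seq nat) * nat) := Q (L2ball (rstep R p.1) p.2.+1%:R^-1 `&` [set g | u g != 0]) = 0%E.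
pose N k : set (G0m R) := if unpickle k is Some p then
  if pselect (good p) then L2ball (rstep R p.1) p.2.+1%:R^-1 `&` [set g | u g != 0] else set0 else set0.
have mb (f : G0 R) r : measurable (L2ball f r `&` [set g | u g != 0] : set (G0m R)).
  by apply: measurableI; [apply: L2open_measurable; exact: L2ball_open|exact: measurable_nonzero].
have nN k : Q.-negligible (N k).
  rewrite /N; case: (unpickle k) => [p|]; last exact: negligible_set0.
  case: (pselect (good p)) => [gp|_] /=; last exact: negligible_set0.
  by exists (L2ball (rstep R p.1) p.2.+1%:R^-1 `&` [set g | u g != 0]); split.
apply: negligibleS (negligible_bigcup nN) => f /= /not_implyP[/existsNP[r /not_implyP[r0 /negP]]].
rewrite -leNgt => h uf.
have [n n0 nr] := invn_small (divr_gt0 r0 (ltr0n R 2)).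
case: n n0 nr => // n _ nr.
have i0 : 0 < n.+1%:R^-1 :> R by rewrite invr_gt0.
have [i fi] := @G0_separable R f _ i0.
have gd : good (i, n).
  rewrite /good; apply/eqP; rewrite eq_le measure_ge0 andbT; apply: le_trans h.
  apply: le_measure; rewrite ?inE; [exact: mb|exact: mb|].
  move=> k [ik uk]; split => //; rewrite /L2ball /= in ik *.
  rewrite (le_lt_trans (L2dist_triangle f (rstep R i) k))// (splitr r) ltrD//; last exact: lt_trans ik nr.
  by rewrite L2distC (lt_trans fi).
exists (pickle (i, n)) => //; rewrite /N pickleK; case: (pselect (good (i, n))) => [gg|/(_ gd)] //=.
by split => //=; apply/eqP.
Qed.

(** The gradient of [v] vanishes on [O], that of [u] off its support, which lies inside [O]; so the
    two gradients have inner product 0 at almost every [g]. *)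
Lemma smooth_strongly_local (beta : R) Gr : 0 < beta -> is_entropic beta Q -> smooth_graph Gr ->
  strongly_local Q Gr.
Proof.
move=> beta0 HQ sG u v O c e _ _ oO uO vO /(form_closureP _ _ _ sG)[mu mv [F [H [mF mH uF vH ->]]]].
have zF := approachable_vanish beta0 HQ sG mu mF uF (Qsupp_complement_open mu) (ae_zero_off_Qsupp mu).
have zH := approachable_vanish beta0 HQ sG mv mH vH oO vO.
have sF := approachable_sqi sG mF uF; have sH := approachable_sqi sG mH vH.
rewrite -(ip_section sF sH).2.
have h : {ae Q, forall g, sqi leb I01 (F g) /\ sqi leb I01 (H g)}.
  by apply: filterS2 (sqi_section_ae sF) (sqi_section_ae sH) => g.
have s0 : sqi leb I01 (fun=> 0 : R) by apply: (@bounded_sqi _ _ 0) => // s _; rewrite normr0.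
have ip0 k : ip leb I01 (fun=> 0) k = 0.
  by rewrite /ip /Rintegral; under eq_integral => s _ do rewrite mul0r; rewrite integral0.
have dz k : sq leb I01 k = 0%E -> sq leb I01 (fun s => k s - 0) = 0%E.
  by move=> <-; congr sq; apply/funext => s; rewrite subr0.
have d0 : sq leb I01 (fun s => (fun=> 0) s - (fun=> 0) s : R) = 0%E.
  by rewrite /sq; under eq_integral => s _ do rewrite subrr expr0n; rewrite integral0.
have dd (k : R -> R) : sq leb I01 (fun s => k s - k s) = 0%E.
  by rewrite /sq; under eq_integral => s _ do rewrite subrr expr0n; rewrite integral0.
have z : {ae Q, forall g, ip leb I01 (F g) (H g) = 0}.
  apply: filterS3 h zF zH => g [a1 a2] b1 b2.
  have [Og|nO] := pselect (O g).
    by rewrite (ip_congr mI a1 a1 a2 s0 (dd _) (dz _ (b2 Og))) ipC ip0.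
  have nS : (~` Qsupp Q u) g by move=> /uO.
  by rewrite (ip_congr mI a1 s0 a2 a2 (dz _ (b1 nS)) (dd _)) ip0.
rewrite /Rintegral (ae_eq_integral (cst 0%E))//; first by rewrite integral0.
- exact: (measurable_int _ (ip_section sF sH).1).
- by apply: filterS z => g -> _.
Qed.

End Closures.

(** * Both cylinder classes have the same limits *)

Section MainTheorem.
Variables (R : realType) (beta : R) (Q : probability (G0m R) R).
Hypotheses (beta0 : 0 < beta) (HQ : is_entropic beta Q).
Local Notation leb := (@lebesgue_measure R).
Local Notation I01 := (@I01 R).
Local Notation QI := (Q \x leb)%E.
Local Notation unc F := (fun p : G0m R * measurableTypeR R => F p.1 p.2).
Local Notation Z := (@Zgraph R).
Local Notation C := (@Cgraph R).
Let sZ : smooth_graph Z := @Zgraph_flow_smooth R.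
Let sC : smooth_graph C := @Cgraph_flow_smooth R.

Lemma approachable_CZ u F : measurable_fun setT u -> measurable_fun (@GI R) (unc F) ->
  approachable Q C u F <-> approachable Q Z u F.
Proof.
move=> mu mF; split.
  apply: (approachable_trans sZ sC mu mF) => w H; exact: Cgraph_approachable beta0 HQ.
apply: (approachable_trans sC sZ mu mF) => w H; exact: Zgraph_approachable.
Qed.

Lemma cylinder_approachable u F : Zgraph u F \/ Cgraph u F ->
  [/\ measurable_fun setT u, measurable_fun (@GI R) (unc F) & approachable Q Z u F].
Proof.
move=> uF; have [c h] : exists c, flow_smooth u F c by case: uF => [/sZ|/sC].
split; [exact: flow_smooth_measurable h|exact: flow_measurable h|].
by case: uF => [|/(Cgraph_approachable beta0 HQ)//]; exact: graph_approachable.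
Qed.

Lemma op_closure_on01 u F : measurable_fun setT u -> measurable_fun (@GI R) (unc F) ->
  approachable Q Z u F -> op_closure Q Z u (on01 F).
Proof.
move=> mu mF uF; apply/(op_closureP Q u (on01 F) sZ); split => //; first exact: jmeas_on01.
by apply: approachable_eq uF => g s s1; rewrite on01E.
Qed.

End MainTheorem.

Theorem theorem7p8 (R : realType) (beta : R) (Q : probability (G0m R) R) :
  0 < beta -> is_entropic beta Q ->
  [/\
   (* (i) *)
   [/\ form_closable Q (@Cgraph R),
       (forall (u v : G0m R -> R) (e : R),
          form_closure Q (@Cgraph R) u v e <-> form_closure Q (@Zgraph R) u v e),
       op_closable Q (@Cgraph R) &
       (forall (u : G0m R -> R) (F : G0m R -> R -> R),
          op_closure Q (@Cgraph R) u F <-> op_closure Q (@Zgraph R) u F)],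
   (* (ii) *)
   (forall (u w : G0m R -> R) (F0 H0 : G0m R -> R -> R),
      (Zgraph u F0 \/ Cgraph u F0) -> (Zgraph w H0 \/ Cgraph w H0) ->
      [/\ (exists F, op_closure Q (@Zgraph R) u F),
          (forall F H, op_closure Q (@Zgraph R) u F -> op_closure Q (@Zgraph R) w H ->
             {ae Q, forall g, inner01 F H g = inner01 F0 H0 g}),
          (exists e, form_closure Q (@Zgraph R) u w e) &
          (forall e, form_closure Q (@Zgraph R) u w e ->
             e%:E = (\int[Q]_g (inner01 F0 H0 g)%:E)%E)]),
   (* (iii) *)
   (forall f : G0m R,
      [/\ form_dom Q (@Zgraph R) (fun g => L2dist f g),
          (exists F, op_closure Q (@Zgraph R) (fun g => L2dist f g) F) &
          (forall F, op_closure Q (@Zgraph R) (fun g => L2dist f g) F ->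
             {ae Q, forall g, inner01 F F g <= 1})]) &
   (* (iv) *)
   strongly_local Q (@Zgraph R)].
Proof.
move=> beta0 HQ.
have sZ : smooth_graph (@Zgraph R) := @Zgraph_flow_smooth R.
have sC : smooth_graph (@Cgraph R) := @Cgraph_flow_smooth R.
split.
- split.
  + exact: (smooth_form_closable beta0 HQ sC).
  + move=> u v e; rewrite (form_closureP Q u v e sC) (form_closureP Q u v e sZ).
    split => -[mu mv [F [H [mF mH uF vH eE]]]]; split => //; exists F, H; split => //.
    * exact/(approachable_CZ beta0 HQ mu mF).
    * exact/(approachable_CZ beta0 HQ mv mH).
    * exact/(approachable_CZ beta0 HQ mu mF).
    * exact/(approachable_CZ beta0 HQ mv mH).
  + exact: (smooth_op_closable beta0 HQ sC).
  + move=> u F; rewrite (op_closureP Q u F sC) (op_closureP Q u F sZ).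
    by split => -[mu jF uF]; split => //; apply/(approachable_CZ beta0 HQ mu (jmeas_GI jF)).
- move=> u w F0 H0 /(cylinder_approachable beta0 HQ)[mu mF0 uF0] /(cylinder_approachable beta0 HQ)[mw mH0 wH0].
  split.
  + by exists (on01 F0); exact: op_closure_on01.
  + move=> F H /(op_closureP _ _ _ sZ)[_ /jmeas_GI mF uF] /(op_closureP _ _ _ sZ)[_ /jmeas_GI mH wH].
    exact: (inner_unique beta0 HQ sZ mu mF mF0 mw mH mH0 uF uF0 wH wH0).1.
  + exists (ip (Q \x @lebesgue_measure R)%E (@GI R) (fun p => F0 p.1 p.2) (fun p => H0 p.1 p.2)); apply/(form_closureP Q _ _ _ sZ); split => //.
    by exists F0, H0.
  + move=> e /(form_closureP _ _ _ _ sZ)[_ _ [F [H [mF mH uF wH ->]]]].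
    rewrite (inner_unique beta0 HQ sZ mu mF mF0 mw mH mH0 uF uF0 wH wH0).2.
    by rewrite integral_inner01//; [exact: (approachable_sqi sZ mF0 uF0)|exact: (approachable_sqi sZ mH0 wH0)].
- move=> f; have md := measurable_distance f.
  have mF := @dist_grad_measurable R f.
  have dZ : approachable Q (@Zgraph R) (fun g => L2dist f g) (dist_grad f).
    by apply/(approachable_CZ beta0 HQ md mF); exact: distance_approachable.
  split.
  + exists (ip (Q \x @lebesgue_measure R)%E (@GI R) (fun p => (dist_grad f) p.1 p.2) (fun p => (dist_grad f) p.1 p.2)); apply/(form_closureP Q _ _ _ sZ); split => //.
    by exists (dist_grad f), (dist_grad f).
  + by exists (on01 (dist_grad f)); exact: op_closure_on01.
  + move=> F /(op_closureP _ _ _ sZ)[_ /jmeas_GI mF' uF].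
    have [h _] := inner_unique beta0 HQ sZ md mF' mF md mF' mF uF dZ uF dZ.
    apply: filterS h => g ->.
    rewrite (_ : inner01 _ _ g = nrm (@lebesgue_measure R) (@I01 R) (dist_grad f g) ^+ 2); last by rewrite nrm_sqr.
    by rewrite expr_le1 ?nrm_ge0// nrm_dist_grad.
- exact: (smooth_strongly_local beta0 HQ sZ).
Qed.
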